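(* Consider the mixed North-East and FA1f kinetically constrained model on $\mathbb{Z}^2$ in the random environment $\omega\sim\nu$ with parameter $\pi$, and assume $\pi>p^{\mathrm{SP}}$ and $q\le q^{\mathrm{OP}}$. 1. $\nu$-almost surely the spectral gap is $0$, i.e., the relaxation time is infinite. 2. There exist two positive constants $c,C$ depending on $\pi$ and a $\nu$-random variable $\tau$ (a function of the environment $\omega$) such that (a) $\mathbb{P}_{\mu}\left(\tau_{0}\ge t\right)\le e^{-t/\tau}$ for all $t>0$, (b) $\nu\left(\tau\ge t\right)\le C\,t^{\frac{c}{\log q}}$ for $t$ large enough.
   Context: Environment: $\omega=(\omega_x)_{x\in\mathbb{Z}^2}\in\{1,2\}^{\mathbb{Z}^2}$ is random with law $\nu$, under which the $\omega_x$ are independent, $\omega_x=1$ with probability $\pi\in(0,1)$ and $\omega_x=2$ with probability $1-\pi$. The environment is fixed (quenched). Configurations: $\Omega=\{0,1\}^{\mathbb{Z}^2}$; a site $x$ is empty if $\eta_x=0$ and occupied if $\eta_x=1$. Constraints: if $\omega_x=1$ then $c_x(\eta)=1$ when $\sum_{y\sim x}(1-\eta_y)\ge1$ (at least one nearest neighbor is empty) and $c_x(\eta)=0$ otherwise; if $\omega_x=2$ then $c_x(\eta)=1$ when $\eta_{x+e_1}=0$ and $\eta_{x+e_2}=0$, and $c_x(\eta)=0$ otherwise ($e_1,e_2$ are the standard basis vectors). For $q\in(0,1)$, $\mu=\bigotimes_{x\in\mathbb{Z}^2}\mu_x$ with each $\mu_x$ Bernoulli of parameter $1-q$ (each site is empty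 with probability $q$). The model is the continuous time Markov process on $\Omega$, reversible with respect to $\mu$, with generator $\mathcal{L}f=\sum_x c_x(\mu_x f-f)$ for local functions $f$, where $\mu_x f$ denotes the average of $f$ over $\eta_x\sim\mu_x$ with the other coordinates fixed. Its Dirichlet form is $\mathcal{D}f=\mu\left(\sum_x c_x\mathrm{Var}_x f\right)$, where $\mathrm{Var}_x$ is the variance with respect to $\mu_x$. The spectral gap is $\inf\mathcal{D}f/\mathrm{Var}_\mu f$ over non-constant $f$ in the domain of $\mathcal{L}$, and the relaxation time is its inverse. $\mathbb{P}_\mu$ denotes probability for the process started from $\mu$ (the environment $\omega$ being fixed). $\tau_0=\inf\{t:\eta_0(t)=0\}$ is the first time at which the origin is empty. $p^{\mathrm{SP}}$ is the critical probability for Bernoulli site percolation on $\mathbb{Z}^2$; $p^{\mathrm{OP}}$ is the critical probability for oriented (site) percolation on $\mathbb{Z}^2$; $q^{\mathrm{OP}}=1-p^{\mathrm{OP}}$. *)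

(* Defs.v *)
From HB Require Import structures.
From mathcomp Require Export all_boot all_order all_algebra.
From mathcomp Require Export all_classical all_reals all_analysis.

Set Implicit Arguments.
Unset Strict Implicit.
Unset Printing Implicit Defensive.
Import Order.TTheory GRing.Theory Num.Theory.
Import numFieldNormedType.Exports.
Local Open Scope classical_set_scope.
Local Open Scope ring_scope.

Definition site : Type := (int * int)%type.
Definition e1 : site := (1, 0).
Definition e2 : site := (0, 1).
Definition neighbors (x : site) : seq site :=
  [:: x + e1; x - e1; x + e2; x - e2].

Definition cylinders : set (set (site -> bool)) :=
  [set A | exists x b, A = [set eta | eta x = b]].

(* {0,1}^(Z^2) with its product sigma-algebra; [true] stands for 1 (occupied).
   An environment in {1,2}^(Z^2) is an element of the same space, where [true]
   stands for 1 (the FA1f constraint) and [false] for 2 (North-East). *)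
Definition config : measurableType _ := g_sigma_algebraType cylinders.

Section ProductLaw.
Variable R : realType.

(* Independent coordinates, each equal to [true] with probability [p]: these
   finite-dimensional marginals determine [P] uniquely. *)
Definition bernoulli_product (p : R) (P : probability config R) : Prop :=
  forall (s : seq site) (v : site -> bool), uniq s ->
    P [set eta | forall x, x \in s -> eta x = v x] =
    (\prod_(x <- s) (if v x then p else 1 - p))%:E.

End ProductLaw.

Section Percolation.
Variable R : realType.

Definition open_connected (e : rel site) (xi : config) (x y : site) : Prop :=
  exists2 p : seq site, path e x p && all xi (x :: p) & last x p = y.

Definition percolates (e : rel site) : set config :=
  [set xi | infinite_set [set y | open_connected e xi 0 y]].

Definition critical_probability (e : rel site) : R :=
  inf [set p : R | 0 <= p <= 1 /\
    exists P : probability config R,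
      bernoulli_product p P /\ (0 < P (percolates e))%E].

Definition adjacent : rel site := [rel x y | y \in neighbors x].
Definition oriented_edge : rel site := [rel x y | y \in [:: x + e1; x + e2]].

Definition pSP : R := critical_probability adjacent.
Definition pOP : R := critical_probability oriented_edge.
Definition qOP : R := 1 - pOP.

End Percolation.

Section Model.
Variables (R : realType) (w : config) (q : R).

Definition constraint (x : site) (eta : config) : bool :=
  if w x then (1 <= \sum_(y <- neighbors x) (1 - eta y))%N
  else ~~ eta (x + e1) && ~~ eta (x + e2).

Definition update (eta : config) (x : site) (b : bool) : config :=
  fun y => if y == x then b else eta y.

Definition site_mean (x : site) (f : config -> R) (eta : config) : R :=
  q * f (update eta x false) + (1 - q) * f (update eta x true).

Definition site_var (x : site) (f : config -> R) (eta : config) : R :=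
  site_mean x (fun zeta => (f zeta - site_mean x f zeta) ^+ 2) eta.

Definition local_fun (f : config -> R) : Prop :=
  exists s : seq site, forall eta zeta : config,
    (forall x, x \in s -> eta x = zeta x) -> f eta = f zeta.

(* The sum has finite support whenever [f] is local. *)
Definition generator (f : config -> R) (eta : config) : R :=
  \sum_(x \in [set: site])
    (constraint x eta)%:R * (site_mean x f eta - f eta).

Section SpectralGap.
Variable mu : probability config R.

(* Domain of the L^2(mu) closure of the generator acting on local functions. *)
Definition generator_domain (f : config -> R) : Prop :=
  f \in Lfun mu 2%:E /\
  exists (g : config -> R) (f_ : nat -> config -> R),
    [/\ g \in Lfun mu 2%:E, (forall n, local_fun (f_ n)),
        ('N[mu]_2%:E[EFin \o (f_ n \- f)%R])%E @[n --> \oo] --> 0%E &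
        ('N[mu]_2%:E[EFin \o (generator (f_ n) \- g)%R])%E @[n --> \oo] --> 0%E].

Definition dirichlet_form (f : config -> R) : \bar R :=
  (\int[mu]_eta
    \esum_(x in [set: site]) ((constraint x eta)%:R * site_var x f eta)%:E)%E.

Definition spectral_gap : \bar R :=
  ereal_inf [set r | exists f : config -> R,
    [/\ generator_domain f,
        ~ (exists a : R, {ae mu, forall eta, f eta = a}) &
        r = (dirichlet_form f / 'V_mu[f])%E]].

(* In [\bar R], 0^-1 = +oo. *)
Definition relaxation_time : \bar R := (spectral_gap ^-1)%E.

(* [K] is the (unique) Feller transition semigroup whose generator extends
   [generator] on local functions; continuity refers to the product topology,
   and the last clause is reversibility with respect to [mu]. *)
Definition kcm_semigroup (K : R -> R.-pker config ~> config) : Prop :=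
  [/\ forall eta (B : set config), measurable B -> K 0 eta B = \d_eta B,
      forall (s t : R) eta (B : set config), 0 <= s -> 0 <= t -> measurable B ->
        K (s + t) eta B = (\int[K s eta]_zeta K t zeta B)%E,
      forall (t : R) (f : {ptws site -> bool} -> R), 0 <= t -> continuous f ->
        continuous (fun eta : {ptws site -> bool} =>
          \int[K t eta]_zeta (f zeta : R)),
      forall f : config -> R, local_fun f -> forall e : R, 0 < e ->
        \forall t \near 0^'+, forall eta : config,
          `| (\int[K t eta]_zeta f zeta - f eta) / t - generator f eta | <= e &
      forall (t : R) (A B : set config), 0 <= t -> measurable A -> measurable B ->
        (\int[mu]_(eta in A) K t eta B = \int[mu]_(eta in B) K t eta A)%E].

Definition past d (T : measurableType d) (X : R -> T -> config) (t : R) :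
    set (set T) :=
  <<s [set A : set T | exists (u : R) (B : set config),
         [/\ 0 <= u <= t, measurable B & A = X u @^-1` B]] >>.

(* [X t], for t >= 0, is the cadlag Markov process of the model with initial
   law [mu]; the values of [X] at negative times are irrelevant. *)
Definition kcm_process d (T : measurableType d) (P : probability T R)
    (X : R -> T -> config) : Prop :=
  [/\ forall t : R, 0 <= t -> measurable_fun setT (X t),
      forall a (t : R), 0 <= t ->
        (X s a : {ptws site -> bool}) @[s --> t^'+]
          --> (X t a : {ptws site -> bool}),
      forall a (t : R), 0 < t -> exists l : {ptws site -> bool},
        (X s a : {ptws site -> bool}) @[s --> t^'-] --> l,
      forall B : set config, measurable B -> P (X 0 @^-1` B) = mu B &
      exists2 K : R -> R.-pker config ~> config, kcm_semigroup K &
        forall (s t : R) (A : set T) (B : set config),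
          0 <= s -> 0 <= t -> past X t A -> measurable B ->
          P (A `&` X (t + s) @^-1` B) = (\int[P]_(a in A) K s (X t a) B)%E].

End SpectralGap.
End Model.

Definition tau0 (R : realType) (T : Type) (X : R -> T -> config) (a : T) :
    \bar R :=
  ereal_inf [set t%:E | t in [set t : R | 0 <= t /\ X t a 0 = false]].

(* Main.v *)
Require Import Defs.
From mathcomp Require Import ring lra zify measurable_realfun.
Set Implicit Arguments.
Unset Strict Implicit.
Unset Printing Implicit Defensive.
Import Order.TTheory GRing.Theory Num.Theory.
Import numFieldNormedType.Exports.
Local Open Scope classical_set_scope.
Local Open Scope ring_scope.

(* Gap zero. The environment almost surely contains arbitrarily large all-North-East
   triangles. For the indicator that the corner of such a triangle is joined to level n by
   an oriented occupied path, of probability theta_n, a pivotal site allowed to update is the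
   whole of the reached front, so that q D <= theta_n - theta_(n+1), and a positive gap would
   make theta_n decay exponentially. At q <= q^OP the Simon-Lieb inequality forbids this.

   Persistence. Easy (FA1f) sites percolate, and the failure of the easy crossings of the
   2n x n rectangles at some scale >= n has probability exponentially small in n: sharpness of
   the transition gives open arms with non-vanishing probability, a four-arm argument with
   Russo's formula excludes the coexistence of open and closed arms, hence closed *-connected
   arms decay. If all scales >= n are good, an infinite easy path starts within distance 2n
   of the origin. Cutting it into long blocks, each likely to contain an empty site, yields a
   Poincare inequality along it; an empty site b at its start is carried to the origin by
   e^(O(n)) legal moves with O(n) simultaneously empty sites, across the hard sites below two
   crossings, at cost q^(-O(n)). Hence the L^2 norm of a function vanishing where the origin
   is empty is bounded by q^(-O(n)) times its energy. The energy controls the decrease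
   of t |-> <f, K_t f> by reversibility and convexity, so the probability that the
   origin is occupied at all integer times up to n decays geometrically. *)

(** * Averages over finitely many coordinates *)

(** The semigroup is known only through its first-order expansion on local functions, and [Kt K t f]
    is not local, so no spectral calculus is available. Energies are therefore taken of conditional
    expectations on finite boxes, bounded by comparing a function with its own jumps inside the box,
    and convexity of correlations replaces the spectral theorem. In a finite box the easy path has
    to stop, and its last block has no successor from which to receive a vacancy. That block can be
    pushed outside any given box, where a nearly local function hardly varies; the resulting error
    tends to 0. The constants c and C may not depend on q. The tail of the scale n concerns the
    environment alone. The cost at scale n is e^(O(n)) q^(-O(n)), and since p^OP >= 1/2 the
    assumption on q gives q <= 1/2, so this is at most q^(-41n). Hence tau >= t forces n to be of
    order log t / log(1/q), and prefactors depending on q only shift what counts as large t.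
    Percolation is treated through averages over finitely many sites, which are polynomial in the
    parameter, so that Russo's formula is a product rule. *)

Lemma updateC (eta : config) x y a b : x != y ->
  update (update eta x a) y b = update (update eta y b) x a.
Proof.
move=> xy; apply/funext => z; rewrite /update.
by case: (eqVneq z y) => [->|//]; rewrite eq_sym (negbTE xy).
Qed.

Lemma updateK (eta : config) x a b : update (update eta x a) x b = update eta x b.
Proof. by apply/funext => z; rewrite /update; case: eqP. Qed.

Lemma update_id (eta : config) x : update eta x (eta x) = eta.
Proof. by apply/funext => z; rewrite /update; case: eqP => [->|]. Qed.

Lemma update_at (eta : config) x b : update eta x b x = b.
Proof. by rewrite /update eqxx. Qed.

Lemma update_ne (eta : config) x y b : y != x -> update eta x b y = eta y.
Proof. by rewrite /update => /negbTE ->. Qed.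

Definition indep (T : Type) (x : site) (f : config -> T) :=
  forall eta b, f (update eta x b) = f eta.

Definition dep (T : Type) (s : seq site) (f : config -> T) :=
  forall eta zeta : config, (forall x, x \in s -> eta x = zeta x) -> f eta = f zeta.

Lemma dep_indep T s (f : config -> T) x : dep s f -> x \notin s -> indep x f.
Proof.
move=> df xs eta b; apply: df => y ys; rewrite update_ne //.
by apply: contraNneq xs => <-.
Qed.

Lemma dep_sub T s t (f : config -> T) : {subset s <= t} -> dep s f -> dep t f.
Proof. by move=> st df eta zeta e; apply: df => x /st; exact: e. Qed.

Definition cle (eta zeta : config) := forall x, eta x -> zeta x.

Lemma cle_update eta zeta x (a b : bool) : cle eta zeta -> (a -> b) ->
  cle (update eta x a) (update zeta x b).
Proof. by move=> le ab y; rewrite /update; case: eqP => // _; exact: le. Qed.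

Section Mean.
Context {R : realType}.
Implicit Types (p q : R) (f g h : config -> R) (s t V : seq site) (x y : site).

Definition mean1 p x f : config -> R :=
  fun eta => p * f (update eta x true) + (1 - p) * f (update eta x false).

Definition mean p s f : config -> R := foldr (mean1 p) f s.

Definition incr f := forall eta zeta, cle eta zeta -> f eta <= f zeta.
Definition decr f := forall eta zeta, cle eta zeta -> f zeta <= f eta.

Lemma mean1_indep p x f : indep x f -> mean1 p x f = f.
Proof. by move=> fx; apply/funext => eta; rewrite /mean1 !fx; ring. Qed.

Lemma indep_mean1 p x f : indep x (mean1 p x f).
Proof. by move=> eta b; rewrite /mean1 !updateK. Qed.

Lemma mean1C p x y f : mean1 p x (mean1 p y f) = mean1 p y (mean1 p x f).
Proof.
case: (eqVneq x y) => [->//|xy]; apply/funext => eta; rewrite /mean1.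
rewrite !(updateC _ _ _ xy); ring.
Qed.

Lemma mean1_mean p x s f : mean1 p x (mean p s f) = mean p s (mean1 p x f).
Proof. by elim: s => //= y s <-; rewrite mean1C. Qed.

Lemma indep_mean p x s f : indep x f -> indep x (mean p s f).
Proof.
move=> fx; elim: s => //= y s IH eta b; rewrite /mean1.
case: (eqVneq x y) => [->|xy]; first by rewrite !updateK.
by rewrite !(updateC _ _ _ xy) !IH.
Qed.

Lemma indep_mean_in p x s f : x \in s -> indep x (mean p s f).
Proof.
elim: s => //= y s IH; rewrite inE; case: (eqVneq x y) => [-> _|_ /= xs].
  exact: indep_mean1.
by rewrite mean1_mean; move: (IH xs); rewrite -mean1_mean => H;
  exact: (@indep_mean p x [:: y] (mean p s f)).
Qed.

Lemma mean_cat p s t f : mean p (s ++ t) f = mean p s (mean p t f).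
Proof. by rewrite /mean foldr_cat. Qed.

Lemma mean_indep p s f : (forall x, x \in s -> indep x f) -> mean p s f = f.
Proof.
elim: s => //= x s IH H; rewrite IH; last by move=> y ys; apply: H; rewrite inE ys orbT.
by apply: mean1_indep; apply: H; rewrite inE eqxx.
Qed.

Lemma mean_perm p s t f : perm_eq s t -> mean p s f = mean p t f.
Proof.
elim: s t => [|x s IH] t st; first by move: st; rewrite perm_sym => /perm_nilP ->.
have xt : x \in t by rewrite -(perm_mem st) inE eqxx.
have /IH E : perm_eq s (rem x t).
  by rewrite -(perm_cons x); apply: (perm_trans st); exact: perm_to_rem.
rewrite /= E; elim: t xt {st E} => //= y t IHt; rewrite inE eq_sym.
case: (eqVneq y x) => [->//|_ /= xt]; by rewrite mean1C IHt.
Qed.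

Lemma mean_mean p s t f : {subset t <= s} -> mean p s (mean p t f) = mean p s f.
Proof.
elim: t => //= x t IH H; rewrite -mean1_mean.
rewrite mean1_indep; last by apply: indep_mean_in; apply: H; rewrite inE eqxx.
by apply: IH => y yt; apply: H; rewrite inE yt orbT.
Qed.

Lemma mean_meanC p s t f : mean p s (mean p t f) = mean p t (mean p s f).
Proof. by elim: s => //= x s ->; rewrite mean1_mean. Qed.

Lemma dep_mean p s V f : dep V f -> dep V (mean p s f).
Proof.
move=> df; elim: s => //= x s IH eta zeta e; rewrite /mean1.
congr (_ * _ + _ * _); apply: IH => y yV; rewrite /update; case: eqP => // _; exact: e.
Qed.

(** Each average removes its site from the set of coordinates that matter, and none is left at the
    end. *)
Lemma mean_cst p s V f eta zeta : dep V f -> {subset V <= s} ->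
  mean p s f eta = mean p s f zeta.
Proof.
move=> df Vs; have : dep [seq x <- V | x \notin s] (mean p s f); last first.
  by apply => x; rewrite mem_filter => /andP[/negP nx /Vs].
elim: s {Vs} => [|x s IH].
  by apply: dep_sub df => x xV; rewrite mem_filter in_nil.
have dm : dep V (mean p (x :: s) f) by exact: dep_mean.
move=> a b e /=; rewrite /mean1.
congr (_ * _ + _ * _); apply: IH => y; rewrite mem_filter => /andP[ys yV];
 rewrite /update; case: eqP => // /eqP yx; apply: e;
 by rewrite mem_filter inE negb_or yx ys.
Qed.

Lemma mean_const p s (c : R) : mean p s (fun=> c) = fun=> c.
Proof. by apply: mean_indep. Qed.

Lemma meanD p s f g : mean p s (fun eta => f eta + g eta) =
  fun eta => mean p s f eta + mean p s g eta.
Proof. by elim: s => //= x s ->; apply/funext => eta; rewrite /mean1; ring. Qed.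

Lemma meanZl p s (c : R) f : mean p s (fun eta => c * f eta) =
  fun eta => c * mean p s f eta.
Proof. by elim: s => //= x s ->; apply/funext => eta; rewrite /mean1; ring. Qed.

Lemma meanB p s f g : mean p s (fun eta => f eta - g eta) =
  fun eta => mean p s f eta - mean p s g eta.
Proof. by elim: s => //= x s ->; apply/funext => eta; rewrite /mean1; ring. Qed.

Lemma mean_sum (I : Type) (r : seq I) (P : pred I) (F : I -> config -> R) p s :
  mean p s (fun eta => \sum_(i <- r | P i) F i eta) =
  fun eta => \sum_(i <- r | P i) mean p s (F i) eta.
Proof.
elim: r => [|i r IH]; apply/funext => eta.
  by under [in mean _ _ _]eq_fun do rewrite big_nil; rewrite mean_const big_nil.
under [in mean _ _ _]eq_fun do rewrite big_cons.
rewrite big_cons; case: (P i); last by rewrite IH.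
by rewrite meanD IH.
Qed.

Lemma mean1_mull p x f g : indep x f ->
  mean1 p x (fun eta => f eta * g eta) = fun eta => f eta * mean1 p x g eta.
Proof. by move=> fx; apply/funext => eta; rewrite /mean1 !fx; ring. Qed.

Lemma mean_mull p s f g : (forall x, x \in s -> indep x f) ->
  mean p s (fun eta => f eta * g eta) = fun eta => f eta * mean p s g eta.
Proof.
elim: s => //= x s IH H; rewrite IH; last by move=> y ys; apply: H; rewrite inE ys orbT.
by apply: mean1_mull; apply: H; rewrite inE eqxx.
Qed.

Lemma mean_mulr p s f g : (forall x, x \in s -> indep x g) ->
  mean p s (fun eta => f eta * g eta) = fun eta => mean p s f eta * g eta.
Proof.
move=> H; under [in LHS]eq_fun do rewrite mulrC.
by rewrite mean_mull //; apply/funext => eta; rewrite mulrC.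
Qed.

(** Averaging first over the sites of [A] in [V] leaves [g] untouched and makes the factor coming
    from [f] insensitive to all of [V], so that it can be pulled out of the remaining average. *)
Lemma mean_indepM p V f g A B : dep A f -> dep B g ->
  (forall x, x \in A -> x \notin B) ->
  mean p V (fun eta => f eta * g eta) = fun eta => mean p V f eta * mean p V g eta.
Proof.
move=> df dg dAB; pose VA := [seq x <- V | x \in A].
have sV : {subset VA <= V} by move=> x; rewrite mem_filter => /andP[].
rewrite -(mean_mean p _ sV) mean_mulr; last first.
  by move=> x; rewrite mem_filter => /andP[/dAB xB _]; exact: dep_indep dg xB.
have iV x : x \in V -> indep x (mean p VA f).
  move=> xV; case: (boolP (x \in A)) => xA.
    by apply: indep_mean_in; rewrite mem_filter xA.
  by apply: indep_mean; apply: dep_indep df xA.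
rewrite mean_mull //; apply/funext => eta; congr (_ * _).
by have := mean_mean p f sV; rewrite mean_indep // => ->.
Qed.

Section Prob.
Variable p : R.
Hypothesis p01 : 0 <= p <= 1.

(** The comparison is required only at configurations equal to [eta] off [s]: a bound valid given
    the explored sites can then be averaged over the unexplored ones. *)
Lemma mean_le_on s f g eta :
  (forall zeta : config, (forall x, x \notin s -> zeta x = eta x) -> f zeta <= g zeta) ->
  mean p s f eta <= mean p s g eta.
Proof.
have [p0 p1] := andP p01.
elim: s eta => [|x s IH] eta H /=; first exact: H.
rewrite /mean1 lerD // ler_wpM2l ?subr_ge0 //; apply: IH => z e; apply: H => y;
 rewrite inE negb_or => /andP[yx ys]; by rewrite e // update_ne.
Qed.

Lemma mean_le s f g eta : (forall zeta, f zeta <= g zeta) -> mean p s f eta <= mean p s g eta.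
Proof. by move=> H; exact: mean_le_on. Qed.

Lemma mean_ge0 s f eta : (forall zeta, 0 <= f zeta) -> 0 <= mean p s f eta.
Proof. by move=> H; rewrite -[0](congr1 (@^~ eta) (mean_const p s 0)); exact: mean_le. Qed.

Lemma mean_le_cst s f (c : R) eta : (forall zeta, f zeta <= c) -> mean p s f eta <= c.
Proof. by move=> H; rewrite -[c](congr1 (@^~ eta) (mean_const p s c)); exact: mean_le. Qed.

Lemma incr_mean s f : incr f -> incr (mean p s f).
Proof.
have [p0 p1] := andP p01.
move=> fi; elim: s => //= x s IH eta zeta le; rewrite /mean1.
by rewrite lerD // ler_wpM2l ?subr_ge0 //; apply: IH; exact: cle_update.
Qed.

Lemma decr_mean s f : decr f -> decr (mean p s f).
Proof.
have [p0 p1] := andP p01.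
move=> fi; elim: s => //= x s IH eta zeta le; rewrite /mean1.
by rewrite lerD // ler_wpM2l ?subr_ge0 //; apply: IH; exact: cle_update.
Qed.

(** Induction on the coordinates: for a single Bernoulli coordinate the covariance is [p * (1 - p)]
    times the product of the two increments, which have the same sign. *)
Lemma harris s f g eta : decr f -> decr g ->
  mean p s f eta * mean p s g eta <= mean p s (fun z => f z * g z) eta.
Proof.
have [p0 p1] := andP p01.
move=> df dg; elim: s eta => //= x s IH eta.
rewrite /mean1; set F1 := mean p s f _; set F0 := mean p s f _.
set G1 := mean p s g _; set G0 := mean p s g _.
have h1 := IH (update eta x true); have h0 := IH (update eta x false).
have F10 : F1 <= F0 by apply: decr_mean => //; apply: cle_update.
have G10 : G1 <= G0 by apply: decr_mean => //; apply: cle_update.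
apply: (@le_trans _ _ (p * (F1 * G1) + (1 - p) * (F0 * G0))); last first.
  by rewrite lerD // ler_wpM2l ?subr_ge0.
rewrite -subr_ge0.
have -> : p * (F1 * G1) + (1 - p) * (F0 * G0) - (p * F1 + (1 - p) * F0) * (p * G1 + (1 - p) * G0)
  = p * (1 - p) * ((F0 - F1) * (G0 - G1)) by ring.
by rewrite mulr_ge0 ?mulr_ge0 ?subr_ge0.
Qed.

Lemma mean_sqr_le s f eta : (mean p s f eta) ^+ 2 <= mean p s (fun z => f z ^+ 2) eta.
Proof.
have [p0 p1] := andP p01.
elim: s eta => //= x s IH eta; rewrite /mean1.
have h1 := IH (update eta x true); have h0 := IH (update eta x false).
set F1 := mean p s f _ in h1 *; set F0 := mean p s f _ in h0 *.
apply: (@le_trans _ _ (p * F1 ^+ 2 + (1 - p) * F0 ^+ 2)); last first.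
  by rewrite lerD // ler_wpM2l ?subr_ge0.
rewrite -subr_ge0.
have -> : p * F1 ^+ 2 + (1 - p) * F0 ^+ 2 - (p * F1 + (1 - p) * F0) ^+ 2 =
  p * (1 - p) * (F1 - F0) ^+ 2 by ring.
by rewrite mulr_ge0 ?sqr_ge0 ?mulr_ge0 ?subr_ge0.
Qed.

Lemma mean_CS s f g eta :
  (mean p s (fun z => f z * g z) eta) ^+ 2 <=
  mean p s (fun z => f z ^+ 2) eta * mean p s (fun z => g z ^+ 2) eta.
Proof.
set a := mean p s (fun z => f z ^+ 2) eta; set b := mean p s (fun z => g z ^+ 2) eta.
set c := mean p s (fun z => f z * g z) eta.
have H (t u : R) : 0 <= t ^+ 2 * a + 2 * (t * u) * c + u ^+ 2 * b.
  have -> : t ^+ 2 * a + 2 * (t * u) * c + u ^+ 2 * b =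
    mean p s (fun z => (t * f z + u * g z) ^+ 2) eta.
    transitivity (mean p s (fun z => t ^+ 2 * f z ^+ 2 + 2 * (t * u) * (f z * g z) + u ^+ 2 * g z ^+ 2) eta).
      by rewrite !meanD !meanZl.
    congr (mean p s _ eta); apply/funext => z; ring.
  by apply: mean_ge0 => z; exact: sqr_ge0.
have a0 : 0 <= a by apply: mean_ge0 => z; exact: sqr_ge0.
have b0 : 0 <= b by apply: mean_ge0 => z; exact: sqr_ge0.
have key (d e : R) : 0 < d -> 0 <= e -> (forall t u : R, 0 <= t ^+ 2 * e + 2 * (t * u) * c + u ^+ 2 * d) ->
    c ^+ 2 <= e * d.
  move=> d0 e0 /(_ d (- c)).
  have -> : d ^+ 2 * e + 2 * (d * - c) * c + (- c) ^+ 2 * d = d * (e * d - c ^+ 2) by ring.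
  by rewrite pmulr_rge0 // subr_ge0.
have [b1|b1] := ltP 0 b; first exact: key.
have [a1|a1] := ltP 0 a.
  rewrite mulrC; apply: key => // t u; have := H u t; congr (_ <= _); ring.
have a2 : a = 0 by apply/eqP; rewrite eq_le a1.
have b2 : b = 0 by apply/eqP; rewrite eq_le b1.
have c2 : c = 0 by move: (H 1 1) (H 1 (-1)); rewrite a2 b2; lra.
by rewrite c2 a2 mul0r expr0n.
Qed.

End Prob.

Lemma mean_incr_p p q s f eta : 0 <= p -> p <= q -> q <= 1 -> incr f ->
  mean p s f eta <= mean q s f eta.
Proof.
move=> p0 pq q1 fi.
have p01 : 0 <= p <= 1 by rewrite p0 (le_trans pq).
have q01 : 0 <= q <= 1 by rewrite q1 (le_trans p0).
elim: s eta => //= x s IH eta; rewrite /mean1.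
have h1 := IH (update eta x true); have h0 := IH (update eta x false).
have h : mean p s f (update eta x false) <= mean p s f (update eta x true).
  by apply: incr_mean => //; apply: cle_update.
nra.
Qed.

Lemma mean_map p (tau : site -> site) s f g eta : injective tau ->
  (forall zeta : config, f zeta = g (zeta \o tau)) ->
  mean p (map tau s) f eta = mean p s g (eta \o tau).
Proof.
move=> ti fg; elim: s eta => //= x s IH eta; rewrite /mean1 !IH.
have E b : update eta (tau x) b \o tau = update (eta \o tau) x b.
  by apply/funext => y; rewrite /update /= (inj_eq ti).
by rewrite !E.
Qed.

Definition cneg (eta : config) : config := fun x => ~~ eta x.

Lemma mean_neg p s f eta : mean p s f eta = mean (1 - p) s (f \o cneg) (cneg eta).
Proof.
elim: s eta => [|x s IH] eta /=.
  by congr f; apply/funext => x; rewrite /cneg negbK.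
rewrite /mean1 !IH.
have E b : cneg (update eta x b) = update (cneg eta) x (~~ b).
  by apply/funext => y; rewrite /cneg /update; case: eqP.
rewrite !E /=; ring.
Qed.

Definition dif x f : config -> R := fun eta => f (update eta x true) - f (update eta x false).

Lemma dif_mean p x s f : x \notin s -> dif x (mean p s f) = mean p s (dif x f).
Proof.
elim: s => //= y s IH; rewrite inE negb_or => /andP[xy xs].
rewrite -IH //; apply/funext => eta; rewrite /dif /mean1 !(updateC _ _ _ xy); ring.
Qed.

Lemma indep_dif x f : indep x (dif x f).
Proof. by move=> eta b; rewrite /dif !updateK. Qed.

(** Russo's formula. The average has degree one in each coordinate, so the product rule yields one
    term per site; [dif x f] does not see [x], so averaging it over [x] as well changes nothing. *)
Lemma mean_derive s f eta p : uniq s ->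
  is_derive p (1 : R) (fun r => mean r s f eta) (\sum_(x <- s) mean p s (dif x f) eta).
Proof.
elim: s eta => [|x s IH] eta /=; first by move=> _; rewrite big_nil; exact: is_derive_cst.
move=> /andP[xs us]; have d1 := IH (update eta x true) us; have d0 := IH (update eta x false) us.
rewrite big_cons (mean1_indep _ (indep_mean p s (indep_dif x f))).
rewrite -(dif_mean _ _ xs).
have -> : (fun r => mean1 r x (mean r s f) eta) =
   (fun r : R => r) * (fun r => mean r s f (update eta x true)) +
   (cst 1 - (fun r : R => r)) * (fun r => mean r s f (update eta x false)).
  by apply/funext => r.
apply: (@is_derive_eq _ _ _ _ _ _ _ _ (is_deriveD (is_deriveM (is_derive_id p (1 : R)) d1)
  (is_deriveM (is_deriveB (is_derive_cst (1 : R) p (1 : R)) (is_derive_id p (1 : R))) d0))).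
rewrite /dif /= /mean1 big_split /= -!mulr_sumr.
rewrite !fctE /= /GRing.scale /=; ring.
Qed.

(** Exploration argument: [S xi] is the unexplored region, and it is unaffected by the states inside
    it. The event [S xi = K] does not depend on the sites of [K], which are therefore still fresh
    Bernoulli variables; the proof sums over the finitely many values of [K]. *)
Lemma mean_resample p V (Q : config -> pred site) H eta :
  let S xi := [seq x <- V | Q xi x] in
  (forall xi x b, x \in S xi -> S (update xi x b) = S xi) ->
  mean p V H eta = mean p V (fun xi => mean p (S xi) H xi) eta.
Proof.
move=> S inv; pose Ks := undup [seq mask (val m) V | m <- enum {: (size V).-tuple bool}].
have SK xi : S xi \in Ks.
  rewrite mem_undup /S filter_mask; apply/mapP.
  exists (map_tuple (Q xi) (in_tuple V)) => //; by rewrite mem_enum.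
have KV K : K \in Ks -> {subset K <= V}.
  by rewrite mem_undup => /mapP[m _ ->] x; exact: mem_mask.
have E F : mean p V F eta =
    \sum_(K <- Ks) mean p V (fun xi => (S xi == K)%:R * F xi) eta.
  rewrite -(congr1 (fun f => f eta) (mean_sum _ _ _ _ _)); congr (mean p V _ eta).
  apply/funext => xi; rewrite -mulr_suml (bigD1_seq (S xi)) //= ?undup_uniq //.
  rewrite eqxx big1 ?addr0 ?mul1r // => K /negbTE; by rewrite eq_sym => ->.
rewrite E [RHS]E !big_seq; apply: eq_bigr => K KK.
have iK x : x \in K -> indep x (fun xi => (S xi == K)%:R : R).
  move=> xK xi b; congr (_%:R); congr (nat_of_bool _); apply/eqP/eqP => e.
    have := inv (update xi x b) x (xi x); rewrite e => /(_ xK).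
    by rewrite updateK update_id.
  by rewrite inv // e.
rewrite -(mean_mean p _ (KV _ KK)) mean_mull //.
congr (mean p V _ eta); apply/funext => xi.
by case: eqP => [->//|_]; rewrite !mul0r.
Qed.

End Mean.

(** * Probabilities of events under finite product measures *)

Section Events.
Context {R : realType}.
Implicit Types (p q : R) (f g : config -> R) (s V : seq site) (A B : set config).

Definition ind A : config -> R := fun eta => `[< A eta >]%:R.
Definition pr p V A (eta : config) : R := mean p V (ind A) eta.

Lemma ind_ge0 A eta : 0 <= ind A eta. Proof. exact: ler0n. Qed.
Lemma ind_le1 A eta : ind A eta <= 1. Proof. by rewrite /ind; case: asboolP; rewrite ?ler01. Qed.
Lemma ind1 A eta : A eta -> ind A eta = 1. Proof. by move=> H; rewrite /ind asboolT. Qed.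
Lemma ind0 A eta : ~ A eta -> ind A eta = 0. Proof. by move=> H; rewrite /ind asboolF. Qed.

Lemma ind_sub A B eta : (A eta -> B eta) -> ind A eta <= ind B eta.
Proof.
move=> AB; rewrite /ind; case: (asboolP (A eta)) => [/AB ?|_]; first by rewrite asboolT.
exact: ler0n.
Qed.

Lemma indI A B eta : ind (A `&` B) eta = ind A eta * ind B eta.
Proof.
rewrite /ind; case: (asboolP (A eta)) => a; case: (asboolP (B eta)) => b.
- by rewrite asboolT // mulr1.
- by rewrite asboolF ?mulr0 // => -[].
- by rewrite asboolF ?mul0r // => -[].
- by rewrite asboolF ?mul0r // => -[].
Qed.

Lemma indC A eta : ind (~` A) eta = 1 - ind A eta.
Proof.
rewrite /ind; case: (asboolP (A eta)) => a; first by rewrite asboolF ?subrr //; exact.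
by rewrite asboolT ?subr0.
Qed.

Definition up A := forall eta zeta, cle eta zeta -> A eta -> A zeta.
Definition down A := forall eta zeta, cle eta zeta -> A zeta -> A eta.

Lemma incr_ind A : up A -> incr (ind A).
Proof. by move=> uA eta zeta /uA; exact: ind_sub. Qed.
Lemma decr_ind A : down A -> decr (ind A).
Proof. by move=> uA eta zeta /uA; exact: ind_sub. Qed.
Lemma downC A : up A -> down (~` A).
Proof. by move=> uA a b /uA ab nb /ab. Qed.

Lemma dep_ind V A : dep V A -> dep V (ind A).
Proof. by move=> dA eta zeta /dA e; rewrite /ind e. Qed.

Section Prob.
Variable p : R.
Hypothesis p01 : 0 <= p <= 1.

Lemma pr_ge0 V A eta : 0 <= pr p V A eta.
Proof. by apply: mean_ge0 => // z; exact: ind_ge0. Qed.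

Lemma pr_le1 V A eta : pr p V A eta <= 1.
Proof. by apply: mean_le_cst => // z; exact: ind_le1. Qed.

Lemma pr_sub V A B eta : A `<=` B -> pr p V A eta <= pr p V B eta.
Proof. by move=> AB; apply: mean_le => // z; apply: ind_sub; exact: AB. Qed.

Lemma prC V A eta : pr p V (~` A) eta = 1 - pr p V A eta.
Proof.
rewrite /pr; have -> : ind (~` A) = (fun z => 1 - ind A z).
  by apply/funext => z; exact: indC.
by rewrite meanB mean_const.
Qed.

Lemma pr_union (I : eqType) (r : seq I) (F : I -> set config) V A eta :
  (forall z, A z -> exists2 i, i \in r & F i z) ->
  pr p V A eta <= \sum_(i <- r) pr p V (F i) eta.
Proof.
move=> H; rewrite /pr.
rewrite -(congr1 (fun f => f eta) (mean_sum r xpredT (fun i => ind (F i)) p V)).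
apply: mean_le => // z; rewrite {1}/ind; case: asboolP => [/H [i ir Fi]|_]; last first.
  by apply: sumr_ge0 => *; exact: ind_ge0.
by rewrite (big_rem i) //= ind1 // lerDl sumr_ge0 // => *; exact: ind_ge0.
Qed.

Lemma prU V A B eta : pr p V (A `|` B) eta <= pr p V A eta + pr p V B eta.
Proof.
rewrite /pr -(congr1 (fun f => f eta) (meanD p V (ind A) (ind B))).
apply: mean_le => // z; rewrite {1}/ind; case: asboolP => [[]|] H.
- by rewrite ind1 // lerDl ind_ge0.
- by rewrite (ind1 H) lerDr ind_ge0.
- by rewrite addr_ge0 ?ind_ge0.
Qed.

Lemma pr_indep V A B S T eta : dep S A -> dep T B -> (forall x, x \in S -> x \notin T) ->
  pr p V (A `&` B) eta = pr p V A eta * pr p V B eta.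
Proof.
move=> dA dB dST; rewrite /pr.
have -> : ind (A `&` B) = (fun z => ind A z * ind B z) by apply/funext => z; exact: indI.
by rewrite (mean_indepM p V (dep_ind dA) (dep_ind dB) dST).
Qed.

Lemma pr_harris V A B eta : down A -> down B ->
  pr p V A eta * pr p V B eta <= pr p V (A `&` B) eta.
Proof.
move=> dA dB; rewrite /pr.
have -> : ind (A `&` B) = (fun z => ind A z * ind B z) by apply/funext => z; exact: indI.
by apply: harris => //; exact: decr_ind.
Qed.

End Prob.
End Events.

(** * Link with the product law on all configurations *)

Section Law.
Context {R : realType}.

Lemma measurable_coord (x : site) (b : bool) : measurable [set eta : config | eta x = b].
Proof. by apply: sub_sigma_algebra; exists x, b. Qed.

Lemma measurable_dep (V : seq site) (A : set config) : dep V A -> measurable A.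
Proof.
elim: V A => [|x V IH] A dA.
  have [[z Az]|nA] := pselect (exists z, A z).
    have -> : A = setT; last exact: measurableT.
    by apply/seteqP; split => // y _; rewrite (dA y z).
  have -> : A = set0; last exact: measurable0.
  by apply/seteqP; split => // y Ay; apply: nA; exists y.
have -> : A = \bigcup_(b in [set: bool]) ([set eta | eta x = b] `&` [set eta | A (update eta x b)]).
  apply/seteqP; split => [eta Ae|eta [b _ /= [e]]]; last by rewrite -e update_id.
  by exists (eta x) => //=; rewrite update_id.
apply: fin_bigcup_measurable; first exact: finite_finset.
move=> b _; apply: measurableI; first exact: measurable_coord.
apply: IH => eta zeta e; apply: dA => y; rewrite inE /update.
by case: eqP => //= _; exact: e.
Qed.

Lemma measurable_funP_dep (d : measure_display) (T : measurableType d) (V : seq site) (f : config -> T) :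
  dep V f -> measurable_fun setT f.
Proof.
move=> df _ B mB; rewrite setTI; apply: (@measurable_dep V) => eta zeta /df e.
by rewrite /preimage /= e.
Qed.

Variables (p : R) (P : probability config R).
Hypothesis hP : bernoulli_product p P.

(** The law is prescribed on cylinders only. The induction moves one site at a time from the event
    [A] to the cylinder over [W], splitting according to the state of that site. *)
Lemma law_pr_cyl (V W : seq site) (v : config) (A : set config) eta :
  uniq W -> (forall y, y \in V -> y \notin W) -> uniq V -> dep V A ->
  P (A `&` [set z | forall y, y \in W -> z y = v y]) =
  (pr p V A eta * \prod_(y <- W) (if v y then p else 1 - p))%:E.
Proof.
elim: V W v A eta => [|a V IH] W v A eta uW dVW uV dA.
  rewrite /pr /= {1}/ind; case: asboolP => Ae.
    have -> : A = setT by apply/seteqP; split => // y _; rewrite (dA y eta).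
    by rewrite setTI hP // mul1r.
  have -> : A = set0 by apply/seteqP; split => // y; rewrite (dA y eta).
  by rewrite set0I measure0 mul0r.
move: uV => /= /andP[aV uV].
have aW : a \notin W by apply: dVW; rewrite inE eqxx.
pose Ab (b : bool) : set config := [set z | A (update z a b)].
have dAb b : dep V (Ab b).
  move=> z y e; apply: dA => u; rewrite inE /update; case: eqP => //= _; exact: e.
have split : A `&` [set z | forall y, y \in W -> z y = v y] =
   \big[setU/set0]_(b <- [:: true; false])
   (Ab b `&` [set z | forall y, y \in a :: W -> z y = (update v a b) y]).
  rewrite !big_cons big_nil setU0; apply/seteqP; split => [z [Az e]|z].
    case E : (z a); [left|right]; (split; first by rewrite /Ab /= -E update_id).
      move=> y; rewrite inE; case: (eqVneq y a) => [->|ya /= yW].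
        by rewrite update_at.
      by rewrite update_ne // e.
    move=> y; rewrite inE; case: (eqVneq y a) => [->|ya /= yW].
      by rewrite update_at.
    by rewrite update_ne // e.
  have H b : (Ab b `&` [set z | forall y, y \in a :: W -> z y = update v a b y]) z ->
    (A `&` [set z | forall y, y \in W -> z y = v y]) z.
    move=> [Az e]; split.
      by have := e a; rewrite inE eqxx update_at => /(_ isT) E; rewrite -(update_id z a) E.
    move=> y yW; rewrite e ?inE ?yW ?orbT // update_ne //.
    by apply: contraNneq aW => <-.
  by move=> [/H|/H].
have mAb b : measurable (Ab b `&` [set z | forall y, y \in a :: W -> z y = (update v a b) y]).
  apply: measurableI; first exact: measurable_dep (dAb b).
  apply: (@measurable_dep (a :: W)) => z y e /=.
  by apply/propext; split => H u uW1; [rewrite -e // H|rewrite e // H].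
have disj : (Ab true `&` [set z | forall y, y \in a :: W -> z y = (update v a true) y]) `&`
   (Ab false `&` [set z | forall y, y \in a :: W -> z y = (update v a false) y]) = set0.
  apply/seteqP; split => // z [[_ /(_ a)] + [_ /(_ a)]].
  by rewrite !inE eqxx !update_at => /(_ isT) -> /(_ isT).
rewrite split !big_cons big_nil setU0.
rewrite (measureU P (mAb true) (mAb false) disj).
have dV' y : y \in V -> y \notin a :: W.
  move=> yV; rewrite inE negb_or dVW ?inE ?yV ?orbT // andbT.
  by apply: contraNneq aV => <-.
have pE b : \prod_(y <- a :: W) (if update v a b y then p else 1 - p) =
   (if b then p else 1 - p) * \prod_(y <- W) (if v y then p else 1 - p).
  rewrite big_cons update_at; congr (_ * _); rewrite !big_seq; apply: eq_bigr => y yW.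
  by rewrite update_ne //; apply: contraNneq aW => <-.
have uW' : uniq (a :: W) by rewrite /= aW.
have prE b : pr p V (Ab b) (update eta a b) = pr p V A (update eta a b).
  rewrite /pr.
  have E : forall s (f g : config -> R) z, a \notin s -> (forall y, y a = z a -> f y = g y) ->
     mean p s f z = mean p s g z.
    elim => [|u s IHs] f g z /=; first by move=> _; exact.
    rewrite inE negb_or => /andP[au us] H; rewrite /mean1.
    by congr (_ * _ + _ * _); apply: IHs => // y; rewrite update_ne // => /H.
  apply: E => // y ya; rewrite /ind /Ab /=; rewrite update_at in ya.
  by rewrite -{2}(update_id y a) ya.
have IHb b : P (Ab b `&` [set z | forall y, y \in a :: W -> z y = (update v a b) y]) =
    (pr p V A (update eta a b) * ((if b then p else 1 - p) *
      \prod_(y <- W) (if v y then p else 1 - p)))%:E.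
  by rewrite -pE -prE; exact: IH.
transitivity ((pr p V A (update eta a true) * (p * \prod_(y <- W) (if v y then p else 1 - p)))%:E +
  (pr p V A (update eta a false) * ((1 - p) * \prod_(y <- W) (if v y then p else 1 - p)))%:E)%E.
  by congr (_ + _)%E; [exact: (IHb true)|exact: (IHb false)].
rewrite -EFinD /pr /= /mean1; congr (_%:E); ring.
Qed.

Lemma law_pr V A eta : uniq V -> dep V A -> P A = (pr p V A eta)%:E.
Proof.
move=> uV dA; have := @law_pr_cyl V [::] eta A eta isT (fun _ _ => isT) uV dA.
rewrite big_nil mulr1 => <-; congr (P _); apply/seteqP; split => z; first by [].
by case.
Qed.

End Law.

(** * Planar duality *)

Definition star : rel site :=
  [rel x y | (`|y.1 - x.1| <= 1) && (`|y.2 - x.2| <= 1)].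

Section Conn.
Variable e : rel site.

(* The starting site [x] itself is not required to satisfy [P]. *)
Inductive conn (P : site -> Prop) (x : site) : site -> Prop :=
| conn0 : conn P x x
| connS y z : conn P x y -> e y z -> P z -> conn P x z.

Lemma conn_sub (P Q : site -> Prop) x y : (forall z, P z -> Q z) -> conn P x y -> conn Q x y.
Proof.
move=> PQ; elim=> [|u v _ IH euv Pv]; first exact: conn0.
by apply: connS IH euv _; exact: PQ.
Qed.

Lemma conn_trans (P : site -> Prop) x y z : conn P x y -> conn P y z -> conn P x z.
Proof. by move=> xy; elim=> // u v _ IH euv Pv; exact: connS IH euv Pv. Qed.

Lemma conn1 (P : site -> Prop) x y : e x y -> P y -> conn P x y.
Proof. exact: connS (conn0 _ _). Qed.

Lemma conn_end (P : site -> Prop) x y : conn P x y -> x = y \/ P y.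
Proof. by case => [|u v _ _ Pv]; [left|right]. Qed.

Lemma conn_rev (P : site -> Prop) x y : symmetric e -> P x -> conn P x y -> conn P y x.
Proof.
move=> se Px; elim=> [|u v xu IH euv Pv]; first exact: conn0.
have Pu : P u by case: (conn_end xu) => [<-|].
apply: conn_trans IH; apply: conn1 => //; by rewrite se.
Qed.

Lemma conn_path (P : site -> Prop) x y : conn P x y ->
  exists s, [/\ path e x s, forall z, z \in s -> P z & last x s = y].
Proof.
elim=> [|u v _ [s [ps sP sl]] euv Pv]; first by exists [::].
exists (rcons s v); split; rewrite ?last_rcons ?rcons_path ?ps ?sl //.
by move=> z; rewrite mem_rcons inE => /orP[/eqP->|/sP].
Qed.

Lemma path_conn (P : site -> Prop) x s : path e x s -> (forall z, z \in s -> P z) ->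
  conn P x (last x s).
Proof.
elim/last_ind: s => [|s v IH]; first by move=> *; exact: conn0.
rewrite rcons_path last_rcons => /andP[ps ev] H.
apply: connS ev _; first by apply: IH => // z zs; apply: H; rewrite mem_rcons inE zs orbT.
by apply: H; rewrite mem_rcons inE eqxx.
Qed.

Lemma conn_map (tau : site -> site) (P Q : site -> Prop) x y :
  (forall u v, e u v -> e (tau u) (tau v)) -> (forall z, P z -> Q (tau z)) ->
  conn P x y -> conn Q (tau x) (tau y).
Proof.
move=> et PQ; elim=> [|u v _ IH euv Pv]; first exact: conn0.
by apply: connS IH (et _ _ euv) _; exact: PQ.
Qed.

End Conn.

Lemma adjacentP (x y : site) : reflect
  ((y.1 = x.1 /\ `|y.2 - x.2| = 1) \/ (y.2 = x.2 /\ `|y.1 - x.1| = 1)) (adjacent x y).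
Proof.
case: x y => x1 x2 [y1 y2]; rewrite /adjacent /neighbors /= !inE /= -!pair_eqE /=.
by apply: (iffP idP); lia.
Qed.

Lemma adjacent_sym : symmetric adjacent.
Proof. by move=> x y; apply/adjacentP/adjacentP; lia. Qed.

Lemma star_sym : symmetric star.
Proof. by move=> x y; rewrite /star /=; apply/idP/idP; lia. Qed.

Lemma adjacent_star x y : adjacent x y -> star x y.
Proof. by move/adjacentP; rewrite /star /=; lia. Qed.

Definition rect (x0 x1 y0 y1 : int) (z : site) : bool :=
  [&& x0 <= z.1, z.1 <= x1, y0 <= z.2 & z.2 <= y1].

Lemma rectP (x0 x1 y0 y1 : int) (z : site) : reflect
  [/\ x0 <= z.1, z.1 <= x1, y0 <= z.2 & z.2 <= y1] (rect x0 x1 y0 y1 z).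
Proof. exact: and4P. Qed.

Section Cross.

(** Among the steps between rows [y] and [y + 1], those counted have their endpoint in row [y]
    strictly left of [x]. The parity [cr] of their number is a winding number modulo 2; looking at
    the lower endpoint only makes it well defined for diagonal steps. *)
Definition stp (y x : int) (s t : site) : bool :=
  [&& s.2 == y, t.2 == y + 1 & s.1 < x] || [&& t.2 == y, s.2 == y + 1 & t.1 < x].

Fixpoint cr (y x : int) (s : site) (sg : seq site) : bool :=
  if sg is t :: sg' then stp y x s t (+) cr y x t sg' else false.

Variables (x0 x1 y0 y1 : int) (s0 : site) (sg : seq site).
Hypothesis psg : path star s0 sg.
Hypothesis rsg : forall z, z \in s0 :: sg -> rect x0 x1 y0 y1 z.
Hypothesis bot : s0.2 = y0.
Hypothesis top : (last s0 sg).2 = y1.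

(** The path is imagined to continue upward from its last site: the second term counts this
    fictitious step when [v] lies in the top row. *)
Definition side (v : site) : bool :=
  cr v.2 v.1 s0 sg (+) ((v.2 == y1) && ((last s0 sg).1 < v.1)).

Lemma cr_horizontal (x y : int) s tl : path star s tl -> (x, y) \notin s :: tl ->
  cr y x s tl = cr y (x + 1) s tl.
Proof.
elim: tl s => //= t tl IH [s1 s2] /andP[st ptl]; rewrite inE negb_or => /andP[xs xtl].
rewrite (IH t) //; congr (_ (+) _).
move: xs xtl; case: t {IH ptl st} => t1 t2; rewrite inE negb_or -!pair_eqE /= /stp /=; lia.
Qed.

(** Step by step the two counts differ by the change of the indicator of lying in row [y + 1]
    strictly left of [x], and these changes telescope. Avoiding the two sites above each other in
    column [x] excludes the steps for which this would fail. *)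
Lemma cr_vertical (x y : int) s tl : path star s tl ->
  (x, y) \notin s :: tl -> (x, y + 1) \notin s :: tl ->
  cr y x s tl (+) cr (y + 1) x s tl =
  ((s.2 == y + 1) && (s.1 < x)) (+) (((last s tl).2 == y + 1) && ((last s tl).1 < x)).
Proof.
elim: tl s => [|t tl IH] [s1 s2]; first by move=> *; rewrite /= addbb.
move=> /= /andP[st ptl]; rewrite !inE negb_or => /andP[xs xtl].
rewrite negb_or => /andP[xs' xtl'].
have {}IH := IH t ptl xtl xtl'.
have E : stp y x (s1, s2) t (+) stp (y + 1) x (s1, s2) t =
   ((s2 == y + 1) && (s1 < x)) (+) ((t.2 == y + 1) && (t.1 < x)).
  move: st xs xs' xtl xtl'; case: t {IH ptl} => t1 t2.
  rewrite !negb_or -!pair_eqE /= /stp /star /= => st xs xs' /andP[xt _] /andP[xt' _].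
  have : t2 = s2 \/ t2 = s2 + 1 \/ t2 = s2 - 1 by have /andP[_ h] := st; lia.
  case=> [e|[e|e]]; rewrite {}e in st xt xt' *.
  - case: (eqVneq s2 (y + 1)) => [e|ne] /=; last by case: (s2 =P y); lia.
    by rewrite e in st xs xs' xt xt' *; rewrite ?eqxx /=; lia.
  - case: (eqVneq s2 (y + 1)) => [e|ne] /=.
      by rewrite e; lia.
    case: (eqVneq s2 y) => [e|ne'] /=; last by lia.
    by rewrite e in st xs xs' xt xt' *; rewrite ?eqxx /=; lia.
  - case: (eqVneq s2 (y + 1)) => [e|ne] /=.
      by rewrite e in st xs xs' xt xt' *; lia.
    case: (eqVneq s2 (y + 2)) => [e|ne'] /=; last by lia.
    by rewrite e in st xs xs' xt xt' *; lia.
move: IH E; do 2 case: (cr _ _ _ _); do 2 case: (stp _ _ _ _);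
 case: (_ && _); case: (_ && _); case: (_ && _) => //.
Qed.

Lemma cr_left y s tl : (forall z, z \in s :: tl -> x0 <= z.1) -> cr y x0 s tl = false.
Proof.
elim: tl s => //= t tl IH s H.
rewrite IH; last by move=> z zt; apply: H; rewrite inE zt orbT.
have := H s (mem_head _ _); have := H t; rewrite !inE eqxx orbT => /(_ isT).
rewrite /stp; lia.
Qed.

Lemma cr_right y s tl : path star s tl -> (forall z, z \in s :: tl -> z.1 <= x1) ->
  (x1, y) \notin s :: tl -> cr y x1 s tl = (s.2 <= y) (+) ((last s tl).2 <= y).
Proof.
elim: tl s => [|t tl IH] [s1 s2]; first by move=> *; rewrite /= addbb.
move=> /= /andP[st ptl] H; rewrite !inE negb_or => /andP[xs xtl].
rewrite (IH t) //; last by move=> z zt; apply: H; rewrite inE zt orbT.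
have := H (s1, s2) (mem_head _ _); have := H t; rewrite !inE eqxx orbT => /(_ isT).
have E : t.1 <= x1 -> s1 <= x1 -> stp y x1 (s1, s2) t = (s2 <= y) (+) (t.2 <= y).
  move: st xs xtl; case: t {IH ptl H} => t1 t2.
  rewrite !negb_or -!pair_eqE /= /stp /star /=; lia.
by move=> /E {}E /= /E ->; case: (_ <= _); case: (_ <= _); case: (_ <= _).
Qed.

(** A nearest-neighbour step that avoids the path does not change [side], which is false in the left
    column and true in the right one. *)
Lemma cross (Q : site -> Prop) u v :
  (forall z, Q z -> rect x0 x1 y0 y1 z /\ z \notin s0 :: sg) ->
  Q u -> conn adjacent Q u v -> u.1 = x0 -> v.1 = x1 -> False.
Proof.
move=> HQ Qu uv u0 v1.
have Qv : Q v by case: (conn_end uv) => [<-|].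
have su : side u = false.
  rewrite /side u0 cr_left; last by move=> z /rsg/rectP[].
  have /rectP[h _ _ _] := rsg (mem_last s0 sg); by rewrite ltNge h andbF.
have sv : side v = true.
  have [rv nv] := HQ _ Qv.
  rewrite /side v1 cr_right //; last first.
  - by rewrite -v1 -surjective_pairing.
  - by move=> z /rsg/rectP[].
  have := rsg (mem_last s0 sg); have := mem_last s0 sg.
  move: top nv rv; case: (last s0 sg) => l1 l2 /= -> nv rv lm rl.
  have : (l1, y1) != v by apply: contraNneq nv => <-.
  move: rv rl v1 bot; case: (v) => a b; rewrite /rect -pair_eqE /=; lia.
have step a b : Q a -> Q b -> adjacent a b -> (a.1 <= b.1) -> (a.2 <= b.2) -> side a = side b.
  move=> Qa Qb /adjacentP ab le1 le2; have [ra na] := HQ _ Qa; have [rb nb] := HQ _ Qb.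
  case: a b ab ra rb na nb le1 le2 {Qa Qb} => a1 a2 [b1 b2] /= ab ra rb na nb le1 le2.
  rewrite /side /=; case: ab => -[e1' e2'].
    have -> : b2 = a2 + 1 by lia.
    have nb' : (a1, a2 + 1) \notin s0 :: sg by rewrite -e1'; have <- : b2 = a2 + 1 by lia.
    have := cr_vertical psg na nb'; rewrite e1' top bot.
    move: ra rb; rewrite /rect /=; do 2 case: (cr _ _ _ _); lia.
  have E1 : b1 = a1 + 1 by lia.
  rewrite e1' E1 -(cr_horizontal psg na); congr (_ (+) _).
  have := mem_last s0 sg => lm; have : (a1, a2) != last s0 sg by apply: contraNneq na => ->.
  move: top; case: (last s0 sg) => l1 l2 /= ->; rewrite -pair_eqE /=; lia.
have : side v = side u; last by rewrite su sv.
elim: uv {v1 sv Qv} => // a b ua IH ab Qb.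
have Qa : Q a by case: (conn_end ua) => [<-|].
rewrite -IH; have ba : adjacent b a by rewrite adjacent_sym.
have : (a.1 <= b.1 /\ a.2 <= b.2) \/ (b.1 <= a.1 /\ b.2 <= a.2).
  by move/adjacentP: ab; lia.
case=> -[l1 l2]; first by rewrite (step a b).
by rewrite (step b a).
Qed.

End Cross.

(** * Either an open horizontal crossing or a closed vertical *-crossing *)

Section Hex.

Lemma addb_telescope (f : nat -> bool) n :
  \big[addb/false]_(i < n) (f i (+) f i.+1) = f 0%N (+) f n.
Proof.
elim: n => [|n IH]; first by rewrite big_ord0 addbb.
by rewrite big_ord_recr /= IH -addbA (addbA (f n)) addbb.
Qed.

(** Think of [a] as the region reached from the left and of [w] as the wall attached to the bottom.
    In each row, count the interface edges, from [a] to its complement, whose outer end satisfies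
    [w]: the parity of this count is the same in all rows and odd in row 0. *)
Lemma hex_parity (N M : nat) (a w : nat -> nat -> bool) :
  (forall j, (j <= M)%N -> a 0%N j) -> (forall j, (j <= M)%N -> ~~ a N j) ->
  (forall i, (i < N)%N -> a i 0%N -> ~~ a i.+1 0%N -> w i.+1 0%N) ->
  (forall i, (i < N)%N -> ~~ a i 0%N -> a i.+1 0%N -> w i 0%N) ->
  (forall i j, (i < N)%N -> (j < M)%N ->
    let o (d d' : bool) := ~~ a (i + d)%N (j + d')%N &&
       (a (i + ~~ d)%N (j + d')%N || a (i + d)%N (j + ~~ d')%N) in
    forall d1 d1' d2 d2' : bool, o d1 d1' -> o d2 d2' ->
      w (i + d1)%N (j + d1')%N = w (i + d2)%N (j + d2')%N) ->
  exists i, [&& (i <= N)%N, ~~ a i M & w i M].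
Proof.
move=> a0 aN b1 b2 face.
pose kh i j := [&& a i j, ~~ a i.+1 j & w i.+1 j] || [&& ~~ a i j, a i.+1 j & w i j].
pose kv i j := [&& a i j, ~~ a i j.+1 & w i j.+1] || [&& ~~ a i j, a i j.+1 & w i j].
(* The boundary of a unit face carries an even number of interface edges, and by [face] their outer
   ends all satisfy [w] or all fail it. *)
have fp i j : (i < N)%N -> (j < M)%N -> kh i j (+) kh i j.+1 = kv i j (+) kv i.+1 j.
  move=> iN jM; have := face i j iN jM.
  rewrite /kh /kv /=;move=> F.
  have {F}G d1 d1' d2 d2' : let o (d d' : bool) := ~~ a (i + d)%N (j + d')%N &&
       (a (i + ~~ d)%N (j + d')%N || a (i + d)%N (j + ~~ d')%N) in
     o d1 d1' ==> o d2 d2' ==> (w (i + d1)%N (j + d1')%N == w (i + d2)%N (j + d2')%N).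
    by apply/implyP => o1; apply/implyP => o2; apply/eqP; exact: F.
  move: (G false false false true) (G false false true false).
  move: (G false false true true) (G false true true false).
  move: (G false true true true) (G true false true true).
  rewrite /= !addn0 !addn1.
  by case: (a i j); case: (a i j.+1); case: (a i.+1 j); case: (a i.+1 j.+1);
   case: (w i j); case: (w i j.+1); case: (w i.+1 j); case: (w i.+1 j.+1).
pose H j := \big[addb/false]_(i < N) kh i j.
have Hs j : (j < M)%N -> H j.+1 = H j.
  move=> jM; have : H j (+) H j.+1 = false.
    rewrite /H -big_split /=.
    under eq_bigr => i _ do rewrite fp //.
    rewrite (addb_telescope (fun i => kv i j)) /kv !a0 ?(ltnW jM) //=.
    by rewrite (negbTE (aN _ jM)) (negbTE (aN _ (ltnW jM))).
  by case: (H j); case: (H j.+1).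
(* In the bottom row every interface edge counts, so the parity is that of the change of [a] between
   the first and the last column. *)
have H0 : H 0%N.
  rewrite /H; under eq_bigr => i _.
    have -> : kh i 0%N = a i 0%N (+) a i.+1 0%N.
      rewrite /kh; have := b1 i (ltn_ord i); have := b2 i (ltn_ord i).
      case: (a i 0%N); case: (a i.+1 0%N) => //=.
        by move=> _ /(_ isT isT) ->.
      by move=> /(_ isT isT) -> _.
    over.
  by rewrite (addb_telescope (fun i => a i 0%N)) a0 // (negbTE (aN _ _)).
have HM j : (j <= M)%N -> H j by elim: j => // j IH jM; rewrite Hs // IH // ltnW.
have := HM M (leqnn M); rewrite /H.
case: (boolP [exists i : 'I_N, kh i M]) => [/existsP[i] ki _|]; last first.
  rewrite negb_exists => /forallP nk; rewrite big1 // => i _; exact/negbTE/nk.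
move: ki; rewrite /kh => /orP[/and3P[_ n1 w1]|/and3P[n1 _ w1]].
  by exists i.+1; rewrite ltn_ord n1.
by exists i; rewrite ltnW // n1.
Qed.

Lemma hex (x0 x1 y0 y1 : int) (op : site -> Prop) : x0 <= x1 -> y0 <= y1 ->
  (exists u v, [/\ u.1 = x0, v.1 = x1, op u, rect x0 x1 y0 y1 u &
     conn adjacent (fun z => op z /\ rect x0 x1 y0 y1 z) u v]) \/
  (exists u v, [/\ u.2 = y0, v.2 = y1, ~ op u, rect x0 x1 y0 y1 u &
     conn star (fun z => ~ op z /\ rect x0 x1 y0 y1 z) u v]).
Proof.
move=> x01 y01; apply: or_asboolP; rewrite orbC -implyNb; apply/implyP => /asboolPn nv.
apply/asboolP; move: nv; apply: contra_notP => nh.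
pose rc := rect x0 x1 y0 y1.
pose A v := exists u, [/\ u.1 = x0, op u, rc u & conn adjacent (fun z => op z /\ rc z) u v].
pose W v := exists u, [/\ u.2 = y0, ~ op u, rc u & conn star (fun z => ~ op z /\ rc z) u v].
(* Column 0 of the grid is the fictitious column [x0 - 1], declared reached, so that every open site
   of the left side has a reached neighbour. *)
pose N := (`|x1 - x0|.+1)%N; pose M := `|y1 - y0|%N.
pose pt i j : site := (x0 - 1 + i%:Z, y0 + j%:Z).
pose a i j := (i == 0)%N || `[< A (pt i j) >].
pose w i j := `[< W (pt i j) >].
have ptrc i j : (0 < i)%N -> (i <= N)%N -> (j <= M)%N -> rc (pt i j).
  by rewrite /rc /rect /pt /N /M /=; lia.
have Arc v : A v -> op v /\ rc v.
  by move=> [u [_ ou ru /conn_end [<-//|]]].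
have Aadj u v : A u -> adjacent u v -> op v -> rc v -> A v.
  move=> [u0 [h1 h2 h3 h4]] uv ov rv; exists u0; split => //; exact: connS h4 uv _.
have A1 v : v.1 = x0 -> op v -> rc v -> A v.
  by move=> v0 ov rv; exists v; split => //; exact: conn0.
have Wadj u v : W u -> star u v -> ~ op v -> rc v -> W v.
  move=> [u0 [h1 h2 h3 h4]] uv ov rv; exists u0; split => //; exact: connS h4 uv _.
have out i j i' j' : (i <= N)%N -> (j <= M)%N -> (i' <= N)%N -> (j' <= M)%N ->
  ~~ a i j -> a i' j' -> adjacent (pt i' j') (pt i j) -> ~ op (pt i j) /\ rc (pt i j).
  move=> iN jM iN' jM' na a' ad; have i0 : (0 < i)%N by move: na; rewrite /a; case: (i).
  have rp := ptrc _ _ i0 iN jM; split => // oij; move: na; rewrite /a negb_or => /andP[_ /asboolPn].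
  apply; move: a'; rewrite /a => /orP[/eqP i'0|/asboolP Au]; last exact: Aadj Au ad oij rp.
  apply: A1 => //; move/adjacentP: ad; rewrite i'0 /pt /=; lia.
have [i /and3P[iN na /asboolP Wi]] : exists i, [&& (i <= N)%N, ~~ a i M & w i M].
  apply: hex_parity.
  - by move=> j _; rewrite /a eqxx.
  - move=> j jM; rewrite /a negb_or /N /=; apply/asboolPn => -[u [u0 ou ru uv]].
    apply: nh; exists u, (pt N j); split => //; rewrite /pt /N /=; lia.
  - move=> i iN ai na; have [] := out i.+1 0%N i 0%N _ _ _ _ na ai _ => //; try by [lia|apply: ltnW].
      by apply/adjacentP; rewrite /pt /=; lia.
    move=> no rp; apply/asboolP; exists (pt i.+1 0%N); split => //; last exact: conn0.
    by rewrite /pt /=; lia.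
  - move=> i iN na ai; have [] := out i 0%N i.+1 0%N _ _ _ _ na ai _ => //; try by [lia|apply: ltnW].
      by apply/adjacentP; rewrite /pt /=; lia.
    move=> no rp; apply/asboolP; exists (pt i 0%N); split => //; last exact: conn0.
    by rewrite /pt /=; lia.
  - move=> i j iN jM o.
    have oout d d' : o d d' -> ~ op (pt (i + d)%N (j + d')%N) /\ rc (pt (i + d)%N (j + d')%N).
      move=> /andP[na /orP[a'|a']].
        apply: (out _ _ _ _ _ _ _ _ na a'); try lia.
        by apply/adjacentP; rewrite /pt /=; case: (d) => /=; lia.
      apply: (out _ _ _ _ _ _ _ _ na a'); try lia.
      by apply/adjacentP; rewrite /pt /=; case: (d') => /=; lia.
    move=> d1 d1' d2 d2' /oout[n1 r1] /oout[n2 r2].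
    have st : star (pt (i + d1)%N (j + d1')%N) (pt (i + d2)%N (j + d2')%N).
      by rewrite /star /pt /=; lia.
    apply/asboolP/asboolP => Wp; first exact: Wadj Wp st n2 r2.
    by apply: Wadj Wp _ n1 r1; rewrite star_sym.
by case: Wi => u [u0 nu ru uv]; exists u, (pt i M); split => //; rewrite /pt /M /=; lia.
Qed.

End Hex.

(** * Exponential decay and mean-field bound *)

Definition box (x : site) (n : nat) : seq site :=
  [seq (x.1 + i%:Z - n%:Z, x.2 + j%:Z - n%:Z) | i <- iota 0 n.*2.+1, j <- iota 0 n.*2.+1].

Lemma mem_box x n z : (z \in box x n) = (`|z.1 - x.1| <= n%:Z) && (`|z.2 - x.2| <= n%:Z).
Proof.
apply/allpairsP/idP => [[[i j] [+ + ->]]|].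
  rewrite !mem_iota /=; lia.
case: z => z1 z2 h; rewrite /= in h; exists (`|(z1 - x.1 + n%:Z)%R|%N, `|(z2 - x.2 + n%:Z)%R|%N).
by rewrite !mem_iota /=; split; [lia|lia|congr (_, _); lia].
Qed.

Lemma box_uniq x n : uniq (box x n).
Proof.
apply: allpairs_uniq; [exact: iota_uniq|exact: iota_uniq|].
by move=> [a b] [c d] _ _ /= [h1 h2]; congr (_, _); lia.
Qed.

Lemma size_box x n : size (box x n) = (n.*2.+1 * n.*2.+1)%N.
Proof. by rewrite size_allpairs !size_iota. Qed.

Section MeanDep.
Context {R : realType}.

Lemma mean_dep_cst (r : R) B V f eta zeta : dep B f -> {subset B <= V} ->
  mean r V f eta = mean r B f zeta.
Proof.
move=> df BV; rewrite -(mean_mean r f BV).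
have -> : mean r B f = fun=> mean r B f zeta.
  by apply/funext => z; apply: mean_cst df _.
by rewrite mean_const.
Qed.

Lemma mean_coord (r : R) V y eta : y \in V -> pr r V [set z : config | z y] eta = r.
Proof.
move=> yV; have dy : dep [:: y] (ind [set z : config | z y] : config -> R).
  by apply: dep_ind => a b /(_ y); rewrite inE eqxx => /(_ isT) e /=; rewrite e.
rewrite /pr (mean_dep_cst (B := [:: y]) r eta eta dy); last by move=> z; rewrite inE => /eqP->.
rewrite /= /mean1 ind1 /= ?update_at // ind0 /= ?update_at //; ring.
Qed.

End MeanDep.

Section Exits.
Variable e : rel site.
Hypothesis e_star : forall x y, e x y -> star x y.
Hypothesis e_shift : forall a x y, e (x + a) (y + a) = e x y.

Definition exits (x : site) (L : nat) : set config :=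
  [set xi | exists2 z, conn e (fun u => xi u) x z & z \notin box x L].

(** A path that returns to [x] can be restarted there. This is why leaving a box around [x] does not
    depend on the state of [x], which later gives independence. *)
Lemma conn_nostart (P : site -> Prop) x z : conn e P x z ->
  conn e (fun u => P u /\ u != x) x z.
Proof.
elim=> [|u v _ IH euv Pv]; first exact: conn0.
by have [->|vx] := eqVneq v x; [exact: conn0|apply: connS IH euv _].
Qed.

Lemma conn_exit (P : site -> Prop) x y L z : conn e P y z -> y \in box x L -> z \notin box x L ->
  exists2 z', conn e (fun u => P u /\ u \in box x L.+1) y z' & z' \notin box x L.
Proof.
move=> yz yx; suff H : z \in box x L /\ conn e (fun u => P u /\ u \in box x L) y z \/
   exists2 z', conn e (fun u => P u /\ u \in box x L.+1) y z' & z' \notin box x L.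
  by move=> nz; case: H => // -[]; rewrite (negbTE nz).
elim: yz => [|u v _ IH euv Pv]; first by left; split => //; exact: conn0.
case: IH => [[ub cu]|]; last by right.
case: (boolP (v \in box x L)) => vb.
  by left; split => //; apply: connS cu euv _.
right; exists v => //; apply: (connS (y := u)) => //.
  apply: conn_sub cu => w [Pw wb]; split => //; move: wb; rewrite !mem_box; lia.
by split => //; move: ub (e_star euv); rewrite !mem_box /star /=; lia.
Qed.

Lemma box_self x n : x \in box x n.
Proof. by rewrite mem_box !subrr normr0. Qed.

Lemma exitsP x L xi : exits x L xi <->
  exists2 z, conn e (fun u => (xi u /\ u != x) /\ u \in box x L.+1) x z & z \notin box x L.
Proof.
split => [[z cz nz]|[z cz nz]].
  by apply: conn_exit nz => //; [exact: conn_nostart|exact: box_self].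
by exists z => //; apply: conn_sub cz => u [[]].
Qed.

Lemma exits_up x L : up (exits x L).
Proof. by move=> a b ab [z cz nz]; exists z => //; apply: conn_sub cz => u /ab. Qed.

Lemma exits_dep x L : dep [seq u <- box x L.+1 | u != x] (exits x L).
Proof.
have H (a b : config) : (forall u, u \in [seq u <- box x L.+1 | u != x] -> a u = b u) ->
    exits x L a -> exits x L b.
  move=> E /exitsP[z cz nz]; apply/exitsP; exists z => //; apply: conn_sub cz.
  by move=> u [[au ux] ub]; split => //; split => //; rewrite -E // mem_filter ux.
by move=> a b E; apply/propext; split; apply: H => // u /E.
Qed.

Lemma exits_anti x L L' : (L <= L')%N -> exits x L' `<=` exits x L.
Proof. by move=> LL xi [z cz nz]; exists z => //; move: nz; rewrite !mem_box; lia. Qed.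

Lemma exits_shift x L (xi : config) : exits x L xi <-> exits 0 L (xi \o (fun z => z + x)).
Proof.
split => [[z cz nz]|[z cz nz]].
  exists (z - x); last by move: nz; rewrite !mem_box /=; lia.
  rewrite -(subrr x); apply: (conn_map (tau := fun u => u - x)) cz.
    by move=> u v; rewrite e_shift.
  by move=> u /=; rewrite subrK.
exists (z + x); last by move: nz; rewrite !mem_box /=; lia.
have := @conn_map e (fun u => u + x) _ (fun u => xi u) 0 z _ _ cz; rewrite add0r; apply => //.
by move=> u v; rewrite e_shift.
Qed.

Lemma box_shift x n : box x n = map (fun z => z + x) (box 0 n).
Proof.
rewrite /box map_allpairs; apply: eq_allpairs => // i j /=.
by rewrite [RHS]surjective_pairing /=; congr (_, _); lia.
Qed.

Context {R : realType}.
Implicit Types (r : R).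

Definition arm r (L : nat) : R := pr r (box 0 L.+1) (exits 0 L) (fun=> false).

Lemma pr_exits r x L V eta : {subset box x L.+1 <= V} -> pr r V (exits x L) eta = arm r L.
Proof.
move=> sV; rewrite /arm /pr.
have d : dep (box x L.+1) (ind (exits x L) : config -> R).
  have sb : {subset [seq u <- box x L.+1 | u != x] <= box x L.+1}.
    by move=> u; rewrite mem_filter => /andP[].
  exact: (dep_ind (dep_sub sb (@exits_dep x L))).
rewrite (mean_dep_cst r eta (fun=> false) d sV) box_shift.
rewrite (@mean_map _ r (fun z => z + x) _ _ (ind (exits 0 L))) //; first exact: addIr.
by move=> z; rewrite /ind; congr (_ %:R); congr (nat_of_bool _); apply: asbool_equiv_eq;
  exact: exits_shift.
Qed.

Lemma arm_ge0 r L : 0 <= r <= 1 -> 0 <= arm r L.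
Proof. by move=> r01; exact: pr_ge0. Qed.
Lemma arm_le1 r L : 0 <= r <= 1 -> arm r L <= 1.
Proof. by move=> r01; exact: pr_le1. Qed.

Lemma arm_anti r L L' : 0 <= r <= 1 -> (L <= L')%N -> arm r L' <= arm r L.
Proof.
move=> r01 LL; rewrite -(@pr_exits r 0 L (box 0 L'.+1) (fun=> false)).
  by apply: pr_sub => //; exact: exits_anti.
by move=> u; rewrite !mem_box; lia.
Qed.

Lemma arm_mono r r' L : 0 <= r -> r <= r' -> r' <= 1 -> arm r L <= arm r' L.
Proof. by move=> *; apply: mean_incr_p => //; apply: incr_ind; exact: exits_up. Qed.

Definition cluster (S : seq site) (xi : config) : site -> Prop :=
  conn e (fun u => xi u /\ u \in S) 0.

Definition touches (S : seq site) (y : site) : set config :=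
  [set xi | exists x, [/\ x \in S, e x y & cluster S xi x]].

(* Expected number of exits from [S]: sites out of [S] next to the cluster of 0 in [S]. *)
Definition psi r (n : nat) (S : seq site) : R :=
  \sum_(y <- box 0 n.+1 | y \notin S) pr r S (touches S y) (fun=> false).

Lemma touches_up S y : up (touches S y).
Proof.
move=> a b ab [x [h1 h2 h3]]; exists x; split => //.
by apply: conn_sub h3 => u [/ab]; split.
Qed.

Lemma touches_dep S y : dep S (touches S y).
Proof.
have H (a b : config) : (forall u, u \in S -> a u = b u) -> touches S y a -> touches S y b.
  move=> E [x [h1 h2 h3]]; exists x; split => //; apply: conn_sub h3.
  by move=> u [au uS]; rewrite -E.
by move=> a b E; apply/propext; split; apply: H => // u /E.
Qed.

Lemma psi_mono r r' n S : 0 <= r -> r <= r' -> r' <= 1 -> psi r n S <= psi r' n S.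
Proof.
move=> *; apply: ler_sum => y _; apply: mean_incr_p => //; apply: incr_ind; exact: touches_up.
Qed.

Section HSL.
Variables (r : R) (S : seq site) (m : nat).
Hypotheses (r01 : 0 <= r <= 1) (S0 : (0 : site) \in S) (Sm : {subset S <= box 0 m}).

(** The sites whose state is not looked at when the cluster of 0 in [S] is explored: those neither
    in the cluster nor in [S] next to it. *)
Let unrev (xi : config) (x : site) : Prop :=
  ~ cluster S xi x /\ ~ (x \in S /\ exists2 c, cluster S xi c & e c x).

Let cluster_in xi x : cluster S xi x -> x \in S.
Proof. by move=> /conn_end[<-//|[]]. Qed.

Let cluster_stable (xi zeta : config) :
  (forall x, ~ unrev xi x -> xi x = zeta x) -> cluster S xi = cluster S zeta.
Proof.
move=> E; apply/funext => u; apply/propext; split.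
  elim=> [|v w xv IH evw [xw wS]]; first exact: conn0.
  apply: (connS IH evw); split => //; rewrite -E // => -[nc _]; apply: nc.
  exact: (connS xv evw).
elim=> [|v w xv IH evw [xw wS]]; first exact: conn0.
apply: (connS IH evw); split => //; rewrite E // => -[_ nc]; apply: nc.
by split => //; exists v.
Qed.

Let unrev_stable (xi zeta : config) :
  (forall x, ~ unrev xi x -> xi x = zeta x) -> unrev xi = unrev zeta.
Proof. by move=> /cluster_stable E; rewrite /unrev E. Qed.

(** Cut the path where it leaves the cluster for the last time. The exit [y] is out of [S],
    otherwise it would belong to the cluster, and for the same reason all later sites are
    unrevealed. *)
Let decomp (zeta : config) z : conn e (fun u => zeta u) 0 z -> cluster S zeta z \/
  exists y, [/\ y \notin S, touches S y zeta, zeta y &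
    conn e (fun u => zeta u /\ unrev zeta u) y z].
Proof.
elim=> [|u v zu IH euv zv]; first by left; exact: conn0.
have [cv|ncv] := pselect (cluster S zeta v); first by left.
right; case: IH => [cu|[y [h1 h2 h3 h4]]].
  exists v; split => //; last exact: conn0.
    by apply/negP => vS; apply: ncv; exact: connS cu euv _.
  by exists u; split => //; exact: cluster_in cu.
exists y; split => //; apply: connS h4 euv _; split => //; split => // -[vS [c cc ecv]].
by apply: ncv; exact: connS cc ecv _.
Qed.

(* Simon-Lieb: a long path exits [S] next to the cluster of 0 in [S] and starts again from there. *)
Lemma hsl L : arm r (L + m.+1)%N <= r * psi r m S * arm r L.
Proof.
pose V := box 0 (L + m.+1).+1; pose eta0 : config := fun=> false.
pose Q xi := fun x => `[< unrev xi x >].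
have QP xi x : reflect (unrev xi x) (Q xi x) by exact: asboolP.
have SV : {subset S <= V} by move=> u /Sm; rewrite !mem_box; lia.
rewrite {1}/arm -/V /pr (@mean_resample _ r V Q) => [|xi x b xS]; last first.
  have xU : unrev xi x by move: xS; rewrite mem_filter => /andP[/QP].
  have /unrev_stable EU : forall y, ~ unrev xi y -> xi y = update xi x b y.
    by move=> y ny; rewrite update_ne //; apply/eqP => yx; apply: ny; rewrite yx.
  by rewrite /Q EU.
have bound xi : mean r [seq x <- V | Q xi x] (ind (exits 0 (L + m.+1))) xi <=
   \sum_(y <- box 0 m.+1 | y \notin S) ind (touches S y) xi * (r * arm r L).
  pose W := [seq x <- V | Q xi x].
  (* Given the exploration, [h y] involves unrevealed sites only. Forgetting this restriction on the
     path, it is contained in the event that [y] is open and starts an arm of length [L], two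
     independent facts. *)
  pose h y : set config := [set zeta : config | zeta y /\
     exists2 z, conn e (fun u => (zeta u /\ unrev xi u) /\ u \in box y L.+1) y z & z \notin box y L].
  apply: (@le_trans _ _ (mean r W (fun zeta =>
     \sum_(y <- box 0 m.+1 | y \notin S) ind (touches S y) xi * ind (h y) zeta) xi)).
    apply: mean_le_on => // zeta E.
    have EV x : x \notin V -> xi x = zeta x.
      by move=> xV; rewrite E // mem_filter (negbTE xV) andbF.
    pose xi' : config := fun x => if x \in V then xi x else zeta x.
    have Ex x : ~ unrev xi x -> xi x = zeta x.
      by move=> nx; rewrite E // mem_filter; case: QP => //.
    have EC := cluster_stable Ex; have EU := unrev_stable Ex.
    rewrite {1}/ind; case: asboolP => [[z cz nz]|_]; last first.
      by apply: sumr_ge0 => y _; rewrite mulr_ge0 // ind_ge0.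
    have [/cluster_in/Sm zS|[y [h1 h2 h3 h4]]] := decomp cz.
      by exfalso; move: nz zS; rewrite !mem_box; lia.
    have yb : y \in box 0 m.+1.
      have [x [/Sm xS exy _]] := h2; move: xS (e_star exy).
      by rewrite !mem_box /star /=; lia.
    rewrite (big_rem y) //= h1.
    have t1 : touches S y xi.
      by have [x [g1 g2 g3]] := h2; exists x; split => //; rewrite EC.
    have hy : h y zeta.
      split => //.
      have nz' : z \notin box y L by move: yb nz; rewrite !mem_box /=; lia.
      by have := conn_exit h4 (box_self y L) nz'; rewrite EU.
    rewrite !ind1 // mulr1 lerDl sumr_ge0 // => u _; by rewrite mulr_ge0 // ind_ge0.
  rewrite (mean_sum (box 0 m.+1) (fun y => y \notin S)
    (fun y zeta => ind (touches S y) xi * ind (h y) zeta) r W).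
  rewrite big_seq_cond [leRHS]big_seq_cond; apply: ler_sum => y /andP[yb yS].
  rewrite (meanZl r W (ind (touches S y) xi)) ler_wpM2l ?ind_ge0 //.
  have yLV : {subset box y L.+1 <= V}.
    by move=> u; move: yb; rewrite !mem_box /=; lia.
  have [yW|yW] := boolP (y \in W).
    have dh : dep W (ind (h y) : config -> R).
      apply: dep_ind.
      have H (a b : config) : (forall u, u \in W -> a u = b u) -> h y a -> h y b.
        move=> E [ay [z cz nz]]; split; first by rewrite -E.
        exists z => //; apply: conn_sub cz => u [[au uu] ub]; split => //; split => //.
        by rewrite -E // mem_filter yLV // andbT; apply/QP.
      by move=> a b E; apply/propext; split; apply: H => // u /E.
    have WV : {subset W <= V} by move=> u; rewrite mem_filter => /andP[].
    rewrite -(mean_dep_cst r xi xi dh WV).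
    have yV : y \in V by exact: WV.
    have dy : dep [:: y] [set z : config | z y].
      by move=> a b /(_ y); rewrite inE eqxx => /(_ isT) E /=; rewrite E.
    have -> : r * arm r L = pr r V ([set z : config | z y] `&` exits y L) xi.
      rewrite (@pr_indep _ r V _ _ _ _ xi dy (@exits_dep y L)).
        by rewrite (@mean_coord _ r V y xi yV) (@pr_exits r y L V xi yLV).
      by move=> x; rewrite inE => /eqP ->; rewrite mem_filter eqxx.
    apply: mean_le => // zeta; apply: ind_sub => -[zy [z cz nz]]; split => //.
    by exists z => //; apply: conn_sub cz => u [[]].
  have nU : ~ unrev xi y.
    move=> U; move: yW; rewrite mem_filter yLV ?box_self // andbT; by case: QP.
  by exfalso; apply: nU; split => [/cluster_in|[+ _]]; rewrite (negbTE yS).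
apply: (@le_trans _ _ (mean r V (fun xi => \sum_(y <- box 0 m.+1 | y \notin S)
   ind (touches S y) xi * (r * arm r L)) eta0)).
  exact: mean_le.
rewrite (mean_sum (box 0 m.+1) (fun y => y \notin S)
    (fun y xi => ind (touches S y) xi * (r * arm r L)) r V).
have -> : r * psi r m S * arm r L = psi r m S * (r * arm r L) by ring.
rewrite /psi mulr_suml.
apply: ler_sum => y _; rewrite mean_mulr // ler_wpM2r ?mulr_ge0 ?arm_ge0 //; first by case/andP: r01.
by rewrite /pr (mean_dep_cst r eta0 eta0 (dep_ind (@touches_dep S y)) SV).
Qed.

End HSL.

Lemma arm_decay r S m : 0 <= r <= 1 -> (0 : site) \in S -> {subset S <= box 0 m} ->
  forall k, arm r (k * m.+1)%N <= (r * psi r m S) ^+ k.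
Proof.
move=> r01 S0 Sm; elim=> [|k IH]; first by rewrite expr0; exact: arm_le1.
rewrite mulSn addnC exprS; apply: (le_trans (hsl r01 S0 Sm _)).
rewrite ler_wpM2l // mulr_ge0 //; first by case/andP: r01.
by apply: sumr_ge0 => y _; exact: pr_ge0.
Qed.

(** * A differential inequality for arm probabilities *)

Section Sharpness.
Variable n : nat.
Let V := box 0 n.+1.
Let G : set config := exits 0 n.

(** Exploration from outside the box. [S xi] collects the sites of the box without an open path to
    the outside, and finding it never looks at the states inside it. *)
Let hit (xi : config) (x : site) : Prop :=
  exists2 z, conn e (fun u => xi u /\ u \in V) x z & z \notin box 0 n.
Let Q (xi : config) (x : site) : bool := `[< x \in box 0 n /\ ~ hit xi x >].
Let S xi := [seq x <- V | Q xi x].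

Let boxV : {subset box 0 n <= V}.
Proof. by move=> u; rewrite !mem_box; lia. Qed.

Let inS xi x : (x \in S xi) <-> x \in box 0 n /\ ~ hit xi x.
Proof.
rewrite mem_filter; split => [/andP[/asboolP//]|H].
by apply/andP; split; [exact/asboolP|apply: boxV; case: H].
Qed.

Let hit_stable (xi zeta : config) : (forall x, x \notin S xi -> xi x = zeta x) ->
  hit xi = hit zeta.
Proof.
move=> E; apply/funext => x; apply/propext; split => -[z /conn_path [s [ps sP sl]] nz].
  elim: s x ps sP sl => [|y s IH] x /=; first by move=> _ _ ->; exists z => //; exact: conn0.
  move=> /andP[exy ps] sP sl.
  have hy : hit xi y.
    exists z => //; rewrite -sl; apply: path_conn => // u us; apply: sP.
    by rewrite inE us orbT.
  have [z' cz' nz'] : hit zeta y.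
    by apply: IH => // u us; apply: sP; rewrite inE us orbT.
  have [xiy yV] := sP y (mem_head _ _).
  exists z' => //; apply: (conn_trans _ cz'); apply: conn1 => //; split => //.
  by rewrite -E //; apply/negP => /inS[_]; apply.
elim: s x ps sP sl => [|y s IH] x /=; first by move=> _ _ ->; exists z => //; exact: conn0.
move=> /andP[exy ps] sP sl.
have hy : hit xi y.
  by apply: IH => // u us; apply: sP; rewrite inE us orbT.
have [zy yV] := sP y (mem_head _ _); have [z' cz' nz'] := hy.
exists z' => //; apply: (conn_trans _ cz'); apply: conn1 => //; split => //.
by rewrite E //; apply/negP => /inS[_]; apply.
Qed.

Let S_stable (xi zeta : config) : (forall x, x \notin S xi -> xi x = zeta x) -> S xi = S zeta.
Proof. by move=> /hit_stable E; apply: eq_filter => x; rewrite /Q E. Qed.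

Let GP xi : G xi <-> (0 : site) \notin S xi.
Proof.
split.
  move=> [z cz nz]; apply/negP => /inS[_]; apply.
  have [z' cz' nz'] := conn_exit cz (box_self 0 n) nz.
  by exists z'.
move=> n0; have [[z cz nz]|nh] := pselect (hit xi 0).
  by exists z => //; apply: conn_sub cz => u [].
by exfalso; move/negP: n0; apply; apply/inS; split => //; exact: box_self.
Qed.

Let pivot xi y : (0 : site) \in S xi -> y \notin S xi -> touches (S xi) y xi ->
  ~~ xi y /\ dif y (ind G : config -> R) xi = 1.
Proof.
move=> S0 yS [x [xS exy cx]].
have [xb nhx] := (inS xi x).1 xS.
have yV : y \in V by move: xb (e_star exy); rewrite !mem_box /star /=; lia.
have hy : hit xi y.
  have [yb|yb] := boolP (y \in box 0 n); last by exists y => //; exact: conn0.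
  have [//|nh] := pselect (hit xi y).
  by exfalso; move/negP: yS; apply; apply/inS.
have xiy : ~~ xi y.
  apply/negP => xiy; apply: nhx; have [z cz nz] := hy.
  by exists z => //; apply: (conn_trans _ cz); exact: conn1.
split => //; rewrite /dif.
have -> : update xi y false = xi.
  by rewrite -[RHS](update_id xi y) (negbTE xiy).
rewrite ind1; last first.
  have sub : cle xi (update xi y true).
    by move=> u; rewrite /update; case: eqP.
  have [z cz nz] := hy; exists z => //.
  apply: (@conn_trans _ _ _ x); first by apply: conn_sub cx => u [/sub].
  apply: (@conn_trans _ _ _ y); first by apply: conn1; rewrite ?update_at.
  by apply: conn_sub cz => u [/sub].
by rewrite ind0 ?subr0 // => /GP; rewrite S0.
Qed.

(** Given that the unexplored set [S] contains 0, the sites touched by the cluster of 0 in [S] are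
    closed and pivotal, and their expected number is [psi r n S], at least [1 / r]. Russo's formula
    counts exactly such sites. *)
Lemma arm_derive_ge r : 0 < r < 1 ->
  (forall T, (0 : site) \in T -> {subset T <= box 0 n} -> 1 <= r * psi r n T) ->
  1 - arm r n <= \sum_(y <- V) mean r V (dif y (ind G)) (fun=> false).
Proof.
move=> /andP[r0 r1] H; have r01 : 0 <= r <= 1 by rewrite !ltW.
have rr : 0 < r * (1 - r) by rewrite mulr_gt0 // subr_gt0.
have dif0 y zeta : 0 <= dif y (ind G : config -> R) zeta.
  rewrite /dif subr_ge0; apply: (incr_ind (@exits_up 0 n)); exact: cle_update.
(* [dif y] does not depend on the state of [y], which is off with probability [1 - r] *)
have E1 y : y \in V -> mean r V (fun z => ind [set z : config | ~~ z y] z * ind [set z | y \notin S z /\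
      touches (S z) y z /\ (0 : site) \in S z] z) (fun=> false) <=
    (1 - r) * mean r V (dif y (ind G)) (fun=> false).
  move=> yV.
  have -> : (1 - r) * mean r V (dif y (ind G)) (fun=> false) =
     mean r V (fun z => ind [set z : config | ~~ z y] z * dif y (ind G) z) (fun=> false).
    rewrite -[RHS](congr1 (@^~ (fun=> false)) (mean_mean r (t := [:: y]) _ _)); last first.
      by move=> u; rewrite inE => /eqP->.
    rewrite [mean r [:: y] _]mean_mulr; last first.
      by move=> u; rewrite inE => /eqP ->; exact: indep_dif.
    have -> : mean r [:: y] (ind [set z : config | ~~ z y]) = (fun=> 1 - r) :> (config -> R).
      apply/funext => z; rewrite /= /mean1 ind0 /= ?update_at // ind1 /= ?update_at //; ring.
    by rewrite meanZl.
  apply: mean_le => // z.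
  have [zy|zy] := boolP (z y); first by rewrite ind0 ?mul0r //= zy.
  have -> : ind [set z0 : config | ~~ z0 y] z = 1 :> R by rewrite ind1.
  rewrite !mul1r {1}/ind; case: asboolP => [[h1 [h2 h3]]|_]; last exact: dif0.
  by have [_ ->] := pivot h3 h1 h2.
have E2 : mean r V (fun z => \sum_(y <- V) ind [set z : config | ~~ z y] z *
     ind [set z | y \notin S z /\ touches (S z) y z /\ (0 : site) \in S z] z) (fun=> false) <=
    (1 - r) * \sum_(y <- V) mean r V (dif y (ind G)) (fun=> false).
  rewrite (mean_sum V xpredT (fun y z => ind [set z : config | ~~ z y] z *
     ind [set z | y \notin S z /\ touches (S z) y z /\ (0 : site) \in S z] z) r V).
  rewrite mulr_sumr big_seq [leRHS]big_seq; apply: ler_sum => y yV; exact: E1.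
have E3 : (1 - arm r n) / r <= mean r V (fun z => \sum_(y <- V) ind [set z : config | ~~ z y] z *
     ind [set z | y \notin S z /\ touches (S z) y z /\ (0 : site) \in S z] z) (fun=> false).
  rewrite [leRHS](@mean_resample _ r V Q) => [|xi x b xS]; last first.
    apply/esym; apply: S_stable => u uS; rewrite update_ne //.
    by apply: contraNneq uS => ->.
  have -> : (1 - arm r n) / r = mean r V (fun z => ind (~` G) z / r) (fun=> false).
    by rewrite mean_mulr // -/(pr r V (~` G) _) prC.
  apply: mean_le => // xi; rewrite -/(S xi).
  have [S0|S0] := boolP ((0 : site) \in S xi); last first.
    rewrite ind0 ?mul0r; last by apply; apply/GP.
    apply: mean_ge0 => // z; apply: sumr_ge0 => y _; by rewrite mulr_ge0 // ind_ge0.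
  rewrite ind1; last by move/GP; rewrite S0.
  have Sb : {subset S xi <= box 0 n} by move=> u /inS[].
  apply: (@le_trans _ _ (psi r n (S xi))).
    by rewrite mul1r -(ler_pM2l r0) divff ?gt_eqF //; exact: H.
  rewrite /psi big_mkcond /=.
  apply: (@le_trans _ _ (mean r (S xi) (fun z => \sum_(y <- V | y \notin S xi) ind (touches (S xi) y) z) xi)).
    rewrite (mean_sum V (fun y => y \notin S xi) (fun y => ind (touches (S xi) y)) r (S xi)).
    rewrite -big_mkcond /=; apply: ler_sum => y _; rewrite /pr.
    have d := @dep_ind R _ _ (@touches_dep (S xi) y).
    by rewrite (mean_cst r (fun=> false) xi d).
  apply: mean_le_on => // zeta Ez.
  have ES : S xi = S zeta by apply: S_stable => x xS; rewrite Ez.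
  rewrite big_mkcond /=; apply: ler_sum => y _; case: ifP => yS; last first.
    by rewrite mulr_ge0 // ind_ge0.
  rewrite {1}/ind; case: asboolP => ty; last by rewrite mulr_ge0 // ind_ge0.
  rewrite ES in ty yS S0; have [h _] := pivot S0 (negbT (negbTE yS)) ty.
  by rewrite !ind1 // mulr1.
have := le_trans E3 E2; rewrite ler_pdivrMr // => E4.
have s0 : 0 <= \sum_(y <- V) mean r V (dif y (ind G)) (fun=> false).
  by apply: sumr_ge0 => y _; exact: mean_ge0.
apply: (le_trans E4); rewrite mulrAC -[leRHS]mul1r ler_wpM2r //.
nra.
Qed.

End Sharpness.

(** The derivative of the arm probability is at least its distance to 1 throughout the interval. By
    the mean value theorem its value [f] at [r1] satisfies [f >= (r1 - r0) * (1 - f)], and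
    [1 + (r1 - r0) <= 2]. *)
Lemma arm_sharp r0 r1 : 0 < r0 -> r0 < r1 -> r1 < 1 ->
  (forall n T, (0 : site) \in T -> {subset T <= box 0 n} -> 1 <= r0 * psi r0 n T) ->
  forall n, (r1 - r0) / 2 <= arm r1 n.
Proof.
move=> r00 r01 r11 H n.
pose f r := arm r n.
pose f' r := \sum_(y <- box 0 n.+1) mean r (box 0 n.+1) (dif y (ind (exits 0 n) : config -> R)) (fun=> false).
have fd r : is_derive r (1 : R) f (f' r).
  by apply: mean_derive; exact: box_uniq.
have cf : {within `[r0, r1], continuous f}.
  apply: derivable_within_continuous => x _; by have [] := fd x.
have [c] := MVT r01 (fun x _ => fd x) cf.
rewrite in_itv /= => /andP[c0 c1] E.
have cb : 0 < c < 1 by rewrite (lt_trans r00) // (lt_trans c1).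
have : 1 - arm c n <= f' c.
  apply: arm_derive_ge => // T T0 Tb; apply: (le_trans (H n T T0 Tb)).
  apply: ler_pM => //; try by rewrite ltW.
    by apply: sumr_ge0 => y _; apply: pr_ge0; rewrite !ltW //; exact: lt_trans r11.
  by apply: psi_mono; rewrite ltW // (lt_trans c1).
have h1 : arm c n <= arm r1 n by apply: arm_mono; rewrite ltW //; case/andP: cb.
have h2 : 0 <= arm r0 n by apply: arm_ge0; rewrite !ltW // (lt_trans r01).
have h3 : arm r1 n <= 1 by apply: arm_le1; rewrite !ltW // (lt_trans r00).
move: E; rewrite /f => E h4; nra.
Qed.

(** Either some finite set has [r0 * psi < 1], and iterating [hsl] gives decay, or none has, and
    [arm_sharp] applies. *)
Lemma arm_dichotomy r0 r1 : 0 < r0 -> r0 < r1 -> r1 < 1 ->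
  (exists M kappa, [/\ 0 <= kappa, kappa < 1 & forall k, arm r0 (k * M.+1)%N <= kappa ^+ k]) \/
  (forall n, (r1 - r0) / 2 <= arm r1 n).
Proof.
move=> r00 r01 r11.
have rr : 0 <= r0 <= 1 by rewrite !ltW // (lt_trans r01).
have [[n [T [T0 Tb lt1]]]|nex] := pselect (exists n T, [/\ (0 : site) \in T,
   {subset T <= box 0 n} & r0 * psi r0 n T < 1]).
  left; exists n, (r0 * psi r0 n T); split => //; last exact: arm_decay.
  rewrite mulr_ge0 ?(ltW r00) //; apply: sumr_ge0 => y _; exact: pr_ge0.
right; apply: arm_sharp => // n T T0 Tb; rewrite leNgt; apply/negP => lt1.
by apply: nex; exists n, T.
Qed.

End Exits.

Definition rot (z : site) : site := (- z.2, z.1).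

Lemma rot_inj : injective rot.
Proof. by move=> [a b] [c d] [h1 h2]; congr (_, _); lia. Qed.

Lemma rot_box n : perm_eq (map rot (box 0 n)) (box 0 n).
Proof.
apply: uniq_perm; rewrite ?(map_inj_uniq rot_inj) ?box_uniq // => z.
apply/mapP/idP => [[u ub ->]|zb].
  by move: ub; rewrite !mem_box /=; lia.
exists (z.2, - z.1); first by move: zb; rewrite !mem_box /=; lia.
by case: z {zb} => a b; rewrite /rot /= opprK.
Qed.

Lemma adjacent_rot x y : adjacent (rot x) (rot y) = adjacent x y.
Proof. by apply/adjacentP/adjacentP; rewrite /rot /=; lia. Qed.

Lemma star_rot x y : star (rot x) (rot y) = star x y.
Proof. by rewrite /star /rot /=; apply/idP/idP; lia. Qed.

Lemma adjacent_shift a x y : adjacent (x + a) (y + a) = adjacent x y.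
Proof. by apply/adjacentP/adjacentP => /=; lia. Qed.

Lemma star_shift a x y : star (x + a) (y + a) = star x y.
Proof. by rewrite /star /=; apply/idP/idP; lia. Qed.

Definition onside (d : 'I_4) (N : nat) (v : site) : bool :=
  nth false [:: v.1 == - N%:Z; v.2 == - N%:Z; v.1 == N%:Z; v.2 == N%:Z] d.

Lemma onside_rot (d : 'I_4) N v : onside (ordS d) N (rot v) = onside d N v.
Proof.
case: d => -[|[|[|[|//]]]] i; rewrite /onside /rot /=; apply/idP/idP; lia.
Qed.

(** * Arms ending on a prescribed side of a box *)

Section SideArms.
Variable e : rel site.
Hypothesis e_star : forall x y, e x y -> star x y.
Hypothesis e_shift : forall a x y, e (x + a) (y + a) = e x y.
Hypothesis e_rot : forall x y, e (rot x) (rot y) = e x y.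

Definition annulus (x : site) (k N : nat) (xi : config) (z : site) : Prop :=
  [/\ xi z, z \notin box x k & z \in box x N].

Definition side_arm (x : site) (k N : nat) (d : 'I_4) : set config :=
  [set xi | exists u' u v, [/\ u' \in box x k, e u' u, annulus x k N xi u,
     conn e (annulus x k N xi) u v & onside d N (v - x)]].

Lemma side_arm_up x k N d : up (side_arm x k N d).
Proof.
move=> a b ab [u' [u [v [h1 h2 h3 h4 h5]]]]; exists u', u, v.
have sub z : annulus x k N a z -> annulus x k N b z by move=> [/ab].
split => //; first exact: sub.
exact: conn_sub h4.
Qed.

Lemma side_arm_dep x k N d : dep [seq z <- box x N | z \notin box x k] (side_arm x k N d).
Proof.
have H (a b : config) : (forall u, u \in [seq z <- box x N | z \notin box x k] -> a u = b u) ->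
    side_arm x k N d a -> side_arm x k N d b.
  move=> E [u' [u [v [h1 h2 h3 h4 h5]]]]; exists u', u, v.
  have sub z : annulus x k N a z -> annulus x k N b z.
    by move=> [az zk zN]; split; rewrite // -E // mem_filter zk.
  split => //; first exact: sub.
  exact: conn_sub h4.
by move=> a b E; apply/propext; split; apply: H => // u /E.
Qed.

Lemma side_arm_shift x k N d (xi : config) :
  side_arm x k N d xi <-> side_arm 0 k N d (xi \o (fun z => z + x)).
Proof.
have bs n z : (z \in box x n) = (z - x \in box 0 n) by rewrite !mem_box /=; lia.
split => -[u' [u [v [h1 h2 h3 h4 h5]]]].
  have an z : annulus x k N xi z -> annulus 0 k N (xi \o (fun z => z + x)) (z - x).
    by move=> [g1 g2 g3]; split; rewrite /= ?subrK -?bs.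
  exists (u' - x), (u - x), (v - x); rewrite e_shift -bs subr0; split => //; first exact: an.
  by apply: (conn_map (tau := fun z => z - x)) h4 => // a b; rewrite e_shift.
have an z : annulus 0 k N (xi \o (fun z => z + x)) z -> annulus x k N xi (z + x).
  by move=> [g1 g2 g3]; split; rewrite // bs addrK.
exists (u' + x), (u + x), (v + x); rewrite e_shift bs !addrK; split => //.
- exact: an.
- by apply: (conn_map (tau := fun z => z + x)) h4 => // a b; rewrite e_shift.
- by move: h5; rewrite subr0.
Qed.

Lemma side_arm_rot k N d (xi : config) :
  side_arm 0 k N d (xi \o rot) -> side_arm 0 k N (ordS d) xi.
Proof.
have bs n z : (rot z \in box 0 n) = (z \in box 0 n) by rewrite !mem_box /=; lia.
move=> [u' [u [v [h1 h2 h3 h4 h5]]]].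
have an z : annulus 0 k N (xi \o rot) z -> annulus 0 k N xi (rot z).
  by move=> [g1 g2 g3]; split; rewrite // bs.
exists (rot u'), (rot u), (rot v); rewrite e_rot bs; split => //.
- exact: an.
- by apply: (conn_map (tau := rot)) h4 => // a b; rewrite e_rot.
- by move: h5; rewrite !subr0 onside_rot.
Qed.

Lemma conn_boundary (P : site -> Prop) x N u z : conn e P u z -> u \in box x N ->
  z \notin box x N ->
  exists2 v, conn e (fun w => P w /\ w \in box x N) u v &
     v \in box x N /\ exists d, onside d N (v - x).
Proof.
move=> uz ux; suff H : z \in box x N /\ conn e (fun w => P w /\ w \in box x N) u z \/
   exists2 v, conn e (fun w => P w /\ w \in box x N) u v & v \in box x N /\ exists d, onside d N (v - x).
  by move=> nz; case: H => // -[]; rewrite (negbTE nz).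
elim: uz => [|a b _ IH eab Pb]; first by left; split => //; exact: conn0.
case: IH => [[ab ca]|]; last by right.
case: (boolP (b \in box x N)) => bb; first by left; split => //; apply: connS ca eab _.
right; exists a => //; split => //; have := e_star eab; move: ab bb.
rewrite !mem_box /star /= => h1 h2 h3.
have [h|[h|[h|h]]] : a.1 - x.1 = - N%:Z \/ a.2 - x.2 = - N%:Z \/ a.1 - x.1 = N%:Z \/ a.2 - x.2 = N%:Z.
  move: h1 h2 h3; lia.
- by exists (Ordinal (isT : 0 < 4)%N); rewrite /onside /= h.
- by exists (Ordinal (isT : 1 < 4)%N); rewrite /onside /= h.
- by exists (Ordinal (isT : 2 < 4)%N); rewrite /onside /= h.
- by exists (Ordinal (isT : 3 < 4)%N); rewrite /onside /= h.
Qed.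

Lemma conn_last_exit (P : site -> Prop) x k y z : conn e P y z -> y \in box x k ->
  z \notin box x k ->
  exists u' u, [/\ u' \in box x k, e u' u, P u, u \notin box x k &
    conn e (fun w => P w /\ w \notin box x k) u z].
Proof.
move=> yz yx; elim: yz => [|a b _ IH eab Pb] nz; first by rewrite yx in nz.
case: (boolP (a \in box x k)) => ab; first by exists a, b; split => //; exact: conn0.
have [u' [u [h1 h2 h3 h4 h5]]] := IH ab; exists u', u; split => //.
exact: (connS h5).
Qed.

Lemma exits_side_arm k N xi : (k < N)%N -> exits e 0 N xi -> exists d, side_arm 0 k N d xi.
Proof.
move=> kN [z cz nz].
have zk : z \notin box 0 k by move: nz; rewrite !mem_box; lia.
have [u' [u [h1 h2 h3 h4 h5]]] := conn_last_exit cz (box_self 0 k) zk.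
have uN : u \in box 0 N by move: h1 (e_star h2); rewrite !mem_box /star /=; lia.
have [v cv [vb [d dv]]] := conn_boundary h5 uN nz.
exists d, u', u, v; split => //.
by apply: conn_sub cv => w [[]].
Qed.

Context {R : realType}.
Implicit Types r : R.

Lemma pr_box_sub r x k N d V eta : {subset box x N <= V} ->
  pr r V (side_arm x k N d) eta = pr r (box 0 N) (side_arm 0 k N d) (fun=> false).
Proof.
move=> sV.
have sb : {subset [seq z <- box x N | z \notin box x k] <= box x N}.
  by move=> u; rewrite mem_filter => /andP[].
have dd : dep (box x N) (ind (side_arm x k N d) : config -> R).
  exact: (dep_ind (dep_sub sb (@side_arm_dep x k N d))).
rewrite /pr (mean_dep_cst r eta (fun=> false) dd sV) box_shift.
rewrite (@mean_map _ r (fun z => z + x) _ _ (ind (side_arm 0 k N d))) //; first exact: addIr.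
by move=> z; rewrite /ind; congr (_ %:R); congr (nat_of_bool _); apply: asbool_equiv_eq;
  exact: side_arm_shift.
Qed.

(** One inequality is enough: the rotation has order four, so following it around makes all four
    probabilities equal. *)
Lemma pr_side_arm_rot r k N d : 0 <= r <= 1 ->
  pr r (box 0 N) (side_arm 0 k N d) (fun=> false) <=
  pr r (box 0 N) (side_arm 0 k N (ordS d)) (fun=> false).
Proof.
move=> r01; rewrite {2}/pr -(mean_perm _ _ (rot_box N)).
rewrite (@mean_map _ r rot _ _ (fun xi => ind (side_arm 0 k N (ordS d)) (xi \o (fun z => (z.2, - z.1))))).
- rewrite /pr; apply: mean_le => // xi; rewrite {1}/ind; case: asboolP => H; last exact: ind_ge0.
  rewrite ind1 //; apply: side_arm_rot.
  suff -> : (xi \o (fun z => (z.2, - z.1))) \o rot = xi by [].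
  by apply/funext => -[a b]; rewrite /rot /= opprK.
- exact: rot_inj.
move=> xi; congr (ind _ _); apply/funext => -[a b]; by rewrite /rot /= opprK.
Qed.

(** Square-root trick. The absences of the four side arms are decreasing and equally likely, so
    Harris' inequality bounds the probability that all are absent from below by a fourth power. That
    event excludes an arm of length [N] and is independent of [exits 0 k], because the latter only
    looks at [box 0 k.+1]. *)
Lemma pr_side_arm r k N : 0 <= r <= 1 -> (k.+1 < N)%N -> 0 < arm e r k ->
  forall d, (1 - pr r (box 0 N) (side_arm 0 k.+1 N d) (fun=> false)) ^+ 4 <=
    1 - arm e r N / arm e r k.
Proof.
move=> r01 kN ak d.
pose eta0 : config := fun=> false; pose V := box 0 N.+1.
pose D i (h : (i < 4)%N) := side_arm 0 k.+1 N (Ordinal h).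
pose o i (h : (i < 4)%N) := pr r (box 0 N) (D i h) eta0.
have S01 : ordS (@Ordinal 4 0 isT) = @Ordinal 4 1 isT by exact: val_inj.
have S12 : ordS (@Ordinal 4 1 isT) = @Ordinal 4 2 isT by exact: val_inj.
have S23 : ordS (@Ordinal 4 2 isT) = @Ordinal 4 3 isT by exact: val_inj.
have S30 : ordS (@Ordinal 4 3 isT) = @Ordinal 4 0 isT by exact: val_inj.
have h0 : o 0%N isT <= o 1%N isT.
  by have := pr_side_arm_rot k.+1 N (@Ordinal 4 0 isT) r01; rewrite S01.
have h1 : o 1%N isT <= o 2 isT.
  by have := pr_side_arm_rot k.+1 N (@Ordinal 4 1 isT) r01; rewrite S12.
have h2 : o 2 isT <= o 3 isT.
  by have := pr_side_arm_rot k.+1 N (@Ordinal 4 2 isT) r01; rewrite S23.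
have h3 : o 3 isT <= o 0%N isT.
  by have := pr_side_arm_rot k.+1 N (@Ordinal 4 3 isT) r01; rewrite S30.
have -> : pr r (box 0 N) (side_arm 0 k.+1 N d) eta0 = o 0%N isT.
  case: d => -[|[|[|[|//]]]] i; rewrite (bool_irrelevance i isT) -/(D _ _) -/(o _ _); lra.
have sV : {subset box 0 N <= V} by move=> u; rewrite !mem_box; lia.
have oV i h : pr r V (D i h) eta0 = o i h by exact: pr_box_sub.
have dn i h : down (~` D i h) by apply: downC; exact: side_arm_up.
pose U := (~` D 0%N isT `&` ~` D 1%N isT) `&` (~` D 2 isT `&` ~` D 3 isT).
have U4 : (1 - o 0%N isT) ^+ 4 <= pr r V U eta0.
  have p01 := pr_harris r01 V eta0 (dn 0%N isT) (dn 1%N isT).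
  have p23 := pr_harris r01 V eta0 (dn 2 isT) (dn 3 isT).
  have dI A B : down A -> down B -> down (A `&` B) by move=> da db a b ab [/(da _ _ ab) ? /(db _ _ ab)].
  have p := pr_harris r01 V eta0 (dI _ _ (dn 0%N isT) (dn 1%N isT)) (dI _ _ (dn 2 isT) (dn 3 isT)).
  apply: le_trans p.
  rewrite !prC !oV in p01 p23.
  have e1 : o 1%N isT = o 0%N isT by lra.
  have e2' : o 2 isT = o 0%N isT by lra.
  have e3 : o 3 isT = o 0%N isT by lra.
  rewrite e1 e2' e3 in p01 p23.
  rewrite (_ : _ ^+ 4 = (1 - o 0%N isT) * (1 - o 0%N isT) * ((1 - o 0%N isT) * (1 - o 0%N isT))); last by ring.
  have x0 : 0 <= 1 - o 0%N isT by rewrite subr_ge0; exact: pr_le1.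
  by apply: ler_pM => //; rewrite mulr_ge0.
apply: (le_trans U4); rewrite lerBrDr -lerBrDl -prC ler_pdivrMr // mulrC.
have -> : arm e r k = pr r V (exits e 0 k) eta0.
  by rewrite (pr_exits e_star e_shift) // => u; rewrite !mem_box; lia.
rewrite -(pr_indep _ _ _ (exits_dep e_star (x := 0) (L := k))
   (T := [seq z <- box 0 N | z \notin box 0 k.+1])).
- apply: pr_sub => // xi ex; split; first exact: (exits_anti (ltnW (ltnW kN))) ex.
  have [d'] := exits_side_arm kN ex.
  case: d' => -[|[|[|[|//]]]] i; rewrite (bool_irrelevance i isT) -/(D _ _) => H;
    by move=> [[g0 g1] [g2 g3]]; (exact: g0 || exact: g1 || exact: g2 || exact: g3).
- have dD i h : dep [seq z <- box 0 N | z \notin box 0 k.+1] (D i h) by exact: side_arm_dep.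
  move=> a b E; rewrite /U /setC /setI /=.
  by rewrite (dD 0%N isT a b E) (dD 1%N isT a b E) (dD 2 isT a b E) (dD 3 isT a b E).
- by move=> x; rewrite !mem_filter => /andP[_ ->].
Qed.

(** Arm probabilities decrease to a limit that is at least [delta], so the ratio
    [arm e r N / arm e r k] in [pr_side_arm] is close to 1 for all large [k], uniformly in [N]. *)
Lemma side_arm_likely r delta eps : 0 <= r <= 1 -> 0 < delta -> 0 < eps ->
  (forall n, delta <= arm e r n) ->
  exists k0, forall k, (k0 <= k)%N -> forall N, (k.+1 < N)%N -> forall d,
    1 - eps <= pr r (box 0 N) (side_arm 0 k.+1 N d) (fun=> false).
Proof.
move=> r01 d0 e0 H.
pose A := inf [set arm e r n | n in [set: nat]].
have hi : has_inf [set arm e r n | n in [set: nat]].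
  split; first by exists (arm e r 0%N); exists 0%N.
  by exists delta => _ [n _ <-].
have dA : delta <= A.
  by apply: lb_le_inf; [case: hi|move=> _ [n _ <-]].
have e40 : 0 < eps ^+ 4 by rewrite exprn_gt0.
have [_ [k0 _ <-] hk0] := inf_adherent (mulr_gt0 d0 e40) hi.
exists k0 => k k0k N kN d.
have ak : 0 < arm e r k by exact: lt_le_trans (H k).
have := pr_side_arm r01 kN ak d.
set P := pr _ _ _ _ => hP.
have hkA : arm e r k < A + delta * eps ^+ 4.
  by apply: le_lt_trans hk0; exact: arm_anti.
have hNA : A <= arm e r N by apply: ge_inf; [case: hi|exists N].
have P1 : P <= 1 by exact: pr_le1.
rewrite lerBlDr -lerBlDl -(@ler_pXn2r _ 4) ?nnegrE ?subr_ge0 // ?(ltW e0) //.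
apply: (le_trans hP); rewrite lerBlDr -lerBlDl ler_pdivlMr // mulrBl mul1r lerBlDr.
apply: (le_trans (ltW hkA)); rewrite lerD // mulrC ler_wpM2l ?(ltW e40) //; exact: H.
Qed.

End SideArms.

(** * Uniqueness of crossing clusters *)

Definition dleft := @Ordinal 4 0 isT.
Definition dbot := @Ordinal 4 1 isT.
Definition dright := @Ordinal 4 2 isT.
Definition dtop := @Ordinal 4 3 isT.

Definition fill (Q : seq site) (b : bool) (xi : config) : config :=
  fun y => if y \in Q then b else xi y.

Lemma box_conn x k a b : a \in box x k -> b \in box x k ->
  conn adjacent (fun z => z \in box x k) a b.
Proof.
case: x a b => x1 x2 [a1 a2] [b1 b2].
have [n] : exists n : nat, (`|(b1 - a1)%R| + `|(b2 - a2)%R| <= n)%N.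
  by exists (`|(b1 - a1)%R| + `|(b2 - a2)%R|)%N.
elim: n a1 a2 => [|n IH] a1 a2 hn ab bb.
  suff -> : (b1, b2) = (a1, a2) by exact: conn0.
  by congr (_, _); lia.
have step (c1 c2 : int) : adjacent (a1, a2) (c1, c2) -> (c1, c2) \in box (x1, x2) k ->
    (`|(b1 - c1)%R| + `|(b2 - c2)%R| <= n)%N ->
    conn adjacent (fun z => z \in box (x1, x2) k) (a1, a2) (b1, b2).
  move=> adj cb hc; apply: conn_trans (IH _ _ hc cb bb); exact: conn1.
have ad (c1 c2 : int) : (c1 = a1 /\ `|c2 - a2| = 1) \/ (c2 = a2 /\ `|c1 - a1| = 1) ->
  adjacent (a1, a2) (c1, c2) by move=> h; apply/adjacentP.
move: ab bb; rewrite !mem_box /= => ab bb.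
case: (ltgtP a1 b1) => h1.
- by apply: (step (a1 + 1) a2); [apply: ad|rewrite mem_box /=|]; lia.
- by apply: (step (a1 - 1) a2); [apply: ad|rewrite mem_box /=|]; lia.
case: (ltgtP a2 b2) => h2.
- by apply: (step a1 (a2 + 1)); [apply: ad|rewrite mem_box /=|]; lia.
- by apply: (step a1 (a2 - 1)); [apply: ad|rewrite mem_box /=|]; lia.
by rewrite h1 h2; exact: conn0.
Qed.

Lemma conn_adj_star P x y : conn adjacent P x y -> conn star P x y.
Proof.
elim=> [|u v _ IH euv Pv]; first exact: conn0.
by apply: connS IH _ Pv; exact: adjacent_star.
Qed.

Definition four_arm (x : site) (k N : nat) : set config :=
  [set xi | [/\ side_arm adjacent x k N dleft xi, side_arm adjacent x k N dright xi,
     side_arm star x k N dbot (cneg xi) & side_arm star x k N dtop (cneg xi)]].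

(* The two closed arms and the inner box separate the two open arms. *)
Lemma arms_separated x k N (xi : config) v1 v2 : (k <= N)%N ->
  side_arm star x k N dbot (cneg xi) -> side_arm star x k N dtop (cneg xi) ->
  onside dleft N (v1 - x) -> onside dright N (v2 - x) ->
  annulus x k N xi v1 -> ~ conn adjacent (annulus x k N xi) v1 v2.
Proof.
move=> kN [u3' [u3 [v3 [a1 a2 a3 a4 a5]]]] [u4' [u4 [v4 [b1 b2 b3 b4 b5]]]] l1 l2 av1 cv.
pose P z := (~~ xi z \/ z \in box x k) /\ z \in box x N.
have PA z : annulus x k N (cneg xi) z -> P z by move=> [h1 _ h3]; split => //; left.
have Pb z : z \in box x k -> P z.
  by move=> zb; split; [right|move: zb; rewrite !mem_box; lia].
have c34 : conn star P v3 v4.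
  have Pv3 : annulus x k N (cneg xi) v3 by case: (conn_end a4) => [<-|].
  apply: (@conn_trans _ _ _ u3).
    by apply: conn_rev; [exact: star_sym|exact: PA|exact: conn_sub a4].
  apply: (@conn_trans _ _ _ u3').
    by apply: conn1; [rewrite star_sym|exact: Pb].
  apply: (@conn_trans _ _ _ u4').
    by apply: conn_adj_star; apply: conn_sub (box_conn a1 b1).
  apply: (@conn_trans _ _ _ u4); last exact: conn_sub b4.
  by apply: conn1 => //; exact: PA.
have Pv3 : P v3 by apply: PA; case: (conn_end a4) => [<-|].
have [s [ps sP sl]] := conn_path c34.
have inP z : z \in v3 :: s -> P z by rewrite inE => /orP[/eqP->|/sP].
have brect z : z \in box x N = rect (x.1 - N%:Z) (x.1 + N%:Z) (x.2 - N%:Z) (x.2 + N%:Z) z.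
  by rewrite mem_box /rect !ler_norml !lerBrDl !lerBlDl -!andbA.
apply: (@cross (x.1 - N%:Z) (x.1 + N%:Z) (x.2 - N%:Z) (x.2 + N%:Z) v3 s ps _ _ _
   (annulus x k N xi) v1 v2) => //.
- by move=> z /inP[_]; rewrite brect.
- by move: a5; rewrite /onside /=; lia.
- by rewrite sl; move: b5; rewrite /onside /=; lia.
- move=> z [xz zk zN]; rewrite -brect; split => //; apply/negP => /inP[[|]] //.
    by rewrite xz.
  by rewrite (negbTE zk).
- by move: l1; rewrite /onside /=; lia.
- by move: l2; rewrite /onside /=; lia.
Qed.

Section Classes.
Context {R : realType}.
Variable N : nat.

Definition bdry : seq site := [seq b <- box 0 N | (`|b.1| == N%:Z) || (`|b.2| == N%:Z)].

Lemma bdry_uniq : uniq bdry. Proof. by rewrite filter_uniq // box_uniq. Qed.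

Lemma size_bdry : (size bdry <= 4 * N.*2.+1)%N.
Proof.
pose r := iota 0 N.*2.+1.
pose L := [seq ((i%:Z - N%:Z, N%:Z) : site) | i <- r] ++ [seq ((i%:Z - N%:Z, - N%:Z) : site) | i <- r]
  ++ [seq ((N%:Z, i%:Z - N%:Z) : site) | i <- r] ++ [seq ((- N%:Z, i%:Z - N%:Z) : site) | i <- r].
have -> : (4 * N.*2.+1 = size L)%N by rewrite !size_cat !size_map size_iota; lia.
apply: uniq_leq_size; first exact: bdry_uniq.
move=> [a b]; rewrite mem_filter mem_box !subr0 /= => /andP[h1 /andP[h2 h3]].
rewrite !mem_cat.
have ia : exists2 i, i \in r & a = i%:Z - N%:Z.
  by exists (`|(a + N%:Z)%R|%N); [rewrite mem_iota; lia|lia].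
have ib : exists2 i, i \in r & b = i%:Z - N%:Z.
  by exists (`|(b + N%:Z)%R|%N); [rewrite mem_iota; lia|lia].
have [i ir ai] := ia; have [j jr bj] := ib.
have : [|| b == N%:Z, b == - N%:Z, a == N%:Z | a == - N%:Z] by lia.
case/or4P => /eqP e; apply/or4P.
- by apply: Or41; apply/mapP; exists i => //; rewrite e ai.
- by apply: Or42; apply/mapP; exists i => //; rewrite e ai.
- by apply: Or43; apply/mapP; exists j => //; rewrite e bj.
- by apply: Or44; apply/mapP; exists j => //; rewrite e bj.
Qed.

Definition joined (xi : config) (a b : site) : Prop :=
  xi a /\ conn adjacent (fun z => xi z /\ z \in box 0 N) a b.

(** A closed boundary site is never joined to an earlier one, so it is a leader too, forming a class
    by itself. This is what makes [classes] decreasing in the configuration. *)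
Definition leader (i : nat) : set config :=
  [set xi | forall j, (j < i)%N -> ~ joined xi (nth 0 bdry j) (nth 0 bdry i)].

(* The number of classes of [joined], each counted by its first member in [bdry]. *)
Definition classes : config -> R := fun xi => \sum_(i < size bdry) ind (leader i) xi.

Lemma joined_up (a b : config) x y : cle a b -> joined a x y -> joined b x y.
Proof.
move=> ab [ax c]; split; first exact: ab.
by apply: conn_sub c => z [/ab].
Qed.

Lemma bdry_box b : b \in bdry -> b \in box 0 N.
Proof. by rewrite mem_filter => /andP[]. Qed.

Lemma joined_sym xi a b : a \in box 0 N -> joined xi a b -> joined xi b a.
Proof.
move=> ab [xa c]; split; first by case: (conn_end c) => [<-|[]].
by apply: conn_rev c => //; exact: adjacent_sym.
Qed.

Lemma joined_trans xi a b c : joined xi a b -> joined xi b c -> joined xi a c.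
Proof. by move=> [xa ab] [_ bc]; split => //; exact: conn_trans bc. Qed.

Lemma leader_down i : down (leader i).
Proof. by move=> a b ab H j ji /(joined_up ab); exact: H. Qed.

Lemma classes_decr : decr classes.
Proof. by move=> a b ab; apply: ler_sum => i _; exact: (decr_ind (@leader_down i)). Qed.

Lemma classes_ge0 xi : 0 <= classes xi.
Proof. by apply: sumr_ge0 => i _; exact: ind_ge0. Qed.

Lemma classes_le xi : classes xi <= (size bdry)%:R.
Proof.
rewrite -[X in _ <= X%:R]card_ord -sum1_card natr_sum; apply: ler_sum => i _; exact: ind_le1.
Qed.

(** Of the two classes that merge, the one whose first member comes later in [bdry] loses its
    leader, and opening sites never creates a leader. *)
Lemma classes_drop (xi0 xi1 : config) b1 b2 : cle xi0 xi1 -> b1 \in bdry -> b2 \in bdry ->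
  xi0 b1 -> xi0 b2 -> ~ joined xi0 b1 b2 -> joined xi1 b1 b2 ->
  classes xi1 + 1 <= classes xi0.
Proof.
move=> le01 b1B b2B o1 o2 nj j12.
pose first b i := [/\ (i < size bdry)%N, joined xi0 (nth 0 bdry i) b &
   forall j, (j < i)%N -> ~ joined xi0 (nth 0 bdry j) b].
have ex b : b \in bdry -> xi0 b -> exists i, first b i.
  move=> bB ob; have ex0 : exists i, (i < size bdry)%N && `[< joined xi0 (nth 0 bdry i) b >].
    exists (index b bdry); rewrite index_mem bB /=; apply/asboolP; rewrite nth_index //.
    by split => //; exact: conn0.
  exists (ex_minn ex0); case: ex_minnP => i /andP[ib /asboolP ji] im; split => //.
  move=> j jlt jj; have : (i <= j)%N.
    by apply: im; rewrite (ltn_trans jlt ib) /=; exact/asboolP.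
  by rewrite leqNgt jlt.
have sym xi i b : (i < size bdry)%N -> joined xi (nth 0 bdry i) b -> joined xi b (nth 0 bdry i).
  by move=> ib; apply: joined_sym; apply: bdry_box; exact: mem_nth.
have key i1 i2 b b' : b \in bdry -> first b i1 -> first b' i2 -> (i1 < i2)%N ->
   joined xi1 b b' -> classes xi1 + 1 <= classes xi0.
  move=> bB [s1 f1 m1] [s2 f2 m2] lt12 jb.
  have bb : b \in box 0 N by exact: bdry_box.
  rewrite /classes (bigD1 (Ordinal s2)) //= [leRHS](bigD1 (Ordinal s2)) //=.
  rewrite ind0; last first.
    move=> L; apply: (L i1 lt12).
    apply: joined_trans (joined_up le01 f1) _; apply: (joined_trans jb).
    by apply: (joined_up le01); exact: sym f2.
  rewrite ind1; last first.
    move=> j jlt jj; apply: (m2 j jlt); exact: joined_trans f2.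
  rewrite add0r [leRHS]addrC lerD2r; apply: ler_sum => i _; exact: (decr_ind (@leader_down i)).
have [i1 f1] := ex _ b1B o1; have [i2 f2] := ex _ b2B o2.
case: (ltngtP i1 i2) => lt.
- exact: key f1 f2 lt j12.
- by apply: key f2 f1 lt _ => //; apply: joined_sym => //; exact: bdry_box.
exfalso; apply: nj; case: f1 => s1 g1 _; case: f2 => s2 g2 _.
by apply: (joined_trans (sym _ _ _ s1 g1)); rewrite lt.
Qed.

End Classes.

(** * Total influence of the sites of a small box *)

Section Influence.
Context {R : realType}.
Variables (p m : R).
Hypotheses (m0 : 0 < m) (mp : m <= p) (mp' : m <= 1 - p).
Let p01 : 0 <= p <= 1.
Proof. by rewrite (le_trans (ltW m0) mp) -subr_ge0 (le_trans (ltW m0) mp'). Qed.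

Lemma fill_cons x Q b xi : fill (x :: Q) b xi = fill Q b (update xi x b).
Proof.
apply/funext => y; rewrite /fill /update inE; by case: (y == x) => //=; case: (y \in Q).
Qed.

Lemma mean_ge_fill Q (h : config -> R) xi : (forall z, 0 <= h z) ->
  m ^+ size Q * h (fill Q true xi) <= mean p Q h xi.
Proof.
move=> h0; elim: Q xi => [|x Q IH] xi /=; first by rewrite expr0 mul1r.
rewrite fill_cons /mean1 exprS -mulrA.
have h1 := IH (update xi x true).
have h2 : 0 <= mean p Q h (update xi x false) by exact: (mean_ge0 p01).
have h3 : 0 <= m ^+ size Q * h (fill Q true (update xi x true)).
  by rewrite mulr_ge0 // exprn_ge0 // ltW.
move: m0 mp mp'; nra.
Qed.

(** Open the sites of [Q] one by one. Each increment of [F] is an influence evaluated at one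
    particular configuration of [Q], and such a configuration has probability at least
    [m ^+ size Q]. *)
Lemma influence Q (F : config -> R) xi : uniq Q -> decr F ->
  m ^+ size Q * (F (fill Q false xi) - F (fill Q true xi)) <=
  \sum_(y <- Q) mean p Q (fun z => - dif y F z) xi.
Proof.
move=> uQ dF; have df0 y z : 0 <= - dif y F z.
  by rewrite /dif opprB subr_ge0; apply: dF; exact: cle_update.
elim: Q xi uQ => [|x Q IH] xi /=; first by rewrite big_nil subrr mulr0.
move=> /andP[xQ uQ]; rewrite big_cons !fill_cons exprS.
have ix : indep x (fun z => - dif x F z) by move=> eta b; rewrite indep_dif.
rewrite (mean1_indep _ (indep_mean p Q ix)).
have h1 := mean_ge_fill Q xi (df0 x).
have E1 : - dif x F (fill Q true xi) =
    F (fill Q true (update xi x false)) - F (fill Q true (update xi x true)).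
  have E b : update (fill Q true xi) x b = fill Q true (update xi x b).
    apply/funext => y; rewrite /fill /update; case: (eqVneq y x) => [->|//].
    by rewrite (negbTE xQ).
  by rewrite /dif !E opprB.
rewrite E1 in h1.
have h2 := IH (update xi x false) uQ.
have h3 : (1 - p) * (\sum_(y <- Q) mean p Q (fun z => - dif y F z) (update xi x false)) <=
    \sum_(y <- Q) mean1 p x (mean p Q (fun z => - dif y F z)) xi.
  rewrite mulr_sumr; apply: ler_sum => y _; rewrite /mean1 lerDr mulr_ge0 //; first by case/andP: p01.
  exact: (mean_ge0 p01).
apply: le_trans (lerD h1 (le_trans _ h3)); last first.
  by apply: ler_wpM2l h2; case/andP: p01; rewrite subr_ge0.
set A := F (fill Q false _); set B := F (fill Q true (update xi x false)).
set C := F (fill Q true (update xi x true)).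
have AB : 0 <= A - B.
  rewrite subr_ge0; apply: dF => y; rewrite /fill; by case: ifP.
have BC : 0 <= B - C.
  by rewrite -/B -/C -E1; exact: df0.
have M0 : 0 <= m ^+ size Q by rewrite exprn_ge0 // ltW.
have -> : m * m ^+ size Q * (A - C) =
  m * (m ^+ size Q * (B - C)) + m * (m ^+ size Q * (A - B)) by ring.
rewrite lerD //.
  rewrite -[leRHS]mul1r ler_wpM2r //; first exact: mulr_ge0.
  by move: m0 mp mp'; lra.
by rewrite ler_wpM2r // mulr_ge0.
Qed.

End Influence.

Lemma ler_sum_sub (R : realType) (I : eqType) (L V : seq I) (g : I -> R) :
  uniq L -> uniq V -> {subset L <= V} -> (forall i, 0 <= g i) ->
  \sum_(i <- L) g i <= \sum_(i <- V) g i.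
Proof.
move=> uL uV LV g0; rewrite [leRHS](bigID (mem L)) /= -[leLHS]addr0.
apply: lerD; last by apply: sumr_ge0.
have P : perm_eq L [seq i <- V | i \in L].
  apply: uniq_perm => //; first by rewrite filter_uniq.
  by move=> i; rewrite mem_filter; case: (boolP (i \in L)) => // /LV ->.
by rewrite (perm_big _ P) /= big_filter.
Qed.

(** The open arms reach distance [2 * N] from [x], hence leave [box 0 N] and meet its boundary at
    two open sites. With the inner box closed these are not joined, by [arms_separated]; with the
    inner box open they are. *)
Lemma classes_four_arm (R : realType) x K N (xi : config) :
  (`|x.1| + K%:Z + 1 < N%:Z) -> (`|x.2| + K%:Z + 1 < N%:Z) ->
  four_arm x K (2 * N) xi ->
  classes (R := R) N (fill (box x K) true xi) + 1 <= classes N (fill (box x K) false xi).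
Proof.
move=> xN1 xN2 [arm1 arm2 arm3 arm4].
set xi1 := fill _ true _; set xi0 := fill _ false _.
pose An := annulus x K (2 * N) xi.
have boxx : {subset box x K.+1 <= box 0 N}.
  move=> [z1 z2]; case: (x) xN1 xN2 => x1 x2; rewrite !mem_box /=; lia.
have boxN : {subset box 0 N <= box x (2 * N)}.
  move=> [z1 z2]; case: (x) xN1 xN2 => x1 x2; rewrite !mem_box /=; lia.
have K2N : (K <= 2 * N)%N by lia.
have sub K' u : u \in box x K' -> u \in box x K'.+1 by rewrite !mem_box; lia.
have side d u' u v : u' \in box x K -> adjacent u' u -> An u -> conn adjacent An u v ->
    onside d (2 * N) (v - x) -> exists b, [/\ b \in bdry N, An b,
      conn adjacent An b v & conn adjacent (fun z => An z /\ z \in box 0 N) u b].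
  move=> u'b u'u Au cuv dv.
  have uN : u \in box 0 N.
    apply: boxx; move: u'b (adjacent_star u'u); case: (u) (u') (x) => a1 a2 [c1 c2] [x1 x2].
    by rewrite !mem_box /star /=; lia.
  have vN : v \notin box 0 N.
    move: dv; case: d => -[|[|[|[|//]]]] i; case: (v) (x) xN1 xN2 => v1 v2 [x1 x2];
    rewrite /onside mem_box /=; lia.
  have [b cb [bN [d' db]]] := conn_boundary adjacent_star cuv uN vN.
  have Ab : An b by case: (conn_end cb) => [<-|[]].
  exists b; split => //.
    rewrite mem_filter bN andbT; move: db.
    case: d' => -[|[|[|[|//]]]] i; case: (b) => b1 b2; rewrite /onside /=; lia.
  apply: (@conn_trans _ _ _ u) => //.
  by apply: (@conn_sub _ _ _ _ _ _ (conn_rev adjacent_sym _ cb)) => // z [].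
have [u1' [u1 [v1 [a1 a2 a3 a4 a5]]]] := arm1.
have [u2' [u2 [v2 [c1 c2 c3 c4 c5]]]] := arm2.
have [b1 [b1B Ab1 cb1 cu1]] := side _ _ _ _ a1 a2 a3 a4 a5.
have [b2 [b2B Ab2 cb2 cu2]] := side _ _ _ _ c1 c2 c3 c4 c5.
have A0 z : An z -> xi0 z by move=> [xz zK _]; rewrite /xi0 /fill (negbTE zK).
have A1 z : An z -> xi1 z by move=> [xz zK _]; rewrite /xi1 /fill (negbTE zK).
have le01 : cle xi0 xi1 by move=> z; rewrite /xi0 /xi1 /fill; case: ifP.
apply: (@classes_drop R N xi0 xi1 b1 b2) => //; [exact: A0|exact: A0| |].
  move=> [_ cj]; apply: (@arms_separated x K (2 * N) xi v1 v2 K2N) => //.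
    by case: (conn_end a4) => [<-|].
  apply: (@conn_trans _ _ _ b1); first by apply: conn_rev cb1 => //; exact: adjacent_sym.
  apply: (@conn_trans _ _ _ b2) => //.
  apply: conn_sub cj => z [z0 zN]; move: z0; rewrite /xi0 /fill; case: ifPn => // zK xz.
  by split => //; exact: boxN.
split; first exact: A1.
pose B1 z := xi1 z /\ z \in box 0 N.
have AB z : An z /\ z \in box 0 N -> B1 z by move=> [/A1].
have bB z : z \in box x K -> B1 z.
  by move=> zK; split; [rewrite /xi1 /fill zK|apply: boxx; exact: sub].
have u1N : B1 u1.
  apply: AB; split => //; apply: boxx; move: a1 (adjacent_star a2).
  by case: (u1) (u1') (x) => d1 d2 [e1 e2] [x1 x2]; rewrite !mem_box /star /=; lia.
have u2N : B1 u2.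
  apply: AB; split => //; apply: boxx; move: c1 (adjacent_star c2).
  by case: (u2) (u2') (x) => d1 d2 [e1 e2] [x1 x2]; rewrite !mem_box /star /=; lia.
apply: (@conn_trans _ _ _ u1).
  by apply: conn_rev => //; [exact: adjacent_sym|apply: conn_sub cu1; exact: AB].
apply: (@conn_trans _ _ _ u1'); first by apply: conn1; [rewrite adjacent_sym|exact: bB].
apply: (@conn_trans _ _ _ u2'); first by apply: conn_sub (box_conn a1 c1); exact: bB.
apply: (@conn_trans _ _ _ u2); first by apply: conn1.
by apply: conn_sub cu2; exact: AB.
Qed.

(** The margin [K + 2] keeps the inner box around a grid point strictly inside [box 0 N], and radius
    [3 * N] leaves room for arms of length [2 * N] from there. *)
Lemma grid_box (a b B K N : nat) : (a <= B)%N -> (b <= B)%N -> N = (B + K + 2)%N ->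
  let x : site := (a%:Z, b%:Z) in
  [/\ `|x.1| + K%:Z + 1 < N%:Z, `|x.2| + K%:Z + 1 < N%:Z,
      {subset box x K <= box 0 (3 * N)} & {subset box x (2 * N) <= box 0 (3 * N)}].
Proof.
move=> aB bB NE x; split; rewrite ?/x /=; try lia.
  by move=> [z1 z2]; rewrite !mem_box /x /=; lia.
by move=> [z1 z2]; rewrite !mem_box /x /=; lia.
Qed.

Lemma grid_disjoint (K W u v : nat) (z : int) : W = K.*2.+1 ->
  `|z - (W * u)%:Z| <= K%:Z -> `|z - (W * v)%:Z| <= K%:Z -> u = v.
Proof.
move=> WE h1 h2; case: (ltngtP u v) => // lt.
  have : (W * u.+1 <= W * v)%N by rewrite leq_mul2l lt orbT.
  rewrite mulnS; lia.
have : (W * v.+1 <= W * u)%N by rewrite leq_mul2l lt orbT.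
rewrite mulnS; lia.
Qed.

Section NoCoexistence.
Context {R : realType}.

Lemma pr_neg (p : R) V (A : set config) eta :
  pr p V [set xi | A (cneg xi)] eta = pr (1 - p) V A (cneg eta).
Proof.
rewrite /pr mean_neg; congr (mean _ _ _ _); apply/funext => xi /=.
rewrite /ind; congr (_%:R); congr (nat_of_bool _); congr (asbool _).
by rewrite /=; congr A; apply/funext => z; rewrite /cneg negbK.
Qed.

(** Each arm is missing with probability at most 1/10. Monotonicity carries the open arms from [p0]
    up to [c] and the closed ones from [p1] down to [c]. *)
Lemma four_arm_likely (p0 p1 : R) x K N V eta c : 0 <= p0 -> p1 <= 1 -> p0 <= c <= p1 ->
  {subset box x N <= V} ->
  (forall d, 9/10 <= pr p0 (box 0 N) (side_arm adjacent 0 K N d) (fun=> false)) ->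
  (forall d, 9/10 <= pr (1 - p1) (box 0 N) (side_arm star 0 K N d) (fun=> false)) ->
  6/10 <= pr c V (four_arm x K N) eta.
Proof.
move=> p00 p11 /andP[p0c cp1] sV H1 H2.
have c01 : 0 <= c <= 1 by rewrite (le_trans p00) //= (le_trans cp1).
have o d : 9/10 <= pr c V (side_arm adjacent x K N d) eta.
  rewrite (pr_box_sub (e := adjacent) adjacent_shift c K d eta sV); apply: (le_trans (H1 d)).
  apply: mean_incr_p => //; first by case/andP: c01.
  by apply: incr_ind; exact: side_arm_up.
have s d : 9/10 <= pr c V [set xi | side_arm star x K N d (cneg xi)] eta.
  rewrite pr_neg (pr_box_sub (e := star) star_shift (1 - c) K d (cneg eta) sV); apply: (le_trans (H2 d)).
  apply: mean_incr_p; [|by rewrite lerD2l lerN2| |].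
  - by rewrite subr_ge0.
  - by rewrite gerBl; case/andP: c01.
  - by apply: incr_ind; exact: side_arm_up.
have -> : pr c V (four_arm x K N) eta = 1 - pr c V (~` four_arm x K N) eta.
  by rewrite prC opprB addrCA subrr addr0.
have U := prU c01 V.
pose A1 := side_arm adjacent x K N dleft.
pose A2 := side_arm adjacent x K N dright.
pose A3 := [set xi | side_arm star x K N dbot (cneg xi)].
pose A4 := [set xi | side_arm star x K N dtop (cneg xi)].
have : pr c V (~` four_arm x K N) eta <= pr c V ((~` A1 `|` ~` A2) `|` (~` A3 `|` ~` A4)) eta.
  apply: pr_sub => // xi nf; apply: contrapT => nU; apply: nf.
  split; apply: contrapT => h; apply: nU.
  - by left; left.
  - by left; right.
  - by right; left.
  - by right; right.
have := U (~` A1 `|` ~` A2) (~` A3 `|` ~` A4) eta.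
have := U (~` A1) (~` A2) eta; have := U (~` A3) (~` A4) eta.
rewrite !prC.
have := o dleft; have := o dright; have := s dbot; have := s dtop.
rewrite -/A1 -/A2 -/A3 -/A4; lra.
Qed.

(* [classes] takes values in [0, O(N)], while opening an inner box surrounded by four arms
   decreases it: over O(N^2) disjoint boxes Russo's formula would make it vary too much. *)
Lemma no_coexistence (p0 p1 delta : R) : 0 < p0 -> p0 < p1 -> p1 < 1 -> 0 < delta ->
  (forall n, delta <= arm adjacent p0 n) -> (forall n, delta <= arm star (1 - p1) n) -> False.
Proof.
move=> p00 p01 p11 d0 Ho Hs.
have r0 : 0 <= p0 <= 1 by rewrite !ltW // (lt_trans p01).
have r1 : 0 <= 1 - p1 <= 1 by rewrite subr_ge0 gerBl !ltW // (lt_trans p00).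
have e0 : 0 < (1 / 10 : R) by lra.
have [k1 Hk1] := side_arm_likely adjacent_star adjacent_shift adjacent_rot r0 d0 e0 Ho.
have ss x y : star x y -> star x y by [].
have [k2 Hk2] := side_arm_likely ss star_shift star_rot r1 d0 e0 Hs.
have [K [HK1 HK2]] : exists K, (forall N, (K < N)%N -> forall d,
    9/10 <= pr p0 (box 0 N) (side_arm adjacent 0 K N d) (fun=> false)) /\
  (forall N, (K < N)%N -> forall d,
    9/10 <= pr (1 - p1) (box 0 N) (side_arm star 0 K N d) (fun=> false)).
  exists (maxn k1 k2).+1; split => N KN d.
    by have := Hk1 _ (leq_maxl k1 k2) N KN d; lra.
  by have := Hk2 _ (leq_maxr k1 k2) N KN d; lra.
pose m := Num.min p0 (1 - p1).
have m0 : 0 < m by rewrite lt_min p00 subr_gt0.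
have mp0 : m <= p0 by rewrite ge_min lexx.
have mp1 : m <= 1 - p1 by rewrite ge_min lexx orbT.
(* Lower bound on the total influence of one inner box: the factor of [influence] for its number of
   sites, times the probability of the four arms. *)
pose kap := m ^+ (K.*2.+1 * K.*2.+1) * (6 / 10).
have kap0 : 0 < kap by rewrite mulr_gt0 ?exprn_gt0 //; lra.
pose eta0 : config := fun=> false.
have [W WE] : exists W, W = K.*2.+1 by exists K.*2.+1.
have bound (M : nat) : (p1 - p0) * ((M.+1 * M.+1)%:R * kap) <=
    ((8 * W + 8 * K + 20) * M.+1)%:R.
  have [N NE] : exists N, N = (W * M + K + 2)%N by exists (W * M + K + 2)%N.
  pose V := box 0 (3 * N).
  pose F : config -> R := classes N.
  pose f r := mean r V F eta0.
  pose f' r := \sum_(y <- V) mean r V (dif y F) eta0.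
  have fd r : is_derive r (1 : R) f (f' r) by apply: mean_derive; exact: box_uniq.
  have cf : {within `[p0, p1], continuous f}.
    by apply: derivable_within_continuous => x _; have [] := fd x.
  have [c] := MVT p01 (fun x _ => fd x) cf.
  rewrite in_itv /= => /andP[c0 c1] E.
  have c01 : 0 <= c <= 1 by rewrite !ltW // ?(lt_trans p00) // (lt_trans c1).
  pose g y := mean c V (fun z => - dif y F z) eta0.
  have dF : decr F by exact: classes_decr.
  have df0 y z : 0 <= - dif y F z.
    by rewrite /dif opprB subr_ge0; apply: dF; exact: cle_update.
  have g0 y : 0 <= g y by apply: mean_ge0.
  have f'E : f' c = - \sum_(y <- V) g y.
    rewrite -sumrN; apply: eq_bigr => y _; rewrite /g.
    under [in RHS]eq_fun do rewrite -mulN1r.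
    by rewrite meanZl mulN1r opprK.
  (* The spacing [W] is the side [2 * K + 1] of an inner box, so the inner boxes are disjoint. *)
  pose T : seq site := [seq ((W * i)%:Z, (W * j)%:Z) | i <- iota 0 M.+1, j <- iota 0 M.+1].
  have TP x : x \in T -> exists i j : nat, [/\ (i <= M)%N, (j <= M)%N & x = ((W * i)%:Z, (W * j)%:Z)].
    by move=> /allpairsP [[i j] [+ + ->]]; rewrite !mem_iota => hi hj; exists i, j; split => //=; lia.
  have hx x : x \in T -> \sum_(y <- box x K) g y >= kap.
    move=> /TP [i [j [iM jM xE]]].
    have iW : (W * i <= W * M)%N by rewrite leq_mul2l iM orbT.
    have jW : (W * j <= W * M)%N by rewrite leq_mul2l jM orbT.
    have [] := grid_box iW jW NE; rewrite -xE => x1 x2 QV BV.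
    have fa : 6/10 <= pr c V (four_arm x K (2 * N)) eta0.
      apply: (@four_arm_likely p0 p1) => //.
      - exact: ltW. - exact: ltW. - by rewrite !ltW.
      - by move=> d; apply: HK1; rewrite NE; clear; lia.
      - by move=> d; apply: HK2; rewrite NE; clear; lia.
    have -> : \sum_(y <- box x K) g y =
       mean c V (fun z => \sum_(y <- box x K) mean c (box x K) (fun u => - dif y F u) z) eta0.
      rewrite (mean_sum (box x K) xpredT (fun y => mean c (box x K) (fun u => - dif y F u)) c V).
      by apply: eq_bigr => y _; rewrite /g -[in LHS](mean_mean c _ QV).
    apply: (@le_trans _ _ (mean c V (fun z => m ^+ (W * W) * ind (four_arm x K (2 * N)) z) eta0)).
      by rewrite meanZl /kap WE ler_wpM2l // exprn_ge0 // ltW.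
    apply: mean_le => // z.
    have mc : m <= c by rewrite (le_trans mp0) // ltW.
    have mc' : m <= 1 - c by rewrite (le_trans mp1) // lerD2l lerN2 ltW.
    apply: le_trans (influence m0 mc mc' z (box_uniq x K) dF).
    rewrite size_box -WE ler_wpM2l ?exprn_ge0 ?(ltW m0) // {1}/ind.
    case: asboolP => fz; last by rewrite subr_ge0; apply: dF => y; rewrite /fill; case: ifP.
    by rewrite lerBrDr addrC; exact: classes_four_arm.
  pose L := [seq y | x <- T, y <- box x K].
  have LE : \sum_(y <- L) g y = \sum_(x <- T) \sum_(y <- box x K) g y.
    by rewrite /L big_allpairs_dep.
  have uL : uniq L.
    apply: allpairs_uniq_dep.
    - apply: allpairs_uniq; [exact: iota_uniq|exact: iota_uniq|].
      move=> [a b] [c' d'] _ _ /= [h1 h2].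
      have W0 : (0 < W)%N by rewrite WE.
      by congr (_, _); apply/eqP; rewrite -(eqn_pmul2l W0); apply/eqP; [case: h1|case: h2].
    - by move=> x _; exact: box_uniq.
    - move=> [x y] [x' y'] /allpairsPdep [a [b [aT bb [-> ->]]]] /allpairsPdep [a' [b' [aT' bb' [-> ->]]]] /= e.
      rewrite -{}e in bb' *; congr (existT _ _ _).
      have [i [j [iM jM aE]]] := TP _ aT; have [i' [j' [iM' jM' aE']]] := TP _ aT'.
      move: bb bb'; rewrite aE aE' !mem_box /= => /andP[h1 h2] /andP[h1' h2'].
      by rewrite (grid_disjoint WE h1 h1') (grid_disjoint WE h2 h2').
  have LV : {subset L <= V}.
    move=> z /allpairsPdep [a [b [aT bb ->]]].
    have [i [j [iM jM aE]]] := TP _ aT.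
    have iW : (W * i <= W * M)%N by rewrite leq_mul2l iM orbT.
    have jW : (W * j <= W * M)%N by rewrite leq_mul2l jM orbT.
    by have [_ _ QV _] := grid_box iW jW NE; apply: QV; rewrite -aE.
  have sumV : (M.+1 * M.+1)%:R * kap <= \sum_(y <- V) g y.
    apply: le_trans (ler_sum_sub uL (box_uniq _ _) LV g0).
    rewrite LE; have -> : (M.+1 * M.+1)%:R * kap = \sum_(x <- T) kap.
      by rewrite big_const_seq count_predT size_allpairs !size_iota iter_addr_0 mulr_natl.
    by rewrite big_seq [leRHS]big_seq; apply: ler_sum => x xT; exact: hx.
  have f1 : 0 <= f p1.
    by apply: mean_ge0 => [|z]; [rewrite !ltW // (lt_trans p00)|exact: classes_ge0].
  have f0 : f p0 <= (size (bdry N))%:R by apply: mean_le_cst => // z; exact: classes_le.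
  have sb : ((size (bdry N))%:R : R) <= ((8 * W + 8 * K + 20) * M.+1)%:R.
    rewrite ler_nat; apply: (leq_trans (size_bdry N)); rewrite NE; clear; nia.
  apply: le_trans sb; apply: le_trans f0.
  have : f p0 - f p1 = (p1 - p0) * \sum_(y <- V) g y.
    by rewrite -opprB E f'E mulNr opprK mulrC.
  move: sumV; set S := \sum_(y <- V) _; set Z := _ * kap => sumV eqf.
  have : (p1 - p0) * Z <= (p1 - p0) * S by rewrite ler_wpM2l // subr_ge0 ltW.
  lra.
pose C := (8 * W + 8 * K + 20)%N.
have pk : 0 < (p1 - p0) * kap by rewrite mulr_gt0 // subr_gt0.
pose M := Num.bound (C%:R / ((p1 - p0) * kap)).
have := bound M; rewrite -/C !natrM mulrA (mulrC (p1 - p0)) -!mulrA.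
rewrite mulrCA [leRHS]mulrC ler_pM2l ?ltr0n //.
have : C%:R / ((p1 - p0) * kap) < M.+1%:R.
  by apply: (lt_trans (archi_boundP _)); rewrite ?ltr_nat // divr_ge0 ?ler0n // ltW.
rewrite ltr_pdivrMr // => h1 h2.
by have := lt_le_trans h1 h2; rewrite ltxx.
Qed.

End NoCoexistence.

(** * Consequences for the critical probabilities *)

Lemma finite_site_box (S : set site) : finite_set S <-> exists n, S `<=` [set` box 0 n].
Proof.
split=> [/finite_seqP [s ->]|[n Sn]]; last exact: sub_finite_set Sn (finite_seq _).
elim: s => [|[x1 x2] s [n IH]]; first by exists 0%N.
exists (n + `|x1| + `|x2|)%N => -[z1 z2]; rewrite /= inE => /orP[/eqP[-> ->]|zs].
  by rewrite mem_box /=; lia.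
by have := IH _ zs; rewrite /= !mem_box /=; lia.
Qed.

Lemma open_connectedP (e : rel site) (xi : config) x y :
  open_connected e xi x y <-> xi x /\ conn e (fun z => xi z) x y.
Proof.
split=> [[s /andP[ps /= /andP[xx /allP sa]] <-]|[xx /conn_path [s [ps sa sl]]]].
  by split => //; exact: path_conn.
by exists s => //; rewrite ps /= xx; apply/allP.
Qed.

Section Critical.
Variable e : rel site.
Hypothesis e_star : forall x y, e x y -> star x y.
Hypothesis e_shift : forall a x y, e (x + a) (y + a) = e x y.
Context {R : realType}.

Lemma percolatesP (xi : config) : percolates e xi <-> xi 0 /\ forall n, exits e 0 n xi.
Proof.
split=> [H|[x0 H] /finite_site_box [n Hn]].
  have ex n : exists2 y, open_connected e xi 0 y & y \notin box 0 n.
    apply: contrapT => nex; apply: H; apply/finite_site_box; exists n => y oy /=.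
    by apply: contrapT => /negP yb; apply: nex; exists y.
  split; first by have [y /open_connectedP[]] := ex 0%N.
  by move=> n; have [y /open_connectedP[_ c] yb] := ex n; exists y.
have [y cy yb] := H n; move/negP: yb; apply; apply: Hn; exact/open_connectedP.
Qed.

Lemma percolates_measurable : measurable (percolates e).
Proof.
have -> : percolates e = [set xi : config | xi 0 = true] `&` \bigcap_n exits e 0 n.
  apply/seteqP; split => xi; first by move=> /percolatesP[h1 h2]; split => // n _.
  by move=> [h1 h2]; apply/percolatesP; split => // n; exact: h2.
apply: measurableI; first exact: measurable_coord.
by apply: bigcapT_measurable => n; exact: (measurable_dep (@exits_dep e e_star 0 n)).
Qed.

Lemma law_exits (p : R) (P : probability config R) x n : bernoulli_product p P ->
  P (exits e x n) = (arm e p n)%:E.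
Proof.
move=> hP; rewrite (law_pr hP (V := box x n.+1) (fun=> false) (box_uniq _ _)).
  by congr (_%:E); apply: pr_exits.
apply: dep_sub (@exits_dep e e_star x n) => u; by rewrite mem_filter => /andP[].
Qed.

Lemma percolates_arm (p : R) (P : probability config R) n : bernoulli_product p P ->
  (P (percolates e) <= (arm e p n)%:E)%E.
Proof.
move=> hP; rewrite -(law_exits 0 n hP); apply: le_measure; rewrite ?inE.
- exact: percolates_measurable.
- exact: (measurable_dep (@exits_dep e e_star 0 n)).
- by move=> xi /percolatesP[].
Qed.

Hypothesis e_right : forall x, e x (x + e1).

Lemma full_percolates : percolates e (fun=> true).
Proof.
apply/percolatesP; split => // n; exists (n.+1%:Z, 0); last by rewrite mem_box /=; lia.
elim: n.+1 => [|k IH]; first exact: conn0.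
apply: (connS IH) => //; suff -> : ((k.+1%:Z, 0) : site) = (k%:Z, 0) + e1 by exact: e_right.
by rewrite [RHS]surjective_pairing /=; congr (_, _); lia.
Qed.

(** At parameter 1 the Dirac mass at the full configuration percolates; without this the infimum in
    [critical_probability] would be a default value. *)
Lemma critical_set_nonempty : [set p : R | 0 <= p <= 1 /\
    exists P : probability config R, bernoulli_product p P /\ (0 < P (percolates e))%E] !=set0.
Proof.
exists 1; split; first by rewrite ler01 lexx.
exists (\d_((fun=> true) : config)); split; last first.
  by rewrite /= diracE mem_set //; exact: full_percolates.
move=> s v us; rewrite /= diracE.
have [sv|/allPn [x xs nv]] := boolP (all v s).
  rewrite mem_set /=; last by move=> x /(allP sv) ->.
  by rewrite big_seq big1 // => x /(allP sv) ->.
rewrite memNset /=; last by move=> /(_ x xs); rewrite (negbTE nv).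
by rewrite (big_rem x xs) /= (negbTE nv) subrr mul0r.
Qed.

Lemma critical_lt (p : R) : critical_probability R e < p ->
  exists p0 delta, [/\ 0 <= p0, p0 < p, 0 < delta & forall n, delta <= arm e p0 n].
Proof.
rewrite /critical_probability; set A := (X in inf X) => lt.
have hA : has_inf A.
  by split; [exact: critical_set_nonempty|exists 0 => x [/andP[]]].
have lt' : 0 < p - inf A by rewrite subr_gt0.
have [p0 [/andP[p00 p01] [P [hP Pp]]] ltp] := inf_adherent lt' hA.
have fin : P (percolates e) \is a fin_num by exact: fin_num_measure percolates_measurable.
exists p0, (fine (P (percolates e))); split => //.
- by move: ltp; rewrite addrC subrK.
- by rewrite fine_gt0 // Pp ltey_eq fin.
- by move=> n; rewrite -lee_fin fineK //; exact: percolates_arm.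
Qed.

Lemma critical_ge (p : R) : (forall r, 0 <= r -> r < p -> forall delta, 0 < delta ->
  exists n, arm e r n < delta) -> p <= critical_probability R e.
Proof.
move=> H; apply: lb_le_inf; first exact: critical_set_nonempty.
move=> r [/andP[r0 r1] [P [hP Pp]]]; rewrite leNgt; apply/negP => rp.
have fin : P (percolates e) \is a fin_num by exact: fin_num_measure percolates_measurable.
have f0 : 0 < fine (P (percolates e)) by rewrite fine_gt0 // Pp ltey_eq fin.
have [n] := H r r0 rp _ f0; rewrite -lte_fin fineK // ltNge.
by rewrite percolates_arm.
Qed.

Lemma expr_small (k delta : R) : 0 <= k -> k < 1 -> 0 < delta -> exists n, k ^+ n < delta.
Proof.
move=> k0 k1 d0; have c : `|k| < 1 by rewrite ger0_norm.
have [n _ H] := cvgr_lt _ (cvg_expr c) _ d0.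
by exists n; apply: H => /=.
Qed.

Lemma psi_continuous m S (p : R) : uniq S -> {for p, continuous (fun r : R => r * psi e r m S : R)}.
Proof.
move=> uS; apply: differentiable_continuous; apply/derivable1_diffP.
have fd y : is_derive p (1 : R) (fun r => pr r S (touches e S y) (fun=> false))
   (\sum_(x <- S) mean p S (dif x (ind (touches e S y) : config -> R)) (fun=> false)).
  exact: mean_derive.
have -> : (fun r => r * psi e r m S) = (fun r : R => r) *
   (\sum_(y <- box 0 m.+1 | y \notin S) (fun r : R => pr r S (touches e S y) (fun=> false))).
  by apply/funext => r; rewrite /psi fctE fct_sumE.
apply: derivableM; first exact: derivable_id.
elim/big_ind : _ => [|f g|y _].
- exact: derivable_cst.
- exact: derivableD.
- by have [] := fd y.
Qed.

(** If the product were below 1 at [p], continuity would keep it below 1 at some [p' > p]. Arms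
    would then decay up to [p'], and the critical probability would be at least [p']. This covers
    the critical point itself. *)
Lemma critical_psi (p : R) S m : 0 < p < 1 -> critical_probability R e <= p ->
  uniq S -> (0 : site) \in S -> {subset S <= box 0 m} -> 1 <= p * psi e p m S.
Proof.
move=> /andP[p0 p1] pc uS S0 Sm; rewrite leNgt; apply/negP => lt1.
have [p' [pp' p'1 lt1']] : exists p', [/\ p < p', p' < 1 & p' * psi e p' m S < 1].
  have cp := @psi_continuous m S p uS.
  have lt2 : \forall t \near p^'+, t * psi e t m S < 1 := cvgr_lt _ (cvg_at_right_filter cp) _ lt1.
  have : \forall t \near p^'+, t * psi e t m S < 1 /\ t < 1 /\ p < t.
    near=> t; split; last split.
    - by near: t; exact: lt2.
    - by near: t; exact: nbhs_right_lt.
    - by near: t; exact: nbhs_right_gt.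
  move=> /(@filter_ex _ _ _) [t [h1 [h2 h3]]]; by exists t.
suff : p' <= critical_probability R e by rewrite leNgt (le_lt_trans pc).
apply: critical_ge => r r0 rp' delta d0.
have p'0 : 0 <= p' by rewrite ltW // (lt_trans p0).
have k0 : 0 <= p' * psi e p' m S.
  rewrite mulr_ge0 //; apply: sumr_ge0 => y _; apply: pr_ge0; by rewrite p'0 ltW.
have [n hn] := expr_small k0 lt1' d0.
exists (n * m.+1)%N; apply: le_lt_trans hn.
apply: (@le_trans _ _ (arm e p' (n * m.+1))).
  by apply: arm_mono => //; exact: ltW.
by apply: arm_decay => //; rewrite p'0 ltW.
Unshelve. all: by end_near.
Qed.

End Critical.

(** * Lower bound on the oriented critical probability *)

Section Oriented.
Context {R : realType}.

Lemma oriented_edgeP x y : oriented_edge x y = (y == x + e1) || (y == x + e2).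
Proof. by rewrite /oriented_edge /= !inE. Qed.

Lemma oriented_star x y : oriented_edge x y -> star x y.
Proof. by rewrite oriented_edgeP => /orP[] /eqP ->; rewrite /star /=; lia. Qed.

Lemma oriented_shift a x y : oriented_edge (x + a) (y + a) = oriented_edge x y.
Proof.
by rewrite !oriented_edgeP ![x + a + _]addrAC !(inj_eq (addIr a)).
Qed.

Lemma oriented_right x : oriented_edge x (x + e1).
Proof. by rewrite oriented_edgeP eqxx. Qed.

(** Take [S] reduced to the origin in [critical_psi]: there are only two exits. The resulting bound
    q <= 1/2 is what turns e^(O(n)) into a power of 1/q independent of q. *)
Lemma half_le_pOP : 1 / 2 <= pOP R.
Proof.
rewrite leNgt; apply/negP => lt.
(* The maximum with 1/4 guarantees a positive parameter, as [critical_psi] requires. *)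
pose p : R := Num.max (pOP R) (1 / 4).
have p0 : 0 < p by rewrite lt_max; apply/orP; right; lra.
have p1 : p < 1 / 2 by rewrite gt_max lt /=; lra.
have p01 : 0 < p < 1 by rewrite p0 /=; lra.
have pc : critical_probability R oriented_edge <= p by rewrite le_max lexx.
have := @critical_psi _ oriented_star oriented_shift R oriented_right p [:: 0] 0 p01 pc isT (mem_head _ _).
move=> /(_ _)/[dup] _ H.
have {H} : 1 <= p * psi oriented_edge p 0 [:: 0].
  have b0 : (0 : site) \in box 0 0 by rewrite mem_box /=; lia.
  by apply: H => z zs; move: (zs); rewrite mem_seq1 => /eqP ->.
suff : psi oriented_edge p 0 [:: 0] <= 2 by move=> h1 h2; nra.
have p01' : 0 <= p <= 1 by case/andP: p01 => h1 h2; rewrite !ltW.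
rewrite /psi.
apply: (@le_trans _ _ (\sum_(y <- box 0 1 | y \notin [:: 0]) ((y == e1) || (y == e2))%:R)).
  apply: ler_sum => y _; rewrite /pr; apply: mean_le_cst => // z.
  rewrite /ind; case: asboolP => // -[x [+ exy _]]; rewrite inE => /eqP x0.
  by move: exy; rewrite x0 oriented_edgeP !add0r => ->.
have -> : \sum_(y <- box 0 1 | y \notin [:: 0]) ((y == e1) || (y == e2))%:R =
   \sum_(y <- [seq y <- box 0 1 | y \notin [:: 0] & (y == e1) || (y == e2)]) (1 : R).
  rewrite big_filter [RHS]big_mkcond /= big_mkcond /=; apply: eq_bigr => y _.
  by rewrite andbC; case: (_ || _); case: (_ \notin _).
by rewrite -(natr_sum _ _ _ (fun=> 1%N)) sum1_size.
Qed.

End Oriented.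

Section ClosedDecay.
Context {R : realType}.

Lemma adjacent_right x : adjacent x (x + e1).
Proof. by apply/adjacentP; case: x => a b; rewrite /=; lia. Qed.

Lemma closed_decay (p : R) : pSP R < p -> p < 1 ->
  exists M kappa, [/\ 0 <= kappa, kappa < 1 &
    forall k, arm star (1 - p) (k * M.+1)%N <= kappa ^+ k].
Proof.
move=> pc p1.
have [p0 [delta [p00 p0p d0 Hd]]] := @critical_lt _ adjacent_star adjacent_shift R
 adjacent_right p pc.
(* Two intermediate parameters: open arms survive at [a], and if closed arms did not decay at
   [1 - p] they would survive at [1 - b]. Since [a < b], the two would coexist. Moreover [a] is
   positive even if [p0] is 0. *)
pose a := (p0 + p) / 2; pose b := (a + p) / 2.
have a0 : 0 < a by rewrite /a; lra.
have ab : a < b by rewrite /b /a; lra.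
have bp : b < p by rewrite /b /a; lra.
have p0a : p0 <= a by rewrite /a; lra.
have r00 : 0 < 1 - p by lra.
have r01 : 1 - p < 1 - b by lra.
have r11 : 1 - b < 1 by lra.
have ss x y : star x y -> star x y by [].
have [//|H] := arm_dichotomy ss star_shift r00 r01 r11.
exfalso; pose d := Num.min delta ((1 - b - (1 - p)) / 2).
have b1 : b < 1 by lra.
have dd : 0 < d by rewrite lt_min d0 /=; lra.
apply: (no_coexistence a0 ab b1 dd) => n.
  apply: (@le_trans _ _ delta); first by rewrite ge_min lexx.
  apply: le_trans (Hd n) _; apply: arm_mono => //; lra.
by apply: le_trans (H n); rewrite ge_min lexx orbT.
Qed.

End ClosedDecay.

(** * Good scales *)

Definition crossH (n : nat) : set config :=
  [set w | exists u v, [/\ u.1 = 0, v.1 = (2 * n)%:Z, w u, rect 0 (2 * n)%:Z 0 n%:Z u &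
     conn adjacent (fun z => w z /\ rect 0 (2 * n)%:Z 0 n%:Z z) u v]].

Definition crossV (n : nat) : set config :=
  [set w | exists u v, [/\ u.2 = 0, v.2 = (2 * n)%:Z, w u, rect 0 n%:Z 0 (2 * n)%:Z u &
     conn adjacent (fun z => w z /\ rect 0 n%:Z 0 (2 * n)%:Z z) u v]].

Definition swap (z : site) : site := (z.2, z.1).

Lemma swapK : involutive swap. Proof. by case. Qed.

Lemma adjacent_swap x y : adjacent (swap x) (swap y) = adjacent x y.
Proof. by apply/adjacentP/adjacentP; rewrite /swap /=; lia. Qed.

Lemma star_swap x y : star (swap x) (swap y) = star x y.
Proof. by rewrite /star /swap /= andbC. Qed.

Lemma rect_swap a b c d z : rect a b c d (swap z) = rect c d a b z.
Proof. by apply/rectP/rectP => -[]. Qed.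

Lemma crossV_swap n (w : config) : crossV n w <-> crossH n (w \o swap).
Proof.
split => -[u [v [h1 h2 h3 h4 h5]]]; exists (swap u), (swap v).
  rewrite /= swapK rect_swap; split => //.
  apply: (conn_map (tau := swap)) h5 => [a b|z [zw zr]]; first by rewrite adjacent_swap.
  by rewrite /= swapK rect_swap.
split => //; first by rewrite rect_swap.
apply: (conn_map (tau := swap)) h5 => [a b|z [zw zr]]; first by rewrite adjacent_swap.
by rewrite rect_swap.
Qed.

(** The dual closed path starts on the bottom side and ends at height [n], hence out of the box of
    radius [n - 1] around its start. *)
Lemma no_crossH n (w : config) : (0 < n)%N -> ~ crossH n w ->
  exists2 i, i \in iota 0 (2 * n).+1 & exits star (i%:Z, 0) n.-1 (cneg w).
Proof.
move=> n0 nc; have h1 : (0 : int) <= (2 * n)%:Z by [].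
have h2 : (0 : int) <= n%:Z by [].
have [//|[[u1 u2] [[v1 v2] [u0 vn nu ru uv]]]] := hex (fun z => w z) h1 h2.
move/rectP: ru => [a1 a2 a3 a4]; rewrite /= in u0 vn a1 a2 a3 a4.
exists `|u1|%N; first by rewrite mem_iota; lia.
exists (v1, v2); last by rewrite mem_box /=; lia.
have -> : (`|u1|%N%:Z, 0) = (u1, u2) :> site by congr (_, _); lia.
by apply: conn_sub uv => z [/negP].
Qed.

Lemma no_crossV n (w : config) : (0 < n)%N -> ~ crossV n w ->
  exists2 i, i \in iota 0 (2 * n).+1 & exits star (0, i%:Z) n.-1 (cneg w).
Proof.
move=> n0 nc; have {}nc : ~ crossH n (w \o swap) by move/crossV_swap.
have [i ii [z cz nz]] := no_crossH n0 nc.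
exists i => //; exists (swap z); last by move: nz; case: (z) => z1 z2; rewrite !mem_box /=; lia.
by apply: (conn_map (tau := swap)) cz => [a b|//]; rewrite star_swap.
Qed.

Definition good (n : nat) : set config := crossH n `&` crossV n.

Lemma conn_dep (V : seq site) (P : pred site) : {subset P <= V} ->
  forall a b : config, (forall z, z \in V -> a z = b z) ->
  forall e u v, conn e (fun z => a z /\ P z) u v -> conn e (fun z => b z /\ P z) u v.
Proof. by move=> PV a b E e u v; apply: conn_sub => z [az Pz]; rewrite -E //; exact: PV. Qed.

Lemma rect_box n z : rect 0 (2 * n)%:Z 0 n%:Z z -> z \in box 0 (2 * n).
Proof. by case: z => z1 z2 /rectP[/=]; rewrite mem_box /=; lia. Qed.

Lemma rect_box' n z : rect 0 n%:Z 0 (2 * n)%:Z z -> z \in box 0 (2 * n).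
Proof. by case: z => z1 z2 /rectP[/=]; rewrite mem_box /=; lia. Qed.

Lemma good_dep n : dep (box 0 (2 * n)) (good n).
Proof.
have H (a b : config) : (forall u, u \in box 0 (2 * n) -> a u = b u) -> good n a -> good n b.
  move=> E [[u [v [h1 h2 h3 h4 h5]]] [u' [v' [g1 g2 g3 g4 g5]]]]; split.
    exists u, v; split => //; first by rewrite -E //; exact: rect_box.
    by apply: (@conn_dep (box 0 (2 * n)) (rect 0 (2 * n)%:Z 0 n%:Z) _ a b E) h5 => z; exact: rect_box.
  exists u', v'; split => //; first by rewrite -E //; exact: rect_box'.
  by apply: (@conn_dep (box 0 (2 * n)) (rect 0 n%:Z 0 (2 * n)%:Z) _ a b E) g5 => z; exact: rect_box'.
by move=> a b E; apply/propext; split; apply: H => // u /E.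
Qed.

(** * Exponential tail of the bad scales *)

Section Tail.
Context {R : realType}.
Variables (p : R) (nu : probability config R).
Hypotheses (p01 : 0 < p < 1) (hnu : bernoulli_product p nu).

Lemma good_arm n : (0 < n)%N ->
  (nu (~` good n) <= ((4 * n + 2)%:R * arm star (1 - p) n.-1)%:E)%E.
Proof.
move=> n0; have [p0 p1] := andP p01.
have p01' : 0 <= p <= 1 by rewrite !ltW.
pose V := box 0 (4 * n).
have dV : dep V (~` good n).
  move=> a b E; rewrite /setC /=; congr (~ _); apply: good_dep => u ub; apply: E.
  by move: ub; rewrite !mem_box; lia.
rewrite (law_pr hnu (fun=> false) (box_uniq _ _) dV) lee_fin.
have ss x y : star x y -> star x y by [].
have U := prU p01' V (~` crossH n) (~` crossV n) (fun=> false).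
have sub : pr p V (~` good n) (fun=> false) <= pr p V (~` crossH n `|` ~` crossV n) (fun=> false).
  apply: pr_sub => // w ng; have [h|h] := pselect (crossH n w); last by left.
  by right => h'; apply: ng.
apply: (le_trans sub); apply: (le_trans U).
have -> : (4 * n + 2)%:R * arm star (1 - p) n.-1 =
   (2 * n).+1%:R * arm star (1 - p) n.-1 + (2 * n).+1%:R * arm star (1 - p) n.-1 :> R.
  by rewrite -mulrDl -natrD; congr (_%:R * _); lia.
have E F (A : set config) : (forall w, A w -> exists2 i : nat, i \in iota 0 (2 * n).+1 &
    exits star (F i) n.-1 (cneg w)) ->
    (forall i, i \in iota 0 (2 * n).+1 -> {subset box (F i) n.-1.+1 <= V}) ->
    pr p V A (fun=> false) <= (2 * n).+1%:R * arm star (1 - p) n.-1.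
  move=> HA HF.
  apply: (le_trans (@pr_union _ p p01' _ (iota 0 (2 * n).+1)
    (fun i => [set w | exits star (F i) n.-1 (cneg w)]) V A _ HA)).
  have -> : (2 * n).+1%:R * arm star (1 - p) n.-1 = \sum_(i <- iota 0 (2 * n).+1) arm star (1 - p) n.-1 :> R.
    by rewrite big_const_seq count_predT size_iota iter_addr_0 mulr_natl.
  rewrite big_seq [leRHS]big_seq; apply: ler_sum => i ii.
  by rewrite pr_neg (pr_exits ss star_shift) //; exact: HF.
apply: lerD.
  apply: (E (fun i => (i%:Z, 0))) => [w /(no_crossH n0)//|i].
  by rewrite mem_iota => ii [z1 z2]; rewrite !mem_box /=; lia.
apply: (E (fun i => (0, i%:Z))) => [w /(no_crossV n0)//|i].
by rewrite mem_iota => ii [z1 z2]; rewrite !mem_box /=; lia.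
Qed.

Definition bad (n : nat) : set config := \bigcup_k ~` good (n + k)%N.

Lemma bad_measurable n : measurable (bad n).
Proof.
by apply: bigcupT_measurable => k; apply: measurableC; exact: (measurable_dep (@good_dep (n + k)%N)).
Qed.

Lemma bad_anti m n : (m <= n)%N -> bad n `<=` bad m.
Proof.
by move=> mn w [k _ ng]; exists (n - m + k)%N => //; rewrite addnA subnKC.
Qed.

Hypothesis (hSP : pSP R < p).

Lemma good_tail : exists C a : R, [/\ 0 < C, 0 < a &
  forall n, (nu (~` good n) <= (C * expR (- (a * n%:R)))%:E)%E].
Proof.
have [p0 p1] := andP p01.
have [M [kappa [k0 k1 H]]] := closed_decay hSP p1.
(* The rate [kappa] may be 0, and its logarithm is needed. *)
pose k : R := Num.max kappa (1 / 2).
have kk : kappa <= k by rewrite le_max lexx.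
have kp : 0 < k by rewrite lt_max; apply/orP; right; lra.
have k1' : k < 1 by rewrite gt_max k1 /=; lra.
pose a0 : R := - ln k / M.+1%:R.
have M0 : 0 < M.+1%:R :> R by rewrite ltr0n.
have a00 : 0 < a0 by rewrite divr_gt0 // oppr_gt0 ln_lt0 // kp.
have r01 : 0 <= 1 - p <= 1 by move: p0 p1; lra.
have ss x y : star x y -> star x y by [].
have armL L : arm star (1 - p) L <= expR (a0 * M%:R) * expR (- (a0 * L%:R)).
  apply: (@le_trans _ _ (arm star (1 - p) (L %/ M.+1 * M.+1))).
    by apply: (arm_anti ss star_shift r01); exact: leq_divM.
  apply: (le_trans (H _)); apply: (@le_trans _ _ (k ^+ (L %/ M.+1))).
    by apply: lerXn2r; rewrite ?nnegrE // ltW.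
  have -> : k = expR (- (a0 * M.+1%:R)).
    by rewrite /a0 mulrAC -mulrA divff ?gt_eqF // mulr1 opprK lnK.
  rewrite -expRM_natl -expRD ler_expR.
  have : (L%:R : R) <= (L %/ M.+1)%:R * M.+1%:R + M%:R.
    rewrite -natrM -natrD ler_nat {1}(divn_eq L M.+1) leq_add2l -ltnS; exact: ltn_pmod.
  rewrite mulrN mulrCA -mulrN => hL; move: a00 hL.
  set x := (L %/ _)%:R * _; set y := L%:R; set z := M%:R => a00 hL.
  have : a0 * y <= a0 * (x + z) by rewrite ler_wpM2l // ltW.
  rewrite mulrDr mulrN; lra.
(* The first factor bounds the linear prefactor against half of the decay. The others pay for
   rounding down to a multiple of [M.+1] and for the shift from [n] to [n - 1]. *)
pose C : R := (8 / a0 + 2) * (expR (a0 * M%:R) * expR a0).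
have C0 : 0 < C by rewrite mulr_gt0 ?mulr_gt0 ?expR_gt0 // addr_gt0 // divr_gt0.
have C1 : 1 <= C.
  have e1 : 1 <= expR (a0 * M%:R) by rewrite -expR0 ler_expR mulr_ge0 // ltW.
  have e2 : 1 <= expR a0 by rewrite -expR0 ler_expR ltW.
  have e3 : 0 < 8 / a0 by rewrite divr_gt0.
  have e4 : 1 <= expR (a0 * M%:R) * expR a0 by rewrite -expRD -expR0 ler_expR addr_ge0 ?(ltW a00) // mulr_ge0 // ltW.
  rewrite /C; move: e3 e4; set x := 8 / a0; set y := _ * _ => e3 e4; nra.
exists C, (a0 / 2); split => //; first by rewrite divr_gt0.
move=> [|n]; first by rewrite mulr0 oppr0 expR0 mulr1; apply: le_trans (probability_le1 _ _) _;
  [apply: measurableC; exact: (measurable_dep (@good_dep 0))|rewrite lee_fin].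
apply: (le_trans (good_arm _)) => //; rewrite lee_fin /=.
apply: (@le_trans _ _ ((4 * n.+1 + 2)%:R * (expR (a0 * M%:R) * expR (- (a0 * n%:R))))).
  by rewrite ler_wpM2l.
have -> : expR (- (a0 * n%:R)) = expR a0 * (expR (- (a0 / 2 * n.+1%:R)) * expR (- (a0 / 2 * n.+1%:R))).
  by rewrite -!expRD; congr expR; rewrite -[n.+1]addn1 natrD; field.
rewrite /C; set E := expR (- (a0 / 2 * _)).
have E0 : 0 < E by exact: expR_gt0.
suff h : (4 * n.+1 + 2)%:R * E <= 8 / a0 + 2.
  set x := expR (a0 * _); set y := expR a0.
  have -> : (4 * n.+1 + 2)%:R * (x * (y * (E * E))) = ((4 * n.+1 + 2)%:R * E) * ((x * y) * E) by ring.
  have -> : (8 / a0 + 2) * (x * y) * E = (8 / a0 + 2) * ((x * y) * E) by ring.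
  by rewrite ler_wpM2r // mulr_ge0 ?mulr_ge0 // ltW // expR_gt0.
rewrite /E expRN ler_pdivrMr ?expR_gt0 //.
have h := expR_ge1Dx (a0 / 2 * n.+1%:R).
have an : 0 <= a0 / 2 * n.+1%:R by rewrite mulr_ge0 // ltW // divr_gt0.
have h1 : (n.+1%:R : R) = 2 / a0 * (a0 / 2 * n.+1%:R) by field; rewrite gt_eqF.
rewrite natrD natrM {1}h1.
move: h an; set t := a0 / 2 * _; set e := expR t => h t0.
have e0 : 0 < e by exact: expR_gt0.
have te : t <= e by apply: le_trans h; rewrite lerDr ler01.
have e1 : 1 <= e by apply: le_trans h; rewrite lerDl.
have a2 : 0 <= 2 / a0 by rewrite divr_ge0 // ltW.
have h2 : 2 / a0 * t <= 2 / a0 * e by rewrite ler_wpM2l.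
have -> : (8 / a0 + 2) * e = 4 * (2 / a0 * e) + 2 * e by field; rewrite gt_eqF.
apply: lerD; first by rewrite ler_wpM2l.
by rewrite -[leLHS]mulr1 ler_wpM2l.
Qed.

Lemma bad_tail : exists C a : R, [/\ 0 < C, 0 < a &
  forall n, (nu (bad n) <= (C * expR (- (a * n%:R)))%:E)%E].
Proof.
have [C [a [C0 a0 H]]] := good_tail.
pose rho := expR (- a).
have r0 : 0 < rho by exact: expR_gt0.
have r1 : rho < 1 by rewrite -expR0 ltr_expR oppr_lt0.
exists (C / (1 - rho)), a; split => //; first by rewrite divr_gt0 // subr_gt0.
move=> n.
have mg k : measurable (~` good (n + k)%N).
  by apply: measurableC; exact: (measurable_dep (@good_dep (n + k)%N)).
have S := @measure_sigma_subadditive _ _ _ nu (bad n) (fun k => ~` good (n + k)%N) mg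
   (bad_measurable n) (@subset_refl _ _).
apply: (le_trans S); apply: lime_le; first exact: is_cvg_nneseries.
apply: nearW => N.
apply: (@le_trans _ _ (\sum_(0 <= k < N) (C * expR (- (a * (n + k)%:R)))%:E)%E).
  by apply: lee_sum => k _; exact: H.
rewrite sumEFin lee_fin.
have -> : \sum_(0 <= k < N) C * expR (- (a * (n + k)%:R)) =
   C * expR (- (a * n%:R)) * \sum_(0 <= k < N) rho ^+ k.
  rewrite mulr_sumr; apply: eq_bigr => k _; rewrite -mulrA; congr (_ * _).
  by rewrite /rho -expRM_natl -expRD; congr expR; rewrite natrD; ring.
rewrite [leRHS]mulrAC ler_wpM2l ?mulr_ge0 ?(ltW C0) ?expR_ge0 //.
rewrite -[leRHS]mul1r ler_pdivlMr ?subr_gt0 //.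
elim: N => [|N IH]; first by rewrite big_geq // mul0r.
rewrite big_nat_recr //= mulrDl.
have -> : (\sum_(0 <= k < N) rho ^+ k) * (1 - rho) = 1 - rho ^+ N.
  elim: N {IH} => [|N IH]; first by rewrite big_geq // mul0r expr0 subrr.
  rewrite big_nat_recr //= mulrDl IH exprS; ring.
by rewrite mulrBr mulr1 mulrC -exprS; rewrite addrA subrK gerBl exprn_ge0 // ltW.
Qed.

End Tail.

(** The coordinate [f] grows by at most one per step, so the path takes the value [c] exactly before
    exceeding it; used to cut a long crossing down to a shorter rectangle. *)
Lemma conn_trunc (e : rel site) (f : site -> int) (c : int) (P : site -> Prop) u v :
  (forall a b, e a b -> f b <= f a + 1) -> conn e P u v -> f u <= c -> c <= f v ->
  exists2 v', f v' = c & conn e (fun z => P z /\ f z <= c) u v'.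
Proof.
move=> ef uv uc; suff H : f v <= c /\ conn e (fun z => P z /\ f z <= c) u v \/
   exists2 v', f v' = c & conn e (fun z => P z /\ f z <= c) u v'.
  by move=> cv; case: H => // -[vc cc]; exists v => //; lia.
elim: uv => [|a b _ IH eab Pb]; first by left; split => //; exact: conn0.
case: IH => [[ac ca]|]; last by right.
have [bc|bc] := leP (f b) c; first by left; split => //; exact: (connS ca).
by right; exists a => //; have := ef _ _ eab; lia.
Qed.

Lemma conn_self (e : rel site) (P : site -> Prop) u v :
  conn e P u v -> conn e (fun z => P z /\ conn e P u z) u v.
Proof.
elim=> [|a b ua IH eab Pb]; first exact: conn0.
by apply: (connS IH eab); split => //; exact: (connS ua).
Qed.

Lemma adjacent_step1 a b : adjacent a b -> b.1 <= a.1 + 1.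
Proof. by move/adjacentP; lia. Qed.

Lemma adjacent_step2 a b : adjacent a b -> b.2 <= a.2 + 1.
Proof. by move/adjacentP; lia. Qed.

(** Cut at height [m'] and at abscissa [m], the two crossings traverse the same rectangle of sides
    [m] and [m'] in both directions, and [cross] forbids them to lie in different components of
    [A]. *)
Lemma crossings_meet (A : site -> Prop) (m m' : nat) u v u' v' :
  (m' <= 2 * m)%N -> (m <= 2 * m')%N ->
  A u -> rect 0 m%:Z 0 (2 * m)%:Z u -> u.2 = 0 -> v.2 = (2 * m)%:Z ->
  conn adjacent (fun z => A z /\ rect 0 m%:Z 0 (2 * m)%:Z z) u v ->
  A u' -> rect 0 (2 * m')%:Z 0 m'%:Z u' -> u'.1 = 0 -> v'.1 = (2 * m')%:Z ->
  conn adjacent (fun z => A z /\ rect 0 (2 * m')%:Z 0 m'%:Z z) u' v' ->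
  conn adjacent A u u'.
Proof.
move=> mm1 mm2 Au ru u0 v1 uv Au' ru' u'0 v'1 uv'.
have [t tE cV] : exists2 t, t.2 = m'%:Z & conn adjacent (fun z => (A z /\
    rect 0 m%:Z 0 (2 * m)%:Z z) /\ z.2 <= m'%:Z) u t.
  by apply: (conn_trunc adjacent_step2 uv); [rewrite u0|rewrite v1; lia].
have [t' t'E cH] : exists2 t, t.1 = m%:Z & conn adjacent (fun z => (A z /\
    rect 0 (2 * m')%:Z 0 m'%:Z z) /\ z.1 <= m%:Z) u' t.
  by apply: (conn_trunc adjacent_step1 uv'); [rewrite u'0|rewrite v'1; lia].
apply: contrapT => nc.
have [s [ps sP sl]] := conn_path (conn_adj_star (conn_self cV)).
have sA z : z \in u :: s -> conn adjacent A u z /\ rect 0 m%:Z 0 m'%:Z z.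
  rewrite inE => /orP[/eqP->|/sP [[[Az rz] zm] cz]].
    split; first exact: conn0.
    by move/rectP: ru => [h1 h2 h3 h4]; apply/rectP; split => //; rewrite u0.
  split; first by apply: conn_sub cz => y [[]].
  by move/rectP: rz => [h1 h2 h3 h4]; apply/rectP.
pose Q z := [/\ A z, rect 0 m%:Z 0 m'%:Z z & conn adjacent A u' z].
apply: (@cross 0 m%:Z 0 m'%:Z u s ps _ u0 _ Q u' t') => //.
- by move=> z /sA[].
- by rewrite sl.
- move=> z [Az rz cz]; split => //; apply/negP => /sA [cu _]; apply: nc.
  by apply: (conn_trans cu); apply: conn_rev cz => //; exact: adjacent_sym.
- split => //; last exact: conn0.
  by move/rectP: ru' => [h1 h2 h3 h4]; apply/rectP; split => //; rewrite u'0.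
- apply: conn_sub (conn_self cH) => z [[[Az rz] zm] cz]; split => //.
    by move/rectP: rz => [h1 h2 h3 h4]; apply/rectP.
  by apply: conn_sub cz => y [[]].
Qed.

(** * Easy crossings around the origin and an infinite easy path *)

Section Barrier.
Variables (w : config) (n : nat).
Hypotheses (n0 : (0 < n)%N) (Hgood : forall m, (n <= m)%N -> good m w).

(** [G] consists of what is joined to the vertical, respectively horizontal, crossing inside its
    rectangle at scale [n]. These two crossings screen the origin in both oriented directions, so a
    hard region above the origin is confined to a square of side [n]. *)
Lemma barrier : exists (G : site -> Prop) (b : site),
  [/\ G b,
      forall z, G z -> w z /\ conn adjacent (fun y => w y /\ y \in box 0 (2 * n)) b z,
      forall z, G z -> z \in box 0 (2 * n),
      forall M, exists2 z, conn adjacent (fun y => w y) b z & z \notin box 0 M &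
      forall z, ~ G 0 -> conn oriented_edge (fun y => ~ G y) 0 z ->
        rect 0 (n%:Z - 1) 0 (n%:Z - 1) z].
Proof.
have [[uH [vH [h1 h2 h3 h4 h5]]] [uV [vV [g1 g2 g3 g4 g5]]]] := Hgood (leqnn n).
pose GH z := conn adjacent (fun z => w z /\ rect 0 (2 * n)%:Z 0 n%:Z z) uH z.
pose GV z := conn adjacent (fun z => w z /\ rect 0 n%:Z 0 (2 * n)%:Z z) uV z.
pose A z := w z /\ z \in box 0 (2 * n).
have HA z : w z /\ rect 0 (2 * n)%:Z 0 n%:Z z -> A z by move=> [wz /rect_box].
have VA z : w z /\ rect 0 n%:Z 0 (2 * n)%:Z z -> A z by move=> [wz /rect_box'].
have GHA z : GH z -> A z.
  by move=> /conn_end[<-|/HA//]; apply: HA.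
have GVA z : GV z -> A z.
  by move=> /conn_end[<-|/VA//]; apply: VA.
have meet : conn adjacent A uV uH.
  apply: (@crossings_meet A n n uV vV uH vH) => //; try lia.
  - exact: VA. - by apply: conn_sub g5 => z h; split; [exact: VA|case: h].
  - exact: HA. - by apply: conn_sub h5 => z h; split; [exact: HA|case: h].
exists (fun z => GV z \/ GH z), uV; split.
- by left; exact: conn0.
- move=> z [Gz|Gz]; first by split; [case: (GVA _ Gz)|apply: conn_sub Gz].
  split; first by case: (GHA _ Gz).
  by apply: (conn_trans meet); apply: conn_sub Gz.
- by move=> z [/GVA[]|/GHA[]].
(* Scales are doubled: the vertical crossing at one scale meets the horizontal crossing at the next,
   which meets the vertical one of its own scale. *)
- have chain k : exists u v, [/\ u.2 = 0, v.2 = (2 * (2 ^ k * n))%:Z, w u,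
     rect 0 (2 ^ k * n)%:Z 0 (2 * (2 ^ k * n))%:Z u &
     conn adjacent (fun z => w z /\ rect 0 (2 ^ k * n)%:Z 0 (2 * (2 ^ k * n))%:Z z) u v] /\
     conn adjacent (fun y => w y) uV u.
    elim: k => [|k [u [v [[a1 a2 a3 a4 a5] a6]]]].
      by exists uV, vV; rewrite expn0 mul1n; split => //; exact: conn0.
    have Hn : (n <= 2 ^ k.+1 * n)%N by rewrite leq_pmull // expn_gt0.
    have [[u1 [v1 [c1 c2 c3 c4 c5]]] [u2 [v2 [d1 d2 d3 d4 d5]]]] := Hgood Hn.
    exists u2, v2; split; first by [].
    apply: (conn_trans a6).
    have EE : (2 ^ k.+1 * n = 2 * (2 ^ k * n))%N by rewrite expnS mulnA.
    apply: (@conn_trans _ _ _ u1).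
      apply: (@crossings_meet (fun y => w y) (2 ^ k * n) (2 ^ k.+1 * n) u v u1 v1) => //; rewrite EE; clear; lia.
    apply: conn_rev => //; first exact: adjacent_sym.
    by apply: (@crossings_meet (fun y => w y) (2 ^ k.+1 * n) (2 ^ k.+1 * n) u2 v2 u1 v1) => //; clear; lia.
  move=> M; have [u [v [[a1 a2 a3 a4 a5] a6]]] := chain M.
  exists v.
    by apply: (conn_trans a6); apply: conn_sub a5 => z [].
  have : (M < 2 ^ M * n)%N by apply: (leq_trans (ltn_expl M (isT : 1 < 2)%N)); rewrite leq_pmulr.
  by case: (v) a2 => v1 v2 /= -> ; rewrite mem_box /=; clear; lia.
- move=> z nG0 cz; pose r1 := rect 0 (n%:Z - 1) 0 (n%:Z - 1).
  pose nG y := ~ (GV y \/ GH y).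
  suff [] : r1 z /\ conn oriented_edge (fun y => nG y /\ r1 y) 0 z by [].
  elim: cz => [|a b _ [ra ca] ab nb].
    split; last exact: conn0.
    by rewrite /r1 /rect /=; move: n0; clear; lia.
  have [rb|nrb] := boolP (r1 b); first by split => //; exact: (connS ca).
  exfalso.
  have nGa : nG a by case: (conn_end ca) => [<-|[]].
  have star_or x y : oriented_edge x y -> adjacent x y.
    rewrite oriented_edgeP => /orP[] /eqP ->; apply/adjacentP; case: x => x1 x2 /=; clear; lia.
  have conn_or P x y : conn oriented_edge P x y -> conn adjacent P x y.
    by elim=> [|x' y' _ IH exy Py]; [exact: conn0|apply: (connS IH) => //; exact: star_or].
  have cab : conn oriented_edge (fun y => nG y /\ (r1 y \/ y = b)) 0 b.
    apply: (@connS _ _ _ a) => //; last by split => //; right.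
    by apply: conn_sub ca => y [ny ry]; split => //; left.
  have : b.1 = n%:Z \/ b.2 = n%:Z.
    move: ab nrb ra; rewrite oriented_edgeP => /orP[] /eqP ->; case: (a) => a1 a2;
    rewrite /r1 /rect /=; clear; lia.
  have rb2 : b.1 <= n%:Z /\ b.2 <= n%:Z.
    move: ab ra; rewrite oriented_edgeP => /orP[] /eqP ->; case: (a) => a1 a2;
    rewrite /r1 /rect /=; clear; lia.
  have rb0 : 0 <= b.1 /\ 0 <= b.2.
    move: ab ra; rewrite oriented_edgeP => /orP[] /eqP ->; case: (a) => a1 a2;
    rewrite /r1 /rect /=; clear; lia.
  have rz y : r1 y \/ y = b -> [/\ 0 <= y.1, y.1 <= n%:Z, 0 <= y.2 & y.2 <= n%:Z].
    case=> [/rectP[]|->]; last by case: rb2; case: rb0; split.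
    by move: n0; clear; case: y => y1 y2 /= *; split; lia.
  (* A path leaving through column [n] would traverse the rectangle of the vertical crossing. One
     leaving through row [n] is itself a bottom-top path in the rectangle of the horizontal
     crossing, so the roles in [cross] are exchanged. *)
  case=> bn.
  + have [s [ps sP sl]] := conn_path (conn_adj_star (conn_self g5)).
    have sA y : y \in uV :: s -> GV y /\ rect 0 n%:Z 0 (2 * n)%:Z y.
      rewrite inE => /orP[/eqP->|/sP [[wy ry] cy] //]; split => //; exact: conn0.
    apply: (@cross 0 n%:Z 0 (2 * n)%:Z uV s ps _ g1 _
       (fun y => nG y /\ rect 0 n%:Z 0 (2 * n)%:Z y) 0 b) => //.
    * by move=> y /sA[].
    * by rewrite sl.
    * by move=> y [ny ry]; split => //; apply/negP => /sA[Gy _]; apply: ny; left.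
    * apply: conn_sub (conn_or _ _ _ cab) => y [ny /rz[k1 k2 k3 k4]]; split => //.
      by apply/rectP; split => //; move: k4; clear; case: (y) => y1 y2 /=; lia.
  + have [s [ps sP sl]] := conn_path (conn_adj_star (conn_or _ _ _ cab)).
    have sA y : y \in (0 : site) :: s -> nG y /\ rect 0 (2 * n)%:Z 0 n%:Z y.
      rewrite inE => /orP[/eqP->|/sP [ny /rz[k1 k2 k3 k4]] //].
        by split => //; apply/rectP; split => //=; clear; lia.
      split => //; apply/rectP; split => //; move: k2; clear; case: (y) => y1 y2 /=; lia.
    apply: (@cross 0 (2 * n)%:Z 0 n%:Z 0 s ps _ _ _
       (fun y => GH y /\ rect 0 (2 * n)%:Z 0 n%:Z y) uH vH) => //.
    * by move=> y /sA[].
    * by rewrite sl.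
    * by move=> y [Gy ry]; split => //; apply/negP => /sA[ny _]; apply: ny; right.
    * by split => //; exact: conn0.
    * by apply: conn_sub (conn_self h5) => y [[wy ry] cy].
Qed.

End Barrier.

(** * Propagating an empty site *)

Section Pebbling.
Context {R : realType}.
Variables (w : config) (b : site) (V0 : seq site).

Definition legal (A : seq site) (x : site) : Prop :=
  forall eta : config, eta b = false -> constraint w x (fill A false eta).

(* From an environment where [b] is empty, the sites of [A'] instead of [A] can be
   emptied by at most [m] legal flips, at most [N] sites being emptied meanwhile. *)
Definition reach (m N : nat) (A A' : seq site) : Prop :=
  exists l : seq (site * seq site), [/\ (size l <= m)%N,
    forall xB, xB \in l -> [/\ xB.1 \in V0, {subset xB.2 <= V0}, (size xB.2 <= N)%N & legal xB.2 xB.1] &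
    forall (G : config -> R) eta, eta b = false ->
      `|G (fill A false eta) - G (fill A' false eta)| <=
      \sum_(xB <- l) `|dif xB.1 G (fill xB.2 false eta)| ].

Lemma fill_mem A A' (eta : config) : A =i A' -> fill A false eta = fill A' false eta.
Proof. by move=> e; apply/funext => z; rewrite /fill e. Qed.

Lemma reach_eq m N A A' : (forall eta : config, eta b = false -> fill A false eta = fill A' false eta) ->
  reach m N A A'.
Proof.
move=> e; exists [::]; split => // G eta h; by rewrite e // subrr normr0 big_nil.
Qed.

Lemma reach_mem m N A A' : A =i A' -> reach m N A A'.
Proof. by move=> e; apply: reach_eq => eta _; exact: fill_mem. Qed.

Lemma reach_sym m N A A' : reach m N A A' -> reach m N A' A.
Proof. by move=> [l [h1 h2 h3]]; exists l; split => // G eta h; rewrite distrC; exact: h3. Qed.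

Lemma reach_trans m1 m2 N A B C : reach m1 N A B -> reach m2 N B C -> reach (m1 + m2) N A C.
Proof.
move=> [l [h1 h2 h3]] [l' [g1 g2 g3]]; exists (l ++ l'); split.
- by rewrite size_cat leq_add.
- by move=> x; rewrite mem_cat => /orP[/h2|/g2].
- move=> G eta h; rewrite big_cat /=; apply: le_trans (lerD (h3 G eta h) (g3 G eta h)).
  exact: ler_distD.
Qed.

Lemma reach_leq m N m' N' A A' : (m <= m')%N -> (N <= N')%N -> reach m N A A' -> reach m' N' A A'.
Proof.
move=> mm NN [l [h1 h2 h3]]; exists l; split => //; first exact: leq_trans mm.
by move=> x /h2[g1 g2 g3 g4]; split => //; exact: leq_trans NN.
Qed.

Lemma fill_push A x (eta : config) : fill (x :: A) false eta = update (fill A false eta) x false.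
Proof.
by apply/funext => y; rewrite /fill /update inE; case: (y == x).
Qed.

Lemma reach_push A x : x \in V0 -> {subset A <= V0} -> legal A x ->
  reach 1 (size A) A (x :: A).
Proof.
move=> xV AV l; exists [:: (x, A)]; split => //.
  by move=> y; rewrite inE => /eqP->.
move=> G eta h; rewrite big_seq1 /= fill_push; set z := fill A false eta.
rewrite -{1}(update_id z x); case: (z x); first by [].
by rewrite subrr normr0.
Qed.

Lemma legal_easy A x y : w x -> adjacent x y -> y \in b :: A -> legal A x.
Proof.
move=> wx xy yA eta h; rewrite /constraint wx.
have ye : fill A false eta y = false.
  by rewrite /fill; move: yA; rewrite inE => /orP[/eqP->|->//]; case: ifP.
have yn : y \in neighbors x by move: xy; rewrite /adjacent.
rewrite (big_rem y) //= ye; lia.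
Qed.

Lemma legal_up A x : x + e1 \in A -> x + e2 \in A -> legal A x.
Proof.
move=> h1 h2 eta h; rewrite /constraint; case: ifP => wx; last by rewrite /fill h1 h2.
rewrite (big_rem (x + e1)) /=; last by rewrite /neighbors inE eqxx.
by rewrite /fill h1; lia.
Qed.

(** A vacancy walks along easy sites: the next site is emptied thanks to the current one, which is
    then refilled by the reverse of a legal move. This makes two flips per step; the start is free
    because [b] is empty. *)
Lemma reach_token A s : path adjacent b s -> (forall z, z \in b :: s -> w z /\ z \in V0) ->
  {subset A <= V0} -> reach (2 * size s) (size A).+2 A (last b s :: A).
Proof.
move=> + + AV; elim/last_ind: s => [|s z IH] /=.
  move=> _ _; apply: reach_eq => eta h; apply/funext => y; rewrite /fill inE.
  by case: (eqVneq y b) => [->|//]; case: ifP.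
rewrite rcons_path last_rcons size_rcons => /andP[ps yz] H.
have Hs u : u \in b :: s -> w u /\ u \in V0.
  by move=> us; apply: H; move: us; rewrite !inE mem_rcons inE => /orP[->//|->]; rewrite !orbT.
have [wz zV] : w z /\ z \in V0 by apply: H; rewrite inE mem_rcons inE eqxx orbT.
have [wy yV] : w (last b s) /\ last b s \in V0 by apply: Hs; exact: mem_last.
set y := last b s in yz wy yV IH *.
rewrite mulnS addnC; apply: (reach_trans (IH ps Hs)).
have r1 : reach 1 (size A).+2 (y :: A) (z :: y :: A).
  apply: (@reach_leq 1 (size (y :: A))) => //; apply: reach_push => //.
    by move=> u; rewrite inE => /orP[/eqP->|/AV].
  by apply: (@legal_easy _ _ y) => //; [rewrite adjacent_sym|rewrite !inE eqxx orbT].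
have r2 : reach 1 (size A).+2 (z :: A) (y :: z :: A).
  apply: (@reach_leq 1 (size (z :: A))) => //; apply: reach_push => //.
    by move=> u; rewrite inE => /orP[/eqP->|/AV].
  by apply: (@legal_easy _ _ z) => //; rewrite !inE eqxx orbT.
apply: (@reach_trans 1 1 _ _ (z :: y :: A)) => //.
apply: reach_sym; rewrite (_ : 1 = 1 + 0)%N //; apply: (reach_trans r2).
by apply: reach_mem => u; rewrite !inE orbCA.
Qed.

Variable (Gam : site -> Prop) (n : nat).
Hypothesis Gam_conn : forall z, Gam z -> exists s,
  [/\ path adjacent b s, forall u, u \in b :: s -> w u /\ u \in V0, last b s = z & (size s <= size V0)%N].
Hypothesis reached_in : forall z, ~ Gam 0 -> conn oriented_edge (fun y => ~ Gam y) 0 z ->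
  rect 0 (n%:Z - 1) 0 (n%:Z - 1) z /\ z \in V0.

(** Off [Gam], empty [z + e1] and [z + e2], flip [z], then undo both helpers by reversing their
    sequences. Four recursive calls and one flip explain the base 5, and the two sites held during a
    call explain the growth by 2. The height [h] drops because [z] moves up the oriented order,
    until [Gam] is met. *)
Lemma reach_place h z A :
  (Gam z \/ [/\ ~ Gam 0, conn oriented_edge (fun y => ~ Gam y) 0 z & (2 * n)%:Z - z.1 - z.2 <= h%:Z]) ->
  {subset A <= V0} -> z \in V0 /\
  reach (5 ^ h * (2 * size V0).+1) (size A + 2 * h + 2) A (z :: A).
Proof.
elim: h z A => [|h IH] z A.
  case=> [/Gam_conn [s [ps sP <- sV]] AV|[n0 cz hz]]; last first.
    by have [/rectP[h1 h2 h3 h4] _] := reached_in n0 cz; exfalso; lia.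
  split; first by case: (sP _ (mem_last _ _)).
  rewrite expn0 mul1n addn0; apply: reach_leq (reach_token ps sP AV); last by rewrite addn2.
  by rewrite leqW // leq_mul2l sV.
have [Gz _ AV|nG] := pselect (Gam z).
  have [zV r] := IH z A (or_introl Gz) AV; split => //.
  apply: reach_leq r; first by rewrite leq_mul2r leq_exp2l // leqnSn orbT.
  lia.
case=> [//|[n0 cz hz]] AV.
have [rz zV] := reached_in n0 cz; split => //.
have nxt y : oriented_edge z y -> Gam y \/
    [/\ ~ Gam 0, conn oriented_edge (fun y => ~ Gam y) 0 y & (2 * n)%:Z - y.1 - y.2 <= h%:Z].
  move=> zy; have [Gy|nGy] := pselect (Gam y); first by left.
  right; split => //; first exact: (connS cz).
  by move: hz; move: zy; rewrite oriented_edgeP => /orP[] /eqP -> ; case: (z) => z1 z2 /=; clear; lia.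
set c := (5 ^ h * (2 * size V0).+1)%N in IH.
have H1 := nxt (z + e1) (oriented_right z).
have oz2 : oriented_edge z (z + e2) by rewrite oriented_edgeP eqxx orbT.
have H2 := nxt (z + e2) oz2.
have sub x B : x \in V0 -> {subset B <= V0} -> {subset x :: B <= V0}.
  by move=> xV BV u; rewrite inE => /orP[/eqP->|/BV].
set N := (size A + 2 * h.+1 + 2)%N.
have [z1V r1] := IH (z + e1) A H1 AV.
have [z2V r2] := IH (z + e2) (z + e1 :: A) H2 (sub _ _ z1V AV).
have [_ r2'] := IH (z + e2) (z :: z + e1 :: A) H2 (sub _ _ zV (sub _ _ z1V AV)).
have [_ r1'] := IH (z + e1) (z :: A) H1 (sub _ _ zV AV).
have p : reach 1 N (z + e2 :: z + e1 :: A) (z :: z + e2 :: z + e1 :: A).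
  apply: (@reach_leq 1 (size (z + e2 :: z + e1 :: A))) => //; first by rewrite /N /=; lia.
  apply: reach_push => //; first by apply: (sub _ _ z2V); exact: (sub _ _ z1V).
  by apply: legal_up; rewrite !inE eqxx ?orbT.
have c0 : (0 < c)%N by rewrite /c muln_gt0 expn_gt0.
have cc : (c + (c + (1 + (c + c))) <= 5 ^ h.+1 * (2 * size V0).+1)%N.
  by rewrite expnS -mulnA -/c; move: c0; clear; lia.
apply: (reach_leq cc (leqnn N)).
apply: (reach_trans (B := z + e1 :: A)); first by apply: reach_leq r1 => //; rewrite /N; lia.
apply: (reach_trans (B := z + e2 :: z + e1 :: A)).
  by apply: reach_leq r2 => //; rewrite /N /=; lia.
apply: (reach_trans p); apply: (reach_trans (B := z :: z + e1 :: A)).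
  apply: reach_sym; rewrite -[c]addn0.
  apply: (reach_trans (B := z + e2 :: z :: z + e1 :: A)).
    by apply: reach_leq r2' => //; rewrite /N /=; lia.
  by apply: reach_mem => u; rewrite !inE orbCA.
apply: reach_sym; rewrite -[c]addn0.
apply: (reach_trans (B := z + e1 :: z :: A)).
  by apply: reach_leq r1' => //; rewrite /N /=; lia.
by apply: reach_mem => u; rewrite !inE orbCA.
Qed.

Lemma reach_origin : (0 < n)%N ->
  reach (5 ^ (2 * n) * (2 * size V0).+1) (4 * n + 2) [::] [:: 0].
Proof.
move=> n0; have H : Gam 0 \/ [/\ ~ Gam 0, conn oriented_edge (fun y => ~ Gam y) 0 0 &
    (2 * n)%:Z - (0 : site).1 - (0 : site).2 <= (2 * n)%:Z].
  have [?|nG] := pselect (Gam 0); [by left|right]; split => //; first exact: conn0.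
  by rewrite /= !subr0.
have nV : {subset [::] <= V0} by [].
have [_ r] := reach_place H nV; apply: reach_leq r => //=; lia.
Qed.

End Pebbling.

(** * Energy cost of a sequence of legal moves *)

Section PebblingEnergy.
Context {R : realType}.
Variables (w : config) (q : R) (V : seq site).
Hypothesis q01 : 0 < q < 1.
Let p01 : 0 <= 1 - q <= 1.
Proof. by case/andP: q01 => h1 h2; rewrite subr_ge0 gerBl !ltW. Qed.

Definition E (f : config -> R) : R := mean (1 - q) V f (fun=> false).

Definition energy (U : seq site) (G : config -> R) : R :=
  \sum_(x <- U) E (fun eta => (constraint w x eta)%:R * dif x G eta ^+ 2).

Lemma E_le f g : (forall z, f z <= g z) -> E f <= E g.
Proof. exact: (mean_le p01). Qed.

Lemma E_ge0 f : (forall z, 0 <= f z) -> 0 <= E f.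
Proof. exact: (mean_ge0 p01). Qed.

(** The sites of [B] are all empty with probability [q ^+ size B], independently of the rest; this
    is the price of evaluating at a configuration emptied on [B]. *)
Lemma E_fill (B : seq site) (H : config -> R) : {subset B <= V} -> (forall z, 0 <= H z) ->
  q ^+ size B * E (fun eta => H (fill B false eta)) <= E H.
Proof.
have [q0 q1] := andP q01.
elim: B H => [|x B IH] H BV H0.
  rewrite expr0 mul1r; apply: E_le => z; by rewrite (_ : fill _ _ _ = z) //; apply/funext => y.
have BV' : {subset B <= V} by move=> u uB; apply: BV; rewrite inE uB orbT.
apply: le_trans (IH H BV' H0); rewrite exprSr -mulrA ler_wpM2l ?exprn_ge0 ?(ltW q0) //.
have xV : {subset [:: x] <= V} by move=> u; rewrite inE => /eqP->; apply: BV; rewrite inE eqxx.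
rewrite [leRHS]/E -(mean_mean _ _ xV).
have -> : q * E (fun eta => H (fill (x :: B) false eta)) =
   E (fun eta => q * H (fill (x :: B) false eta)) by rewrite /E meanZl.
apply: E_le => z.
rewrite /= /mean1 opprB addrCA subrr addr0 fill_cons lerDr mulr_ge0 ?H0 // subr_ge0 ltW //.
Qed.

Lemma energy_ge0 U G : 0 <= energy U G.
Proof.
by apply: sumr_ge0 => x _; apply: E_ge0 => z; rewrite mulr_ge0 ?sqr_ge0 // ler0n.
Qed.

Lemma sqr_sum_le (I : Type) (r : seq I) (F : I -> R) :
  (\sum_(i <- r) F i) ^+ 2 <= (size r)%:R * \sum_(i <- r) F i ^+ 2.
Proof.
elim: r => [|i r IH]; first by rewrite !big_nil expr0n /= mul0r.
rewrite !big_cons /=; set S := \sum_(j <- r) F j in IH *; set T := \sum_(j <- r) F j ^+ 2 in IH *.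
rewrite -natr1; set k := (size r)%:R in IH *.
have k0 : 0 <= k by exact: ler0n.
have T0 : 0 <= T by apply: sumr_ge0 => j _; exact: sqr_ge0.
have [kz|kp] := eqVneq k 0.
  have S0 : S = 0 by apply/eqP; rewrite -sqrf_eq0 eq_le sqr_ge0 andbT; move: IH; rewrite kz mul0r.
  by rewrite S0 addr0 kz add0r mul1r lerDl.
have {}kp : 0 < k by rewrite lt_neqAle eq_sym kp.
have : 0 <= (k * F i - S) ^+ 2 by exact: sqr_ge0.
have -> : (k * F i - S) ^+ 2 = k ^+ 2 * F i ^+ 2 - 2 * k * (F i * S) + S ^+ 2 by ring.
move=> h; have h1 : k * (2 * (F i * S)) <= k * (k * F i ^+ 2 + T).
  have -> : k * (2 * (F i * S)) = 2 * k * (F i * S) by ring.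
  have -> : k * (k * F i ^+ 2 + T) = k ^+ 2 * F i ^+ 2 + k * T by ring.
  lra.
rewrite ler_pM2l // in h1.
have -> : (F i + S) ^+ 2 = F i ^+ 2 + 2 * (F i * S) + S ^+ 2 by ring.
have -> : (k + 1) * (F i ^+ 2 + T) = k * F i ^+ 2 + k * T + F i ^+ 2 + T by ring.
lra.
Qed.

(** Telescope [G] along the flips and use Cauchy-Schwarz over at most [m] of them. Legality inserts
    the constraint for free, and [E_fill] undoes the forced vacancies. *)
Lemma reach_energy b V0 m N U (G : config -> R) :
  reach (R := R) w b V0 m N [::] [:: 0] -> {subset V0 <= V} -> {subset V0 <= U} -> uniq U ->
  (0 : site) \in V ->
  q ^+ N.+1 * E (fun eta => (~~ eta b)%:R * G eta ^+ 2) <=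
  2 * m%:R ^+ 2 * energy U G + 2 * E (fun eta => (~~ eta 0)%:R * G eta ^+ 2).
Proof.
have [q0 q1] := andP q01.
move=> [l [h1 h2 h3]] V0V V0U uU OV.
pose cd x : config -> R := fun eta => (constraint w x eta)%:R * dif x G eta ^+ 2.
have cd0 x z : 0 <= cd x z by rewrite mulr_ge0 ?sqr_ge0 // ler0n.
pose G0 : config -> R := fun eta => (~~ eta 0)%:R * G eta ^+ 2.
have G00 z : 0 <= G0 z by rewrite mulr_ge0 ?sqr_ge0 // ler0n.
have pt eta : (~~ eta b)%:R * G eta ^+ 2 <=
   2 * (m%:R * \sum_(xB <- l) cd xB.1 (fill xB.2 false eta)) + 2 * G0 (fill [:: 0] false eta).
  have R0 : 0 <= 2 * (m%:R * \sum_(xB <- l) cd xB.1 (fill xB.2 false eta)) + 2 * G0 (fill [:: 0] false eta).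
    have S0 : 0 <= \sum_(xB <- l) cd xB.1 (fill xB.2 false eta) by apply: sumr_ge0.
    by apply: addr_ge0; apply: mulr_ge0 => //; exact: mulr_ge0.
  case eb : (eta b); first by rewrite mul0r.
  rewrite mul1r.
  have hG := h3 G eta eb.
  have f0 : fill [::] false eta = eta by apply/funext.
  rewrite f0 in hG; set G1 := G (fill [:: 0] false eta) in hG *.
  have G0E : G0 (fill [:: 0] false eta) = G1 ^+ 2.
    by rewrite /G0 /fill inE eqxx mul1r.
  have hs : (G eta - G1) ^+ 2 <= m%:R * \sum_(xB <- l) cd xB.1 (fill xB.2 false eta).
    rewrite -real_normK ?num_real //.
    apply: (@le_trans _ _ ((\sum_(xB <- l) `|dif xB.1 G (fill xB.2 false eta)|) ^+ 2)).
      by apply: lerXn2r => //; rewrite nnegrE //; apply: sumr_ge0.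
    apply: (le_trans (sqr_sum_le _ _)); apply: ler_pM => //; first by apply: sumr_ge0 => *; exact: sqr_ge0.
      by rewrite ler_nat.
    rewrite big_seq [leRHS]big_seq; apply: ler_sum => xB xBl.
    have [g1 g2 g3 g4] := h2 _ xBl; rewrite /cd (g4 eta eb) mul1r.
    by rewrite real_normK ?num_real.
  rewrite G0E; move: hs; set S := m%:R * _ => hs.
  have : 0 <= (G eta - 2 * G1) ^+ 2 by exact: sqr_ge0.
  nra.
have q1' : q <= 1 by exact: ltW.
have qN : 0 <= q ^+ N.+1 by rewrite exprn_ge0 // ltW.
apply: (@le_trans _ _ (q ^+ N.+1 * E (fun eta =>
   2 * (m%:R * \sum_(xB <- l) cd xB.1 (fill xB.2 false eta)) + 2 * G0 (fill [:: 0] false eta)))).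
  by rewrite ler_wpM2l //; exact: E_le.
have EE : E (fun eta =>
   2 * (m%:R * \sum_(xB <- l) cd xB.1 (fill xB.2 false eta)) + 2 * G0 (fill [:: 0] false eta)) =
  2 * (m%:R * \sum_(xB <- l) E (fun eta => cd xB.1 (fill xB.2 false eta))) +
  2 * E (fun eta => G0 (fill [:: 0] false eta)).
  rewrite /E meanD !meanZl (mean_sum l xpredT (fun xB eta => cd xB.1 (fill xB.2 false eta))).
  by [].
rewrite EE mulrDr; apply: lerD.
  have -> : 2 * m%:R ^+ 2 * energy U G = 2 * (m%:R * (m%:R * energy U G)) :> R by ring.
  rewrite mulrCA ler_wpM2l // mulrCA ler_wpM2l // mulr_sumr.
  apply: (@le_trans _ _ (\sum_(xB <- l) energy U G)); last first.
    rewrite big_const_seq count_predT iter_addr_0 -(mulr_natl (energy U G)).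
    by rewrite ler_wpM2r ?energy_ge0 // ler_nat.
  rewrite big_seq [leRHS]big_seq; apply: ler_sum => xB xBl.
  have [g1 g2 g3 g4] := h2 _ xBl.
  apply: (@le_trans _ _ (E (cd xB.1))).
    have BV : {subset xB.2 <= V} by move=> u /g2/V0V.
    apply: le_trans (E_fill BV (cd0 _)).
    rewrite ler_wpM2r //; first by apply: E_ge0.
    by apply: ler_wiXn2l; rewrite ?(ltW q0) // leqW.
  rewrite /energy (big_rem xB.1) /=; last exact: V0U.
  rewrite lerDl; apply: sumr_ge0 => x _; apply: E_ge0 => z; exact: cd0.
rewrite mulrCA ler_wpM2l //.
have OV' : {subset [:: 0] <= V} by move=> u; rewrite inE => /eqP->.
apply: le_trans (E_fill OV' G00); rewrite ler_wpM2r //; first by apply: E_ge0.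
by rewrite /= expr1 -[leRHS]expr1; apply: ler_wiXn2l; rewrite ?(ltW q0).
Qed.

End PebblingEnergy.

(** * Poincaré inequality along a path of easy sites *)

Section BlockPoincare.
Context {R : realType}.
Variables (w : config) (q : R) (V : seq site).
Hypothesis q01 : 0 < q < 1.
Let p01 : 0 <= 1 - q <= 1.
Proof. by case/andP: q01 => h1 h2; rewrite subr_ge0 gerBl !ltW. Qed.
Local Notation EV := (E q V).
Local Notation m := (mean (1 - q)).
Implicit Types (s t : seq site) (f g h G : config -> R) (x u z : site).

Lemma E_mean s f : {subset s <= V} -> EV (m s f) = EV f.
Proof. by move=> sV; rewrite /E mean_mean. Qed.

Lemma E_add f g : EV (fun e => f e + g e) = EV f + EV g.
Proof. by rewrite /E meanD. Qed.

Lemma E_scale (c : R) f : EV (fun e => c * f e) = c * EV f.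
Proof. by rewrite /E meanZl. Qed.

(** Pythagoras for the projection [m s], with a weight that does not see [s] and therefore commutes
    with it. *)
Lemma E_orth s h G : {subset s <= V} -> (forall x, x \in s -> indep x h) ->
  EV (fun e => h e * (G e - m s G e) ^+ 2) =
  EV (fun e => h e * G e ^+ 2) - EV (fun e => h e * m s G e ^+ 2).
Proof.
move=> sV hs; have ms x : x \in s -> indep x (fun e => h e * m s G e).
  by move=> xs e b; rewrite hs // (indep_mean_in _ _ xs).
have H : EV (fun e => h e * m s G e * G e) = EV (fun e => h e * m s G e ^+ 2).
  rewrite -(E_mean _ sV) mean_mull //; congr EV; apply/funext => e; ring.
have -> : (fun e => h e * (G e - m s G e) ^+ 2) = (fun e => h e * G e ^+ 2 +
    ((-2) * (h e * m s G e * G e) + h e * m s G e ^+ 2)) by apply/funext => e; ring.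
rewrite {1}/E !meanD !meanZl -/(EV _) -![mean _ V _ _]/(EV _) H; ring.
Qed.

Lemma E_orth_le s h G : {subset s <= V} -> (forall x, x \in s -> indep x h) ->
  (forall e, 0 <= h e) ->
  EV (fun e => h e * (G e - m s G e) ^+ 2) <= EV (fun e => h e * G e ^+ 2).
Proof.
move=> sV hs h0; rewrite E_orth // gerBl; apply: E_ge0 => // e.
by rewrite mulr_ge0 ?sqr_ge0.
Qed.

Lemma E_mean_le s h G : {subset s <= V} -> (forall x, x \in s -> indep x h) ->
  (forall e, 0 <= h e) ->
  EV (fun e => h e * m s G e ^+ 2) <= EV (fun e => h e * G e ^+ 2).
Proof.
move=> sV hs h0; rewrite -subr_ge0 -E_orth //; apply: E_ge0 => // e.
by rewrite mulr_ge0 ?sqr_ge0.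
Qed.

Definition empty u : config -> R := fun e => (~~ e u)%:R.

Lemma empty_ge0 u e : 0 <= empty u e. Proof. exact: ler0n. Qed.
Lemma empty_le1 u e : empty u e <= 1. Proof. by rewrite /empty lern1 leq_b1. Qed.
Lemma indep_empty u x : x != u -> indep x (empty u).
Proof. by move=> xu e b; rewrite /empty update_ne // eq_sym. Qed.

Lemma E_empty u f : u \in V -> indep u f -> EV (fun e => empty u e * f e) = q * EV f.
Proof.
move=> uV uf; have sV : {subset [:: u] <= V} by move=> x; rewrite inE => /eqP->.
rewrite -(E_mean _ sV) -E_scale; congr EV; apply/funext => e /=.
by rewrite /mean1 /empty !update_at /= mul0r mulr0 add0r mul1r uf; congr (_ * _); ring.
Qed.

Fixpoint chain_const (k : nat) : R := if k is k'.+1 then 3 / q * (1 + chain_const k') else 0.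

Lemma chain_const_ge0 k : 0 <= chain_const k.
Proof.
have [q0 _] := andP q01.
by elim: k => //= k IH; rewrite mulr_ge0 ?divr_ge0 ?(ltW q0) ?addr_ge0.
Qed.

Lemma chain_const_mono k l : (k <= l)%N -> chain_const k <= chain_const l.
Proof.
have [q0 q1] := andP q01.
elim: l k => [|l IH] [|k] //= kl; first by rewrite mulr_ge0 ?divr_ge0 ?(ltW q0) ?addr_ge0 ?chain_const_ge0.
by rewrite ler_wpM2l ?divr_ge0 ?(ltW q0) // lerD2l IH.
Qed.

Definition ener x G : R := EV (fun e => (constraint w x e)%:R * dif x G e ^+ 2).

Lemma ener_ge0 x G : 0 <= ener x G.
Proof. by apply: E_ge0 => // e; rewrite mulr_ge0 ?ler0n ?sqr_ge0. Qed.

Lemma empty_ener u z G : z \in V -> u != z -> w z -> adjacent u z ->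
  EV (fun e => empty u e * (G e - m [:: z] G e) ^+ 2) <= ener z G.
Proof.
have [q0 q1] := andP q01.
move=> zV uz wz auz; have sV : {subset [:: z] <= V} by move=> x; rewrite inE => /eqP->.
have zu : z != u by rewrite eq_sym.
rewrite -(E_mean _ sV) mean_mull; last first.
  by move=> x; rewrite inE => /eqP->; apply: indep_empty.
apply: E_le => // e.
have -> : m [:: z] (fun e => (G e - m [:: z] G e) ^+ 2) e = q * (1 - q) * dif z G e ^+ 2.
  by rewrite /= /mean1 /dif !updateK; ring.
rewrite /empty; case eu : (e u); first by rewrite mul0r mulr_ge0 ?ler0n ?sqr_ge0.
have -> : constraint w z e.
  rewrite /constraint wz (big_rem u) /=; last by move: auz; rewrite adjacent_sym.
  by rewrite eu.
by rewrite !mul1r ler_piMl ?sqr_ge0 //; nra.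
Qed.

(** An empty [u] makes [z] legal and thus controls the variance in [z]. For the remaining sites the
    role of [u] is handed over to [z], which must be empty itself: hence a factor of order [1 / q]
    per site in [chain_const]. *)
Lemma chain_poincare s u G : path adjacent u s -> uniq (u :: s) ->
  (forall x, x \in s -> w x) -> {subset s <= V} ->
  EV (fun e => empty u e * (G e - m s G e) ^+ 2) <= chain_const (size s) * \sum_(x <- s) ener x G.
Proof.
have [q0 q1] := andP q01.
elim: s u => [|z s IH] u /=.
  move=> *; rewrite mul0r; rewrite (_ : (fun e => _) = fun=> 0) /E ?mean_const //.
  by apply/funext => e; rewrite subrr expr0n mulr0.
case/andP => uz ps /and3P[]; rewrite inE negb_or => /andP[unz us] zs Us ws sV.
have zV : z \in V by apply: sV; rewrite inE eqxx.
have sV' : {subset s <= V} by move=> x xs; apply: sV; rewrite inE xs orbT.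
have z1V : {subset [:: z] <= V} by move=> x; rewrite inE => /eqP->.
have uZs : uniq (z :: s) by rewrite /= zs Us.
have ws' x : x \in s -> w x by move=> xs; apply: ws; rewrite inE xs orbT.
have wz : w z by apply: ws; rewrite inE eqxx.
have IH' := IH z ps uZs ws' sV'.
set D' := \sum_(x <- s) ener x G in IH' *; rewrite big_cons -/D'.
have Dz := empty_ener G zV unz wz uz.
set Ck := chain_const (size s) in IH' *.
have hz x : x \in [:: z] -> indep x (empty u).
  by rewrite inE => /eqP->; apply: indep_empty; rewrite eq_sym.
have hs x : x \in s -> indep x (empty u).
  by move=> xs; apply: indep_empty; apply: contraNneq us => <-.
pose F' := fun e => G e - m s G e.
have mF : m [:: z] F' = fun e => m [:: z] G e - m s (m [:: z] G) e.
  by rewrite /F' meanB mean_meanC.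
have split : EV (fun e => empty u e * (G e - m (z :: s) G e) ^+ 2) =
    EV (fun e => empty u e * (G e - m [:: z] G e) ^+ 2) + EV (fun e => empty u e * m [:: z] F' e ^+ 2).
  have hzs x : x \in z :: s -> indep x (empty u).
    by rewrite inE => /orP[h|/hs//]; apply: hz; rewrite inE.
  rewrite (E_orth _ sV hzs) (E_orth _ z1V hz) mF.
  rewrite (E_orth _ sV' hs).
  have -> : m (z :: s) G = m s (m [:: z] G) by rewrite -mean_meanC.
  ring.
have ge0 f u' : 0 <= EV (fun e => empty u' e * f e ^+ 2).
  by apply: E_ge0 => // e; rewrite mulr_ge0 ?sqr_ge0 ?empty_ge0.
have izmF : indep z (fun e => empty u e * m [:: z] F' e ^+ 2).
  by move=> e b; rewrite hz ?mem_head // (indep_mean_in _ _ (mem_head z [::])).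
(* The averaged term no longer sees [z], so requiring [z] to be empty costs exactly the factor [q],
   after which the induction hypothesis started from [z] applies. *)
have qE : q * EV (fun e => empty u e * m [:: z] F' e ^+ 2) <=
   2 * EV (fun e => empty z e * F' e ^+ 2) + 2 * EV (fun e => empty u e * (F' e - m [:: z] F' e) ^+ 2).
  rewrite -(E_empty zV izmF).
  have -> : 2 * EV (fun e => empty z e * F' e ^+ 2) + 2 * EV (fun e => empty u e * (F' e - m [:: z] F' e) ^+ 2)
    = EV (fun e => 2 * (empty z e * F' e ^+ 2) + 2 * (empty u e * (F' e - m [:: z] F' e) ^+ 2)).
    by rewrite E_add !E_scale.
  apply: E_le => // e.
  have := empty_ge0 u e; have := empty_ge0 z e; have := empty_le1 u e; have := empty_le1 z e.
  set a := empty z e; set b := empty u e; set x := F' e; set y := m [:: z] F' e.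
  move=> a1 b1 a0 b0.
  have h1 : y ^+ 2 <= 2 * x ^+ 2 + 2 * (x - y) ^+ 2 by have : 0 <= (2 * x - y) ^+ 2 := sqr_ge0 _; nra.
  have x0 : 0 <= x ^+ 2 := sqr_ge0 _; have xy0 : 0 <= (x - y) ^+ 2 := sqr_ge0 _.
  apply: (@le_trans _ _ (a * b * (2 * x ^+ 2 + 2 * (x - y) ^+ 2))).
    by rewrite mulrA ler_wpM2l // mulr_ge0.
  rewrite mulrDr lerD //.
    by rewrite mulrCA ler_wpM2l // ler_wpM2r // ler_piMr.
  by rewrite mulrCA ler_wpM2l // ler_wpM2r // ler_piMl.
have last : EV (fun e => empty u e * (F' e - m [:: z] F' e) ^+ 2) <= ener z G.
  apply: le_trans Dz.
  have -> : (fun e => empty u e * (F' e - m [:: z] F' e) ^+ 2) =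
    (fun e => empty u e * ((fun e => G e - m [:: z] G e) e - m s (fun e => G e - m [:: z] G e) e) ^+ 2).
    apply/funext => e; rewrite mF meanB /F'; congr (_ * _ ^+ 2); ring.
  by apply: (@E_orth_le s) => // e; exact: empty_ge0.
rewrite split; set X := EV (fun e => empty u e * m [:: z] F' e ^+ 2) in qE *.
have X1 : X <= 2 / q * (Ck * D' + ener z G).
  rewrite -(ler_pM2l q0); apply: (le_trans qE).
  have -> : q * (2 / q * (Ck * D' + ener z G)) = 2 * (Ck * D') + 2 * ener z G by field; rewrite gt_eqF.
  by rewrite lerD // ler_wpM2l.
apply: (le_trans (lerD Dz X1)).
have D0 : 0 <= D' by apply: sumr_ge0 => x _; exact: ener_ge0.
have C0 : 0 <= Ck by exact: chain_const_ge0.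
have e0 := ener_ge0 z G.
have qi : 1 <= q^-1 by rewrite invf_ge1 // ltW.
have qCD : 0 <= q^-1 * (Ck * D') by rewrite !mulr_ge0 // invr_ge0 ltW.
have qCe : 0 <= q^-1 * (Ck * ener z G) by rewrite !mulr_ge0 // invr_ge0 ltW.
have qD : 0 <= q^-1 * D' by rewrite !mulr_ge0 // invr_ge0 ltW.
have qe : ener z G <= q^-1 * ener z G by rewrite ler_peMl.
have -> : 3 / q * (1 + Ck) * (ener z G + D') = 3 * (q^-1 * ener z G + q^-1 * D' + q^-1 * (Ck * ener z G) + q^-1 * (Ck * D')) by ring.
have -> : 2 / q * (Ck * D' + ener z G) = 2 * (q^-1 * (Ck * D')) + 2 * (q^-1 * ener z G) by ring.
by lra.
Qed.

Definition helped t : config -> R := fun e => (has (fun x => ~~ e x) t)%:R.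

Lemma helped_ge0 t e : 0 <= helped t e. Proof. exact: ler0n. Qed.

Lemma helped_indep t x : x \notin t -> indep x (helped t).
Proof.
move=> xt e b; rewrite /helped; congr (_%:R); congr nat_of_bool; apply: eq_in_has => y yt.
by rewrite update_ne //; apply: contraNneq xt => <-.
Qed.

Lemma helped_fail t e : uniq t -> m t (fun e => 1 - helped t e) e = (1 - q) ^+ size t.
Proof.
elim: t e => [|x t IH] e /=; first by rewrite /helped /= subr0.
case/andP => xt /IH {}IH; rewrite exprS.
have -> : (fun e => 1 - helped (x :: t) e) = (fun e => (e x)%:R * (1 - helped t e)).
  apply/funext => e'; rewrite /helped /=; case: (e' x) => /=; first by rewrite mul1r.
  by rewrite mul0r subrr.
rewrite mean_mull; last first.
  by move=> y yt e' b; rewrite update_ne //; apply: contraNneq xt => ->.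
by rewrite /mean1 !update_at /= !IH mul1r mul0r mulr0 addr0.
Qed.

(** From an empty site [u] of [t], run [chain_poincare] backwards through the part of [t] before [u]
    and then through [s]. The variance over [s] alone is no larger than over this longer stretch,
    and summing over [u] gives the factor [size t]. *)
Lemma helped_poincare s t G : sorted adjacent (s ++ t) -> uniq (s ++ t) ->
  (forall x, x \in s ++ t -> w x) -> {subset s ++ t <= V} ->
  EV (fun e => helped t e * (G e - m s G e) ^+ 2) <=
  (size t)%:R * (chain_const (size s + size t) * \sum_(x <- s ++ t) ener x G).
Proof.
move=> st ust wst stV.
have sV : {subset s <= V} by move=> x xs; apply: stV; rewrite mem_cat xs.
have h1 u : u \in t -> EV (fun e => empty u e * (G e - m s G e) ^+ 2) <=
    chain_const (size s + size t) * \sum_(x <- s ++ t) ener x G.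
  move=> ut; have tE : t = take (index u t) t ++ u :: drop (index u t).+1 t.
    by rewrite -[in LHS](cat_take_drop (index u t) t) (drop_nth u) ?index_mem // nth_index.
  set t1 := take _ t in tE; set t2 := drop _ t in tE.
  have stE : s ++ t = rcons (s ++ t1) u ++ t2 by rewrite tE cat_rcons -catA.
  have /cat_sorted2[pr _] : sorted adjacent (rcons (s ++ t1) u ++ t2) by rewrite -stE.
  have ur : uniq (rcons (s ++ t1) u) by move: ust; rewrite stE cat_uniq => /and3P[].
  have sub x : x \in s ++ t1 -> x \in s ++ t by move=> xs; rewrite stE mem_cat mem_rcons inE xs orbT.
  have pu : path adjacent u (rev (s ++ t1)).
    have : sorted adjacent (rev (rcons (s ++ t1) u)).
      rewrite rev_sorted; apply: sub_sorted pr => x y xy /=; by rewrite adjacent_sym.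
    by rewrite rev_rcons.
  have uu : uniq (u :: rev (s ++ t1)) by rewrite -rev_rcons rev_uniq.
  have := @chain_poincare (rev (s ++ t1)) u G pu uu.
  have wr x : x \in rev (s ++ t1) -> w x by rewrite mem_rev => /sub/wst.
  have Vr : {subset rev (s ++ t1) <= V} by move=> x; rewrite mem_rev => /sub/stV.
  move=> /(_ wr Vr); rewrite size_rev => H.
  have mr : m (rev (s ++ t1)) G = m (s ++ t1) G by apply: mean_perm; rewrite perm_rev.
  rewrite mr in H.
  have sums : \sum_(x <- rev (s ++ t1)) ener x G <= \sum_(x <- s ++ t) ener x G.
    rewrite stE big_cat big_rcons /= (perm_big (s ++ t1)) /=; last by rewrite perm_rev.
    rewrite addrAC -addrA lerDl addr_ge0 ?ener_ge0 //; apply: sumr_ge0 => x _; exact: ener_ge0.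
  apply: (@le_trans _ _ (chain_const (size (s ++ t1)) * \sum_(x <- rev (s ++ t1)) ener x G)); last first.
    apply: ler_pM => //; first exact: chain_const_ge0.
      by apply: sumr_ge0 => x _; exact: ener_ge0.
    by apply: chain_const_mono; rewrite size_cat leq_add2l tE size_cat leq_addr.
  apply: le_trans H.
  have iu x : x \in s ++ t1 -> indep x (empty u).
    move=> xs; apply: indep_empty; apply: contraTneq uu => <-; by rewrite /= mem_rev xs.
  have V1 : {subset s ++ t1 <= V} by move=> x /sub/stV.
  rewrite (@E_orth (s ++ t1)) // (@E_orth s) //; last by move=> x xs; apply: iu; rewrite mem_cat xs.
  rewrite lerD2l lerN2 mean_cat mean_meanC; apply: E_mean_le => //.
  - by move=> x xt; apply: V1; rewrite mem_cat xt orbT.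
  - by move=> x xt; apply: iu; rewrite mem_cat xt orbT.
apply: (@le_trans _ _ (\sum_(u <- t) EV (fun e => empty u e * (G e - m s G e) ^+ 2))).
  have -> : \sum_(u <- t) EV (fun e => empty u e * (G e - m s G e) ^+ 2) =
    EV (fun e => \sum_(u <- t) (empty u e * (G e - m s G e) ^+ 2)) by rewrite /E mean_sum.
  apply: E_le => // e; rewrite -mulr_suml ler_wpM2r ?sqr_ge0 //.
  rewrite /helped; case: hasP => [[x xt ex]|_]; last by apply: sumr_ge0 => x _; exact: empty_ge0.
  rewrite (big_rem x) //= /empty ex lerDl; apply: sumr_ge0 => y _; exact: ler0n.
apply: (@le_trans _ _ (\sum_(u <- t) (chain_const (size s + size t) * \sum_(x <- s ++ t) ener x G))).
  by rewrite big_seq [leRHS]big_seq; apply: ler_sum.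
by rewrite big_const_seq count_predT iter_addr_0 -(mulr_natl (_ * _)).
Qed.

(** A martingale increment: the later blocks have already been averaged out, so by [block_sumE]
    these variances add up to the variance over the whole path. *)
Definition block_var (B : seq site) (bs : seq (seq site)) G : R :=
  EV (fun e => (m (flatten bs) G e - m B (m (flatten bs) G) e) ^+ 2).

Lemma block_var_ge0 B bs G : 0 <= block_var B bs G.
Proof. by apply: E_ge0 => // e; exact: sqr_ge0. Qed.

Fixpoint block_sum (bs : seq (seq site)) G : R :=
  if bs is B :: bs' then block_var B bs' G + block_sum bs' G else 0.

Lemma E_orth1 s G : {subset s <= V} ->
  EV (fun e => (G e - m s G e) ^+ 2) = EV (fun e => G e ^+ 2) - EV (fun e => m s G e ^+ 2).
Proof.
move=> sV; have := @E_orth s (fun=> 1) G sV (fun x _ e b => erefl).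
have H f : EV (fun e => 1 * f e) = EV f by congr EV; apply/funext => e; rewrite mul1r.
by rewrite !H.
Qed.

Lemma block_sumE bs G : {subset flatten bs <= V} ->
  block_sum bs G = EV (fun e => (G e - m (flatten bs) G e) ^+ 2).
Proof.
elim: bs => [|B bs IH] /= bV.
  by rewrite (_ : (fun e => _) = fun=> 0) /E ?mean_const //; apply/funext => e; rewrite subrr expr0n.
have BV : {subset B <= V} by move=> x xB; apply: bV; rewrite mem_cat xB.
have bV' : {subset flatten bs <= V} by move=> x xB; apply: bV; rewrite mem_cat xB orbT.
rewrite IH // E_orth1 // E_orth1 //= /block_var E_orth1 // mean_cat; ring.
Qed.

(** Split according to whether [B'] contains an empty site. If it does, the helped term bounds the
    variance of [B]. If not, Cauchy-Schwarz over [B'] gives the small probability of this event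
    times a norm bounded by the two block variances. *)
Lemma block_step B B' bs G : uniq B' -> {subset flatten [:: B, B' & bs] <= V} ->
  uniq (flatten [:: B, B' & bs]) ->
  block_var B (B' :: bs) G <=
  2 * EV (fun e => helped B' e * (G e - m B G e) ^+ 2) +
  2 * (1 - q) ^+ size B' * (block_var B (B' :: bs) G + block_var B' bs G).
Proof.
move=> uB' /= bV.
rewrite !cat_uniq has_cat negb_or => /and4P[_ /andP[hBB' hBbs] _ /andP[hB'bs _]].
have BV : {subset B <= V} by move=> x xB; apply: bV; rewrite mem_cat xB.
have BV' : {subset B' <= V} by move=> x xB; apply: bV; rewrite !mem_cat xB orbT.
have bV' : {subset flatten bs <= V} by move=> x xB; apply: bV; rewrite !mem_cat xB !orbT.
pose H := m (flatten bs) G; pose D := fun e => H e - m B H e.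
have var1 : block_var B (B' :: bs) G = EV (fun e => m B' D e ^+ 2).
  rewrite /block_var /= mean_cat /D meanB; congr EV; apply/funext => e.
  by rewrite (mean_meanC _ B' B).
have DE : D = m (flatten bs) (fun e => G e - m B G e) by rewrite /D meanB mean_meanC.
have var2 : EV (fun e => D e ^+ 2) <= block_var B (B' :: bs) G + block_var B' bs G.
  have := E_orth1 D BV'; rewrite var1 => h.
  rewrite -lerBlDl -h /block_var -/H.
  have -> : (fun e => (D e - m B' D e) ^+ 2) = (fun e => 1 * ((fun e => H e - m B' H e) e - m B (fun e => H e - m B' H e) e) ^+ 2).
    apply/funext => e; rewrite mul1r /D !meanB (mean_meanC _ B' B); congr (_ ^+ 2); ring.
  apply: (le_trans (@E_orth_le B (fun=> 1) _ BV (fun x _ e b => erefl) (fun=> ler01))).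
  by apply: E_le => // e; rewrite mul1r.
set c := helped B'; set eps := (1 - q) ^+ size B'.
have eps0 : 0 <= eps by rewrite exprn_ge0 //; case/andP: p01.
have pt e : m B' D e ^+ 2 <= 2 * m B' (fun e => c e * D e ^+ 2) e + 2 * (eps * m B' (fun e => D e ^+ 2) e).
  have DE' : D = (fun e => c e * D e + (1 - c e) * D e) by apply/funext => e'; ring.
  have -> : m B' D e = m B' (fun e => c e * D e) e + m B' (fun e => (1 - c e) * D e) e.
    by rewrite {1}DE' meanD.
  have h1 : m B' (fun e => c e * D e) e ^+ 2 <= m B' (fun e => c e * D e ^+ 2) e.
    apply: (le_trans (mean_sqr_le p01 _ _ _)); apply: mean_le => // z.
    rewrite exprMn ler_wpM2r ?sqr_ge0 // /c /helped; by case: has; rewrite ?expr0n ?expr1n.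
  have h2 : m B' (fun e => (1 - c e) * D e) e ^+ 2 <= eps * m B' (fun e => D e ^+ 2) e.
    apply: (le_trans (mean_CS p01 _ _ _ _)).
    have -> : m B' (fun z : config => (1 - c z) ^+ 2) e = eps.
      rewrite /eps -(helped_fail e uB'); congr (m B' _ e); apply/funext => z.
      by rewrite /c /helped; case: has; rewrite ?subrr ?subr0 ?expr0n ?expr1n.
    by [].
  set a := m B' _ e in h1 *; set b := m B' _ e in h2 *.
  have : 0 <= (a - b) ^+ 2 by exact: sqr_ge0.
  move: h1 h2; set X := m B' _ e; set Y := eps * _; nra.
rewrite {1}var1.
apply: (@le_trans _ _ (EV (fun e => 2 * m B' (fun e => c e * D e ^+ 2) e + 2 * (eps * m B' (fun e => D e ^+ 2) e)))).
  exact: E_le.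
rewrite E_add !E_scale !(E_mean _ BV').
apply: lerD.
  rewrite ler_wpM2l //.
  have cb x : x \in flatten bs -> indep x c.
    by move=> xb; apply: helped_indep; apply: contraNN hB'bs => xB; apply/hasP; exists x.
  rewrite DE; apply: E_mean_le => // e; exact: helped_ge0.
by rewrite -mulrA ler_wpM2l // ler_wpM2l.
Qed.

Fixpoint helped_sum (bs : seq (seq site)) G : R :=
  match bs with
  | B :: ((B' :: _) as bs') => EV (fun e => helped B' e * (G e - m B G e) ^+ 2) + helped_sum bs' G
  | _ => 0
  end.

(** The error terms of [block_step] add up to at most [4 * eps], hence half, of the left-hand side
    and are absorbed by it. The last block has no successor and remains as a boundary term. *)
Lemma block_sum_le eps B bs G : 0 <= eps -> eps <= 1 / 8 ->
  (forall B', B' \in bs -> (1 - q) ^+ size B' <= eps) ->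
  {subset flatten (B :: bs) <= V} -> uniq (flatten (B :: bs)) ->
  block_sum (B :: bs) G <= 4 * helped_sum (B :: bs) G +
     2 * EV (fun e => (G e - m (last B bs) G e) ^+ 2).
Proof.
move=> eps0 eps8 He bV ub.
(* Each variance is charged at most twice, for its own block and as successor of the previous one;
   the first block is not a successor, hence the subtracted term. *)
suff H : block_sum (B :: bs) G <= 2 * helped_sum (B :: bs) G + EV (fun e => (G e - m (last B bs) G e) ^+ 2) +
    2 * eps * (2 * block_sum (B :: bs) G - block_var B bs G).
  set Sn := EV (fun e => (G e - m (last B bs) G e) ^+ 2) in H *.
  have Sn0 : 0 <= Sn by apply: E_ge0 => // e; exact: sqr_ge0.
  have bv0 := block_var_ge0 B bs G.
  have bs0 : forall bs, 0 <= block_sum bs G.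
    by elim=> [|B' bs' IH] //=; rewrite addr_ge0 ?block_var_ge0.
  have b1 : block_var B bs G <= block_sum (B :: bs) G by rewrite /= lerDl.
  have b0 := bs0 (B :: bs).
  have hX : 2 * eps * (2 * block_sum (B :: bs) G - block_var B bs G) <= 2 * (1 / 8) * (2 * block_sum (B :: bs) G - block_var B bs G).
    by rewrite ler_wpM2r ?ler_wpM2l // subr_ge0; lra.
  by move: H hX; set X := 2 * eps * _; lra.
elim: bs B He bV ub => [|B' bs IH] B He bV ub.
  rewrite /= /block_var /= addr0 mulr0 add0r.
  set X := EV _; have X0 : 0 <= X by apply: E_ge0 => // e; exact: sqr_ge0.
  have -> : X + 2 * eps * (2 * X - X) = X + 2 * (eps * X) by ring.
  by rewrite lerDl !mulr_ge0.
have He' B0 : B0 \in bs -> (1 - q) ^+ size B0 <= eps by move=> h; apply: He; rewrite inE h orbT.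
have bV' : {subset flatten (B' :: bs) <= V} by move=> x xb; apply: bV; rewrite /= mem_cat xb orbT.
have ub' : uniq (flatten (B' :: bs)) by move: ub; rewrite /= cat_uniq => /and3P[].
have uB' : uniq B' by move: ub'; rewrite /= cat_uniq => /and3P[].
have h1 := IH B' He' bV' ub'.
have h2 := block_step G uB' bV ub.
have h3 : (1 - q) ^+ size B' <= eps by apply: He; rewrite mem_head.
have SS0 : 0 <= block_var B (B' :: bs) G + block_var B' bs G by rewrite addr_ge0 ?block_var_ge0.
have h4 : 2 * (1 - q) ^+ size B' * (block_var B (B' :: bs) G + block_var B' bs G) <=
  2 * (eps * (block_var B (B' :: bs) G + block_var B' bs G)).
  by rewrite -mulrA ler_wpM2l // ler_wpM2r.
move: h1 h2 h4; set Sn := EV (fun e => (G e - m (last B' bs) G e) ^+ 2).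
have -> : block_sum (B :: B' :: bs) G = block_var B (B' :: bs) G + block_sum (B' :: bs) G by [].
have -> : helped_sum (B :: B' :: bs) G = EV (fun e => helped B' e * (G e - m B G e) ^+ 2) + helped_sum (B' :: bs) G by [].
set X := block_var B _ G; set Y := block_var B' bs G; set Z := block_sum _ G.
have -> : 2 * eps * (2 * Z - Y) = 4 * (eps * Z) - 2 * (eps * Y) by ring.
have -> : 2 * eps * (2 * (X + Z) - X) = 2 * (eps * X) + 4 * (eps * Z) by ring.
have -> : 2 * (eps * (X + Y)) = 2 * (eps * X) + 2 * (eps * Y) by ring.
set h := EV _; set hs := helped_sum _ G; set T := 2 * (1 - q) ^+ _ * _; lra.
Qed.

Lemma helped_sum_le K bs G : (forall B, B \in bs -> (size B <= K)%N) ->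
  sorted adjacent (flatten bs) -> uniq (flatten bs) ->
  (forall x, x \in flatten bs -> w x) -> {subset flatten bs <= V} ->
  helped_sum bs G <= 2 * (K%:R * chain_const (2 * K)) * \sum_(x <- flatten bs) ener x G.
Proof.
move=> HK; pose c := K%:R * chain_const (2 * K).
have c0 : 0 <= c by rewrite mulr_ge0 ?chain_const_ge0.
have D0 s : 0 <= \sum_(x <- s) ener x G by apply: sumr_ge0 => x _; exact: ener_ge0.
elim: bs HK => [|B [|B' bs] IH] HK sb ub wb bV; try by rewrite /= !mulr_ge0 ?chain_const_ge0.
(* Consecutive pairs of blocks overlap, so an energy is charged at most twice, and once only in the
   first block. *)
suff H : forall bs B, (forall B', B' \in B :: bs -> (size B' <= K)%N) -> sorted adjacent (flatten (B :: bs)) ->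
   uniq (flatten (B :: bs)) -> (forall x, x \in flatten (B :: bs) -> w x) -> {subset flatten (B :: bs) <= V} ->
   helped_sum (B :: bs) G <= c * (2 * (\sum_(x <- flatten (B :: bs)) ener x G) - \sum_(x <- B) ener x G).
  have := H _ _ HK sb ub wb bV; move/le_trans; apply.
  by rewrite -/c -mulrA [leRHS]mulrCA ler_wpM2l // gerBl.
move=> {IH HK sb ub wb bV B B' bs}; elim=> [|B' bs IH] B HK sb ub wb bV.
  by rewrite /= mulr_ge0 // cats0 mulr_natl mulr2n addrK.
have sub x : x \in flatten (B' :: bs) -> x \in flatten (B :: B' :: bs).
  by move=> h; rewrite /= mem_cat /= h orbT.
have [_ sb'] : sorted adjacent B /\ sorted adjacent (flatten (B' :: bs)) by move: sb => /= /cat_sorted2[].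
have ub' : uniq (flatten (B' :: bs)) by move: ub; rewrite /= cat_uniq => /and3P[].
have {}IH : helped_sum (B' :: bs) G <= c *
     (2 * (\sum_(x <- flatten (B' :: bs)) ener x G) - \sum_(x <- B') ener x G).
  by apply: IH => // [B0 h|x /sub/wb|x /sub/bV//]; first by apply: HK; rewrite inE h orbT.
have [s1 _] : sorted adjacent (B ++ B') /\ sorted adjacent (flatten bs).
  by move: (sb); rewrite /= catA => /cat_sorted2[h1 h2]; split.
have u1 : uniq (B ++ B') by move: ub; rewrite /= catA cat_uniq => /and3P[].
have sub1 x : x \in B ++ B' -> x \in flatten (B :: B' :: bs).
  by rewrite /= !mem_cat => /orP[->|->]; rewrite ?orbT.
have := @helped_poincare B B' G s1 u1 (fun x hx => wb x (sub1 x hx)) (fun x hx => bV x (sub1 x hx)).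
have KB : (size B <= K)%N by apply: HK; rewrite mem_head.
have KB' : (size B' <= K)%N by apply: HK; rewrite !inE eqxx orbT.
have cc : chain_const (size B + size B') <= chain_const (2 * K).
  by apply: chain_const_mono; rewrite mul2n -addnn leq_add.
move=> h; have {}h : EV (fun e => helped B' e * (G e - m B G e) ^+ 2) <= c * \sum_(x <- B ++ B') ener x G.
  apply: (le_trans h); rewrite mulrA ler_wpM2r //; apply: ler_pM => //; first exact: chain_const_ge0.
  by rewrite ler_nat.
have -> : helped_sum (B :: B' :: bs) G = EV (fun e => helped B' e * (G e - m B G e) ^+ 2) + helped_sum (B' :: bs) G by [].
apply: (le_trans (lerD h IH)); rewrite -mulrDr ler_wpM2l //= !big_cat /=; lra.
Qed.

End BlockPoincare.

(** Length at least [K] makes a block likely to contain an empty site; length below [2 * K] keeps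
    the constants of [helped_poincare] bounded. *)
Lemma chop (T : eqType) (K : nat) (s : seq T) : (0 < K)%N -> (K <= size s)%N ->
  exists B bs, [/\ flatten (B :: bs) = s, (K <= size B)%N, (size B < 2 * K)%N &
     forall B', B' \in bs -> (K <= size B')%N /\ (size B' < 2 * K)%N].
Proof.
move=> K0; have [n] := ubnP (size s); elim: n s => // n IH s /ltnSE sn Ks.
have [lt|ge] := ltnP (size s) (2 * K).
  by exists s, [::]; split => //=; rewrite cats0.
have sd : (size (drop K s) = size s - K)%N by rewrite size_drop.
have [||B [bs [h1 h2 h3 h4]]] := IH (drop K s); rewrite ?sd; try lia.
exists (take K s), (B :: bs).
have st : size (take K s) = K by rewrite size_takel.
rewrite st; split => //; try lia.
- by rewrite -[RHS](cat_take_drop K s) -h1.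
- by move=> B'; rewrite inE => /orP[/eqP->//|/h4].
Qed.

Section PathPoincare.
Context {R : realType}.
Variable q : R.
Hypothesis q01 : 0 < q < 1.

Lemma short_block : exists2 K, (0 < K)%N & (1 - q) ^+ K <= 1 / 8.
Proof.
have [q0 q1] := andP q01.
have := @cvg_geometric R 1 (1 - q); rewrite ger0_norm ?subr_ge0 ?(ltW q1) // gtrBl q0 => /(_ isT).
move/cvgrPdist_le => /(_ (1 / 8)) []; first by lra.
move=> N _ /(_ N.+1 (leqnSn _)); rewrite sub0r normrN /geometric /= ger0_norm mul1r => [h|].
  by exists N.+1 => //; move: h; rewrite !mul1r.
by rewrite exprn_ge0 // subr_ge0 ltW.
Qed.

(** The second moment of [G] is the variance over the path plus that of the averaged function. The
    latter does not depend on [b], so it may be tested on the event that [b] is empty and compared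
    there with [G]. The last block, close to the end of the path, is left as an error. *)
Lemma path_poincare : exists (C : R) (K : nat), 0 < C /\
  forall (w : config) (V U L : seq site) (b : site),
    path adjacent b L -> uniq (b :: L) -> (forall x, x \in b :: L -> w x) ->
    {subset b :: L <= V} -> {subset b :: L <= U} -> uniq U -> (K <= size L)%N ->
    exists B : seq site, {subset B <= drop (size L - K) L} /\ forall G : config -> R,
      E q V (fun e => G e ^+ 2) <=
      C * (energy w q V U G + E q V (fun e => (~~ e b)%:R * G e ^+ 2) +
           E q V (fun e => (G e - mean (1 - q) B G e) ^+ 2)).
Proof.
have [q0 q1] := andP q01; have [K K0 HK] := short_block.
pose c := (2 * K)%:R * chain_const q (2 * (2 * K)).
have c0 : 0 <= c by rewrite mulr_ge0 ?chain_const_ge0.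
(* [8 * c] combines the factor 4 of [block_sum_le] with [2 * c] from [helped_sum_le], 2 is the
   boundary factor, and [2 / q] comes from testing on an empty [b]. *)
pose C := 2 / q + (1 + 2 / q) * (8 * c + 2).
have qi : 0 < 2 / q by rewrite divr_gt0.
have C0 : 0 < C by rewrite addr_gt0 // mulr_gt0 //; lra.
exists C, (2 * K)%N; split => // w V U L b pL uL wL LV LU uU KL.
have [|B [bs [hB KB B2 Hbs]]] := @chop _ K (b :: L) K0; first by apply: leq_trans (leqW KL); rewrite leq_pmull.
have sz B' : B' \in B :: bs -> (K <= size B')%N /\ (size B' < 2 * K)%N.
  by rewrite inE => /orP[/eqP->//|]; exact: Hbs.
exists (last B bs); split.
  have lB : last B bs \in B :: bs by exact: mem_last.
  have [_ lsz] := sz _ lB.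
  have fl : exists s, b :: L = s ++ last B bs.
    rewrite -hB; elim: bs B {hB KB B2 Hbs sz lB lsz} => [|B' bs IH] B /=; first by exists [::]; rewrite cats0.
    by have [s /= ->] := IH B'; exists (B ++ s); rewrite catA.
  have [s hs] := fl.
  have ss : size (b :: L) = (size s + size (last B bs))%N by rewrite hs size_cat.
  case: s hs ss => [|b' s] /= hs ss.
    by move: ss lsz KL; rewrite add0n => <-; clear; lia.
  case: hs => _ hs x xl; rewrite hs drop_cat; case: ltnP => h.
    by rewrite mem_cat xl orbT.
  have -> : (size (s ++ last B bs) - 2 * K - size s = 0)%N by rewrite size_cat; move: lsz; clear; lia.
  by rewrite drop0.
move=> G; have bV : {subset flatten (B :: bs) <= V} by rewrite hB.
have ub : uniq (flatten (B :: bs)) by rewrite hB.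
set Sn := E q V (fun e => (G e - mean (1 - q) (last B bs) G e) ^+ 2).
have H1 : block_sum q V (B :: bs) G <= 4 * helped_sum q V (B :: bs) G + 2 * Sn.
  have e0 : 0 <= 1 / 8 :> R by lra.
  have HB B' : B' \in bs -> (1 - q) ^+ size B' <= 1 / 8; last first.
    exact: (block_sum_le q01 G e0 (lexx _) HB bV ub).
  move=> B'in; have [KB' _] := sz B' (mem_behead (s := B :: bs) B'in).
  apply: le_trans HK; apply: ler_wiXn2l => //; last by rewrite gerBl ltW.
  by rewrite subr_ge0 ltW.
have H2 : helped_sum q V (B :: bs) G <= 2 * c * \sum_(x <- flatten (B :: bs)) ener w q V x G.
  apply: helped_sum_le => //; try by rewrite hB.
  by move=> B' /sz[_ /ltnW].
have H3 : \sum_(x <- flatten (B :: bs)) ener w q V x G <= energy w q V U G.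
  rewrite hB /energy; apply: ler_sum_sub => //.
  by move=> x; exact: ener_ge0.
rewrite block_sumE // in H1.
set m := mean (1 - q) (flatten (B :: bs)) in H1 *.
set en := energy _ _ _ _ _ in H3 *.
have en0 : 0 <= en by exact: energy_ge0.
have Sn0 : 0 <= Sn by apply: E_ge0 => // e; exact: sqr_ge0.
set T := E q V (fun e => (G e - m G e) ^+ 2) in H1.
have T0 : 0 <= T by apply: E_ge0 => // e; exact: sqr_ge0.
have HT : T <= 8 * c * en + 2 * Sn.
  apply: (le_trans H1); rewrite lerD2r.
  have -> : 8 * c * en = 4 * (2 * c * en) by ring.
  rewrite ler_wpM2l //; apply: (le_trans H2); rewrite ler_wpM2l // mulr_ge0 //.
have HE : E q V (fun e => G e ^+ 2) = T + E q V (fun e => m G e ^+ 2).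
  by rewrite /T E_orth1 // subrK.
set Eb := E q V (fun e => (~~ e b)%:R * G e ^+ 2).
have Eb0 : 0 <= Eb by apply: E_ge0 => // e; rewrite mulr_ge0 ?ler0n ?sqr_ge0.
have bin : b \in flatten (B :: bs) by rewrite hB mem_head.
have Hm : q * E q V (fun e => m G e ^+ 2) <= 2 * Eb + 2 * T.
  have ib : indep b (fun e => m G e ^+ 2) by move=> e x; rewrite /m (indep_mean_in _ _ bin).
  rewrite -(@E_empty _ q V b _ (bV _ bin) ib).
  rewrite /Eb /T -!E_scale -E_add; apply: E_le => // e.
  rewrite /empty; case: (e b) => /=.
    by rewrite !mul0r mulr0 add0r mulr_ge0 ?sqr_ge0.
  rewrite !mul1r; have : 0 <= (2 * G e - m G e) ^+ 2 by exact: sqr_ge0.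
  set x := G e; set y := m G e; nra.
have Hm2 : E q V (fun e => m G e ^+ 2) <= 2 / q * (Eb + T).
  rewrite -(ler_pM2l q0); apply: (le_trans Hm).
  have -> : q * (2 / q * (Eb + T)) = 2 * Eb + 2 * T by field; rewrite gt_eqF.
  by [].
rewrite HE; apply: (@le_trans _ _ ((1 + 2 / q) * T + 2 / q * Eb)).
  by move: Hm2; set X := E q V _; set y := 2 / q; lra.
rewrite /C; set y := 2 / q in qi *.
have h1 : (1 + y) * T <= (1 + y) * (8 * c * en + 2 * Sn) by rewrite ler_wpM2l //; lra.
have y1 : 0 <= 1 + y by move: qi; clear; lra.
have h2 : 0 <= (1 + y) * (8 * c) by rewrite mulr_ge0 // mulr_ge0.
have h3 : 0 <= y by exact: ltW.
have p1 : 0 <= (1 + y) * (8 * c) * Eb by rewrite mulr_ge0.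
have p2 : 0 <= (1 + y) * (8 * c) * Sn by rewrite mulr_ge0.
have p3 : 0 <= y * en by rewrite mulr_ge0.
have p4 : 0 <= y * Eb by rewrite mulr_ge0.
have p5 : 0 <= y * Sn by rewrite mulr_ge0.
move: h1 p1 p2; set z := (1 + y) * (8 * c).
have -> : (1 + y) * (8 * c * en + 2 * Sn) = z * en + 2 * (1 + y) * Sn by rewrite /z; ring.
have -> : (y + (1 + y) * (8 * c + 2)) * (en + Eb + Sn) = y * en + y * Eb + y * Sn + z * en + z * Eb + z * Sn + 2 * (1 + y) * en + 2 * (1 + y) * Eb + 2 * (1 + y) * Sn by rewrite /z; ring.
have -> : 2 * (1 + y) * en = 2 * en + 2 * (y * en) by ring.
have -> : 2 * (1 + y) * Eb = 2 * Eb + 2 * (y * Eb) by ring.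
lra.
Qed.

End PathPoincare.

(** * Poincaré inequality in a box *)

Lemma conn_upath (P : site -> Prop) x y : conn adjacent P x y ->
  exists s, [/\ path adjacent x s, uniq (x :: s), forall z, z \in s -> P z & last x s = y].
Proof.
move=> /conn_path [s [ps sP <-]]; case/shortenP: ps => s' ps' us' sub.
by exists s'; split => // z /sub/sP.
Qed.

Lemma adjacent_box x y z n : adjacent x y -> x \in box z n -> y \in box z n.+1.
Proof.
by rewrite !mem_box => /adjacentP; case: x y z => [x1 x2] [y1 y2] [z1 z2] /=; lia.
Qed.

(** A step changes the distance to the centre by at most one. This places the last block of the path
    far away. *)
Lemma path_tail_box M k x s y : path adjacent x s -> last x s \notin box 0 (M + k) ->
  y \in drop (size s - k) s -> y \notin box 0 M.
Proof.
elim/last_ind: s k => [|s z IH] k //.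
rewrite rcons_path last_rcons size_rcons => /andP[ps sz] zM.
case: k zM => [|k] zM.
  by rewrite subn0 drop_oversize // size_rcons.
rewrite subSS drop_rcons; last by rewrite leq_subr.
rewrite mem_rcons inE => /orP[/eqP->|]; first by apply: contraNN zM; rewrite !mem_box; lia.
apply: IH => //; apply: contraNN zM => /(adjacent_box sz); by rewrite addnS.
Qed.

Lemma path_size_box M k x s : path adjacent x s -> x \in box 0 M ->
  last x s \notin box 0 (M + k) -> (k <= size s)%N.
Proof.
elim/last_ind: s k => [|s z IH] k /=.
  by move=> _ xM; case: k => // k /negP[]; move: xM; rewrite !mem_box; lia.
rewrite rcons_path last_rcons size_rcons => /andP[ps sz] xM zM.
case: k zM => // k zM; rewrite ltnS; apply: IH => //.
apply: contraNN zM => /(adjacent_box sz); by rewrite addnS.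
Qed.

Section Block.
Context {R : realType}.
Variable q : R.
Hypothesis q01 : 0 < q < 1.

Definition moves (n : nat) : nat := (5 ^ (2 * n) * (2 * size (box 0%R (2 * n))).+1)%N.
(** The constants of [reach_energy] with [moves n] flips and [4 * n + 2] simultaneous vacancies; the
    numerator adds its two coefficients. *)
Definition cost (n : nat) : R := (2 * (moves n)%:R ^+ 2 + 2) / q ^+ (4 * n + 3).

Lemma cost_ge1 n : 1 <= cost n.
Proof.
have [q0 q1] := andP q01.
rewrite /cost ler_pdivlMr ?exprn_gt0 // mul1r.
apply: (@le_trans _ _ 1); first by rewrite exprn_ile1 ?ltW.
have : 0 <= 2 * (moves n)%:R ^+ 2 :> R by rewrite mulr_ge0 ?exprn_ge0 ?ler0n.
lra.
Qed.

(** The variance on [B] is harmless because [B] avoids an arbitrary prescribed box [M0]: functions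
    nearly determined inside that box hardly depend on [B]. Averages are over [box 0 M.+1] since the
    constraints of [box 0 M] look one site further. *)
Lemma box_poincare : exists2 C : R, 0 < C &
  forall (w : config) (n : nat), (0 < n)%N -> (forall m, (n <= m)%N -> good m w) ->
  forall M0, exists M (B : seq site), [/\ (M0 <= M)%N, {subset B <= box 0 M},
    forall x, x \in B -> x \notin box 0 M0 &
    forall G, E q (box 0 M.+1) (fun e => G e ^+ 2) <=
      C * cost n * (energy w q (box 0 M.+1) (box 0 M) G +
         E q (box 0 M.+1) (fun e => (~~ e 0)%:R * G e ^+ 2) +
         E q (box 0 M.+1) (fun e => (G e - mean (1 - q) B G e) ^+ 2))].
Proof.
have [q0 q1] := andP q01; have [C [K [C0 HC]]] := path_poincare q01.
exists (2 * C); first by rewrite mulr_gt0.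
move=> w n n0 gw M0; have [Gam [b [Gb G1 G2 G3 G4]]] := barrier n0 gw.
pose A := maxn M0 (2 * n); have [z bz zA] := G3 (A + K)%N.
have wb : w b by case: (G1 b Gb).
have [s [ps us ws ls]] := conn_upath bz.
have bA : b \in box 0 A by have := G2 b Gb; rewrite !mem_box /A; lia.
rewrite -ls in zA.
pose M := \max_(x <- b :: s) maxn A (maxn `|x.1| `|x.2|).
have MA : (A <= M)%N by rewrite /M big_cons; lia.
have sM : {subset b :: s <= box 0 M}.
  move=> x xs; have : (maxn A (maxn `|x.1| `|x.2|) <= M)%N by rewrite /M (big_rem x) //= leq_maxl.
  by rewrite mem_box /= !subr0; clear; case: x => x1 x2 /=; lia.
have boxS k l : (k <= l)%N -> {subset box 0 k <= box 0 l} by move=> kl x; rewrite !mem_box; lia.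
have sM1 : {subset b :: s <= box 0 M.+1} by move=> x /sM; exact: boxS.
have ws' x : x \in b :: s -> w x by rewrite inE => /orP[/eqP->|/ws].
have Ks : (K <= size s)%N by exact: (path_size_box ps bA zA).
have [B [Bs HG]] := HC w (box 0 M.+1) (box 0 M) s b ps us ws' sM1 sM (box_uniq _ _) Ks.
exists M, B; split.
- by apply: leq_trans MA; rewrite leq_maxl.
- by move=> x /Bs/mem_drop xs; apply: sM; rewrite inE xs orbT.
- move=> x /Bs/(path_tail_box ps zA); apply: contraNN; apply: boxS; exact: leq_maxl.
move=> G; apply: (le_trans (HG G)).
set en := energy _ _ _ _ _; set Eb := E _ _ _; set er := E _ _ _; set E0 := E _ _ (fun e => (~~ e 0)%:R * _).
have O0 : 0 \in box 0 (2 * n) by rewrite mem_box /=; lia.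
have V0M : {subset box 0 (2 * n) <= box 0 M} by apply: boxS; apply: leq_trans MA; exact: leq_maxr.
have V0M1 : {subset box 0 (2 * n) <= box 0 M.+1} by move=> x /V0M; exact: boxS.
have Gc (z0 : site) : Gam z0 -> exists s0 : seq site, [/\ path adjacent b s0, forall u, u \in b :: s0 -> w u /\ u \in box 0 (2 * n),
    last b s0 = z0 & (size s0 <= size (box 0%R (2 * n)))%N].
  move=> Gz; have [_ /conn_upath[s0 [p0 u0 w0 l0]]] := G1 _ Gz.
  exists s0; split => //; first by move=> u; rewrite inE => /orP[/eqP->|/w0//]; split => //; exact: G2.
  by apply: uniq_leq_size; [case/andP: u0|move=> x /w0[]].
have Gr z0 : ~ Gam 0 -> conn oriented_edge (fun y => ~ Gam y) 0 z0 ->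
    rect 0 (n%:Z - 1) 0 (n%:Z - 1) z0 /\ z0 \in box 0 (2 * n).
  move=> nG cz; have rz := G4 _ nG cz; split => //; move/rectP: rz => [h1 h2 h3 h4].
  by rewrite mem_box /= !subr0; move: h1 h2 h3 h4; clear; case: z0 => x y /=; lia.
have ro := reach_origin (R := R) Gc Gr n0.
have := reach_energy q01 G ro V0M1 V0M (box_uniq _ _) (V0M1 _ O0).
rewrite -/en -/Eb -/E0 -/(moves n) -addnS.
move=> Hr.
have qN : 0 < q ^+ (4 * n + 3) by rewrite exprn_gt0.
have en0 : 0 <= en by exact: energy_ge0.
have er0 : 0 <= er by apply: E_ge0 => // e; exact: sqr_ge0.
have E00 : 0 <= E0 by apply: E_ge0 => // e; rewrite mulr_ge0 ?ler0n ?sqr_ge0.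
have c1 := cost_ge1 n.
have mv0 : 0 <= 2 * (moves n)%:R ^+ 2 :> R by rewrite mulr_ge0 ?exprn_ge0 ?ler0n.
have h1 : Eb <= cost n * (en + E0).
  rewrite -(ler_pM2l qN); apply: (le_trans Hr).
  have -> : q ^+ (4 * n + 3) * (cost n * (en + E0)) = (2 * (moves n)%:R ^+ 2 + 2) * (en + E0).
    by rewrite /cost; field; rewrite gt_eqF.
  rewrite [leRHS]mulrDr; apply: lerD; first by rewrite ler_wpM2r // lerDl.
  by rewrite ler_wpM2r // lerDr.
have -> : 2 * C * cost n * (en + E0 + er) = C * (2 * (cost n * (en + E0)) + 2 * (cost n * er)) by ring.
rewrite ler_wpM2l ?(ltW C0) //.
have h2 : er <= cost n * er by rewrite ler_peMl.
have h3 : en + E0 <= cost n * (en + E0) by rewrite ler_peMl // addr_ge0.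
by move: h1 h2 h3; set t1 := cost n * _; set t2 := cost n * _; lra.
Qed.

End Block.

(** * Integrals of bounded measurable functions *)

Section BoundedMeasurable.
Context d (T : measurableType d) (R : realType).
Implicit Types (f g : T -> R) (A : set T).

Definition bm f : Prop := measurable_fun setT f /\ exists C, forall x, `|f x| <= C.

Lemma bm_cst (c : R) : bm (fun=> c).
Proof. by split; [exact: measurable_cst|exists `|c|]. Qed.

Lemma bmD f g : bm f -> bm g -> bm (fun x => f x + g x).
Proof.
move=> [mf [C fC]] [mg [D gD]]; split; first exact: measurable_funD.
by exists (C + D) => x; apply: le_trans (ler_normD _ _) _; rewrite lerD.
Qed.

Lemma bmM f g : bm f -> bm g -> bm (fun x => f x * g x).
Proof.
move=> [mf [C fC]] [mg [D gD]]; split; first exact: measurable_funM.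
by exists (C * D) => x; rewrite normrM ler_pM.
Qed.

Lemma bmZ (c : R) f : bm f -> bm (fun x => c * f x).
Proof. by move=> bf; apply: bmM => //; exact: bm_cst. Qed.

Lemma bmN f : bm f -> bm (fun x => - f x).
Proof. by move=> /(bmZ (-1)); under eq_fun do rewrite mulN1r. Qed.

Lemma bmB f g : bm f -> bm g -> bm (fun x => f x - g x).
Proof. by move=> bf bg; apply: bmD => //; exact: bmN. Qed.

Lemma bmX f n : bm f -> bm (fun x => f x ^+ n).
Proof.
move=> bf; elim: n => [|n IH]; first exact: bm_cst.
by under eq_fun do rewrite exprS; exact: bmM.
Qed.

Lemma bm_sum (I : Type) (r : seq I) (F : I -> T -> R) : (forall i, bm (F i)) ->
  bm (fun x => \sum_(i <- r) F i x).
Proof.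
move=> bF; elim: r => [|i r IH].
  by under eq_fun do rewrite big_nil; exact: bm_cst.
by under eq_fun do rewrite big_cons; exact: bmD.
Qed.

Lemma bm_indic A : measurable A -> bm (\1_A : T -> R).
Proof.
move=> mA; split; first exact: measurable_indic.
by exists 1 => x; rewrite indicE; case: (x \in A); rewrite ?normr0 ?normr1.
Qed.

Lemma measurable_level f r : measurable_fun setT f -> measurable [set x | r <= f x].
Proof.
move=> mf; rewrite -[X in measurable X]setTI.
have -> : [set x | r <= f x] = f @^-1` `[r, +oo[ by apply/seteqP; split => x /=; rewrite in_itv /= andbT.
by apply: mf => //; exact: measurable_itv.
Qed.

(* Uniform approximation by the staircase [eps * #{k <= N : k * eps <= f + C} - C]. *)
Lemma bm_approx f (e : R) : bm f -> 0 < e ->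
  exists s : seq (R * R), forall x, `|f x - \sum_(cr <- s) cr.1 * \1_[set y | cr.2 <= f y] x| <= e.
Proof.
move=> [mf [C fC]] e0; have [N hN] : exists N : nat, 2 * C <= e * N%:R.
  exists (Num.truncn (2 * C / e)).+1; rewrite -ler_pdivrMl // [e^-1 * _]mulrC.
  exact/ltW/truncnS_gt.
exists ((- C, - C) :: [seq (e, e * k%:R - C) | k <- iota 1 N]) => x.
rewrite big_cons big_map /= indicE mem_set ?mulr1; last first.
  by move: (fC x); rewrite ler_norml => /andP[].
rewrite opprD opprK addrA; set u := f x + C.
have u0 : 0 <= u by move: (fC x); rewrite ler_norml /u; lra.
have uN : u <= e * N%:R by apply: le_trans hN; move: (fC x); rewrite ler_norml /u; lra.
have -> : \sum_(k <- iota 1 N) e * \1_[set y | e * k%:R - C <= f y] x =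
    \sum_(k <- iota 1 N) (if e * k%:R <= u then e else 0).
  apply: eq_bigr => k _; rewrite indicE; case: ifP => h.
    by rewrite mem_set ?mulr1 //= lerBlDr.
  by rewrite memNset ?mulr0 //= lerBlDr -/u h.
set S := fun N => \sum_(k <- iota 1 N) (if e * k%:R <= u then e else 0).
have H n : (e * n%:R <= u -> S n = e * n%:R) /\ (u < e * n%:R -> S n <= u < S n + e).
  elim: n => [|n [IH1 IH2]]; first by rewrite mulr0 /S big_nil; split => // /(le_lt_trans u0); rewrite ltxx.
  have SS : S n.+1 = S n + (if e * n.+1%:R <= u then e else 0).
    by rewrite /S -(addn1 n) iotaD big_cat /= big_seq1 add1n addn1.
  have eS : e * n.+1%:R = e * n%:R + e by rewrite -natr1 mulrDr mulr1.
  split => h.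
    by rewrite SS h eS IH1 // (le_trans _ h) // eS lerDl ltW.
  have hf : (e * n.+1%:R <= u) = false by rewrite leNgt h.
  rewrite SS hf addr0; have [h'|h'] := leP (e * n%:R) u; last exact: IH2.
  by rewrite IH1 // h' -eS.
rewrite -/(S N) ler_norml; have [H1 H2] := H N.
have [h|h] := leP (e * N%:R) u; first by rewrite H1 //; lra.
by have := H2 h; lra.
Qed.

(** Passage from sets to bounded functions: level sets contribute 0, staircases are uniformly close
    to [f], and [Th] is bounded for the uniform norm. It is applied to the difference of the two
    sides of an identity known on measurable sets. *)
Lemma bm_zero (Th : (T -> R) -> R) (M : R) f : bm f ->
  (forall g h, bm g -> bm h -> Th (fun x => g x + h x) = Th g + Th h) ->
  (forall c g, bm g -> Th (fun x => c * g x) = c * Th g) ->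
  (forall g C, bm g -> (forall x, `|g x| <= C) -> `|Th g| <= M * C) ->
  (forall r, Th \1_[set y | r <= f y] = 0) -> Th f = 0.
Proof.
move=> bf ThD ThZ Thb Th0.
have bl r : bm (\1_[set y | r <= f y] : T -> R) by apply: bm_indic; apply: measurable_level; case: bf.
have ThS (s : seq (R * R)) : Th (fun x => \sum_(cr <- s) cr.1 * \1_[set y | cr.2 <= f y] x) = 0.
  elim: s => [|cr s IH].
    have := ThZ 0 (fun=> 0) (bm_cst 0); rewrite !mul0r => {2}<-.
    by congr Th; apply/funext => x; rewrite big_nil.
  under eq_fun do rewrite big_cons.
  rewrite ThD ?IH ?ThZ ?Th0 ?mulr0 ?addr0 //; first exact: bmZ.
  by apply: bm_sum => i; exact: bmZ.
have M0 : 0 <= M.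
  by have := Thb (fun=> 0) 1 (bm_cst 0); rewrite mulr1 normr0 => h; apply: le_trans (h _) => // ?; exact: ler01.
apply/eqP; rewrite -normr_eq0 eq_le normr_ge0 andbT; apply/ler_addgt0Pr => e e0; rewrite add0r.
have e1 : 0 < e / (M + 1) by rewrite divr_gt0 //; lra.
have [s hs] := bm_approx bf e1.
set S := fun x => \sum_(cr <- s) cr.1 * \1_[set y | cr.2 <= f y] x.
have bS : bm S by apply: bm_sum => i; exact: bmZ.
have -> : Th f = Th (fun x => f x - S x).
  have -> : Th f = Th (fun x => (f x - S x) + S x) by congr Th; apply/funext => x; rewrite subrK.
  by rewrite ThD ?ThS ?addr0 //; exact: bmB.
apply: le_trans (Thb _ _ _ hs) _; first exact: bmB.
by rewrite mulrA ler_pdivrMr ?mulrDr ?mulr1 1?mulrC ?lerDl ?ltW //; lra.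
Qed.

Section Integral.
Variable m : {measure set T -> \bar R}.
Hypothesis m1 : m setT = 1%E.

Definition I f : R := (\int[m]_x f x)%R.

Lemma bm_integrable f : bm f -> m.-integrable setT (EFin \o f).
Proof.
move=> [mf [C fC]]; apply: measurable_bounded_integrable => //; first by rewrite m1 ltry.
exists C; split; first exact: num_real.
by move=> M CM x _; exact: le_trans (fC x) (ltW CM).
Qed.

Lemma I_EFin f : bm f -> (I f)%:E = (\int[m]_x (f x)%:E)%E.
Proof. by move=> bf; rewrite /I /Rintegral fineK //; apply: integrable_fin_num => //; exact: bm_integrable. Qed.

Lemma I_D f g : bm f -> bm g -> I (fun x => f x + g x) = I f + I g.
Proof. by move=> bf bg; rewrite /I RintegralD //; exact: bm_integrable. Qed.

Lemma I_B f g : bm f -> bm g -> I (fun x => f x - g x) = I f - I g.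
Proof. by move=> bf bg; rewrite /I RintegralB //; exact: bm_integrable. Qed.

Lemma I_Z c f : bm f -> I (fun x => c * f x) = c * I f.
Proof. by move=> bf; rewrite /I RintegralZl //; exact: bm_integrable. Qed.

Lemma I_sqrB f g : bm f -> bm g ->
  I (fun x => (f x - g x) ^+ 2) =
  I (fun x => f x ^+ 2) - 2 * I (fun x => f x * g x) + I (fun x => g x ^+ 2).
Proof.
move=> bf bg.
have bfg : bm (fun x => f x * g x) := bmM bf bg.
have bf2 := bmX 2 bf; have bg2 := bmX 2 bg.
have -> : (fun x => (f x - g x) ^+ 2) = fun x => (f x ^+ 2 - 2 * (f x * g x)) + g x ^+ 2.
  by apply/funext => x; ring.
by rewrite (I_D (bmB bf2 (bmZ 2 bfg)) bg2) (I_B bf2 (bmZ 2 bfg)) (I_Z 2 bfg).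
Qed.

Lemma I_cst c : I (fun=> c) = c.
Proof. by rewrite /I Rintegral_cst // m1 /= mulr1. Qed.

Lemma I_le f g : bm f -> bm g -> (forall x, f x <= g x) -> I f <= I g.
Proof. by move=> bf bg fg; apply: le_Rintegral => //; exact: bm_integrable. Qed.

Lemma I_ge0 f : (forall x, 0 <= f x) -> 0 <= I f.
Proof. by move=> f0; apply: Rintegral_ge0. Qed.

Lemma I_norm f C : bm f -> (forall x, `|f x| <= C) -> `|I f| <= C.
Proof.
move=> bf fC; rewrite ler_norml -{1}(I_cst (- C)) -{2}(I_cst C).
by apply/andP; split; apply: I_le => //; try exact: bm_cst; move=> x; have := fC x; rewrite ler_norml => /andP[].
Qed.

Lemma I_sum (J : Type) (r : seq J) (F : J -> T -> R) : (forall i, bm (F i)) ->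
  I (fun x => \sum_(i <- r) F i x) = \sum_(i <- r) I (F i).
Proof.
move=> bF; elim: r => [|i r IH].
  by under eq_fun do rewrite big_nil; rewrite I_cst big_nil.
by under eq_fun do rewrite big_cons; rewrite I_D ?IH ?big_cons //; exact: bm_sum.
Qed.

Lemma I_indic A : measurable A -> (I (\1_A))%:E = m A.
Proof.
move=> mA; have h : m A \is a fin_num.
  rewrite ge0_fin_numE //; apply: le_lt_trans (_ : m setT < +oo)%E; last by rewrite m1 ltry.
  by apply: le_measure => //; rewrite inE.
by rewrite /I /Rintegral integral_indic // setIT fineK.
Qed.

End Integral.
End BoundedMeasurable.

Lemma bm_comp d (T : measurableType d) d' (T' : measurableType d') (R : realType)
  (X : T -> T') (f : T' -> R) : measurable_fun setT X -> bm f -> bm (f \o X).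
Proof.
move=> mX [mf [C fC]]; split; first exact: measurableT_comp.
by exists C => x; exact: fC.
Qed.

Lemma I_comp d (T : measurableType d) d' (T' : measurableType d') (R : realType)
  (m : {measure set T -> \bar R}) (m' : {measure set T' -> \bar R})
  (X : T -> T') (f : T' -> R) : measurable_fun setT X -> m setT = 1%E -> m' setT = 1%E ->
  (forall B, measurable B -> m (X @^-1` B) = m' B) -> bm f -> I m (f \o X) = I m' f.
Proof.
move=> mX m1 m1' H bf; apply/eqP; rewrite -subr_eq0; apply/eqP.
apply: (@bm_zero _ _ _ (fun f => I m (f \o X) - I m' f) 2 f bf).
- by move=> g h bg bh; rewrite /= !I_D //; [ring|exact: bm_comp..].
- by move=> c g bg; rewrite /= !I_Z //; [ring|exact: bm_comp].
- move=> g C bg gC; apply: le_trans (ler_normB _ _) _.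
  rewrite mulr2n mulrDl !mul1r; apply: lerD; apply: I_norm => //; first exact: bm_comp.
  by move=> x; exact: gC.
- move=> r; have mL : measurable [set y | r <= f y] by apply: measurable_level; case: bf.
  have mL' : measurable (X @^-1` [set y | r <= f y]) by rewrite -[X in measurable X]setTI; exact: mX.
  have -> : \1_[set y | r <= f y] \o X = \1_(X @^-1` [set y | r <= f y]) :> (T -> R).
    by apply/funext => x; rewrite /= !indicE; congr (_%:R); congr nat_of_bool; apply/idP/idP; rewrite !inE.
  apply/eqP; rewrite subr_eq0 -(inj_eq (@EFin_inj R)) !I_indic //; apply/eqP; exact: H.
Qed.

(** * The semigroup *)

#[local] Opaque I.

Section Semigroup.
Context {R : realType}.
Variables (w : config) (q : R) (mu : probability config R).
Variable K : R -> R.-pker config ~> config.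
Hypothesis hK : kcm_semigroup w q mu K.
Implicit Types (f g h : config -> R) (s t : R) (A B : set config).

Definition Kt t f : config -> R := fun eta => I (K t eta) f.

Local Notation Im := (I mu).

Lemma mu1 : mu setT = 1%E. Proof. exact: probability_setT. Qed.
Lemma K1 t eta : K t eta setT = 1%E. Proof. exact: prob_kernel. Qed.
Local Hint Resolve mu1 K1 : core.

Lemma Kt_D t f g : bm f -> bm g -> Kt t (fun x => f x + g x) = fun x => Kt t f x + Kt t g x.
Proof. by move=> bf bg; apply/funext => x; rewrite /Kt I_D. Qed.

Lemma Kt_Z t c f : bm f -> Kt t (fun x => c * f x) = fun x => c * Kt t f x.
Proof. by move=> bf; apply/funext => x; rewrite /Kt I_Z. Qed.

Lemma Kt_sum t (J : Type) (r : seq J) (F : J -> config -> R) eta : (forall i, bm (F i)) ->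
  Kt t (fun x => \sum_(i <- r) F i x) eta = \sum_(i <- r) Kt t (F i) eta.
Proof. by move=> bF; rewrite /Kt I_sum. Qed.

Lemma Kt_cst t (c : R) : Kt t (fun=> c) = fun=> c.
Proof. by apply/funext => x; rewrite /Kt I_cst. Qed.

Lemma Kt_norm t f C eta : bm f -> (forall x, `|f x| <= C) -> `|Kt t f eta| <= C.
Proof. by move=> bf fC; exact: I_norm. Qed.

Lemma Kt_le t f g eta : bm f -> bm g -> (forall x, f x <= g x) -> Kt t f eta <= Kt t g eta.
Proof. by move=> bf bg fg; exact: I_le. Qed.

Lemma Kt_ge0 t f eta : (forall x, 0 <= f x) -> 0 <= Kt t f eta.
Proof. exact: I_ge0. Qed.

Lemma Kt_indic t A eta : measurable A -> (Kt t \1_A eta)%:E = K t eta A.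
Proof. by move=> mA; rewrite I_indic. Qed.

Lemma bm_Kt t f : bm f -> bm (Kt t f).
Proof.
move=> bf; have [mf [C fC]] := bf; split; last by exists C => x; exact: Kt_norm.
(* The integral against a kernel is measurable for nonnegative integrands, hence the shift by
   [C]. *)
have C0 x : 0 <= f x + C by have := fC x; rewrite ler_norml; lra.
have bC : bm (fun x : config => f x + C) by apply: bmD => //; exact: bm_cst.
have -> : Kt t f = fun x => fine (\int[K t x]_y (f y + C)%:E)%E - C.
  apply/funext => x; rewrite -[X in X - C]/(Kt t (fun y => f y + C) x) Kt_D //; last exact: bm_cst.
  by rewrite Kt_cst addrK.
apply: measurable_funB; last exact: measurable_cst.
apply: measurableT_comp; first exact: fine_measurable.
apply: measurable_fun_integral_kernel => //; first by move=> U mU; exact: measurable_kernel.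
by apply/measurable_EFinP; case: bC.
Qed.

Lemma Im_sym_indic t A B : 0 <= t -> measurable A -> measurable B ->
  Im (fun x => \1_A x * Kt t \1_B x) = Im (fun x => \1_B x * Kt t \1_A x).
Proof.
have [_ _ _ _ rev] := hK; move=> t0 mA mB.
have H A' B' : measurable B' -> measurable A' -> Im (fun x => \1_A' x * Kt t \1_B' x) = fine (\int[mu]_(x in A') K t x B')%E.
  move=> mB' mA'; rewrite -[LHS]/(fine _%:E).
  rewrite I_EFin //; last by apply: bmM; [exact: bm_indic|apply: bm_Kt; exact: bm_indic].
  congr fine; rewrite [RHS]integral_mkcond; apply: eq_integral => x _; rewrite patchE indicE EFinM Kt_indic //.
  by case: ifP => h; [rewrite mul1e|rewrite mul0e].
by rewrite !H // rev.
Qed.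

Lemma Im_sym t f g : 0 <= t -> bm f -> bm g ->
  Im (fun x => f x * Kt t g x) = Im (fun x => g x * Kt t f x).
Proof.
move=> t0.
(* Used twice: to pass from level sets to functions in the second factor, then, with the roles
   exchanged, in the first. *)
have gen f0 g0 : bm f0 -> bm g0 ->
   (forall r, Im (fun x => f0 x * Kt t \1_[set y | r <= g0 y] x) = Im (fun x => \1_[set y | r <= g0 y] x * Kt t f0 x)) ->
   Im (fun x => f0 x * Kt t g0 x) = Im (fun x => g0 x * Kt t f0 x).
  move=> bf bg Hr; apply/eqP; rewrite -subr_eq0; apply/eqP.
  have [_ [C fC]] := bf.
  apply: (@bm_zero _ _ _ (fun g => Im (fun x => f0 x * Kt t g x) - Im (fun x => g x * Kt t f0 x)) (2 * C) g0 bg).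
  - move=> g1 g2 b1 b2; rewrite Kt_D //.
    under [X in I _ X - _]eq_fun do rewrite mulrDr.
    under [X in _ - I _ X]eq_fun do rewrite mulrDl.
    rewrite (I_D mu1 (bmM bf (bm_Kt t b1)) (bmM bf (bm_Kt t b2))).
    rewrite (I_D mu1 (bmM b1 (bm_Kt t bf)) (bmM b2 (bm_Kt t bf))) opprD addrACA //.
  - move=> c g1 b1; rewrite Kt_Z //.
    under [X in I _ X - _]eq_fun do rewrite mulrCA.
    under [X in _ - I _ X]eq_fun do rewrite -mulrA.
    by rewrite (I_Z mu1 c (bmM bf (bm_Kt t b1))) (I_Z mu1 c (bmM b1 (bm_Kt t bf))) mulrBr.
  - move=> g1 D b1 g1D; apply: le_trans (ler_normB _ _) _.
    rewrite -mulrA mulr2n mulrDl !mul1r; apply: lerD; apply: I_norm => //; try by apply: bmM => //; exact: bm_Kt.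
      by move=> x; rewrite normrM; apply: ler_pM => //; exact: Kt_norm.
    by move=> x; rewrite normrM mulrC; apply: ler_pM => //; exact: Kt_norm.
  - by move=> r; apply/eqP; rewrite subr_eq0 Hr.
move=> bf bg; have mL h r : bm h -> measurable [set y | r <= h y] by move=> [mh _]; exact: measurable_level.
have bL h r : bm h -> bm (\1_[set y | r <= h y] : config -> R) by move=> bh; exact: bm_indic (mL h r bh).
apply: (gen f g bf bg) => r; apply/esym; apply: (gen _ f (bL g r bg) bf) => r'.
by apply: Im_sym_indic => //; exact: mL.
Qed.

Lemma Kt_semi s t f : 0 <= s -> 0 <= t -> bm f -> Kt (s + t) f = Kt s (Kt t f).
Proof.
have [_ CK _ _ _] := hK; move=> s0 t0 bf; apply/funext => eta; apply/eqP; rewrite -subr_eq0; apply/eqP.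
apply: (@bm_zero _ _ _ (fun f => Kt (s + t) f eta - Kt s (Kt t f) eta) 2 f bf).
- by move=> g h bg bh; rewrite !Kt_D //; [ring|exact: bm_Kt..].
- by move=> c g bg; rewrite !Kt_Z //; [ring|exact: bm_Kt].
- move=> g C bg gC; apply: le_trans (ler_normB _ _) _.
  rewrite mulr2n mulrDl !mul1r; apply: lerD; apply: Kt_norm => //; first exact: bm_Kt.
  by move=> x; exact: Kt_norm.
- move=> r; have mL : measurable [set y | r <= f y] by apply: measurable_level; case: bf.
  apply/eqP; rewrite subr_eq0 -(inj_eq (@EFin_inj R)) Kt_indic // CK //.
  rewrite /(Kt s _ _) I_EFin //; last by apply: bm_Kt; exact: bm_indic.
  by apply/eqP; apply: eq_integral => x _; rewrite Kt_indic.
Qed.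

Lemma Kt_0 f : bm f -> Kt 0 f = f.
Proof.
have [K0 _ _ _ _] := hK; move=> bf; apply/funext => eta; apply/eqP; rewrite -subr_eq0; apply/eqP.
apply: (@bm_zero _ _ _ (fun f => Kt 0 f eta - f eta) 2 f bf).
- by move=> g h bg bh; rewrite Kt_D //; ring.
- by move=> c g bg; rewrite Kt_Z //; ring.
- move=> g C bg gC; apply: le_trans (ler_normB _ _) _.
  by rewrite mulr2n mulrDl !mul1r; apply: lerD => //; exact: Kt_norm.
- move=> r; have mL : measurable [set y | r <= f y] by apply: measurable_level; case: bf.
  by apply/eqP; rewrite subr_eq0 -(inj_eq (@EFin_inj R)) Kt_indic // K0.
Qed.

Lemma Im_inv t f : 0 <= t -> bm f -> Im (Kt t f) = Im f.
Proof.
move=> t0 bf; have := Im_sym t0 (@bm_cst _ config R 1) bf; rewrite Kt_cst.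
have -> : (fun x => 1 * Kt t f x) = Kt t f by apply/funext => x; rewrite mul1r.
by move=> ->; congr (I _ _); apply/funext => x; rewrite mulr1.
Qed.

Lemma Kt_sqr_le t f eta : bm f -> Kt t f eta ^+ 2 <= Kt t (fun x => f x ^+ 2) eta.
Proof.
move=> bf; set c := Kt t f eta.
have : 0 <= Kt t (fun x => (f x - c) ^+ 2) eta by apply: Kt_ge0 => x; exact: sqr_ge0.
have -> : (fun x : config => (f x - c) ^+ 2) = fun x => f x ^+ 2 + (- (2 * c) * f x + c ^+ 2).
  by apply/funext => x; ring.
have b2 : bm (fun x : config => - (2 * c) * f x) by exact: bmZ.
have bc : bm (fun _ : config => c ^+ 2) by exact: bm_cst.
rewrite Kt_D; [|exact: bmX|exact: bmD].
rewrite Kt_D // Kt_Z // Kt_cst -/c; set X := Kt t _ eta => h.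
by rewrite -subr_ge0; move: h; congr (_ <= _); ring.
Qed.

#[local] Opaque Kt.

Definition corr f t : R := Im (fun x => f x * Kt t f x).

Lemma corr_add f s t : 0 <= s -> 0 <= t -> bm f ->
  corr f (s + t) = Im (fun x => Kt s f x * Kt t f x).
Proof.
move=> s0 t0 bf; rewrite /corr (Kt_semi s0 t0 bf) (Im_sym s0 bf (bm_Kt t bf)).
by congr (I _ _); apply/funext => x; rewrite mulrC.
Qed.

Lemma corr_sqr f t : 0 <= t -> bm f -> corr f (t + t) = Im (fun x => Kt t f x ^+ 2).
Proof. by move=> t0 bf; rewrite (corr_add t0 t0 bf); congr (I _ _); apply/funext => x; rewrite expr2. Qed.

(** With [u = t / 2], reversibility writes the three correlations as scalar products of [Kt u f] and
    [Kt (u + s) f], and convexity says that the squared distance of these two is nonnegative. *)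
Lemma corr_convex f s t : 0 <= s -> 0 <= t -> bm f ->
  2 * corr f (t + s) <= corr f t + corr f (t + 2 * s).
Proof.
move=> s0 t0 bf; have [u [u0 ->]] : exists u, 0 <= u /\ t = u + u.
  by exists (t / 2); split; [rewrite divr_ge0|rewrite -splitr].
have us0 : 0 <= u + s by exact: addr_ge0.
have -> : u + u + s = u + (u + s) by rewrite addrA.
have -> : u + u + 2 * s = (u + s) + (u + s) by ring.
rewrite (corr_sqr u0 bf) (corr_sqr us0 bf) (corr_add u0 us0 bf).
have := I_ge0 mu (fun x => sqr_ge0 (Kt u f x - Kt (u + s) f x)).
rewrite (I_sqrB mu1 (bm_Kt u bf) (bm_Kt (u + s) bf)).
set a := I _ _; set b := I _ _; set c := I _ _; lra.
Qed.

Lemma corr_decr f s t : 0 <= s -> 0 <= t -> bm f -> corr f (t + s) <= corr f t.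
Proof.
move=> s0 t0 bf; have [u [u0 ->]] : exists u, 0 <= u /\ t = u + u.
  by exists (t / 2); split; [rewrite divr_ge0|rewrite -splitr].
have [v [v0 ->]] : exists v, 0 <= v /\ s = v + v.
  by exists (s / 2); split; [rewrite divr_ge0|rewrite -splitr].
have -> : u + u + (v + v) = (v + u) + (v + u) by ring.
rewrite (corr_sqr u0 bf) (corr_sqr (addr_ge0 v0 u0) bf).
have b1 := bm_Kt u bf.
rewrite -(Im_inv v0 (bmX 2 b1)); apply: (I_le mu1).
- exact: bmX (bm_Kt _ bf).
- exact: bm_Kt (bmX 2 b1).
by move=> x; rewrite (Kt_semi v0 u0 bf); exact: Kt_sqr_le.
Qed.

(* By convexity the decrease over [1, 1 + 1/N] is at most a fraction [1/N] of the one over [0, 1]. *)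
Lemma corr_slope f N : (0 < N)%N -> bm f ->
  N%:R * (corr f 1 - corr f (1 + N%:R^-1)) <= corr f 0 - corr f 1.
Proof.
move=> N0 bf; have N0' : 0 < N%:R :> R by rewrite ltr0n.
pose b k := corr f (k%:R / N%:R).
have nn k : 0 <= k%:R / N%:R :> R by rewrite divr_ge0 ?ler0n.
have step k : b k.+1 - b k.+2 <= b k - b k.+1.
  have := corr_convex (nn 1%N) (nn k) bf.
  have -> : k%:R / N%:R + 1%:R / N%:R = k.+1%:R / N%:R :> R by rewrite -mulrDl natr1.
  have -> : k%:R / N%:R + 2 * (1%:R / N%:R) = k.+2%:R / N%:R :> R by rewrite mulrA -mulrDl mulr1 -natrD addn2.
  rewrite -/(b k) -/(b k.+1) -/(b k.+2); move: (b k) (b k.+1) (b k.+2) => x y z; lra.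
have Nne : N%:R != 0 :> R by rewrite gt_eqF.
have bN : b N = corr f 1 by rewrite /b (divff Nne).
have bN1 : b N.+1 = corr f (1 + N%:R^-1) by rewrite /b -natr1 mulrDl (divff Nne) mul1r.
have b0 : b 0%N = corr f 0 by rewrite /b mul0r.
rewrite -b0 -bN -bN1; move: b step {bN bN1 b0}; clear => b step.
have mono k l : b (k + l)%N - b (k + l).+1 <= b k - b k.+1.
  elim: l => [|l IH]; first by rewrite addn0.
  by rewrite addnS; apply: le_trans (step _) IH.
have sumb n : b 0%N - b n = \sum_(0 <= k < n) (b k - b k.+1).
  elim: n => [|n IH]; first by rewrite big_geq ?subrr.
  by rewrite big_nat_recr //= -IH; ring.
rewrite sumb; apply: (@le_trans _ _ (\sum_(0 <= k < N) (b N - b N.+1))).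
  by rewrite sumr_const_nat subn0 mulr_natl.
rewrite big_nat [leRHS]big_nat; apply: ler_sum => k /andP[_ kN].
by rewrite -(subnKC (ltnW kN)); exact: mono.
Qed.

Lemma corr0 f : bm f -> corr f 0 = Im (fun x => f x ^+ 2).
Proof. by move=> bf; rewrite /corr Kt_0 //; congr (I _ _); apply/funext => x; rewrite expr2. Qed.

End Semigroup.

(** * Conditional expectations *)

(** One representative for each pattern on [V]. Expanding over them reduces integrals of functions
    of [V] to cylinder probabilities. *)
Definition atoms (V : seq site) : seq config :=
  foldr (fun x l => [seq update s x true | s <- l] ++ [seq update s x false | s <- l])
    [:: (fun=> false) : config] V.

Section Atoms.
Context {R : realType}.
Implicit Types (V : seq site) (f g : config -> R).

Definition cyl V (s : config) : config -> R := fun eta => (all (fun y => eta y == s y) V)%:R.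

Lemma cyl_depl V eta : dep V (fun s => cyl V s eta).
Proof. by move=> a b e; rewrite /cyl; congr (_%:R); congr nat_of_bool; apply: eq_in_all => y /e ->. Qed.

Lemma cyl_dep V s : dep V (cyl V s).
Proof. by move=> a b e; rewrite /cyl; congr (_%:R); congr nat_of_bool; apply: eq_in_all => y /e ->. Qed.

Lemma cyl_mull V (F : config -> R) s t : dep V F -> cyl V s t * F t = cyl V s t * F s.
Proof.
move=> dF; rewrite /cyl; case: allP => [h|_]; last by rewrite !mul0r.
by rewrite (dF t s) // => y /h /eqP.
Qed.

Lemma sum_atoms V f eta : uniq V -> dep V f -> \sum_(s <- atoms V) f s * cyl V s eta = f eta.
Proof.
elim: V f eta => [|x V IH] f eta /=; first by move=> _ df; rewrite big_seq1 /cyl mulr1; apply: df.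
move=> /andP[xV uV] df; rewrite big_cat !big_map /=.
have H b : \sum_(s <- atoms V) f (update s x b) * cyl (x :: V) (update s x b) eta =
    (eta x == b)%:R * f (update eta x b).
  rewrite -(IH (fun s => f (update s x b)) eta uV) ?mulr_sumr; last first.
    by move=> a c e; apply: df => y; rewrite inE /update; case: eqP => //= _; exact: e.
  apply: eq_bigr => s _; rewrite /cyl /= update_at.
  have -> : all (fun y => eta y == update s x b y) V = all (fun y => eta y == s y) V.
    by apply: eq_in_all => y yV; rewrite update_ne //; apply: contraNneq xV => <-.
  by case: (eta x == b); rewrite /= ?mul1r ?mul0r ?mulr0.
rewrite !H; rewrite -{5}(update_id eta x); case: (eta x) => /=; by rewrite ?mul1r ?mul0r ?addr0 ?add0r.
Qed.

Lemma bm_cyl V s : bm (cyl V s).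
Proof.
split; first by apply: measurable_funP_dep; exact: cyl_dep.
by exists 1 => x; rewrite /cyl; case: all; rewrite ?normr1 ?normr0.
Qed.

Lemma bm_dep V f : uniq V -> dep V f -> bm f.
Proof.
move=> uV df; have -> : f = fun eta => \sum_(s <- atoms V) f s * cyl V s eta.
  by apply/funext => eta; rewrite sum_atoms.
by apply: bm_sum => s; apply: bmZ; exact: bm_cyl.
Qed.

Lemma E_const q V (c : R) : E q V (fun=> c) = c.
Proof. by rewrite /E mean_const. Qed.

Lemma E_sum q V (J : Type) (r : seq J) (F : J -> config -> R) :
  E q V (fun eta => \sum_(i <- r) F i eta) = \sum_(i <- r) E q V (F i).
Proof. by rewrite /E mean_sum. Qed.

Section Law.
Variables (q : R) (mu : probability config R).
Hypothesis hmu : bernoulli_product (1 - q) mu.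

Let mu1 : mu setT = 1%E := mu1 mu.

Lemma I_dep V f : uniq V -> dep V f -> I mu f = E q V f.
Proof.
move=> uV df; have fE : f = fun eta => \sum_(s <- atoms V) f s * cyl V s eta.
  by apply/funext => eta; rewrite sum_atoms.
rewrite fE (I_sum mu1); last by move=> s; apply: bmZ; exact: bm_cyl.
rewrite E_sum; apply: eq_bigr => s _; rewrite (I_Z mu1 _ (bm_cyl V s)) E_scale; congr (_ * _).
pose A : set config := [set eta | all (fun y => eta y == s y) V].
have dA : dep V A.
  move=> a b e; rewrite /A /=; congr is_true; apply: eq_in_all => y /e; by move=> ->.
have -> : cyl V s = \1_A :> (config -> R).
  by apply/funext => eta; rewrite indicE /cyl; congr (_%:R); congr nat_of_bool; apply/idP/idP; rewrite inE.
apply: EFin_inj; rewrite (I_indic mu1); last exact: measurable_dep dA.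
apply: (etrans (law_pr hmu (fun=> false) uV dA)); congr (_%:E); rewrite /pr /E.
Qed.

Hypothesis q01 : 0 < q < 1.

Lemma I_cyl_gt0 V s : uniq V -> 0 < I mu (cyl V s).
Proof.
move=> uV; have [q0 q1] := andP q01; pose A : set config := [set eta | forall x, x \in V -> eta x = s x].
have mA : measurable A.
  apply: (@measurable_dep V) => a b e; apply/propext; split => H x xV; by [rewrite -e ?H|rewrite e ?H].
have -> : cyl V s = \1_A :> (config -> R).
  apply/funext => eta; rewrite indicE /cyl; congr (_%:R); congr nat_of_bool; apply/allP/idP; rewrite inE.
    by move=> h x /h/eqP.
  by move=> h x /h ->.
have : (I mu \1_A)%:E = (\prod_(x <- V) (if s x then 1 - q else 1 - (1 - q)))%:E.
  by rewrite (I_indic mu1 mA); exact: (hmu s uV).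
move=> [->]; apply: prodr_gt0 => x _.
by case: (s x); lra.
Qed.

(** Conditional expectation given the sites of [V], as an elementary quotient: all patterns on [V]
    have positive probability because [0 < q < 1]. *)
Definition cond V g : config -> R := fun eta => I mu (fun z => g z * cyl V eta z) / I mu (cyl V eta).

Lemma cond_dep V g : dep V (cond V g).
Proof.
move=> a b e; rewrite /cond; have -> : cyl V a = cyl V b :> (config -> R).
  by apply/funext => z; exact: (cyl_depl z e).
by [].
Qed.

Lemma I_condM V g h : uniq V -> bm g -> dep V h ->
  I mu (fun z => g z * h z) = I mu (fun z => cond V g z * h z).
Proof.
move=> uV bg dh.
have hE : h = fun eta => \sum_(s <- atoms V) h s * cyl V s eta.
  by apply/funext => eta; rewrite sum_atoms.
have L f : bm f -> I mu (fun z => f z * h z) = \sum_(s <- atoms V) h s * I mu (fun z => f z * cyl V s z).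
  move=> bf; rewrite {1}hE.
  have -> : (fun z => f z * \sum_(s <- atoms V) h s * cyl V s z) =
     fun z => \sum_(s <- atoms V) h s * (f z * cyl V s z).
    by apply/funext => z; rewrite mulr_sumr; apply: eq_bigr => s _; rewrite mulrCA.
  rewrite (I_sum mu1); last by move=> s; apply: bmZ; apply: bmM => //; exact: bm_cyl.
  by apply: eq_bigr => s _; rewrite (I_Z mu1) //; apply: bmM => //; exact: bm_cyl.
rewrite !L //; last by apply: (bm_dep uV); exact: cond_dep.
apply: eq_bigr => s _; congr (_ * _).
have -> : (fun z => cond V g z * cyl V s z) = fun z => cond V g s * cyl V s z.
  by apply/funext => z; rewrite mulrC (cyl_mull _ _ (@cond_dep V g)) mulrC.
by rewrite (I_Z mu1 _ (bm_cyl V s)) /cond divfK // gt_eqF // I_cyl_gt0.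
Qed.

End Law.
End Atoms.

(** * Energy and the slope of correlations *)

(** Off [U], resampling must be invisible at the single configuration [eta], not at all
    configurations; this is what holds for [jump eta]. *)
Lemma generatorE (R : realType) (w : config) (q : R) (U : seq site) (f : config -> R) (eta : config) :
  uniq U -> (forall x, x \notin U -> site_mean q x f eta = f eta) ->
  generator w q f eta = \sum_(x <- U) (constraint w x eta)%:R * (site_mean q x f eta - f eta).
Proof.
move=> uU H; rewrite /generator -(fsbig_widen [set` U] [set: site]) //; first by rewrite -fsbig_seq.
by move=> x [_ /= /negP xU]; rewrite H // subrr mulr0.
Qed.

Lemma site_meanE (R : realType) (q : R) x f : site_mean q x f = mean1 (1 - q) x f.
Proof. by apply/funext => eta; rewrite /site_mean /mean1 addrC; congr (_ + _ * _); ring. Qed.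

Section Slope.
Context {R : realType}.
Variables (w : config) (q : R) (mu : probability config R).
Hypothesis q01 : 0 < q < 1.
Hypothesis hmu : bernoulli_product (1 - q) mu.
Variable K : R -> R.-pker config ~> config.
Hypothesis hK : kcm_semigroup w q mu K.
Variables (V U : seq site) (G : config -> R).
Hypothesis (uV : uniq V) (uU : uniq U) (dG : dep V G).
Hypothesis UV : {subset U <= V}.
Hypothesis UnV : forall x y, x \in U -> y \in neighbors x -> y \in V.
Implicit Types (eta zeta : config) (s t : R) (f g : config -> R).

Let mu1 : mu setT = 1%E := mu1 mu.
Local Notation Im := (I mu).
Local Notation T t F := (Kt K t).

(* [zeta] is obtained from [eta] by flipping one site of [U], as seen from [V]. *)
Definition flipped eta zeta : bool :=
  has (fun x => all (fun y => zeta y == update eta x (~~ eta x) y) V) U.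

Lemma flipped_sym eta zeta : flipped eta zeta = flipped zeta eta.
Proof.
suff H a b : flipped a b -> flipped b a by apply/idP/idP; exact: H.
move=> /hasP[x xU /allP h]; apply/hasP; exists x => //; apply/allP => y yV.
have hx := eqP (h x (UV xU)); rewrite update_at in hx.
case: (eqVneq y x) => [->|yx]; first by rewrite update_at hx negbK.
by have := h y yV; rewrite !update_ne // eq_sym.
Qed.

Lemma flipped_depl zeta : dep V (fun eta => flipped eta zeta).
Proof.
move=> a b e; apply: eq_in_has => x xU; apply: eq_in_all => y yV.
by rewrite /update (e x (UV xU)) (e y yV).
Qed.

Lemma flipped_depr eta : dep V (flipped eta).
Proof. by move=> a b e; rewrite flipped_sym [RHS]flipped_sym; exact: flipped_depl. Qed.

(** The increment of [G], kept only along a single flip in [U]. The cut-off makes its generator at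
    [eta] a sum over [U], although [G] may depend on further sites of [V], and its antisymmetry
    combines well with reversibility. *)
Definition jump eta zeta : R := (flipped eta zeta)%:R * (G eta - G zeta).

Lemma jump_anti eta zeta : jump eta zeta = - jump zeta eta.
Proof. by rewrite /jump flipped_sym -mulrN opprB. Qed.

Lemma jump_depl zeta : dep V (fun eta => jump eta zeta).
Proof. by move=> a b e; rewrite /jump (flipped_depl zeta e) (dG e). Qed.

Lemma jump_depr eta : dep V (jump eta).
Proof. by move=> a b e; rewrite /jump (flipped_depr eta e) (dG e). Qed.

Lemma jump_diag eta : jump eta eta = 0.
Proof. by rewrite /jump subrr mulr0. Qed.

Lemma jump_update eta x b :
  jump eta (update eta x b) = (x \in U)%:R * (G eta - G (update eta x b)).
Proof.
rewrite /jump; case: (eqVneq b (eta x)) => [->|bx].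
  by rewrite update_id subrr !mulr0.
have bE : b = ~~ eta x by move: bx; case: b (eta x) => [] [].
case: (boolP (x \in U)) => xU.
  congr (_%:R * _); congr nat_of_bool; apply/hasP; exists x => //; apply/allP => y _; by rewrite bE.
rewrite mul0r; case: (boolP (x \in V)) => xV; last first.
  by rewrite (dep_indep dG xV) subrr mulr0.
rewrite /flipped; case: hasP => [[y yU /allP /(_ x xV)]|_]; last by rewrite mul0r.
rewrite update_at update_ne; last by apply: contraNneq xU => ->.
by rewrite (negbTE bx).
Qed.

Definition drift eta : R := \sum_(x <- U) (constraint w x eta)%:R * (G eta - site_mean q x G eta).
Definition drift2 eta : R := \sum_(x <- U) (constraint w x eta)%:R *
  site_mean q x (fun z => (G eta - G z) ^+ 2) eta.

Lemma generator_jump eta : generator w q (jump eta) eta = drift eta.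
Proof.
rewrite (generatorE (U := U) w) //.
  rewrite /drift big_seq [RHS]big_seq; apply: eq_bigr => x xU; congr (_ * _).
  by rewrite /site_mean !jump_update jump_diag xU subr0 !mul1r; ring.
by move=> x xU; rewrite /site_mean !jump_update jump_diag (negbTE xU) !mul0r; ring.
Qed.

Lemma generator_jump2 eta : generator w q (fun z => jump eta z ^+ 2) eta = drift2 eta.
Proof.
rewrite (generatorE (U := U) w) //.
  rewrite /drift2 big_seq [RHS]big_seq; apply: eq_bigr => x xU; congr (_ * _).
  by rewrite /site_mean !jump_update jump_diag xU !mul1r; ring.
by move=> x xU; rewrite /site_mean !jump_update jump_diag (negbTE xU) !mul0r; ring.
Qed.

Lemma constraint_dep x : x \in U -> dep V (constraint w x).
Proof.
move=> xU a b e; rewrite /constraint; case: ifP => _.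
  congr leq; rewrite !big_seq; apply: eq_bigr => y yn; by rewrite (e _ (UnV xU yn)).
by rewrite !e //; apply: (UnV xU); rewrite /neighbors !inE eqxx ?orbT.
Qed.

Lemma constraint_indep x : indep x (constraint w x).
Proof.
move=> eta b; rewrite /constraint.
have ne y : y \in neighbors x -> y != x.
  by rewrite /neighbors !inE => /or4P[] /eqP ->; case: x => x1 x2; rewrite /eq_op /=; lia.
case: ifP => _.
  congr leq; rewrite !big_seq; apply: eq_bigr => y yn; by rewrite update_ne // ne.
by rewrite !update_ne // ne // /neighbors !inE eqxx ?orbT.
Qed.

Lemma site_mean_dep x f : x \in V -> dep V f -> dep V (site_mean q x f).
Proof. by move=> xV df; rewrite site_meanE; exact: (@dep_mean R (1 - q) [:: x]). Qed.

Lemma sum_dep (F : site -> config -> R) : (forall x, x \in U -> dep V (F x)) ->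
  dep V (fun eta => \sum_(x <- U) F x eta).
Proof. by move=> dF a b e; rewrite !big_seq; apply: eq_bigr => x xU; rewrite (dF x xU _ _ e). Qed.

Lemma drift_dep : dep V drift.
Proof.
apply: sum_dep => x xU a b e.
by rewrite (constraint_dep xU e) (dG e) (site_mean_dep (UV xU) dG e).
Qed.

Lemma drift2_dep : dep V drift2.
Proof.
apply: sum_dep => x xU.
have H b : dep V (fun eta => G (update eta x b)).
  by move=> a c e; apply: dG => y yV; rewrite /update; case: eqP => // _; exact: e.
move=> a c e; rewrite (constraint_dep xU e) /site_mean (dG e) (H true _ _ e) (H false _ _ e) //.
Qed.

Local Notation en := (energy w q V U G).

Lemma E_drift : E q V (fun eta => G eta * drift eta) = q * (1 - q) * en.
Proof.
have -> : (fun eta => G eta * drift eta) = fun eta =>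
    \sum_(x <- U) (constraint w x eta)%:R * (G eta * (G eta - mean1 (1 - q) x G eta)).
  by apply/funext => eta; rewrite mulr_sumr; apply: eq_bigr => x _; rewrite site_meanE mulrCA.
rewrite E_sum /energy mulr_sumr big_seq [RHS]big_seq; apply: eq_bigr => x xU.
have xV : {subset [:: x] <= V} by move=> y; rewrite inE => /eqP->; exact: UV.
rewrite -(E_mean _ _ xV) -E_scale; congr (E _ _ _); apply/funext => eta /=.
rewrite mean1_mull; last by move=> z b; rewrite constraint_indep.
rewrite mulrCA; congr (_ * _); rewrite /mean1 /dif !updateK; ring.
Qed.

Lemma E_drift2 : E q V drift2 = 2 * (q * (1 - q)) * en.
Proof.
rewrite /drift2 E_sum /energy mulr_sumr big_seq [RHS]big_seq; apply: eq_bigr => x xU.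
have xV : {subset [:: x] <= V} by move=> y; rewrite inE => /eqP->; exact: UV.
rewrite -(E_mean _ _ xV) -E_scale; congr (E _ _ _); apply/funext => eta /=.
rewrite mean1_mull; last by move=> z b; rewrite constraint_indep.
rewrite mulrCA; congr (_ * _); rewrite /site_mean /mean1 /dif !updateK; ring.
Qed.

(** The expectation of [F] at the pair (initial state, state at time [t]) for the process started
    from [eta]. *)
Definition diag t (F : config -> config -> R) : config -> R := fun eta => Kt K t (F eta) eta.

Section Diag.
Variable F : config -> config -> R.
Hypothesis dF : forall zeta, dep V (fun eta => F eta zeta).
Hypothesis bF : forall eta, bm (F eta).

Let F_eq a b : (forall x, x \in V -> a x = b x) -> F a = F b.
Proof. by move=> e; apply/funext => z; exact: dF. Qed.

Lemma diag_atoms t eta : diag t F eta = \sum_(s <- atoms V) Kt K t (F s) eta * cyl V s eta.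
Proof.
by rewrite (sum_atoms (f := fun s : config => Kt K t (F s) eta)) // => a b e; rewrite (F_eq e).
Qed.

Lemma bm_diag t : bm (diag t F).
Proof.
have -> : diag t F = fun eta => \sum_(s <- atoms V) Kt K t (F s) eta * cyl V s eta.
  by apply/funext => eta; exact: diag_atoms.
by apply: bm_sum => s; apply: bmM; [exact: bm_Kt|exact: bm_cyl].
Qed.

Lemma I_diag t : 0 <= t ->
  Im (diag t F) = Im (fun z => \sum_(s <- atoms V) F s z * Kt K t (cyl V s) z).
Proof.
move=> t0; have -> : diag t F = fun eta => \sum_(s <- atoms V) cyl V s eta * Kt K t (F s) eta.
  by apply/funext => eta; rewrite diag_atoms; apply: eq_bigr => s _; rewrite mulrC.
have bc (s : config) : bm (cyl V s : config -> R) := bm_cyl V s.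
rewrite (I_sum mu1) => [|s]; last by apply: bmM => //; exact: bm_Kt.
rewrite (I_sum mu1) => [|s]; last by apply: bmM => //; exact: bm_Kt.
by apply: eq_bigr => s _; rewrite (Im_sym hK t0 (bc s) (bF s)).
Qed.

Lemma diag_rate (L : config -> R) (e : R) : dep V L ->
  (forall eta, local_fun (F eta)) -> (forall eta, F eta eta = 0) ->
  (forall eta, generator w q (F eta) eta = L eta) -> 0 < e ->
  \forall t \near 0^'+, forall eta, `|diag t F eta - t * L eta| <= t * e.
Proof.
move=> dL lF F0 FL e0; have [_ _ _ rate _] := hK.
have H (l : seq config) : \forall t \near 0^'+, forall eta,
    \sum_(s <- l) `|Kt K t (F s) eta - t * L eta| * cyl V s eta <= \sum_(s <- l) (t * e) * cyl V s eta.
  elim: l => [|s l IH]; first by near=> t; move=> eta; rewrite !big_nil.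
  apply: filterS3 (nbhs_right_gt 0) IH (rate _ (lF s) _ e0) => t t0 IHt rt eta.
  rewrite !big_cons; apply: lerD; last exact: IHt.
  rewrite /cyl; case: allP => [h|_]; last by rewrite !mulr0.
  rewrite !mulr1.
  have e1 x : x \in V -> s x = eta x by move=> /h/eqP.
  have := rt eta; rewrite (F_eq e1) F0 FL subr0 => hr.
  have -> : Kt K t (F eta) eta - t * L eta = t * (Kt K t (F eta) eta / t - L eta).
    by rewrite mulrBr mulrCA divff ?mulr1 // gt_eqF.
  by rewrite normrM gtr0_norm // ler_pM2l.
apply: filterS (H (atoms V)) => t h eta; have {h} := h eta.
rewrite (sum_atoms (f := fun s : config => `|Kt K t (F s) eta - t * L eta|)) //; last first.
  by move=> a b e1; rewrite (F_eq e1).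
by rewrite (sum_atoms (f := fun _ : config => t * e)).
Unshelve. all: by end_near.
Qed.

End Diag.

(** Average the square of [g eta - g zeta - jump eta zeta] over the stationary two-time law.
    Stationarity makes the two squares of [g] equal; reversibility and antisymmetry make the two
    cross terms with [jump] add up, whence the coefficient 4. *)
Lemma diag_lower g t : 0 <= t -> bm g ->
  4 * Im (fun z => g z * diag t jump z) - Im (diag t (fun eta zeta => jump eta zeta ^+ 2)) <=
  2 * (Im (fun z => g z ^+ 2) - Im (fun z => g z * Kt K t g z)).
Proof.
move=> t0 bg.
have bj eta : bm (jump eta) by apply: (bm_dep uV); exact: jump_depr.
have bgj eta : bm (fun z => g z * jump eta z) := bmM bg (bj eta).
have bj2 eta : bm (fun z => jump eta z ^+ 2) := bmX 2 (bj eta).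
have dgj zeta : dep V (fun eta => g zeta * jump eta zeta) by move=> a b e; rewrite (jump_depl zeta e).
have dj2 zeta : dep V (fun eta => jump eta zeta ^+ 2) by move=> a b e; rewrite (jump_depl zeta e).
have bg2 := bmX 2 bg.
have bD := bm_diag jump_depl bj t.
have bD2 := bm_diag dj2 bj2 t.
have bDg := bm_diag dgj bgj t.
have bK := bm_Kt K t bg; have bK2 := bm_Kt K t bg2.
have cross : Im (diag t (fun eta zeta => g zeta * jump eta zeta)) = - Im (fun z => g z * diag t jump z).
  rewrite (I_diag dgj bgj t0).
  have -> : (fun z => \sum_(s <- atoms V) g z * jump s z * Kt K t (cyl V s) z) =
    fun z => -1 * (g z * diag t jump z).
    apply/funext => z; under eq_bigr do rewrite -mulrA; rewrite -mulr_sumr mulrCA; congr (_ * _).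
    have bc (s : config) : bm (cyl V s : config -> R) := bm_cyl V s.
    transitivity (Kt K t (fun eta => \sum_(s <- atoms V) jump s z * cyl V s eta) z).
      by rewrite (Kt_sum K t) => [|s]; [apply: eq_bigr => s _; rewrite (Kt_Z K t _ (bc s))|exact: bmZ].
    rewrite /diag mulN1r -mulN1r -[RHS]/((fun x => -1 * Kt K t (jump z) x) z) -(Kt_Z K t (-1) (bj z)).
    by congr (Kt K t _ z); apply/funext => eta; rewrite (sum_atoms _ uV (jump_depl z)) jump_anti mulN1r.
  by rewrite (I_Z mu1 _ (bmM bg bD)) mulN1r.
have pt eta : 0 <= g eta ^+ 2 - 2 * (g eta * Kt K t g eta) + Kt K t (fun z => g z ^+ 2) eta
    - 2 * (g eta * diag t jump eta) + 2 * diag t (fun eta zeta => g zeta * jump eta zeta) eta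
    + diag t (fun eta zeta => jump eta zeta ^+ 2) eta.
  pose c := g eta.
  have : 0 <= Kt K t (fun z => (c - g z - jump eta z) ^+ 2) eta by apply: Kt_ge0 => z; exact: sqr_ge0.
  have -> : (fun z => (c - g z - jump eta z) ^+ 2) = fun z => c ^+ 2 + (- (2 * c) * g z + (g z ^+ 2 +
      (- (2 * c) * jump eta z + (2 * (g z * jump eta z) + jump eta z ^+ 2)))).
    by apply/funext => z; ring.
  have b5 := bmZ 2 (bgj eta); have b4 := bmZ (- (2 * c)) (bj eta); have b2 := bmZ (- (2 * c)) bg.
  have b56 := bmD b5 (bj2 eta); have b456 := bmD b4 b56; have b3 := bmD bg2 b456; have b23 := bmD b2 b3.
  rewrite (Kt_D K t (@bm_cst _ config R (c ^+ 2)) b23) (Kt_D K t b2 b3) (Kt_D K t bg2 b456) (Kt_D K t b4 b56) (Kt_D K t b5 (bj2 eta)).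
  rewrite (Kt_cst K t) (Kt_Z K t _ bg) (Kt_Z K t _ (bj eta)) (Kt_Z K t 2 (bgj eta)).
  rewrite -/(diag t jump eta) -/(diag t (fun eta zeta => jump eta zeta ^+ 2) eta)
     -/(diag t (fun eta zeta => g zeta * jump eta zeta) eta) /c.
  by set X := Kt K t _ eta; set Y := diag _ _ _; set Z := diag _ _ _; set X' := Kt K t _ eta; set W := diag _ _ _; lra.
have bgK := bmM bg bK; have bgD := bmM bg bD.
have : 0 <= Im (fun eta => g eta ^+ 2 - 2 * (g eta * Kt K t g eta) + Kt K t (fun z => g z ^+ 2) eta
    - 2 * (g eta * diag t jump eta) + 2 * diag t (fun eta zeta => g zeta * jump eta zeta) eta
    + diag t (fun eta zeta => jump eta zeta ^+ 2) eta) by apply: I_ge0.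
have c1 := bmB bg2 (bmZ 2 bgK); have c2 := bmD c1 bK2; have c3 := bmB c2 (bmZ 2 bgD).
have c4 := bmD c3 (bmZ 2 bDg).
rewrite (I_D mu1 c4 bD2) (I_D mu1 c3 (bmZ 2 bDg)) (I_B mu1 c2 (bmZ 2 bgD)) (I_D mu1 c1 bK2) (I_B mu1 bg2 (bmZ 2 bgK)).
rewrite (I_Z mu1 2 bgK) (I_Z mu1 2 bgD) (I_Z mu1 2 bDg) cross (Im_inv hK t0 bg2).
set X := I _ _; set Y := I _ _; set Z := I _ _; set W := I _ _; lra.
Qed.

(** To first order in [t] the two jump terms of [diag_lower] are [q * (1 - q)] and
    [2 * (q * (1 - q))] times the energy of [G]. As [4 - 2 = 2], the factor 2 on the other side
    leaves exactly one energy. In the cross term [g] may be replaced by [G] because the drift only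
    sees [V]. *)
Lemma energy_slope g (e : R) : bm g -> (forall z, `|g z| <= 1) -> G = cond mu V g -> 0 < e ->
  \forall t \near 0^'+, t * (q * (1 - q) * en - e) <= Im (fun z => g z ^+ 2) - Im (fun z => g z * Kt K t g z).
Proof.
(* Four times the error of the first expansion plus once that of the second. *)
move=> bg g1 GE e0; have e5 : 0 < e / 5 by rewrite divr_gt0.
have dj2 zeta : dep V (fun eta => jump eta zeta ^+ 2) by move=> a b h; rewrite (jump_depl zeta h).
have bj eta : bm (jump eta) by apply: (bm_dep uV); exact: jump_depr.
have bj2 eta : bm (fun z => jump eta z ^+ 2) := bmX 2 (bj eta).
have lj eta : local_fun (jump eta) by exists V; exact: jump_depr.
have lj2 eta : local_fun (fun z => jump eta z ^+ 2).
  by exists V => a b h; rewrite (jump_depr eta h).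
have j0 eta : jump eta eta ^+ 2 = 0 by rewrite jump_diag expr0n.
have r1 := diag_rate jump_depl drift_dep lj jump_diag generator_jump e5.
have r2 := diag_rate dj2 drift2_dep lj2 j0 generator_jump2 e5.
apply: filterS3 (nbhs_right_gt 0) r1 r2 => t t0 h1 h2.
have lo := diag_lower (ltW t0) bg.
have bD := bm_diag jump_depl bj t; have bD2 := bm_diag dj2 bj2 t.
have bdr : bm drift by apply: (bm_dep uV); exact: drift_dep.
have bdr2 : bm drift2 by apply: (bm_dep uV); exact: drift2_dep.
have s1 : `|Im (fun z => g z * (diag t jump z - t * drift z))| <= t * (e / 5).
  apply: (I_norm mu1); first by apply: bmM => //; apply: bmB => //; exact: bmZ.
  move=> z; rewrite normrM -[leRHS]mul1r; apply: ler_pM => //; exact: h1.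
have s2 : `|Im (fun z => diag t (fun eta zeta => jump eta zeta ^+ 2) z - t * drift2 z)| <= t * (e / 5).
  by apply: (I_norm mu1); [apply: bmB => //; exact: bmZ|exact: h2].
have bgd := bmM bg bdr; have bgD := bmM bg bD.
have E1 : Im (fun z => g z * (diag t jump z - t * drift z)) = Im (fun z => g z * diag t jump z) - t * (q * (1 - q) * en).
  have -> : (fun z => g z * (diag t jump z - t * drift z)) = fun z => g z * diag t jump z - t * (g z * drift z).
    by apply/funext => z; ring.
  rewrite (I_B mu1 bgD (bmZ t bgd)) (I_Z mu1 t bgd) (I_condM hmu q01 uV bg drift_dep) -GE.
  have dGd : dep V (fun z => G z * drift z) by move=> a b h; rewrite (dG h) (drift_dep h).
  by rewrite (I_dep hmu uV dGd) E_drift.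
have E2 : Im (fun z => diag t (fun eta zeta => jump eta zeta ^+ 2) z - t * drift2 z) =
    Im (diag t (fun eta zeta => jump eta zeta ^+ 2)) - t * (2 * (q * (1 - q)) * en).
  by rewrite (I_B mu1 bD2 (bmZ t bdr2)) (I_Z mu1 t bdr2) (I_dep hmu uV drift2_dep) E_drift2.
rewrite E1 ler_norml in s1; rewrite E2 ler_norml in s2.
have te : 0 < t * (e / 5) by rewrite mulr_gt0.
move: s1 s2 te lo => /andP[s1 _] /andP[_ s2].
have -> : t * (q * (1 - q) * en - e) = t * (q * (1 - q) * en) - 5 * (t * (e / 5)) by field.
have tE : t * (2 * (q * (1 - q)) * en) = 2 * (t * (q * (1 - q) * en)) by ring.
rewrite tE in s2; move: s1 s2; set A := t * (q * _ * _); set B := t * (e / 5); set X := I _ _; set Y := I _ _; set Z := I _ _; set W := I _ _.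
lra.
Qed.

End Slope.

(** * Density of local functions in the mean square *)

Section LocalApprox.
Context {R : realType}.
Variable mu : probability config R.
Implicit Types (f g h : config -> R) (A B : set config).

Let mu1 : mu setT = 1%E := mu1 mu.

Lemma I_tri f g h : bm f -> bm g -> bm h ->
  I mu (fun z => (f z - h z) ^+ 2) <= 2 * I mu (fun z => (f z - g z) ^+ 2) + 2 * I mu (fun z => (g z - h z) ^+ 2).
Proof.
move=> bf bg bh.
have b1 := bmX 2 (bmB bf bg); have b2 := bmX 2 (bmB bg bh).
rewrite -(I_Z mu1 2 b1) -(I_Z mu1 2 b2) -(I_D mu1 (bmZ 2 b1) (bmZ 2 b2)).
apply: (I_le mu1); [exact: bmX 2 (bmB bf bh)|exact: bmD (bmZ 2 b1) (bmZ 2 b2)|move=> z].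
have : 0 <= (f z - g z - (g z - h z)) ^+ 2 by exact: sqr_ge0.
set a := f z; set b := g z; set c := h z; nra.
Qed.

Lemma bm_box n h : dep (box 0 n) h -> bm h.
Proof. by move=> dh; apply: bm_dep dh; exact: box_uniq. Qed.

Lemma box_sub (k l : nat) : (k <= l)%N -> {subset box 0 k <= box 0 l}.
Proof. by move=> kl x; rewrite !mem_box; lia. Qed.

Lemma dep_box_le (T : Type) (k l : nat) (f : config -> T) : (k <= l)%N -> dep (box 0 k) f -> dep (box 0 l) f.
Proof. by move=> kl; apply: dep_sub; exact: box_sub. Qed.

(** These sets are shown to form a sigma-algebra containing the cylinders, hence to be all
    measurable sets. *)
Definition approxS : set (set config) := [set A | measurable A /\
  forall e : R, 0 < e -> exists n A', dep (box 0 n) A' /\ I mu (fun z => (\1_A z - \1_A' z) ^+ 2) <= e].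

Lemma dep_indic V A : dep V A -> dep V (\1_A : config -> R).
Proof.
move=> dA a b e; rewrite !indicE; congr (_%:R); congr nat_of_bool; apply/idP/idP; rewrite !inE.
  by rewrite (dA a b e).
by rewrite (dA a b e).
Qed.

Lemma bm_box_indic n A : dep (box 0 n) A -> bm (\1_A : config -> R).
Proof. by move=> dA; apply: bm_box; exact: dep_indic dA. Qed.

Lemma approxS_sub A B A' B' z : ((\1_(A `|` B) z - \1_(A' `|` B') z) ^+ 2 : R) <=
  (\1_A z - \1_A' z) ^+ 2 + (\1_B z - \1_B' z) ^+ 2.
Proof.
rewrite !indicE !in_setU.
by case: (z \in A); case: (z \in A'); case: (z \in B); case: (z \in B') => /=; lra.
Qed.

Lemma approxSU A B : approxS A -> approxS B -> approxS (A `|` B).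
Proof.
move=> [mA HA] [mB HB]; split; first exact: measurableU.
move=> e e0; have e2 : 0 < e / 2 by rewrite divr_gt0.
have [n [A' [dA' hA]]] := HA _ e2; have [m [B' [dB' hB]]] := HB _ e2.
have dU : dep (box 0 (maxn n m)) (A' `|` B').
  move=> a b h; rewrite /setU /=; congr (_ \/ _).
    exact: (dep_box_le (leq_maxl n m) dA').
  exact: (dep_box_le (leq_maxr n m) dB').
exists (maxn n m), (A' `|` B'); split => //.
have bA : bm (\1_A : config -> R) := bm_indic R mA.
have bB : bm (\1_B : config -> R) := bm_indic R mB.
have bA' : bm (\1_A' : config -> R) := bm_box_indic dA'.
have bB' : bm (\1_B' : config -> R) := bm_box_indic dB'.
have bU : bm (\1_(A `|` B) : config -> R) := bm_indic R (measurableU _ _ mA mB).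
have bU' : bm (\1_(A' `|` B') : config -> R) := bm_box_indic dU.
have b1 := bmX 2 (bmB bA bA'); have b2 := bmX 2 (bmB bB bB').
rewrite [e]splitr; apply: le_trans (lerD hA hB).
rewrite -(I_D mu1 b1 b2); apply: (I_le mu1); [exact: bmX 2 (bmB bU bU')|exact: bmD|].
by move=> z; exact: approxS_sub.
Qed.

Lemma approxS_dep n A : dep (box 0 n) A -> approxS A.
Proof.
move=> dA; split; first exact: measurable_dep dA.
move=> e e0; exists n, A; split => //.
rewrite (_ : (fun z => _) = fun=> 0); first by rewrite (I_cst mu1) ltW.
by apply/funext => z; rewrite subrr expr0n.
Qed.

Lemma approxSP A : measurable A -> approxS A.
Proof.
suff S : <<s cylinders >> `<=` approxS by exact: S.
move=> {A}; apply: smallest_sub; last first.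
  move=> _ [x [b ->]]; apply: (@approxS_dep (maxn `|x.1| `|x.2|)) => a c e /=; congr (_ = _); apply: e.
  by rewrite mem_box /= !subr0; case: x => x y /=; lia.
split.
- by apply: (@approxS_dep 0).
- move=> A [mA HA]; rewrite setTD; split; first exact: measurableC.
  move=> e e0; have [n [A' [dA' hA]]] := HA _ e0; exists n, (~` A'); split.
    by move=> a b h; rewrite /setC /= (dA' a b h).
  apply: le_trans hA; rewrite le_eqVlt; apply/orP; left; apply/eqP; congr (I _ _).
  by apply/funext => z; rewrite !indicE !in_setC; case: (z \in A); case: (z \in A');
    rewrite /= ?subrr ?subr0 ?sub0r ?sqrrN.
- suff H (F : nat -> set config) : (forall n, approxS (F n)) -> approxS (\bigcup_k F k) by exact: H.
  move=> HF; pose B n := \bigcup_(k < n) F k.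
  have HB n : approxS (B n).
    elim: n => [|n IH]; first by rewrite /B bigcup_mkord big_ord0; apply: (@approxS_dep 0).
    by rewrite /B bigcup_mkord big_ord_recr /= -bigcup_mkord; exact: approxSU.
  have mF : measurable (\bigcup_k F k) by apply: bigcup_measurable => k _; case: (HF k).
  have mB n : measurable (B n) by case: (HB n).
  have BF : \bigcup_n B n = \bigcup_k F k.
    apply/seteqP; split => [z [n _ [k kn Fk]]|z [k _ Fk]]; first by exists k.
    by exists k.+1 => //; exists k => /=.
  have ndB : nondecreasing_seq B.
    by apply/nondecreasing_seqP => n; apply/subsetPset => z [k /= kn Fk]; exists k => //=; exact: ltnW.
  split => // e e0; have e4 : 0 < e / 4 by rewrite divr_gt0.
  have cv : mu (B n) @[n --> \oo] --> mu (\bigcup_n B n).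
    by apply: nondecreasing_cvg_mu => //; rewrite BF.
  have bF : bm (\1_(\bigcup_k F k) : config -> R) := bm_indic R mF.
  have bB n : bm (\1_(B n) : config -> R) := bm_indic R (mB n).
  have [n hn] : exists n, I mu (fun z => (\1_(\bigcup_k F k) z - \1_(B n) z) ^+ 2) <= e / 4.
    rewrite BF -(I_indic mu1 mF) in cv.
    have cv' : (I mu (\1_(B n)))%:E @[n --> \oo] --> (I mu (\1_(\bigcup_k F k)))%:E.
      by apply: cvg_trans cv; apply: near_eq_cvg; near=> n; rewrite (I_indic mu1 (mB n)).
    move/fine_cvgP : cv' => [_ /cvgrPdist_le /(_ _ e4)[N _ /(_ N (leqnn N)) /=]] h.
    exists N; apply: le_trans h.
    apply: le_trans (ler_norm _); rewrite -(I_B mu1 bF (bB N)).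
    apply: (I_le mu1); [exact: bmX 2 (bmB bF (bB N))|exact: bmB bF (bB N)|move=> z].
    have sub : z \in B N -> z \in \bigcup_k F k by rewrite !inE -BF => h'; exists N.
    rewrite !indicE; case E1 : (z \in B N).
      by rewrite sub // subrr expr0n.
    by case: (z \in _); rewrite subr0 ?expr1n ?expr0n.
  have [m [A' [dA' hA]]] := (HB n).2 _ e4.
  exists m, A'; split => //.
  apply: (le_trans (I_tri bF (bB n) (bm_box_indic dA'))).
  by move: hn hA; set X := I _ _; set Y := I _ _; lra.
Unshelve. all: by end_near.
Qed.

Lemma local_approx f (e : R) : bm f -> 0 < e ->
  exists n h, dep (box 0 n) h /\ I mu (fun z => (f z - h z) ^+ 2) <= e.
Proof.
(* An error at most 1 has a square no larger than itself, hence at most [e / 4]. *)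
move=> bf e0; have e8 : 0 < Num.min 1 (e / 4) by rewrite lt_min ltr01 divr_gt0.
have [s hs] := bm_approx bf e8; set S := fun x => _ in hs.
have bl r : bm (\1_[set y | r <= f y] : config -> R).
  by apply: bm_indic; apply: measurable_level; case: bf.
suff [n [h [dh hh]]] : exists n h, dep (box 0 n) h /\ I mu (fun z => (\sum_(cr <- s) cr.1 * \1_[set y | cr.2 <= f y] z - h z) ^+ 2) <= e / 4.
  exists n, h; split => //.
  have bS : bm (fun z => \sum_(cr <- s) cr.1 * \1_[set y | cr.2 <= f y] z) by apply: bm_sum => i; exact: bmZ.
  apply: (le_trans (I_tri bf bS (bm_box dh))).
  have : I mu (fun z => (f z - \sum_(cr <- s) cr.1 * \1_[set y | cr.2 <= f y] z) ^+ 2) <= e / 4.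
    rewrite -[leRHS](I_cst mu1); apply: (I_le mu1); [exact: bmX 2 (bmB bf bS)|exact: bm_cst|move=> z].
    have := hs z; rewrite le_min => /andP[h1 h2]; apply: le_trans h2.
    by rewrite -real_normK ?num_real // expr2 ler_piMl.
  by move: hh; set X := I _ _; set Y := I _ _; lra.
clear hs S; elim: s (e / 4) (divr_gt0 e0 (ltr0n R 4)) => [|cr s IH] d d0.
  exists 0%N, (fun=> 0); split => //.
  rewrite (_ : (fun z => _) = fun=> 0); first by rewrite (I_cst mu1) ltW.
  by apply/funext => z; rewrite big_nil subrr expr0n.
have d4 : 0 < d / 4 by rewrite divr_gt0.
have [n [h [dh hh]]] := IH _ d4.
have c0 : 0 < cr.1 ^+ 2 + 1 by rewrite ltr_wpDl ?sqr_ge0.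
have d5 : 0 < d / 4 / (cr.1 ^+ 2 + 1) by rewrite divr_gt0.
have mL : measurable [set y | cr.2 <= f y] by apply: measurable_level; case: bf.
have [m [A' [dA' hA]]] := (approxSP mL).2 _ d5.
pose h' z : R := cr.1 * \1_A' z + h z.
have dh' : dep (box 0 (maxn n m)) h'.
  move=> a b ee; rewrite /h' (dep_box_le (leq_maxl n m) dh ee).
  by rewrite (dep_indic (dep_box_le (leq_maxr n m) dA') ee).
exists (maxn n m), h'; split => //.
have bS : bm (fun z => \sum_(cr <- s) cr.1 * \1_[set y | cr.2 <= f y] z) by apply: bm_sum => i; exact: bmZ.
have bA' : bm (\1_A' : config -> R) := bm_box_indic dA'.
have b1 := bmX 2 (bmB (bl cr.2) bA'); have b2 := bmX 2 (bmB bS (bm_box dh)).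
apply: (@le_trans _ _ (2 * (cr.1 ^+ 2 * (d / 4 / (cr.1 ^+ 2 + 1))) + 2 * (d / 4))).
  apply: (@le_trans _ _ (2 * (cr.1 ^+ 2 * I mu (fun z => (\1_[set y | cr.2 <= f y] z - \1_A' z) ^+ 2)) +
      2 * I mu (fun z => (\sum_(cr <- s) cr.1 * \1_[set y | cr.2 <= f y] z - h z) ^+ 2))); last first.
    by apply: lerD; apply: ler_wpM2l => //; apply: ler_wpM2l => //; exact: sqr_ge0.
  have b3 := bmZ (cr.1 ^+ 2) b1.
  rewrite -(I_Z mu1 (cr.1 ^+ 2) b1) -(I_Z mu1 2 b3) -(I_Z mu1 2 b2) -(I_D mu1 (bmZ 2 b3) (bmZ 2 b2)).
  apply: (I_le mu1); [|exact: bmD (bmZ 2 b3) (bmZ 2 b2)|move=> z].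
    apply: bmX; apply: bmB; last exact: bm_box dh'.
    by apply: bm_sum => i; exact: bmZ.
  rewrite big_cons /h'; set a := \1_[set y | _] z; set b := \1_A' z; set c := \sum_(_ <- _) _; set c' := h z.
  have : 0 <= (cr.1 * (a - b) - (c - c')) ^+ 2 by exact: sqr_ge0.
  rewrite -subr_ge0 => hh'; rewrite -subr_ge0; move: hh'; rewrite subr0; congr (_ <= _); ring.
have h3 : cr.1 ^+ 2 * (d / 4 / (cr.1 ^+ 2 + 1)) <= d / 4.
  rewrite mulrCA -[leRHS]mulr1 ler_wpM2l ?(ltW d4) //.
  by rewrite ler_pdivrMr // mul1r lerDl.
lra.
Qed.

End LocalApprox.

(** * From the energy in boxes to the decrease of correlations *)

Section Spectral.
Context {R : realType}.
Variables (w : config) (q : R) (mu : probability config R).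
Hypothesis q01 : 0 < q < 1.
Hypothesis hmu : bernoulli_product (1 - q) mu.
Variable K : R -> R.-pker config ~> config.
Hypothesis hK : kcm_semigroup w q mu K.
Implicit Types (f g h : config -> R).

Let mu1 : mu setT = 1%E := mu1 mu.
Local Notation Im := (I mu).

Lemma cond_pythagoras V g h : uniq V -> bm g -> dep V h ->
  Im (fun z => (g z - h z) ^+ 2) =
  Im (fun z => (g z - cond mu V g z) ^+ 2) + Im (fun z => (cond mu V g z - h z) ^+ 2).
Proof.
move=> uV bg dh; set G := cond mu V g.
have dG : dep V G := @cond_dep R mu V g.
have bG := bm_dep uV dG; have bh := bm_dep uV dh.
rewrite (I_sqrB mu1 bg bh) (I_sqrB mu1 bg bG) (I_sqrB mu1 bG bh).
rewrite (I_condM hmu q01 uV bg dh) (I_condM hmu q01 uV bg dG) -/G.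
have -> : Im (fun z => G z * G z) = Im (fun z => G z ^+ 2) by congr (I _ _); apply/funext => z; rewrite expr2.
set a := I _ _; set b := I _ _; set c := I _ _; set d := I _ _; lra.
Qed.

Lemma cond_weighted V g c : uniq V -> bm g -> dep V c -> (forall z, 0 <= c z) ->
  Im (fun z => c z * cond mu V g z ^+ 2) <= Im (fun z => c z * g z ^+ 2).
Proof.
move=> uV bg dc c0; set G := cond mu V g.
have dG : dep V G := @cond_dep R mu V g.
have bG := bm_dep uV dG; have bc := bm_dep uV dc.
have : 0 <= Im (fun z => c z * (g z - G z) ^+ 2).
  by apply: I_ge0 => z; apply: mulr_ge0 => //; exact: sqr_ge0.
have b1 := bmM bc (bmX 2 bg); have b2 := bmM bg (bmM bc bG); have b3 := bmM bc (bmX 2 bG).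
have -> : (fun z => c z * (g z - G z) ^+ 2) = fun z => (c z * g z ^+ 2 - 2 * (g z * (c z * G z))) + c z * G z ^+ 2.
  by apply/funext => z; ring.
rewrite (I_D mu1 (bmB b1 (bmZ 2 b2)) b3) (I_B mu1 b1 (bmZ 2 b2)) (I_Z mu1 2 b2).
have dcG : dep V (fun z => c z * G z) by move=> a b e; rewrite (dc _ _ e) (dG _ _ e).
rewrite (I_condM hmu q01 uV bg dcG) -/G.
have -> : Im (fun z => G z * (c z * G z)) = Im (fun z => c z * G z ^+ 2).
  by congr (I _ _); apply/funext => z; ring.
set a := I _ _; set b := I _ _; lra.
Qed.

Section Gap.
Variable f : config -> R.
Hypothesis bf : bm f.
Hypothesis f1 : forall z, `|f z| <= 1.
Local Notation X := (corr mu K f 0 - corr mu K f 1).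
Local Notation g := (Kt K (1 / 2) f).

Let half0 : (0 : R) <= 1 / 2. Proof. by rewrite divr_ge0. Qed.
Let halfD : (1 / 2 + 1 / 2 : R) = 1. Proof. by field. Qed.
Let bg : bm g := bm_Kt K (1 / 2) bf.
Let g1 z : `|g z| <= 1. Proof. exact: Kt_norm. Qed.

(** The left side is the second difference of the correlation at times 0, 1/2 and 1, and the middle
    value is at least the last one. *)
Lemma half_close : Im (fun z => (f z - g z) ^+ 2) <= X.
Proof.
rewrite (I_sqrB mu1 bf bg) -(corr0 hK bf) -(corr_sqr hK half0 bf) halfD.
have := corr_decr hK half0 half0 bf; rewrite halfD.
rewrite [corr mu K f (1 / 2)]/corr; set a := corr _ _ _ _; set b := corr _ _ _ _; set c := I _ _; lra.
Qed.

(** For [g] taken at time 1/2, the pairing of [g] with [g - Kt K s g] is the decrease of the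
    correlation of [f] from 1 to [1 + s]. With [s] the inverse of a large integer, [energy_slope]
    bounds the energy by the rate of this decrease and [corr_slope] bounds that rate. *)
Lemma half_energy V U : uniq V -> uniq U -> {subset U <= V} ->
  (forall x y, x \in U -> y \in neighbors x -> y \in V) ->
  q * (1 - q) * energy w q V U (cond mu V g) <= X.
Proof.
move=> uV uU UV UnV; apply/ler_addgt0Pr => e e0; rewrite -lerBlDr.
have := energy_slope q01 hmu hK uV uU (@cond_dep R mu V g) UV UnV bg g1 erefl e0.
move=> /nbhs_ballP[d /= d0 H].
have [N hN] : exists N : nat, d^-1 < N.+1%:R.
  by exists (Num.truncn d^-1); exact: truncnS_gt.
have N0 : 0 < N.+1%:R :> R by rewrite ltr0n.
have Nd : N.+1%:R^-1 < d by rewrite invf_plt // posrE.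
have Ni : 0 < N.+1%:R^-1 :> R by rewrite invr_gt0.
have Nb : ball (0 : R) d N.+1%:R^-1 by rewrite /ball /= sub0r normrN gtr0_norm.
have {H} := H _ Nb Ni.
rewrite -(corr_sqr hK half0 bf) halfD.
have -> : Im (fun z => g z * Kt K N.+1%:R^-1 g z) = corr mu K f (1 + N.+1%:R^-1).
  have -> : (1 : R) + N.+1%:R^-1 = 1 / 2 + (N.+1%:R^-1 + 1 / 2) by rewrite addrCA halfD addrC.
  by rewrite (corr_add hK half0 (addr_ge0 (ltW Ni) half0) bf) (Kt_semi hK (ltW Ni) half0 bf).
rewrite ler_pdivrMl // => h; apply: (le_trans h).
exact: (corr_slope hK (ltn0Sn N) bf).
Qed.

Hypothesis f0 : forall z : config, z 0 = false -> f z = 0.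

(** The Poincaré inequality is applied to the conditional expectation of [g]. The energy is handled
    by [half_energy]; the term with an empty origin is small because [f] vanishes there and [g] is
    close to [f]; the far block is invisible to a local approximation of [g]. *)
Lemma half_norm (Cc : R) : 0 < Cc ->
  (forall M0, exists M (B : seq site), [/\ (M0 <= M)%N, {subset B <= box 0 M},
    forall x, x \in B -> x \notin box 0 M0 &
    forall G, E q (box 0 M.+1) (fun e => G e ^+ 2) <=
      Cc * (energy w q (box 0 M.+1) (box 0 M) G +
         E q (box 0 M.+1) (fun e => (~~ e 0)%:R * G e ^+ 2) +
         E q (box 0 M.+1) (fun e => (G e - mean (1 - q) B G e) ^+ 2))]) ->
  Im (fun z => g z ^+ 2) <= Cc * ((q * (1 - q))^-1 + 1) * X.
Proof.
have [q0 q1] := andP q01; have qq : 0 < q * (1 - q) by rewrite mulr_gt0 ?subr_gt0.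
move=> C0 HP; apply/ler_addgt0Pr => e e0.
(* The approximation error enters once directly and once multiplied by [Cc]. *)
have e1 : 0 < e / (Cc + 1) by rewrite divr_gt0 // addr_gt0.
have [n0 [h [dh hh]]] := local_approx mu bg e1.
have [M [B [M0M BM Bn HG]]] := HP n0.
set V := box 0 M.+1 in HG; pose G := cond mu V g.
have uV : uniq V by exact: box_uniq.
have dG : dep V G := @cond_dep R mu V g.
have dhV : dep V h by apply: dep_box_le dh; exact: leqW.
have bG := bm_dep uV dG; have bh := bm_dep uV dhV.
have BV : {subset B <= V} by move=> x /BM; apply: box_sub.
have UV : {subset box 0 M <= V} by apply: box_sub.
have UnV x y : x \in box 0 M -> y \in neighbors x -> y \in V.
  by move=> xM yx; apply: (adjacent_box _ xM).
have O0 : (0 : site) \in V by exact: box_self.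
have pyt := cond_pythagoras uV bg dhV.
have gG0 : 0 <= Im (fun z => (g z - G z) ^+ 2) by apply: I_ge0 => z; exact: sqr_ge0.
have Gh0 : 0 <= Im (fun z => (G z - h z) ^+ 2) by apply: I_ge0 => z; exact: sqr_ge0.
have Ggap : Im (fun z => g z ^+ 2) = Im (fun z => (g z - G z) ^+ 2) + Im (fun z => G z ^+ 2).
  have := cond_pythagoras (h := fun=> 0) uV bg (fun _ _ _ => erefl).
  rewrite -/G => H0.
  have E0 k : (fun z : config => (k z - 0) ^+ 2) = fun z => k z ^+ 2 :> R by apply/funext => z; rewrite subr0.
  by rewrite !E0 in H0.
have err : E q V (fun z => (G z - mean (1 - q) B G z) ^+ 2) <= e / (Cc + 1).
  have mh : mean (1 - q) B h = h.
    by apply: mean_indep => x /Bn xn; exact: dep_indep dh xn.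
  have -> : (fun z => (G z - mean (1 - q) B G z) ^+ 2) =
      fun z => 1 * ((fun z => G z - h z) z - mean (1 - q) B (fun z => G z - h z) z) ^+ 2.
    by apply/funext => z; rewrite meanB mh mul1r; congr (_ ^+ 2); ring.
  apply: (le_trans (@E_orth_le R q V q01 B (fun=> 1) (fun z => G z - h z) BV (fun x _ a b => erefl) (fun=> ler01))).
  have -> : (fun z => 1 * (G z - h z) ^+ 2) = fun z => (G z - h z) ^+ 2 by apply/funext => z; rewrite mul1r.
  rewrite -(I_dep hmu uV); last by move=> a b ee; rewrite (dG _ _ ee) (dhV _ _ ee).
  by apply: le_trans hh; rewrite pyt lerDr.
have zero : E q V (fun z => (~~ z 0)%:R * G z ^+ 2) <= X.
  have d0 : dep V (fun z : config => (~~ z 0)%:R : R) by move=> a b ee; rewrite (ee _ O0).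
  rewrite -(I_dep hmu uV); last by move=> a b ee; rewrite (dG _ _ ee) (d0 _ _ ee).
  apply: le_trans (cond_weighted uV bg d0 (fun=> ler0n _ _)) _.
  apply: le_trans _ half_close; apply: (I_le mu1).
  - by apply: bmM; [exact: (bm_dep uV d0)|exact: bmX].
  - by apply: bmX; exact: bmB.
  move=> z; case z0 : (z 0); first by rewrite mul0r sqr_ge0.
  by rewrite (f0 z0) sub0r sqrrN; set a := g z; rewrite mul1r.
have en := half_energy uV (box_uniq 0 M) UV UnV; rewrite -/G in en.
have hE := HG G; rewrite -(I_dep hmu uV) in hE; last by move=> a b ee; rewrite (dG _ _ ee).
have en' : energy w q V (box 0 M) G <= (q * (1 - q))^-1 * X by rewrite ler_pdivlMl.
rewrite Ggap.
have gGe : Im (fun z => (g z - G z) ^+ 2) <= e / (Cc + 1).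
  by apply: le_trans hh; rewrite pyt lerDl.
have hE2 : Im (fun z => G z ^+ 2) <= Cc * ((q * (1 - q))^-1 * X + X + e / (Cc + 1)).
  apply: (le_trans hE); rewrite ler_pM2l //; exact: (lerD (lerD en' zero) err).
have eE : e = e / (Cc + 1) + Cc * (e / (Cc + 1)).
  by field; rewrite gt_eqF // addr_gt0.
rewrite eE; apply: (le_trans (lerD gGe hE2)).
have -> : Cc * ((q * (1 - q))^-1 * X + X + e / (Cc + 1)) = Cc * ((q * (1 - q))^-1 + 1) * X + Cc * (e / (Cc + 1)) by ring.
by rewrite addrCA.
Qed.

End Gap.
End Spectral.

Lemma spectral_bound (R : realType) (q : R) : 0 < q < 1 -> exists2 C : R, 1 < C &
  forall (w : config) (mu : probability config R) (K : R -> R.-pker config ~> config) (n : nat) (f : config -> R),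
  bernoulli_product (1 - q) mu -> kcm_semigroup w q mu K ->
  (0 < n)%N -> (forall m, (n <= m)%N -> good m w) ->
  bm f -> (forall z, `|f z| <= 1) -> (forall z : config, z 0 = false -> f z = 0) ->
  I mu (fun z => f z ^+ 2) <= C * cost q n * (I mu (fun z => f z ^+ 2) - I mu (fun z => f z * Kt K 1 f z)).
Proof.
move=> q01; have [q0 q1] := andP q01; have [C C0 HC] := box_poincare q01.
have qq : 0 < (q * (1 - q))^-1 + 1 by rewrite addr_gt0 // invr_gt0 mulr_gt0 ?subr_gt0.
exists (2 + 2 * (C * ((q * (1 - q))^-1 + 1))).
  by have : 0 < C * ((q * (1 - q))^-1 + 1) by [exact: mulr_gt0]; lra.
move=> w mu K n f hmu hK n0 gw bf f1 f0.
have c1 := cost_ge1 q01 n; have c0 : 0 < cost q n by lra.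
have Cc0 : 0 < C * cost q n by exact: mulr_gt0.
have h1 := half_norm q01 hmu hK bf f1 f0 Cc0 (HC w n n0 gw).
have h2 := half_close hK bf.
have bg := bm_Kt K (1 / 2) bf.
have mu1 := mu1 mu.
have h3 := I_tri mu bf bg (@bm_cst _ config R 0).
have E0 k : (fun z : config => (k z - 0) ^+ 2) = fun z => k z ^+ 2 :> R by apply/funext => z; rewrite subr0.
rewrite !E0 in h3.
have XE : corr mu K f 0 - corr mu K f 1 = I mu (fun z => f z ^+ 2) - I mu (fun z => f z * Kt K 1 f z).
  by rewrite (corr0 hK bf).
rewrite -XE; set X := corr _ _ _ _ - _ in XE h1 h2 *.
have X0 : 0 <= X by apply: le_trans h2; apply: I_ge0 => z; exact: sqr_ge0.
apply: (le_trans h3); apply: (@le_trans _ _ (2 * X + 2 * (C * cost q n * ((q * (1 - q))^-1 + 1) * X))).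
  by apply: lerD; rewrite ler_wpM2l.
have -> : (2 + 2 * (C * ((q * (1 - q))^-1 + 1))) * cost q n * X = 2 * (cost q n * X) + 2 * (C * cost q n * ((q * (1 - q))^-1 + 1) * X) by ring.
by rewrite lerD2r ler_wpM2l // ler_peMl.
Qed.

(** * Persistence *)

Section KilledSemigroup.
Context {R : realType}.
Variables (w : config) (q : R) (mu : probability config R).
Hypothesis q01 : 0 < q < 1.
Hypothesis hmu : bernoulli_product (1 - q) mu.
Variable K : R -> R.-pker config ~> config.
Hypothesis hK : kcm_semigroup w q mu K.
Variable D : R.
Hypothesis D1 : 1 < D.
Hypothesis HD : forall f : config -> R, bm f -> (forall z, `|f z| <= 1) ->
  (forall z : config, z 0 = false -> f z = 0) ->
  I mu (fun z => f z ^+ 2) <= D * (I mu (fun z => f z ^+ 2) - I mu (fun z => f z * Kt K 1 f z)).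

Let mu1 : mu setT = 1%E := mu1 mu.

Definition occ : config -> R := fun z => (z 0)%:R.

Lemma occ_dep : dep [:: 0] occ.
Proof. by move=> a b e; rewrite /occ (e 0) ?mem_head. Qed.

Lemma bm_occ : bm occ. Proof. exact: (bm_dep _ occ_dep). Qed.

(** The probability, from a given state, that the origin is occupied at the times 0, 1, ..., [k]. *)
Definition killed (k : nat) : config -> R := iter k (fun f z => occ z * Kt K 1 f z) occ.

Lemma bm_killed k : bm (killed k).
Proof. by elim: k => [|k IH] /=; [exact: bm_occ|apply: bmM; [exact: bm_occ|exact: bm_Kt]]. Qed.

Lemma occ01 z : 0 <= occ z <= 1. Proof. by rewrite /occ; case: (z 0); rewrite ?lexx ?ler01. Qed.

Lemma occ_killed k z : occ z * killed k z = killed k z.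
Proof.
have H x : occ z * (occ z * x) = occ z * x by rewrite /occ; case: (z 0); rewrite ?mul1r ?mul0r.
by case: k => [|k] /=; rewrite ?H //; rewrite -{2}[occ z]mulr1 H mulr1.
Qed.

Lemma killed_ge0 k z : 0 <= killed k z.
Proof.
elim: k z => [|k IH] z /=; first by case/andP: (occ01 z).
by apply: mulr_ge0; [case/andP: (occ01 z)|exact: Kt_ge0].
Qed.

Lemma killed_decr k z : killed k.+1 z <= killed k z.
Proof.
have o x : 0 <= occ x by case/andP: (occ01 x).
elim: k z => [|k IH] z.
  rewrite /killed /= -[leRHS]mulr1; apply: ler_wpM2l => //.
  rewrite -[leRHS](congr1 (@^~ z) (Kt_cst K 1 1)).
  by apply: Kt_le; [exact: bm_occ|exact: bm_cst|move=> x; case/andP: (occ01 x)].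
by apply: ler_wpM2l => //; exact: (@Kt_le R K 1 (killed k.+1) (killed k) z (bm_killed k.+1) (bm_killed k) IH).
Qed.

Lemma killed_le1 k z : killed k z <= 1.
Proof.
elim: k => [|k IH]; first by case/andP: (occ01 z).
exact: le_trans (killed_decr k z) IH.
Qed.

(** Killing on both sides of the time-one step gives a self-adjoint operator, so steps can be moved
    from one factor to the other. In particular the squared norm of [killed k] is the mean of
    [killed (2 * k)]. *)
Lemma killed_pair j k : I mu (fun z => killed j z * killed k z) = I mu (killed (j + k)).
Proof.
elim: j k => [|j IH] k.
  by congr (I _ _); apply/funext => z; exact: occ_killed.
rewrite addSnnS -IH.
have -> : (fun z => killed j.+1 z * killed k z) = fun z => killed k z * Kt K 1 (killed j) z.
  by apply/funext => z; rewrite -[in RHS]occ_killed /=; ring.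
rewrite (Im_sym hK ler01 (bm_killed k) (bm_killed j)); congr (I _ _).
by apply/funext => z; rewrite -[in LHS]occ_killed /=; ring.
Qed.

(** [HD] applies to [killed k], which vanishes when the origin is empty, and gives a factor
    [1 - D^-1] from step [2 * k] to the next; the step after that merely does not increase the
    mean. *)
Lemma killed_decay k : I mu (killed (2 * k)) <= (1 - q) * (1 - D^-1) ^+ k.
Proof.
have D0 : 0 < D by apply: lt_trans D1.
have k1 : 0 <= 1 - D^-1 by rewrite subr_ge0 invf_le1 // ltW.
elim: k => [|k IH].
  rewrite muln0 expr0 mulr1 /killed /= (I_dep hmu _ occ_dep) //.
  rewrite /E /= /mean1 /occ !update_at /= mulr1 mulr0 addr0 //.
rewrite exprSr mulrA.
have sq : I mu (fun z => killed k z ^+ 2) = I mu (killed (2 * k)).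
  by rewrite mul2n -addnn -killed_pair; congr (I _ _); apply/funext => z; rewrite expr2.
have odd : I mu (fun z => killed k z * Kt K 1 (killed k) z) = I mu (killed (2 * k).+1).
  have -> : (2 * k).+1 = (k + k.+1)%N by rewrite mul2n -addnn addnS.
  rewrite -killed_pair; congr (I _ _); apply/funext => z.
  by rewrite -[in LHS]occ_killed /=; ring.
have kn z : `|killed k z| <= 1 by rewrite ger0_norm ?killed_ge0 // killed_le1.
have k0 (z : config) : z 0 = false -> killed k z = 0.
  by move=> z0; rewrite -occ_killed /occ z0 mul0r.
have := HD (bm_killed k) kn k0; rewrite sq odd => h.
have le1 : I mu (killed (2 * k.+1)) <= I mu (killed (2 * k).+1).
  have -> : (2 * k.+1 = (2 * k).+2)%N by rewrite mulnS.
  by apply: (I_le mu1); [exact: bm_killed|exact: bm_killed|exact: killed_decr].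
apply: (le_trans le1); apply: (@le_trans _ _ (I mu (killed (2 * k)) * (1 - D^-1))); last first.
  exact: ler_wpM2r.
rewrite mulrBr mulr1 lerBrDl -lerBrDr mulrC ler_pdivrMl //.
Qed.

(** A bound without prefactor for all positive times is wanted. The factor [1 - q] for an occupied
    origin at time 0 absorbs the rounding of [t] to an even integer, which is why [q] enters the
    rate. *)
Lemma killed_exp k (t : R) : t <= 2 * k.+1%:R ->
  I mu (killed (2 * k)) <= expR (- (t / (2 * D / q))).
Proof.
have [q0 q1] := andP q01; have D0 : 0 < D by apply: lt_trans D1.
move=> tk; apply: (le_trans (killed_decay k)).
have e1 : 1 - q <= expR (- q) by exact: expR_ge1Dx.
have e2 : 1 - D^-1 <= expR (- D^-1) by exact: expR_ge1Dx.
have k1 : 0 <= 1 - D^-1 by rewrite subr_ge0 invf_le1 // ltW.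
have q10 : 0 <= 1 - q by rewrite subr_ge0 ltW.
apply: (@le_trans _ _ (expR (- q) * expR (- D^-1) ^+ k)).
  apply: (ler_pM q10 (exprn_ge0 k k1) e1); apply: lerXn2r => //.
  by rewrite nnegrE expR_ge0.
rewrite -expRM_natl -expRD ler_expR.
have -> : t / (2 * D / q) = q * (t / 2) / D by field; rewrite !gt_eqF.
have tk2 : t / 2 <= k%:R + 1 by rewrite ler_pdivrMr // mulrC natr1.
have Di : 0 < D^-1 by rewrite invr_gt0.
have Di1 : D^-1 < 1 by rewrite invf_lt1.
rewrite mulrN -opprD lerN2; apply: (@le_trans _ _ (q * (k%:R + 1) * D^-1)).
  by rewrite ler_wpM2r ?(ltW Di) // ler_wpM2l // ltW.
have -> : q * (k%:R + 1) * D^-1 = q * D^-1 + (q * k%:R) * D^-1 by ring.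
apply: lerD; first by rewrite ler_piMr ?(ltW q0) // ltW.
by rewrite ler_wpM2r ?(ltW Di) // ler_piMl ?ler0n // ltW.
Qed.

(** * Survival of an occupied origin for the process *)

Section Process.
Context d (T : measurableType d) (P : probability T R) (X : R -> T -> config).
Hypothesis mX : forall t : R, 0 <= t -> measurable_fun setT (X t).
Hypothesis law0 : forall B : set config, measurable B -> P (X 0 @^-1` B) = mu B.
Hypothesis markov : forall (s t : R) (A : set T) (B : set config),
  0 <= s -> 0 <= t -> past X t A -> measurable B ->
  P (A `&` X (t + s) @^-1` B) = (\int[P]_(a in A) K s (X t a) B)%E.

Let P1 : P setT = 1%E. Proof. exact: probability_setT. Qed.

Lemma past_measurable t A : past X t A -> measurable A.
Proof.
apply: smallest_sub => [|_ [u [B [/andP[u0 ut] mB ->]]]]; first exact: sigma_algebra_measurable.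
by rewrite -[X in measurable X]setTI; exact: mX.
Qed.

Lemma bm_X t (f : config -> R) : 0 <= t -> bm f -> bm (fun a => f (X t a)).
Proof. by move=> t0 bf; apply: (bm_comp (mX t0) bf). Qed.

Lemma markov_fun s t A (f : config -> R) : 0 <= s -> 0 <= t -> past X t A -> bm f ->
  I P (fun a => \1_A a * f (X (t + s) a)) = I P (fun a => \1_A a * Kt K s f (X t a)).
Proof.
move=> s0 t0 pA bf; have mA := past_measurable pA.
have bA : bm (\1_A : T -> R) := bm_indic R mA.
have ts0 : 0 <= t + s := addr_ge0 t0 s0.
have b1 (h : config -> R) : bm h -> bm (fun a => \1_A a * h (X (t + s) a)) by move=> bh; exact: (bmM bA (bm_X ts0 bh)).
have b2 (h : config -> R) : bm h -> bm (fun a => \1_A a * Kt K s h (X t a)).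
  by move=> bh; exact: (bmM bA (bm_X t0 (bm_Kt K s bh))).
apply/eqP; rewrite -subr_eq0; apply/eqP.
apply: (@bm_zero _ _ _ (fun f => I P (fun a => \1_A a * f (X (t + s) a)) - I P (fun a => \1_A a * Kt K s f (X t a))) 2 f bf).
- move=> g h bg bh; rewrite (Kt_D K s bg bh).
  have -> : (fun a => \1_A a * (g (X (t + s) a) + h (X (t + s) a))) =
    fun a => \1_A a * g (X (t + s) a) + \1_A a * h (X (t + s) a) by apply/funext => a; rewrite mulrDr.
  have -> : (fun a => \1_A a * (Kt K s g (X t a) + Kt K s h (X t a))) =
    fun a => \1_A a * Kt K s g (X t a) + \1_A a * Kt K s h (X t a) by apply/funext => a; rewrite mulrDr.
  by rewrite (I_D P1 (b1 g bg) (b1 h bh)) (I_D P1 (b2 g bg) (b2 h bh)) opprD addrACA.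
- move=> c g bg; rewrite (Kt_Z K s c bg).
  have -> : (fun a => \1_A a * (c * g (X (t + s) a))) = fun a => c * (\1_A a * g (X (t + s) a)).
    by apply/funext => a; rewrite mulrCA.
  have -> : (fun a => \1_A a * (c * Kt K s g (X t a))) = fun a => c * (\1_A a * Kt K s g (X t a)).
    by apply/funext => a; rewrite mulrCA.
  by rewrite (I_Z P1 c (b1 g bg)) (I_Z P1 c (b2 g bg)) mulrBr.
- move=> g C bg gC; apply: le_trans (ler_normB _ _) _.
  have A1 a x : `|x| <= C -> `|\1_A a * x| <= C.
    by rewrite indicE; case: (a \in A); rewrite ?mul1r ?mul0r ?normr0 //; apply: le_trans.
  rewrite mulr2n mulrDl !mul1r; apply: lerD.
    by apply: (I_norm P1 (b1 g bg)) => a; exact: A1.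
  by apply: (I_norm P1 (b2 g bg)) => a; apply: A1; exact: Kt_norm.
- move=> r; have mL : measurable [set y | r <= f y] by apply: measurable_level; case: bf.
  set L := [set y | r <= f y] in mL *.
  have bL : bm (\1_L : config -> R) := bm_indic R mL.
  apply/eqP; rewrite subr_eq0 -(inj_eq (@EFin_inj R)); apply/eqP.
  have -> : (fun a => \1_A a * \1_L (X (t + s) a)) = \1_(A `&` X (t + s) @^-1` L) :> (T -> R).
    apply/funext => a; rewrite !indicE in_setI -natrM mulnb; congr (_%:R); congr nat_of_bool.
  have mXL : measurable (X (t + s) @^-1` L) by rewrite -[X in measurable X]setTI; exact: (mX ts0).
  rewrite (I_indic P1 (measurableI _ _ mA mXL)) (I_EFin P1 (b2 _ bL)).
  apply: (etrans (markov s0 t0 pA mL)); rewrite [LHS]integral_mkcond; apply: eq_integral => a _.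
  rewrite patchE indicE EFinM Kt_indic //; by case: (a \in A); rewrite ?mul1e ?mul0e.
Qed.

Definition occupied (n : nat) : set T := [set a | forall j, (j <= n)%N -> X j%:R a 0 = true].

Lemma occupied_past n : past X n%:R (occupied n).
Proof.
have -> : occupied n = \bigcap_(j in `I_n.+1) X j%:R @^-1` [set z : config | z 0 = true].
  by apply/seteqP; split => a h j; [move=> jn; exact: h|move=> jn; apply: h; rewrite /= ltnS].
rewrite /past; set G := [set A : set T | _].
apply: (@bigcap_measurable _ (g_sigma_algebraType G)); first by exists 0%N.
move=> j /= jn; apply: sub_sigma_algebra; exists j%:R, [set z : config | z 0 = true].
by split; [rewrite ler0n ler_nat -ltnS|exact: measurable_coord|].
Qed.

(** The observation times are removed one by one, the last first: the Markov property turns an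
    observation into one more step of [killed]. *)
Lemma occupied_killed n : P (occupied n) = (I mu (killed n))%:E.
Proof.
have n0 j : 0 <= j%:R :> R := ler0n R j.
have mO j : measurable (occupied j) := past_measurable (@occupied_past j).
have occE j a : \1_(occupied j) a * occ (X j%:R a) = \1_(occupied j) a :> R.
  rewrite indicE /occ; case: (boolP (a \in occupied j)) => [|_]; last by rewrite mul0r.
  by rewrite inE => /(_ j (leqnn j)) ->; rewrite mulr1.
have occS j a : \1_(occupied j) a * occ (X j.+1%:R a) = \1_(occupied j.+1) a :> R.
  rewrite !indicE /occ -natrM mulnb; congr (_%:R); congr nat_of_bool; apply/andP/idP.
    by rewrite !inE => -[h1 h2] i; rewrite leq_eqVlt ltnS => /orP[/eqP->//|]; exact: h1.
  by rewrite !inE => h; split; [move=> i ij; apply: h; exact: leqW|exact: h].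
have u j k : I P (fun a => \1_(occupied j) a * killed k (X j%:R a)) = I mu (killed (j + k)).
  elim: j k => [|j IH] k.
    rewrite add0n -(I_comp (mX (lexx 0)) P1 mu1 law0 (bm_killed k)); congr (I _ _).
    apply/funext => a; rewrite /= -(occ_killed k (X 0 a)) mulrA; congr (_ * _).
    rewrite indicE /occ; case E : (X 0 a 0); last by rewrite mulr0.
    by rewrite mem_set ?mulr1 // => i; rewrite leqn0 => /eqP->.
  rewrite addSnnS -IH.
  transitivity (I P (fun a => \1_(occupied j) a * killed k (X (j%:R + 1) a))).
    congr (I _ _); apply/funext => a; rewrite natr1 -(occ_killed k (X j.+1%:R a)) mulrA.
    by rewrite [RHS]mulrA occS occE.
  rewrite (markov_fun ler01 (n0 j) (@occupied_past j) (bm_killed k)).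
  by congr (I _ _); apply/funext => a /=; rewrite mulrA occE.
rewrite -(I_indic P1 (mO n)) -[in RHS](addn0 n) -u; congr (_%:E).
by congr (I _ _); apply/funext => a; rewrite [RHS]occE.
Qed.

Hypothesis rcont : forall a (t : R), 0 <= t ->
  (X s a : {ptws site -> bool}) @[s --> t^'+] --> (X t a : {ptws site -> bool}).

Lemma tau0_ge a (t : R) : (t%:E <= tau0 X a)%E <-> forall s, 0 <= s -> s < t -> X s a 0 = true.
Proof.
split=> [h s s0 st|h].
  apply: contraTT st => /negbTE Xs; rewrite -leNgt -lee_fin; apply: (le_trans h).
  by apply: ereal_inf_lbound; exists s.
apply: le_ereal_inf_tmp => _ [s [s0 Xs] <-]; rewrite lee_fin leNgt; apply/negP => st.
by have := h s s0 st; rewrite Xs.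
Qed.

(** By right continuity an empty origin remains empty for a short while, so an empty time before [t]
    can be replaced by a rational one. *)
Lemma tau0_measurable (t : R) : measurable [set a | (t%:E <= tau0 X a)%E].
Proof.
pose B (r : rat) : set T := if (0 <= ratr r :> R) && (ratr r < t) then X (ratr r) @^-1` [set z : config | z 0 = false] else set0.
have -> : [set a | (t%:E <= tau0 X a)%E] = ~` \bigcup_r B r.
  apply/seteqP; split => a /=.
    move=> /tau0_ge h [r _]; rewrite /B; case: ifP => // /andP[r0 rt] /= Xr.
    by have := h _ r0 rt; rewrite Xr.
  move=> nB; apply/tau0_ge => s s0 st; apply/negPn/negP => /negbTE Xs; apply: nB.
  have cv : X u a 0 @[u --> s^'+] --> X s a 0.
    have h1 := @rcont a s s0; have h2 := @proj_continuous site (fun=> bool) 0 (X s a).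
    exact: (cvg_comp _ _ h1 h2).
  have /cv : nbhs (X s a 0) [set X s a 0] by exact: discrete_set1.
  rewrite Xs => /nbhs_ballP[dl /= d0 H].
  have [r] : exists r : rat, ratr r \in `]s, (Num.min t (s + dl))[%R.
    by apply: rat_in_itvoo; rewrite lt_min st ltrDl.
  rewrite in_itv /= lt_min => /and3P[sr rt rd].
  exists r => //; rewrite /B rt (le_trans s0 (ltW sr)) /=.
  apply: (H (ratr r)) => //; rewrite /ball /= distrC gtr0_norm ?subr_gt0 //.
  by rewrite ltrBlDl.
apply: measurableC; apply: bigcupT_measurable_rat => r; rewrite /B; case: ifP => [/andP[r0 _]|_]; last exact: measurable0.
by rewrite -[X in measurable X]setTI; apply: (mX r0) => //; exact: measurable_coord.
Qed.

Lemma survival (t : R) : 0 < t ->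
  (P [set a | (t%:E <= tau0 X a)%E] <= (expR (- (t / (2 * D / q))))%:E)%E.
Proof.
(* The first inequality is strict because [tau0 >= t] says nothing about time [t] itself. *)
move=> t0; have [k [k1 k2]] : exists k, 2 * k%:R < t /\ t <= 2 * k.+1%:R.
  have ex : exists m, t <= 2 * m%:R.
    exists (Num.truncn t).+1; have h := truncnS_gt t; apply: ltW; apply: (lt_le_trans h).
    by rewrite ler_peMl ?ler0n // ler1n.
  case: (ex_minnP ex) => -[|m] hm Hm; first by move: hm; rewrite mulr0 leNgt t0.
  exists m; split => //; rewrite ltNge; apply/negP => /Hm; by rewrite ltnn.
apply: (@le_trans _ _ (P (occupied (2 * k)))).
  apply: le_measure; rewrite ?inE; [exact: tau0_measurable|exact: past_measurable (@occupied_past _)|].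
  move=> a /tau0_ge h j jk; apply: h; first exact: ler0n.
  by apply: le_lt_trans k1; rewrite -natrM ler_nat.
by rewrite occupied_killed lee_fin; exact: killed_exp.
Qed.

End Process.
End KilledSemigroup.

(** * Absence of a spectral gap *)

Definition level (x z : site) : int := z.1 + z.2 - x.1 - x.2.

Definition reaches (x : site) (n : nat) : set config :=
  [set eta : config | exists2 z, conn oriented_edge (fun y => eta y) x z & level x z = n%:Z].

Definition triangle (x : site) (n : nat) : seq site :=
  [seq z <- box x n | [&& x.1 <= z.1, x.2 <= z.2 & level x z <= n%:Z]].

Lemma triangle_uniq x n : uniq (triangle x n).
Proof. exact/filter_uniq/box_uniq. Qed.

Lemma mem_triangle x n z : (z \in triangle x n) = [&& x.1 <= z.1, x.2 <= z.2 & level x z <= n%:Z].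
Proof.
rewrite mem_filter mem_box /level; case: x z => [x1 x2] [z1 z2] /=; lia.
Qed.

Lemma oriented_level x u v : oriented_edge u v -> level x v = level x u + 1.
Proof. by rewrite oriented_edgeP /level => /orP[] /eqP ->; case: x u => [? ?] [? ?] /=; lia. Qed.

Lemma conn_above (P : site -> Prop) x z : conn oriented_edge P x z -> x.1 <= z.1 /\ x.2 <= z.2.
Proof.
elim=> [|u v _ [h1 h2] uv _] //; move: uv h1 h2; rewrite oriented_edgeP => /orP[] /eqP ->;
  case: x u => [? ?] [? ?] /=; lia.
Qed.

Lemma conn_in_triangle (P : site -> Prop) x n z : conn oriented_edge P x z -> level x z <= n%:Z ->
  conn oriented_edge (fun y => P y /\ y \in triangle x n) x z.
Proof.
elim=> [|u v cu IH uv Pv] ln; first exact: conn0.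
have lu := oriented_level x uv.
have cv := connS cu uv Pv.
apply: connS (IH _) uv _; first by lia.
split => //; rewrite mem_triangle ln andbT.
by have [h1 h2] := conn_above cv; rewrite h1 h2.
Qed.

Lemma reaches_dep x n : dep (triangle x n) (reaches x n).
Proof.
have H (a b : config) : (forall y, y \in triangle x n -> a y = b y) -> reaches x n a -> reaches x n b.
  move=> e [z cz lz]; exists z => //; have lz' : level x z <= n%:Z by rewrite lz.
  by apply: conn_sub (conn_in_triangle cz lz') => y [ay yt]; rewrite -e.
by move=> a b e; apply/propext; split; apply: H => // y /e.
Qed.

Lemma reaches_pred x n (eta : config) : reaches x n.+1 eta -> exists u v,
  [/\ conn oriented_edge (fun y => eta y) x u, level x u = n%:Z, oriented_edge u v & eta v].
Proof.
move=> [z cz]; case: z / cz => [|u v cu uv ev] h; first by move: h; rewrite /level; lia.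
by exists u, v; split => //; have := oriented_level x uv; lia.
Qed.

Lemma reaches_anti x n : reaches x n.+1 `<=` reaches x n.
Proof. by move=> eta /reaches_pred[u [v [cu lu _ _]]]; exists u. Qed.

(** An oriented path gains one level per step, so it could meet [y] at its endpoint only. *)
Lemma conn_avoid (eta : config) x y z : conn oriented_edge (fun u => eta u) x z ->
  level x z <= level x y -> z != y -> conn oriented_edge (fun u => update eta y false u) x z.
Proof.
elim=> [|u v cu IH uv ev] lz zy; first exact: conn0.
have lu := oriented_level x uv.
apply: connS (IH _ _) uv _; first by lia.
  by apply/eqP => uy; move: lz; rewrite -uy; lia.
by rewrite update_ne.
Qed.

(** With both oriented neighbours empty, no path can continue beyond [y]. *)
Lemma conn_avoid_dead (eta : config) x y z : eta (y + e1) = false -> eta (y + e2) = false ->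
  conn oriented_edge (fun u => update eta y true u) x z ->
  z != y -> conn oriented_edge (fun u => update eta y false u) x z.
Proof.
move=> d1 d2; elim=> [|u v cu IH uv ev] zy; first exact: conn0.
rewrite update_ne // in ev; case: (eqVneq u y) => [uy|uy]; last first.
  by apply: connS (IH uy) uv _; rewrite update_ne.
by move: uv ev; rewrite uy oriented_edgeP => /orP[] /eqP ->; rewrite ?d1 ?d2.
Qed.

Section Front.
Context {R : realType}.

Definition reach_ind x n : config -> R := ind (reaches x n).

Lemma reach_ind_dep x n : dep (triangle x n) (reach_ind x n).
Proof. exact: dep_ind (@reaches_dep x n). Qed.

Lemma dif_dead x n y (eta : config) : eta (y + e1) = false -> eta (y + e2) = false ->
  level x y != n%:Z -> dif y (reach_ind x n) eta = 0.
Proof.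
move=> d1 d2 ly; apply/eqP; rewrite subr_eq0 /reach_ind /ind; apply/eqP; congr (_%:R); congr nat_of_bool.
apply: asbool_equiv_eq; split => -[z cz lz]; exists z => //.
  by apply: (conn_avoid_dead d1 d2 cz); apply: contraNneq ly => <-; rewrite lz.
by apply: conn_sub cz => u; rewrite /update; case: (u == y).
Qed.

Lemma dif_pivotal x n y (eta : config) : dif y (reach_ind x n) eta != 0 ->
  ~ reaches x n (update eta y false) /\ reaches x n (update eta y true).
Proof.
have up : reaches x n (update eta y false) -> reaches x n (update eta y true).
  by move=> [z cz lz]; exists z => //; apply: conn_sub cz => u; rewrite /update; case: (u == y).
rewrite /dif /reach_ind => h; have [h1|h1] := pselect (reaches x n (update eta y false)).
  by move: h; rewrite (ind1 h1) (ind1 (up h1)) subrr eqxx.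
split => //; have [//|h2] := pselect (reaches x n (update eta y true)).
by move: h; rewrite (ind0 h1) (ind0 h2) subrr eqxx.
Qed.

Definition front x n : seq site := [seq z <- triangle x n | level x z == n%:Z].

(* If an occupied site with two empty oriented neighbours is pivotal, it is the only
   site of the front that is reached, and the path cannot be continued. *)
Lemma front_sum x n (eta : config) :
  \sum_(y <- front x n) (eta y)%:R * ((~~ eta (y + e1) && ~~ eta (y + e2))%:R * dif y (reach_ind x n) eta ^+ 2)
  <= reach_ind x n eta - reach_ind x n.+1 eta.
Proof.
pose c y : R := (eta y)%:R * ((~~ eta (y + e1) && ~~ eta (y + e2))%:R * dif y (reach_ind x n) eta ^+ 2).
have [[y yf cy]|no] := pselect (exists2 y, y \in front x n & c y != 0); last first.
  rewrite big_seq big1 => [|y yf]; first by rewrite subr_ge0; apply: ind_sub; exact: reaches_anti.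
  by apply/eqP/negPn/negP => cy; apply: no; exists y.
have ly : level x y = n%:Z by move: yf; rewrite mem_filter => /andP[/eqP].
move: (cy); rewrite /c !mulf_eq0 !negb_or => /and4P[ey dy dp _].
have {}ey : eta y = true by move: ey; case: (eta y); rewrite ?eqxx.
have {dy}[d1 d2] : eta (y + e1) = false /\ eta (y + e2) = false.
  by move: dy; case: (eta (y + e1)); case: (eta (y + e2)); rewrite ?eqxx.
have [np] := dif_pivotal dp; rewrite -{1}ey update_id => re.
have uni z : conn oriented_edge (fun u => eta u) x z -> level x z = n%:Z -> z = y.
  move=> cz lz; apply/eqP/negPn/negP => zy; apply: np; exists z => //.
  by apply: conn_avoid cz _ zy; rewrite lz ly.
have nr : ~ reaches x n.+1 eta.
  move=> /reaches_pred[u [v [cu lu uv ev]]].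
  by move: uv ev; rewrite (uni u cu lu) oriented_edgeP => /orP[] /eqP ->; rewrite ?d1 ?d2.
rewrite /reach_ind (ind0 nr) subr0.
have others z : z \in front x n -> z != y -> c z = 0.
  rewrite mem_filter => /andP[/eqP lz _] zy; apply/eqP/negPn/negP.
  rewrite /c !mulf_eq0 !negb_or => /and4P[ez _ dz _].
  have {}ez : eta z = true by move: ez; case: (eta z); rewrite ?eqxx.
  have [nz] := dif_pivotal dz; rewrite -{1}ez update_id => -[u cu lu].
  have uy := uni u cu lu; apply: nz; exists y; last exact: ly.
  by rewrite -uy; apply: conn_avoid cu _ _; [rewrite lu lz|rewrite uy eq_sym].
rewrite (ind1 re) (bigD1_seq y) //=; last by rewrite filter_uniq // triangle_uniq.
rewrite big_seq_cond big1 ?addr0; last by move=> z /andP[zf zy]; exact: others.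
rewrite ey d1 d2 /dif -{2}ey update_id (ind1 re) (ind0 np) subr0 expr1n !mul1r //.
Qed.

End Front.

Lemma constraint_nbhd (w : config) x : dep (neighbors x) (constraint w x).
Proof.
move=> a b e; rewrite /constraint; case: ifP => _.
  by congr leq; rewrite !big_seq; apply: eq_bigr => y /e ->.
by rewrite !e // /neighbors !inE eqxx ?orbT.
Qed.

Lemma e1_ne (y : site) : y + e1 != y.
Proof. by case: y => a b; rewrite /eq_op /=; lia. Qed.

Lemma e2_ne (y : site) : y + e2 != y.
Proof. by case: y => a b; rewrite /eq_op /=; lia. Qed.

(** * Dirichlet form and variance of the test function *)

Section TestFunction.
Context {R : realType}.
Variables (w : config) (q : R) (mu : probability config R).
Hypothesis q01 : 0 < q < 1.
Hypothesis hmu : bernoulli_product (1 - q) mu.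
Let mu1 : mu setT = 1%E := mu1 mu.

Lemma bm_Lfun2 (f : config -> R) : bm f -> f \in Lfun mu 2%:E.
Proof.
move=> bf; have [mf [C fC]] := bf; rewrite inE /=; apply/andP; split; rewrite inE //=.
rewrite /finite_norm unlock poweR_lty //.
have -> : (\int[mu]_x (`|(EFin \o f) x| `^ 2) = \int[mu]_x (f x ^+ 2)%:E)%E.
  apply: eq_integral => x _; rewrite /= -[2%R]/(2%:R) powR_mulrn ?normr_ge0 //.
  by rewrite real_normK ?num_real.
exact: integrable_lty (bm_integrable mu1 (bmX 2 bf)).
Qed.

Lemma local_domain (f : config -> R) (V : seq site) : uniq V -> dep V f -> generator_domain w q mu f.
Proof.
move=> uV df; have bf := bm_dep uV df; split; first exact: bm_Lfun2.
have gE (eta : config) : generator w q f eta = \sum_(x <- V) (constraint w x eta)%:R * (site_mean q x f eta - f eta).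
  apply: generatorE => // x xV; rewrite /site_mean !(dep_indep df xV); ring.
have bg : bm (generator w q f).
  have -> : generator w q f = fun eta => \sum_(x <- V) (constraint w x eta)%:R * (site_mean q x f eta - f eta).
    by apply/funext.
  pose W := undup (flatten [seq neighbors x ++ V | x <- V]).
  apply: (@bm_dep R W); first exact: undup_uniq.
  have sub x y : x \in V -> y \in neighbors x ++ V -> y \in W.
    by move=> xV yx; rewrite mem_undup; apply/flattenP; exists (neighbors x ++ V) => //; apply/mapP; exists x.
  move=> a b e; rewrite !big_seq; apply: eq_bigr => x xV.
  have eV y : y \in V -> a y = b y by move=> yV; apply/e/(sub x) => //; rewrite mem_cat yV orbT.
  have -> : constraint w x a = constraint w x b.
    by apply: constraint_nbhd => y yx; apply/e/(sub x) => //; rewrite mem_cat yx.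
  have sm : site_mean q x f a = site_mean q x f b by rewrite site_meanE; apply: (@dep_mean R (1 - q) [:: x] V f df).
  by rewrite sm (df _ _ eV).
have L0 (h : config -> R) : ('N[mu]_2%:E[EFin \o (h \- h)%R])%E = 0%E.
  have -> : EFin \o (h \- h)%R = cst 0%E by apply/funext => z /=; rewrite subrr.
  by rewrite Lnorm0.
exists (generator w q f), (fun=> f); split; first exact: bm_Lfun2.
- by move=> n; exists V.
- by rewrite L0; exact: cvg_cst.
- by rewrite L0; exact: cvg_cst.
Qed.

Lemma dirichlet_dep (f : config -> R) (V : seq site) : uniq V -> dep V f ->
  dirichlet_form w q mu f = (\sum_(x <- V) I mu (fun z => (constraint w x z)%:R * (q * (1 - q) * dif x f z ^+ 2)))%:E.
Proof.
move=> uV df; have bf := bm_dep uV df.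
have sv x (z : config) : site_var q x f z = q * (1 - q) * dif x f z ^+ 2.
  by rewrite /site_var /site_mean /dif !updateK; ring.
have bt x : bm (fun z : config => (constraint w x z)%:R * (q * (1 - q) * dif x f z ^+ 2)).
  have bu b : bm (fun z : config => f (update z x b)).
    apply: (bm_dep uV) => a c e; apply: df => y yV; rewrite /update; case: eqP => // _; exact: e.
  have bc : bm (fun z : config => (constraint w x z)%:R : R).
    apply: (@bm_dep R (undup (neighbors x))); first exact: undup_uniq.
    move=> a c e; congr (_%:R); congr nat_of_bool; apply: constraint_nbhd => y yx; apply: e.
    by rewrite mem_undup.
  by apply: bmM => //; apply: bmZ; apply: bmX; exact: bmB (bu true) (bu false).
rewrite /dirichlet_form -(I_sum mu1 V bt) (I_EFin mu1); last exact: bm_sum.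
apply: eq_integral => z _.
pose g x : \bar R := ((constraint w x z)%:R * (q * (1 - q) * dif x f z ^+ 2))%:E.
have [q0 q1] := andP q01.
have g0 x : (0 <= g x)%E.
  by rewrite lee_fin; apply: mulr_ge0; rewrite ?ler0n //; apply: mulr_ge0; rewrite ?sqr_ge0 // mulr_ge0 ?subr_ge0 ?ltW.
have -> : (\esum_(x in [set: site]) ((constraint w x z)%:R * site_var q x f z)%:E = \esum_(x in [set` V]) g x)%E.
  rewrite [RHS]esum_mkcond; apply: eq_esum => x _; rewrite sv -/(g x); case: ifP => // /negbT xV.
  have xV' : x \notin V by apply: contraNN xV => h; rewrite inE.
  by rewrite /g /dif !(dep_indep df xV') subrr expr0n /= !mulr0.
have fV : finite_set [set` V] by exact: finite_seq.
by rewrite (esum_fset fV) => [|x _]; [rewrite -fsbig_seq // -sumEFin|exact: g0].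
Qed.

Lemma E_occ V u f : u \in V -> indep u f -> E q V (fun e => (e u)%:R * f e) = (1 - q) * E q V f.
Proof.
move=> uV uf; have sV : {subset [:: u] <= V} by move=> x; rewrite inE => /eqP->.
rewrite -(E_mean _ _ sV) -E_scale; congr (E _ _ _); apply/funext => e /=.
by rewrite /mean1 !update_at /= mul0r mulr0 addr0 mul1r uf.
Qed.

Section Triangle.
Variables (x : site) (n : nat).
Hypothesis wNE : forall y, y \in triangle x n -> w y = false.
Local Notation f := (reach_ind (R := R) x n).
Local Notation th k := (I mu (reach_ind (R := R) x k)).

Lemma bm_reach k : bm (reach_ind (R := R) x k).
Proof. exact: bm_dep (triangle_uniq x k) (@reach_ind_dep R x k). Qed.

(** A North-East site may update only if both its oriented neighbours are empty, so by [dif_dead]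
    only the front contributes, and [front_sum] bounds its contribution by the loss from one level
    to the next. *)
Lemma dirichlet_reach : exists2 D : R, dirichlet_form w q mu f = D%:E & 0 <= D <= q * (th n - th n.+1).
Proof.
have [q0 q1] := andP q01.
eexists; first exact: (dirichlet_dep (triangle_uniq x n) (@reach_ind_dep R x n)).
apply/andP; split.
  apply: sumr_ge0 => y _; apply: I_ge0 => z; apply: mulr_ge0; rewrite ?ler0n //.
  by apply: mulr_ge0; rewrite ?sqr_ge0 // mulr_ge0 ?subr_ge0 ?ltW.
pose V := box x n.+2.
have tV k : (k <= n.+1)%N -> {subset triangle x k <= V}.
  move=> kn y; rewrite mem_triangle mem_box /level; move: kn; case: x y => [x1 x2] [y1 y2] /=; lia.
have uV : uniq V := box_uniq x n.+2.
have nV y : y \in triangle x n -> (y + e1 \in V) /\ (y + e2 \in V).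
  rewrite mem_triangle !mem_box /level /e1 /e2; case: x y => [x1 x2] [y1 y2] /=; lia.
pose dead y : config -> R := fun z => (~~ z (y + e1) && ~~ z (y + e2))%:R.
(* The factor [1 - q] is read as the probability that [y] is occupied, independently of [dead y] and
   [dif y f], to match [front_sum]. *)
have term y : y \in triangle x n -> I mu (fun z => (constraint w y z)%:R * (q * (1 - q) * dif y f z ^+ 2)) =
   if level x y == n%:Z then q * I mu (fun z => (z y)%:R * (dead y z * dif y f z ^+ 2)) else 0.
  move=> yt.
  have dif_d : dep V (dif y f).
    have H b : dep V (fun z => f (update z y b)).
      move=> a c e; apply: (@reach_ind_dep R) => u ut; rewrite /update; case: eqP => // _; apply: e; exact: tV ut.
    by move=> a c e; rewrite /dif (H true _ _ e) (H false _ _ e).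
  have dead_d : dep V (dead y) by have [h1 h2] := nV y yt; move=> a c e; rewrite /dead !e.
  have dd_d : dep V (fun z => dead y z * dif y f z ^+ 2) by move=> a c e; rewrite (dead_d _ _ e) (dif_d _ _ e).
  have dd_i : indep y (fun z => dead y z * dif y f z ^+ 2).
    move=> z b; by rewrite indep_dif /dead !update_ne ?e1_ne ?e2_ne.
  have cE : (fun z => (constraint w y z)%:R * (q * (1 - q) * dif y f z ^+ 2)) =
     (fun z => q * (1 - q) * (dead y z * dif y f z ^+ 2)).
    by apply/funext => z; rewrite /constraint wNE // -/(dead y z) mulrCA.
  have yV : y \in V := tV n (leqnSn n) y yt.
  rewrite cE; case: ifP => ly.
    have occ_d : dep V (fun z => (z y)%:R * (dead y z * dif y f z ^+ 2)) by move=> a c e; rewrite (e y yV) (dd_d _ _ e).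
    rewrite (I_dep hmu uV occ_d) (E_occ yV dd_i) -(I_dep hmu uV dd_d) (I_Z mu1 _ (bm_dep uV dd_d)); ring.
  rewrite (_ : (fun z => _) = fun=> 0) ?(I_cst mu1) //; apply/funext => z; rewrite /dead.
  case z1 : (z (y + e1)); case z2 : (z (y + e2)); rewrite /= ?mul0r ?mulr0 //.
  by rewrite (dif_dead z1 z2) ?ly // expr0n /= !mulr0.
rewrite big_seq (eq_bigr _ term) -big_seq -big_mkcond /= -big_filter -/(front x n) -mulr_sumr.
rewrite ler_pM2l // -(I_B mu1 (bm_reach n) (bm_reach n.+1)).
have bt (y : site) : bm (fun z : config => (z y)%:R * (dead y z * dif y f z ^+ 2)).
  have bd : bm (dead y).
    apply: (@bm_dep R (undup [:: y + e1; y + e2])); first exact: undup_uniq.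
    by move=> a c e; rewrite /dead !e // mem_undup !inE eqxx ?orbT.
  have bo : bm (fun z : config => (z y)%:R : R).
    by apply: (@bm_dep R [:: y]) => // a c e; rewrite e // mem_head.
  apply: bmM => //; apply: bmM => //; apply: bmX; apply: bmB.
    apply: (bm_dep (triangle_uniq x n)) => a c e; apply: (@reach_ind_dep R) => u ut; rewrite /update; case: eqP => // _; exact: e.
  apply: (bm_dep (triangle_uniq x n)) => a c e; apply: (@reach_ind_dep R) => u ut; rewrite /update; case: eqP => // _; exact: e.
rewrite -(I_sum mu1 _ bt); apply: (I_le mu1); [exact: bm_sum|exact: bmB (bm_reach n) (bm_reach n.+1)|move=> z].
exact: front_sum.
Qed.

Lemma variance_reach : ('V_mu[f] = (th n - th n ^+ 2)%:E)%E.
Proof.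
have bf := bm_reach n; have bc : bm (fun _ : config => th n) := @bm_cst _ config R _.
have Ef : fine ('E_mu[f])%E = th n by rewrite expectation.unlock.
rewrite /variance covariance.unlock Ef expectation.unlock.
have -> : (\int[mu]_z ((((f \- cst (th n)) * (f \- cst (th n)))%R z)%:E))%E = (I mu (fun z => (f z - th n) ^+ 2))%:E.
  by rewrite (I_EFin mu1) //; apply: bmX; exact: bmB bf bc.
congr (_%:E); rewrite (I_sqrB mu1 bf bc) (I_cst mu1).
have -> : (fun z => f z ^+ 2) = f.
  by apply/funext => z; rewrite /reach_ind /ind; case: asbool; rewrite ?expr1n ?expr0n.
have -> : I mu (fun z => f z * th n) = th n * th n.
  have -> : (fun z => f z * th n) = fun z => th n * f z by apply/funext => z; rewrite mulrC.
  by rewrite (I_Z mu1 _ bf).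
ring.
Qed.

End Triangle.
End TestFunction.

Lemma geom_beats_square (R : realType) (r : R) : 0 < r -> r < 1 ->
  exists n : nat, (2 * n.+1%:R + 3) ^+ 2 * r ^+ n < 1.
Proof.
(* For [dl <= 1] the cube of [1 + dl] is at most [1 + 7 * dl], hence at most [r^-1]. By Bernoulli's
   inequality [r ^+ n] then decays at least like the inverse of a cube, which beats the square. *)
move=> r0 r1; pose dl := Num.min 1 ((r^-1 - 1) / 7).
have ri : 1 < r^-1 by rewrite invf_gt1.
have d0 : 0 < dl by rewrite /dl lt_min ltr01 divr_gt0 // subr_gt0.
have d1 : dl <= 1 by rewrite /dl ge_min lexx.
have d7 : 7 * dl <= r^-1 - 1.
  have : dl <= (r^-1 - 1) / 7 by rewrite /dl ge_min lexx orbT.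
  by rewrite ler_pdivlMr // mulrC.
have cube : (1 + dl) ^+ 3 * r <= 1.
  rewrite -ler_pdivlMr // div1r; apply: le_trans (_ : 1 + 7 * dl <= _); last by rewrite -lerBrDl.
  have -> : (1 + dl) ^+ 3 = 1 + 3 * dl + 3 * dl ^+ 2 + dl ^+ 3 by ring.
  have h2 : dl ^+ 2 <= dl by rewrite expr2 ler_piMl // ltW.
  have h3 : dl ^+ 3 <= dl ^+ 2 by rewrite [dl ^+ 3]exprS ler_piMl // ?sqr_ge0.
  move: h2 h3 d0; move: (dl ^+ 2) (dl ^+ 3) => a b; lra.
have bern n : 1 + n%:R * dl <= (1 + dl) ^+ n.
  elim: n => [|n IH]; first by rewrite mul0r addr0 expr0.
  rewrite exprS -natr1; apply: (@le_trans _ _ ((1 + dl) * (1 + n%:R * dl))); last first.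
    by rewrite ler_wpM2l // addr_ge0 // ltW.
  have : 0 <= n%:R * dl ^+ 2 by rewrite mulr_ge0 ?sqr_ge0 ?ler0n.
  have -> : (1 + dl) * (1 + n%:R * dl) = 1 + (n%:R + 1) * dl + n%:R * dl ^+ 2 by ring.
  by move: (n%:R * dl ^+ 2) => a; lra.
have d30 : 0 < dl ^+ 3 by rewrite exprn_gt0.
(* From 5 on, [2 * (N + 1) + 3] is at most [3 * N], whence the 9. *)
pose n := maxn 5 (Num.truncn (9 / dl ^+ 3)).+1.
have n5 : 5 <= n%:R :> R by rewrite (ler_nat R 5) leq_maxl.
have nd : 9 < n%:R * dl ^+ 3.
  rewrite -ltr_pdivrMr //; apply: (lt_le_trans (truncnS_gt _)); by rewrite ler_nat leq_maxr.
exists n; set N := n%:R in n5 nd *.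
have -> : n.+1%:R = N + 1 :> R by rewrite -natr1.
have b0 : 0 < (1 + N * dl) ^+ 3.
  by rewrite exprn_gt0 // addr_gt0 // mulr_gt0 //; lra.
have N0 : 0 < N by lra.
have rn : (1 + N * dl) ^+ 3 * r ^+ n <= 1.
  apply: (@le_trans _ _ (((1 + dl) ^+ n) ^+ 3 * r ^+ n)).
    rewrite ler_wpM2r ?exprn_ge0 ?(ltW r0) // lerXn2r ?nnegrE //; last exact: bern.
      by rewrite addr_ge0 // mulr_ge0 // ltW.
    by rewrite exprn_ge0 // addr_ge0 // ltW.
  rewrite exprAC -exprMn; apply: exprn_ile1 => //.
  by rewrite mulr_ge0 ?(ltW r0) // exprn_ge0 // addr_ge0 // ltW.
have h : (2 * (N + 1) + 3) ^+ 2 < (1 + N * dl) ^+ 3.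
  apply: (@le_lt_trans _ _ (9 * N ^+ 2)); first by nra.
  apply: (@lt_le_trans _ _ (N ^+ 2 * (N * dl ^+ 3))).
    by rewrite mulrC ltr_pM2l // exprn_gt0.
  have -> : N ^+ 2 * (N * dl ^+ 3) = (N * dl) ^+ 3 by ring.
  rewrite lerXn2r ?nnegrE ?mulr_ge0 ?addr_ge0 ?(ltW N0) ?(ltW d0) //.
    by rewrite mulr_ge0 // ltW.
  by rewrite lerDr.
by apply: lt_le_trans rn; rewrite ltr_pM2r // exprn_gt0.
Qed.

(** * A positive gap contradicts criticality *)

Section Gap.
Context {R : realType}.
Variables (w : config) (q : R) (mu : probability config R).
Hypothesis q01 : 0 < q < 1.
Hypothesis hmu : bernoulli_product (1 - q) mu.
Hypothesis hq : q <= qOP R.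
Let mu1 : mu setT = 1%E := mu1 mu.
Local Notation th x n := (I mu (reach_ind (R := R) x n)).

Lemma reaches_shift x n (xi : config) : reaches x n xi <-> reaches 0 n (xi \o (fun z => z + x)).
Proof.
split => [[z cz lz]|[z cz lz]].
  exists (z - x); last by move: lz; rewrite /level; case: x z {cz} => [? ?] [? ?] /=; lia.
  rewrite -(subrr x); apply: (conn_map (tau := fun u => u - x)) cz.
    by move=> u v; rewrite oriented_shift.
  by move=> u /=; rewrite subrK.
exists (z + x); last by move: lz; rewrite /level; case: x z {cz} => [? ?] [? ?] /=; lia.
have := @conn_map oriented_edge (fun u => u + x) _ (fun u => xi u) 0 z _ _ cz; rewrite add0r; apply => //.
by move=> u v; rewrite oriented_shift.
Qed.

Lemma reach_dep_box x n : dep (box x n) (reach_ind (R := R) x n).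
Proof. by apply: dep_sub (@reach_ind_dep R x n) => y; rewrite mem_filter => /andP[]. Qed.

Lemma theta_shift x n : th x n = th 0 n.
Proof.
rewrite (I_dep hmu (box_uniq x n) (@reach_dep_box x n)) (I_dep hmu (box_uniq 0 n) (@reach_dep_box 0 n)).
rewrite /E box_shift (@mean_map _ _ (fun z => z + x) _ _ (reach_ind (R := R) 0 n)) //; first exact: addIr.
move=> z; rewrite /reach_ind /ind; congr (_ %:R); congr (nat_of_bool _); apply: asbool_equiv_eq.
exact: reaches_shift.
Qed.

(** An exit from the triangle sits at level [n + 1], so the path to it has reached level [n]. There
    are at most [(2 * n + 3) ^+ 2] candidates, and [critical_psi] bounds the sum of their
    probabilities from below. *)
Lemma theta_critical n : 1 <= (2 * n%:R + 3) ^+ 2 * th 0 n.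
Proof.
have [q0 q1] := andP q01.
have p01 : 0 < 1 - q < 1 by rewrite subr_gt0 q1 gtrBl.
have pc : critical_probability R oriented_edge <= 1 - q by move: hq; rewrite /qOP /pOP; lra.
have S0 : (0 : site) \in triangle 0 n by rewrite mem_triangle /level /=; lia.
have Sb : {subset triangle 0 n <= box 0 n} by move=> y; rewrite mem_filter => /andP[].
have th0 : 0 <= th 0 n by apply: I_ge0 => z; exact: ind_ge0.
apply: (le_trans (critical_psi oriented_star oriented_shift oriented_right p01 pc (triangle_uniq 0 n) S0 Sb)).
have psi0 : 0 <= psi oriented_edge (1 - q) n (triangle 0 n).
  by apply: sumr_ge0 => y _; apply: pr_ge0; rewrite !ltW //; case/andP: p01.
apply: (@le_trans _ _ (psi oriented_edge (1 - q) n (triangle 0 n))).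
  by rewrite ler_piMl // gerBl ltW.
rewrite /psi; apply: (@le_trans _ _ (\sum_(y <- box 0 n.+1) th 0 n)); last first.
  rewrite big_const_seq count_predT iter_addr_0 size_box -(mulr_natl (I mu _)) ler_wpM2r //.
  rewrite natrM -expr2 le_eqVlt; apply/orP; left; apply/eqP; congr (_ ^+ 2).
  by rewrite -natr1 -mul2n natrM -natr1; ring.
rewrite big_mkcond; apply: ler_sum => y _; case: ifP => // yS.
rewrite (I_dep hmu (triangle_uniq 0 n) (@reach_ind_dep R 0 n)).
apply: pr_sub; first by rewrite !ltW //; case/andP: p01.
move=> eta [u [uS uy cu]]; exists u.
  by apply: conn_sub cu => v [].
have ly := oriented_level 0 uy; have [h1 h2] := conn_above cu.
move: uS yS; rewrite !mem_triangle; move: uy; rewrite oriented_edgeP.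
move: ly h1 h2; rewrite /level; case: (u) (y) => [u1 u2] [y1 y2] /= ly h1 h2 /orP[] /eqP [-> ->]; lia.
Qed.

Lemma theta_gt0 n : 0 < th 0 n.
Proof.
have h := theta_critical n; rewrite ltNge; apply/negP => th0.
have : (2 * n%:R + 3) ^+ 2 * th 0 n <= 0 by rewrite mulr_ge0_le0 // sqr_ge0.
lra.
Qed.

Lemma theta_anti n : th 0 n.+1 <= th 0 n.
Proof.
apply: (I_le mu1); [exact: bm_reach|exact: bm_reach|move=> z; apply: ind_sub; exact: reaches_anti].
Qed.

(** Level 1 is out of reach when [e1] and [e2] are both empty. The index starts at 1 because level 0
    is always reached. *)
Lemma theta_le n : th 0 n.+1 <= 1 - q ^+ 2.
Proof.
elim: n => [|n IH]; last exact: le_trans (theta_anti _) IH.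
pose V : seq site := [:: e1; e2].
have uV : uniq V by [].
pose g : config -> R := fun z => empty e1 z * empty e2 z.
have dg : dep V g by move=> a b e; rewrite /g /empty !e.
have bg := bm_dep uV dg.
have -> : 1 - q ^+ 2 = I mu (fun z => 1 - g z).
  rewrite (I_B mu1 (@bm_cst _ config R 1) bg) (I_cst mu1) (I_dep hmu uV dg) /g.
  have h1 : E q V (fun z : config => empty e1 z * empty e2 z) = q * E q V (empty e2) :> R.
    apply: E_empty; first exact: mem_head.
    exact: (@indep_empty R e2 e1).
  have h2 : E q V (empty e2) = q * E q V (fun=> 1) :> R.
    have -> : empty e2 = (fun z => empty e2 z * 1) :> (config -> R) by apply/funext => z; rewrite mulr1.
    by apply: E_empty; rewrite // mem_seq2 eqxx orbT.
  by rewrite h1 h2 E_const mulr1 expr2.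
apply: (I_le mu1); [exact: bm_reach|exact: bmB (@bm_cst _ config R 1) bg|move=> z].
have [/reaches_pred[u [v [cu lu uv ev]]]|nr] := pselect (reaches 0 1 z); last first.
  rewrite /reach_ind (ind0 nr) subr_ge0 /g /empty -natrM lern1 mulnb; exact: leq_b1.
rewrite (_ : g z = 0) ?subr0; first exact: ind_le1.
have u0 : u = 0.
  have [k1 k2] := conn_above cu; move: lu k1 k2; rewrite /level; case: (u) => u1 u2 /= *; congr (_, _); lia.
by rewrite /g /empty; move: uv ev; rewrite u0 oriented_edgeP !add0r => /orP[] /eqP -> ->; rewrite ?mul0r ?mulr0.
Qed.

Hypothesis NE : forall n, exists x, forall y, y \in triangle x n -> w y = false.

(** For a hard triangle of depth [n + 1] the variance is at least [q ^+ 2] times the mean, by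
    [theta_le], while the Dirichlet form is at most [q] times the decrease of the mean. *)
Lemma gap_ratio (g : R) n : 0 < g -> (g%:E <= spectral_gap w q mu)%E -> th 0 n.+2 <= (1 - q * g) * th 0 n.+1.
Proof.
have [q0 q1] := andP q01.
move=> g0 hg; have [x wx] := NE n.+1.
have [D DE /andP[D0 Dle]] := dirichlet_reach q01 hmu wx.
rewrite !theta_shift in Dle.
have VE := variance_reach mu x n.+1; rewrite theta_shift in VE.
have t0 := theta_gt0 n.+1; have t1 := theta_le n.
set t := th 0 n.+1 in Dle VE t0 t1 *; set t' := th 0 n.+2 in Dle *.
have V0 : q ^+ 2 * t <= t - t ^+ 2 by nra.
have Vp : 0 < t - t ^+ 2 by apply: lt_le_trans V0; rewrite mulr_gt0 // exprn_gt0.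
have : (spectral_gap w q mu <= (D / (t - t ^+ 2))%:E)%E.
  apply: ereal_inf_lbound; exists (reach_ind x n.+1); split.
  - exact: (local_domain w q mu (triangle_uniq x n.+1) (@reach_ind_dep R x n.+1)).
  (* An almost surely constant indicator would have mean 0 or 1, both excluded. *)
  - move=> [a Ha].
    have mA : measurable (reaches x n.+1) := measurable_dep (@reaches_dep x n.+1).
    have IA : (I mu (reach_ind x n.+1))%:E = mu (reaches x n.+1).
      have -> : reach_ind x n.+1 = \1_(reaches x n.+1) :> (config -> R); last exact: I_indic.
      apply/funext => z; rewrite indicE; have [h|h] := pselect (reaches x n.+1 z).
        by rewrite mem_set // /reach_ind (ind1 h).
      by rewrite memNset // /reach_ind (ind0 h).
    rewrite theta_shift -/t in IA.
    have [a1|a1] := eqVneq a 1.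
      have : mu (~` reaches x n.+1) = 0%E.
        apply: (measure_negligible (measurableC mA)); apply: negligibleS Ha => z nz /= h.
        by move: h; rewrite a1 /reach_ind (ind0 nz) => /esym/eqP; rewrite oner_eq0.
      rewrite probability_setC // -IA -EFinB => -[] /eqP; rewrite subr_eq0 => /eqP t_eq1.
      by move: t1; rewrite -t_eq1 leNgt gtrBl exprn_gt0.
    have : mu (reaches x n.+1) = 0%E.
      apply: (measure_negligible mA); apply: negligibleS Ha => z nz /= h.
      by move: h; rewrite /reach_ind (ind1 nz) => /esym/eqP; rewrite (negbTE a1).
    by rewrite -IA => -[] h; move: t0; rewrite h ltxx.
  - by rewrite DE VE EFinM inver gt_eqF.
move=> /(le_trans hg); rewrite lee_fin ler_pdivlMr // => h.
have h2 : g * (q ^+ 2 * t) <= q * (t - t').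
  by apply: le_trans Dle; apply: le_trans h; rewrite ler_wpM2l // ltW.
have : q * (q * g * t) <= q * (t - t') by move: h2; congr (_ <= _); ring.
by rewrite ler_pM2l // => h3; lra.
Qed.

Lemma gap_eq0 : spectral_gap w q mu = 0%E.
Proof.
have [q0 q1] := andP q01.
have ge0 : (0 <= spectral_gap w q mu)%E.
  apply: le_ereal_inf_tmp => _ [f [_ _ ->]]; apply: mule_ge0.
    apply: integral_ge0 => z _; apply: esum_ge0 => y _; rewrite lee_fin mulr_ge0 ?ler0n //.
    by rewrite /site_var /site_mean addr_ge0 // mulr_ge0 ?sqr_ge0 ?subr_ge0 ?ltW.
  by rewrite inve_ge0; exact: variance_ge0.
apply/eqP; rewrite eq_le ge0 andbT leNgt; apply/negP => gp.
have [g g0 hg] : exists2 g : R, 0 < g & (g%:E <= spectral_gap w q mu)%E.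
  move: gp; case: (spectral_gap w q mu) => [r| |] //.
    by rewrite lte_fin => r0; exists r.
  by move=> _; exists 1 => //; rewrite leey.
pose r := 1 - q * g.
have r1 : r < 1 by rewrite /r gtrBl mulr_gt0.
have step n : th 0 n.+2 <= r * th 0 n.+1 := gap_ratio n g0 hg.
have r0 : 0 < r.
  by have := lt_le_trans (theta_gt0 2) (step 0%N); rewrite pmulr_lgt0 // theta_gt0.
have dec n : th 0 n.+1 <= r ^+ n.
  elim: n => [|n IH]; first by apply: (le_trans (theta_le 0)); rewrite expr0 gerBl exprn_ge0 // ltW.
  by apply: (le_trans (step n)); rewrite exprS ler_wpM2l // ltW.
have [n hn] := geom_beats_square r0 r1.
have := theta_critical n.+1; rewrite leNgt => /negP; apply.
by apply: le_lt_trans hn; rewrite ler_wpM2l ?sqr_ge0.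
Qed.

End Gap.

(** * Large North-East triangles in the environment *)

Section Triangles.
Context {R : realType}.
Variables (p : R) (nu : probability config R).
Hypothesis p01 : 0 < p < 1.
Hypothesis hnu : bernoulli_product p nu.

Let pin : 0 <= p <= 1. Proof. by case/andP: p01 => *; rewrite !ltW. Qed.

(** The spacing [n + 1] between consecutive corners makes the triangles disjoint and these events
    independent. *)
Definition blocked n (i : nat) : set config :=
  [set w : config | exists2 y, y \in triangle (i%:Z * n.+1%:Z, 0) n & w y].

Lemma blocked_dep n i : dep (triangle (i%:Z * n.+1%:Z, 0) n) (blocked n i).
Proof.
by move=> a b e; apply/propext; split => -[y yt wy]; exists y => //; [rewrite -e|rewrite e].
Qed.

Lemma blocked_small n : exists2 k : R, 0 <= k < 1 & forall N, (nu (\bigcap_(i < N) blocked n i) <= (k ^+ N)%:E)%E.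
Proof.
have [p0 p1] := andP p01.
pose k : R := 1 - (1 - p) ^+ (n.*2.+1 * n.*2.+1).
have kap0 : 0 < (1 - p) ^+ (n.*2.+1 * n.*2.+1) by rewrite exprn_gt0 // subr_gt0.
have kap1 : (1 - p) ^+ (n.*2.+1 * n.*2.+1) <= 1 by rewrite exprn_ile1 // ?subr_ge0 ?gerBl ltW.
exists k; first by rewrite /k subr_ge0 kap1 /= gtrBl.
move=> N; pose V := box 0 (N * n.+1 + n)%N.
have uV : uniq V := box_uniq _ _.
have tV i : (i < N)%N -> {subset triangle (i%:Z * n.+1%:Z, 0) n <= V}.
  move=> iN y; rewrite mem_triangle mem_box /level; case: y => y1 y2 /=; nia.
have pA i : (i < N)%N -> pr p V (blocked n i) (fun=> false) <= k.
  move=> iN; pose t := triangle (i%:Z * n.+1%:Z, 0) n.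
  have dB : dep V (blocked n i) := dep_sub (tV i iN) (@blocked_dep n i).
  have dnB : dep V (~` blocked n i) by move=> a b e; rewrite /setC /mkset (dB a b e).
  have h := hnu (fun=> false) (triangle_uniq (i%:Z * n.+1%:Z, 0) n).
  rewrite -/t /= big_const_seq count_predT iter_mulr_1 in h.
  have tE : [set eta : config | forall x, x \in t -> eta x = false] = ~` blocked n i.
    apply/seteqP; split => w /= hw; first by move=> [y yt]; rewrite hw.
    by move=> y yt; apply/negP => wy; apply: hw; exists y.
  rewrite tE in h; have h2 := law_pr hnu (fun=> false) uV dnB; rewrite prC in h2.
  have h3 : 1 - pr p V (blocked n i) (fun=> false) = (1 - p) ^+ size t := EFin_inj (etrans (esym h2) h).
  have st : (size t <= n.*2.+1 * n.*2.+1)%N.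
    by rewrite -(size_box (i%:Z * n.+1%:Z, 0) n) size_filter count_size.
  have : (1 - p) ^+ (n.*2.+1 * n.*2.+1) <= (1 - p) ^+ size t.
    by apply: ler_wiXn2l => //; rewrite ?subr_ge0 ?gerBl ltW.
  by move: h3; rewrite /k; move: (pr _ _ _ _) (_ ^+ size t) (_ ^+ (_ * _)) => x y z; lra.
pose T m := flatten [seq triangle (i%:Z * n.+1%:Z, 0) n | i <- iota 0 m].
have dT m : dep (T m) (\bigcap_(i < m) blocked n i).
  move=> a b e; apply/propext; split => h i /= im; have ee : blocked n i a = blocked n i b.
  - apply: (@blocked_dep n i) => y yt; apply: e; apply/flattenP; exists (triangle (i%:Z * n.+1%:Z, 0) n) => //.
    by apply: map_f; rewrite mem_iota.
  - by rewrite -ee; exact: h.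
  - apply: (@blocked_dep n i) => y yt; apply: e; apply/flattenP; exists (triangle (i%:Z * n.+1%:Z, 0) n) => //.
    by apply: map_f; rewrite mem_iota.
  - by rewrite ee; exact: h.
have dC m : (m <= N)%N -> dep V (\bigcap_(i < m) blocked n i).
  move=> mN; apply: dep_sub (dT m) => y /flattenP[t /mapP[i im te]] yt.
  rewrite mem_iota /= in im; rewrite te in yt.
  by apply: tV yt; exact: leq_trans im mN.
rewrite (law_pr hnu (fun=> false) uV (dC N (leqnn N))) lee_fin.
have: (N <= N)%N by []. 
elim: {-2}N => [|m IH] mN.
  by rewrite expr0; apply: pr_le1.
have -> : \bigcap_(i < m.+1) blocked n i = (\bigcap_(i < m) blocked n i) `&` blocked n m.
  apply/seteqP; split => w h; first by split => [i /= im|]; apply: h => //=; exact: ltnW.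
  by move=> i /=; rewrite ltnS leq_eqVlt => /orP[/eqP ->|im]; [case: h|case: h => h _; exact: h].
have dis x : x \in T m -> x \notin triangle (m%:Z * n.+1%:Z, 0) n.
  move=> /flattenP[t /mapP[i im te]]; rewrite mem_iota /= in im; rewrite te !mem_triangle /level.
  case: x => x1 x2 /= /and3P[? ? h]; apply/negP => /and3P[h2 ? ?]; nia.
rewrite (@pr_indep _ p V _ _ _ _ (fun=> false) (dT m) (@blocked_dep n m) dis).
rewrite exprSr; apply: ler_pM; [| |exact: IH (ltnW mN)|exact: pA]; by apply: pr_ge0.
Qed.

Lemma blocked_measurable n i : measurable (blocked n i).
Proof. exact: measurable_dep (@blocked_dep n i). Qed.

Lemma triangles_ae : {ae nu, forall w : config, forall n, exists x, forall y, y \in triangle x n -> w y = false}.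
Proof.
apply: (@negligibleS _ _ _ nu (\bigcup_n \bigcap_i blocked n i)).
  move=> w /= /existsNP[n hn]; exists n => // i _; apply: contrapT => h; apply: hn.
  exists (i%:Z * n.+1%:Z, 0) => y yt; apply/negP => wy; apply: h; by exists y.
apply: negligible_bigcup => n.
have mB : measurable (\bigcap_i blocked n i) by apply: bigcapT_measurable => i; exact: blocked_measurable.
exists (\bigcap_i blocked n i); split => //.
have [k /andP[k0 k1] hk] := blocked_small n.
apply/eqP; rewrite eq_le measure_ge0 andbT; apply/lee_addgt0Pr => e e0; rewrite add0e.
have [N hN] := expr_small k0 k1 e0.
apply: (@le_trans _ _ (nu (\bigcap_(i < N) blocked n i))); last by apply: (le_trans (hk N)); rewrite lee_fin ltW.
apply: le_measure; rewrite ?inE //.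
  by apply: fin_bigcap_measurable => // i _; exact: blocked_measurable.
by move=> w h i _; exact: h.
Qed.

End Triangles.

(** * The random relaxation scale *)

(** The base 5 is bounded by 8 and the box has side [4 * n + 1]; only powers of 2 are kept, since
    they can be converted into powers of [q^-1]. *)
Lemma moves_le n : (moves n <= 2 ^ (14 * n + 2))%N.
Proof.
have l2 m : (m.+1 <= 2 ^ m)%N by exact: ltn_expl.
rewrite /moves size_box.
have h5 : (5 ^ (2 * n) <= 2 ^ (6 * n))%N.
  have -> : (6 * n = 3 * (2 * n))%N by lia.
  by rewrite [(2 ^ (3 * _))%N]expnM; case: n => // n; rewrite leq_exp2r.
have h4 : ((2 * n).*2.+1 <= 2 ^ (4 * n))%N by rewrite (_ : (2 * n).*2 = 4 * n)%N; [exact: l2|lia].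
have h8 : ((2 * ((2 * n).*2.+1 * (2 * n).*2.+1)).+1 <= 2 ^ (8 * n + 2))%N.
  have := leq_mul h4 h4; rewrite -expnD (_ : 4 * n + 4 * n = 8 * n)%N; last lia.
  have : (0 < 2 ^ (8 * n))%N by rewrite expn_gt0.
  by rewrite expnD; move: (2 ^ (8 * n))%N ((2 * n).*2.+1 * (2 * n).*2.+1)%N => a b; lia.
have -> : (14 * n + 2 = 6 * n + (8 * n + 2))%N by lia.
by rewrite expnD; exact: leq_mul.
Qed.

(** As [2 <= q^-1], the exponents add up to [(28 * n + 6) + (4 * n + 3)], and [32 * n + 9 <= 41 * n]
    for positive [n]. *)
Lemma cost_le (R : realType) (q : R) n : 0 < q -> q <= 1 / 2 -> (0 < n)%N -> cost q n <= q^-1 ^+ (41 * n).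
Proof.
move=> q0 q2 n0; have q2' : 2 <= q^-1 by rewrite -[2]invrK lef_pV2 ?posrE ?invr_gt0 //; lra.
have mr : (moves n)%:R <= 2 ^+ (14 * n + 2) :> R by rewrite -natrX ler_nat; exact: moves_le.
have num : 2 * (moves n)%:R ^+ 2 + 2 <= q^-1 ^+ (28 * n + 6).
  apply: (@le_trans _ _ (2 ^+ (28 * n + 6))); last by rewrite lerXn2r ?nnegrE ?invr_ge0 // ltW.
  have h : (moves n)%:R ^+ 2 <= 2 ^+ (28 * n + 4) :> R.
    have -> : (28 * n + 4 = (14 * n + 2) * 2)%N by lia.
    by rewrite [2 ^+ _]exprM lerXn2r ?nnegrE ?ler0n ?exprn_ge0.
  have one : 1 <= 2 ^+ (28 * n + 4) :> R by rewrite exprn_ege1 // ler1n.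
  have -> : (28 * n + 6 = (28 * n + 4) + 2)%N by lia.
  rewrite (exprD 2 (28 * n + 4) 2) (_ : 2 ^+ 2 = 4 :> R); last by ring.
  by move: h one; move: (_ ^+ 2) (_ ^+ (28 * n + 4)) => x y; lra.
rewrite /cost -exprVn; apply: (@le_trans _ _ (q^-1 ^+ (28 * n + 6) * q^-1 ^+ (4 * n + 3))).
  by rewrite ler_wpM2r // exprn_ge0 // invr_ge0 ltW.
rewrite -exprD ler_eXn2l; [lia|lra].
Qed.

Section Scale.
Context {R : realType}.

(* The junk value 0 is only taken on the null set where every scale is bad. *)
Definition scale (w : config) : nat :=
  if pselect (exists n, `[< ~ bad n w >]) is left h then ex_minn h else 0%N.

Lemma scale_not_bad w : (exists n, ~ bad n w) -> ~ bad (scale w) w.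
Proof.
move=> [n nb]; rewrite /scale; case: pselect => [h|[]]; last by exists n; exact: asboolT.
by case: ex_minnP => m /asboolP.
Qed.

Lemma scale_gt n : [set w | (n < scale w)%N] = bad n `\` \bigcap_k bad k.
Proof.
apply/seteqP; rewrite /scale; split => w /=.
  case: pselect => // h; case: ex_minnP => m /asboolP mb min nm; split; last by move=> hm; apply: mb; exact: hm.
  apply: contrapT => nb; have := min n (asboolT nb); lia.
move=> [bn nb]; case: pselect => [h|[]]; last first.
  by apply: contrapT => no; apply: nb => k _; apply: contrapT => nk; apply: no; exists k; exact: asboolT.
case: ex_minnP => m /asboolP mb min; rewrite ltnNge; apply/negP => mn; apply: mb; exact: bad_anti mn w bn.
Qed.

Lemma scale_gt_measurable n : measurable [set w | (n < scale w)%N].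
Proof.
rewrite scale_gt; apply: measurableD; first exact: bad_measurable.
by apply: bigcapT_measurable => k; exact: bad_measurable.
Qed.

Lemma measurable_scale (g : nat -> R) : measurable_fun setT (g \o scale).
Proof.
have m1 n : measurable [set w | scale w = n].
  case: n => [|n].
    have -> : [set w | scale w = 0%N] = ~` [set w | (0 < scale w)%N].
      by apply/seteqP; split => w /=; [move=> ->|move/negP; rewrite lt0n negbK => /eqP].
    by apply: measurableC; exact: scale_gt_measurable.
  have -> : [set w | scale w = n.+1] = [set w | (n < scale w)%N] `\` [set w | (n.+1 < scale w)%N].
    apply/seteqP; split => w /=; first by move=> ->; rewrite ltnn ltnSn.
    by move=> [h1 /negP h2]; lia.
  by apply: measurableD; exact: scale_gt_measurable.
move=> _ B mB; rewrite setTI.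
have -> : (g \o scale) @^-1` B = \bigcup_(n in [set n | B (g n)]) [set w | scale w = n].
  by apply/seteqP; split => w /=; [move=> h; exists (scale w)|move=> [n /= h ->]].
exact: bigcup_measurable.
Qed.

End Scale.

(** * Polynomial tail of the relaxation scale *)

Section Tail.
Context {R : realType}.
Variables (p : R) (nu : probability config R).
Hypothesis p01 : 0 < p < 1.
Hypothesis hnu : bernoulli_product p nu.
Hypothesis hSP : pSP R < p.

Lemma scale_ae : {ae nu, forall w, exists n, ~ bad n w}.
Proof.
have [C [a [C0 a0 H]]] := bad_tail p01 hnu hSP.
have mB : measurable (\bigcap_k bad k) by apply: bigcapT_measurable => k; exact: bad_measurable.
exists (\bigcap_k bad k); split => //; last first.
  by move=> w /= no k _; apply: contrapT => nk; apply: no; exists k.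
apply/eqP; rewrite eq_le measure_ge0 andbT; apply/lee_addgt0Pr => e e0; rewrite add0e.
have k0 : 0 <= expR (- a) by exact: expR_ge0.
have k1 : expR (- a) < 1 by rewrite -expR0 ltr_expR oppr_lt0.
have [N hN] := expr_small k0 k1 (divr_gt0 e0 C0).
apply: (@le_trans _ _ (nu (bad N))).
  by apply: le_measure; rewrite ?inE //; [exact: bad_measurable|move=> w; exact].
apply: (le_trans (H N)); rewrite lee_fin -mulNr mulrC expRM_natr mulrC.
by rewrite mulrC -ler_pdivlMr // ltW.
Qed.

(** The constants are fixed before [A] and [q]: the prefactor only moves the threshold on [t], at
    the price of replacing [ln (t / A)] by half of [ln t]. *)
Lemma scale_tail : exists c C : R, [/\ 0 < c, 0 < C &
  forall A q : R, 0 < A -> 0 < q -> q < 1 -> \forall t \near +oo_R,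
    (nu [set w | (t <= A * q^-1 ^+ (41 * (scale w).+1))%R] <= (C * t `^ (c / ln q))%:E)%E].
Proof.
have [C [a [C0 a0 H]]] := bad_tail p01 hnu hSP.
(* 82 is twice the exponent 41, the 2 coming from [ln t <= 2 * ln (t / A)]; [3 * a] pays for
   rounding [x] down to [n]. *)
exists (a / 82), (C * expR (3 * a)); split; rewrite ?mulr_gt0 ?expR_gt0 ?divr_gt0 //.
move=> A q A0 q0 q1; set r := q^-1 ^+ 41.
have r1 : 1 < r by rewrite exprn_egt1 // invf_gt1.
have r0 : 0 < r by apply: lt_trans r1.
have lr0 : 0 < ln r by rewrite ln_gt0.
have lrE : ln r = - (41 * ln q) by rewrite /r lnXn ?invr_gt0 // lnV ?posrE // mulNrn mulr_natl.
near=> t.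
have t1 : 1 < t by near: t; exact: nbhs_pinfty_gt.
have tA : A ^+ 2 <= t by near: t; apply: nbhs_pinfty_ge; exact: num_real.
have tr : A * r ^+ 2 <= t by near: t; apply: nbhs_pinfty_ge; exact: num_real.
have t0 : 0 < t by apply: lt_trans t1.
have lnt : ln t <= 2 * ln (t / A).
  have : 2 * ln A <= ln t by rewrite mulr_natl -lnXn // ler_ln ?posrE ?exprn_gt0.
  by rewrite ln_div ?posrE //; lra.
pose x := ln (t / A) / ln r.
have x2 : 2 <= x.
  rewrite /x ler_pdivlMr // mulr_natl -lnXn // ler_ln ?posrE ?(exprn_gt0 2 r0) ?divr_gt0 //.
  by rewrite ler_pdivlMr // mulrC.
(* The margin [n + 1 < x] accounts for the successor in [(scale w).+1] and for a strict
   inequality. *)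
have [n [n1 n3]] : exists n : nat, n%:R + 1 < x /\ x < n%:R + 3.
  exists (Num.truncn x).-2.
  have xt : (2 <= Num.truncn x)%N by rewrite truncn_ge_nat //; lra.
  have h1 : (Num.truncn x)%:R <= x by rewrite truncn_le //; lra.
  have h2 := truncnS_gt x.
  move: xt h1 h2; case: (Num.truncn x) => [|[|m]] // _; clear.
  by rewrite -!natr1 => h1 h2; split; move: h1 h2; move: (m%:R) => u; lra.
have small m : (m <= n)%N -> A * q^-1 ^+ (41 * m.+1) < t.
  move=> mn; rewrite exprM -/r mulrC -ltr_pdivlMr // -ltr_ln ?posrE ?(exprn_gt0 _ r0) ?divr_gt0 //.
  rewrite lnXn // -[_ *+ _]mulr_natl -ltr_pdivlMr //; apply: le_lt_trans n1.
  by rewrite natr1 ler_nat ltnS.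
have sub : [set w | (t <= A * q^-1 ^+ (41 * (scale w).+1))%R] `<=` bad n.
  move=> w /= h; suff : [set w | (n < scale w)%N] w by rewrite scale_gt => -[].
  by rewrite /= ltnNge; apply/negP => /small; rewrite ltNge h.
have mS : measurable [set w | (t <= A * q^-1 ^+ (41 * (scale w).+1))%R].
  have := @measurable_scale R (fun m => A * q^-1 ^+ (41 * m.+1)) measurableT _ (measurable_itv `[t, +oo[).
  by rewrite setTI; congr measurable; apply/seteqP; split => w /=; rewrite in_itv /= andbT.
apply: (@le_trans _ _ (nu (bad n))).
  by apply: le_measure; rewrite ?inE //; exact: bad_measurable.
apply: (le_trans (H n)); rewrite lee_fin -mulrA ler_wpM2l ?(ltW C0) //.
rewrite /powR gt_eqF // -expRD ler_expR.
have lq : ln q < 0 by rewrite ln_lt0 // q0.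
have -> : a / 82 / ln q * ln t = - (a * (ln t / (2 * ln r))).
  rewrite lrE; field; rewrite lt_eqF //.
have h : ln t / (2 * ln r) <= x.
  rewrite /x ler_pdivrMr ?mulr_gt0 // mulrCA mulfVK ?gt_eqF //.
rewrite -mulrN (mulrC 3) -mulrBr ler_wpM2l ?(ltW a0) //.
by move: n3 h; lra.
Unshelve. all: by end_near.
Qed.

End Tail.

Theorem theorem3p2 (R : realType) (p : R) (nu : probability config R)
    (hp : 0 < p < 1) (hnu : bernoulli_product p nu) (hSP : pSP R < p) :
  (forall (q : R) (mu : probability config R),
     0 < q < 1 -> q <= qOP R -> bernoulli_product (1 - q) mu ->
     {ae nu, forall w : config,
        spectral_gap w q mu = 0%E /\ relaxation_time w q mu = +oo%E})
  /\
  (exists c C : R, [/\ 0 < c, 0 < C &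
     forall (q : R) (mu : probability config R),
       0 < q < 1 -> q <= qOP R -> bernoulli_product (1 - q) mu ->
       exists tau : config -> R,
         [/\ measurable_fun setT tau,
             forall w, 0 < tau w,
             {ae nu, forall w : config,
                forall (d : measure_display) (T : measurableType d)
                       (P : probability T R) (X : R -> T -> config),
                  kcm_process w q mu P X ->
                  forall t : R, 0 < t ->
                    (P [set a | t%:E <= tau0 X a] <=
                     (expR (- (t / tau w))%R)%:E)%E} &
             \forall t \near (+oo_R)%R,
               (nu [set w | (t <= tau w)%R] <= (C * t `^ (c / ln q))%R%:E)%E]]).
Proof.
split=> [q mu q01 hq hmu|].
  have := triangles_ae hp hnu; apply: filterS => w hw.
  have g0 := gap_eq0 q01 hmu hq hw.
  by split => //; rewrite /relaxation_time g0 inve0.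
have [c [C [c0 C0 H]]] := scale_tail hp hnu hSP.
exists c, C; split => // q mu q01 hq hmu.
have [q0 q1] := andP q01.
have q2 : q <= 1 / 2 by have := @half_le_pOP R; move: hq; rewrite /qOP; lra.
have [B B1 HB] := spectral_bound q01.
have B0 : 0 < B by apply: lt_trans B1.
(* The time constant of [survival] is [2 * D / q], and [D] will be [B] times a power of [q^-1]. *)
pose A := 2 * B / q; have A0 : 0 < A by rewrite divr_gt0 // mulr_gt0.
have qi0 k : 0 < q^-1 ^+ k by rewrite exprn_gt0 // invr_gt0.
have qi1 k : 1 <= q^-1 ^+ k by rewrite exprn_ege1 // ltW // invf_gt1.
exists (fun w => A * q^-1 ^+ (41 * (scale w).+1)); split.
- exact: (measurable_scale (fun m => A * q^-1 ^+ (41 * m.+1))).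
- by move=> w; rewrite mulr_gt0.
- have := scale_ae hp hnu hSP; apply: filterS => w gw d T P X [mX rX _ law0 [K hK markov]] t t0.
  (* The successor makes the scale positive, as the pebbling estimates require; off a null set all
     scales from [n] on are good. *)
  pose n := (scale w).+1; pose D := B * q^-1 ^+ (41 * n).
  have nb : ~ bad n w.
    by move=> /(bad_anti (leqnSn _)); exact: scale_not_bad.
  have D1 : 1 < D by apply: (lt_le_trans B1); rewrite /D ler_peMr // ltW.
  have HD (f : config -> R) : bm f -> (forall z, `|f z| <= 1) ->
      (forall z : config, z 0 = false -> f z = 0) ->
      I mu (fun z => f z ^+ 2) <= D * (I mu (fun z => f z ^+ 2) - I mu (fun z => f z * Kt K 1 f z)).
    move=> bf f1 f0; have gm m : (n <= m)%N -> good m w.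
      by move=> nm; apply: contrapT => ng; apply: nb; exists (m - n)%N => //; rewrite subnKC.
    have cn := cost_ge1 q01 n.
    have h := HB w mu K n f hmu hK (ltn0Sn _) gm bf f1 f0.
    have c1 : 0 < B * cost q n by rewrite mulr_gt0 // (lt_le_trans ltr01).
    have pos : 0 <= I mu (fun z => f z ^+ 2) - I mu (fun z => f z * Kt K 1 f z).
      rewrite -(pmulr_rge0 _ c1); apply: le_trans h; apply: I_ge0 => z; exact: sqr_ge0.
    apply: (le_trans h); rewrite ler_wpM2r // ler_wpM2l ?(ltW B0) //; exact: cost_le.
  have := survival q01 hmu hK D1 HD mX law0 markov rX t0.
  congr (_ <= _)%E; congr (_%:E); congr expR; congr (- (_ / _)).
  by rewrite /A /D; field; rewrite gt_eqF.
- exact: H.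
Qed.
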